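(* Let $\lambda>1$ and endow $\mathbb{R}^2$ with the strip density $f(x,y)=1$ if $|y|\le1$ and $f(x,y)=\lambda$ if $|y|>1$. Then for any prescribed volume $v>0$ an isoperimetric set exists and is connected.
   Context: For a positive lower semicontinuous density $f$ on $\mathbb{R}^2$: $|E|_f=\int_E f\,dx$ and $P_f(E)=\liminf_h\int_{\partial E_h}f\,d\mathcal{H}^1$, the $\liminf$ being taken among all smooth sets $E_h\to E$ in $L^1$. An isoperimetric set of volume $v$ minimises $P_f$ among sets with $|\cdot|_f=v$. Sets are identified up to null sets (connectedness refers to a suitable representative). *)

(* Defs.v *)
From HB Require Import structures.
From mathcomp Require Import all_boot all_order all_algebra.
From mathcomp Require Import all_classical all_reals all_analysis.

Set Implicit Arguments.
Unset Strict Implicit.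
Unset Printing Implicit Defensive.

Import Order.TTheory GRing.Theory Num.Theory.
Import numFieldNormedType.Exports.

Local Open Scope classical_set_scope.
Local Open Scope ring_scope.
Local Open Scope ereal_scope.

(* The norm that [R * R] carries in the library is the sup norm; it is used
   here only for topology and differentiability, where equivalent norms agree.
   The metric notions below (diameter, Hausdorff measure) are Euclidean. *)
Definition euclidean_dist (R : realType) (p q : R * R) : R :=
  Num.sqrt ((p.1 - q.1) ^+ 2 + (p.2 - q.2) ^+ 2)%R.

(* [maxe 0] only matters for the empty set, whose diameter is 0. *)
Definition diameter (R : realType) (A : set (R * R)) : \bar R :=
  maxe 0 (ereal_sup [set (euclidean_dist p.1 p.2)%:E | p in A `*` A]).

Definition hausdorff1_delta (R : realType) (delta : R) (A : set (R * R)) :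
    \bar R :=
  ereal_inf [set \sum_(0 <= i <oo) diameter (C i) | C in
    [set C : nat -> set (R * R) |
      A `<=` \bigcup_i C i /\ forall i, diameter (C i) <= delta%:E]].

(* One-dimensional Hausdorff measure, as a function on all subsets of the
   plane.  The supremum over [delta > 0] is the limit as [delta] tends to 0,
   and no normalising constant is needed in dimension 1. *)
Definition hausdorff1 (R : realType) (A : set (R * R)) : \bar R :=
  ereal_sup [set hausdorff1_delta delta A | delta in [set d : R | (0 < d)%R]].

(* [measurableTypeR R] is [R] with its Borel sigma-algebra, on which
   [lebesgue_measure] is a measure. *)
Definition area (R : realType) :
    {measure set (measurableTypeR R * measurableTypeR R)%type -> \bar R} :=
  (@lebesgue_measure R \x @lebesgue_measure R)%E.

Definition boundary (T : topologicalType) (E : set T) : set T :=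
  closure E `\` interior E.

Fixpoint differentiability_class (R : realType) (n : nat) (g : R * R -> R) :
    Prop :=
  if n is m.+1 then
    (forall p, differentiable g p) /\
    (forall v, differentiability_class m ('D_v g))
  else continuous g.

Definition smooth_function (R : realType) (g : R * R -> R) : Prop :=
  forall n, differentiability_class n g.

(* Open sets with smooth boundary, lying locally on one side of it.  Asking
   the local defining function [g] to be smooth on the whole plane is no
   restriction: multiply by a cut-off function. *)
Definition smooth_set (R : realType) (E : set (R * R)) : Prop :=
  open E /\
  forall p, boundary E p ->
    exists g : R * R -> R,
      [/\ smooth_function g,
          exists v : R * R, 'd g p v != 0%R &
          \forall q \near p, E q <-> (g q < 0)%R].

Definition cvg_L1 (R : realType) (Eh : nat -> set (R * R)) (E : set (R * R)) :
    Prop :=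
  (fun h => area R (Eh h `+` E)) @ \oo --> (0 : \bar R).

Definition weighted_volume (R : realType) (f : R * R -> R) (E : set (R * R)) :
    \bar R :=
  \int[area R]_(p in E) (f p)%:E.

(* The integral only evaluates [hausdorff1] on Borel sets, where it is a
   measure. *)
Definition boundary_integral (R : realType) (f : R * R -> R)
    (E : set (R * R)) : \bar R :=
  \int[@hausdorff1 R]_(p in boundary E) (f p)%:E.

Definition weighted_perimeter (R : realType) (f : R * R -> R)
    (E : set (R * R)) : \bar R :=
  ereal_inf [set limn_einf (fun h => boundary_integral f (Eh h)) | Eh in
    [set Eh : nat -> set (R * R) |
      (forall h, smooth_set (Eh h)) /\ cvg_L1 Eh E]].

(* Borel sets suffice, since sets matter only up to null sets. *)
Definition isoperimetric (R : realType) (f : R * R -> R) (v : R)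
    (E : set (R * R)) : Prop :=
  [/\ measurable E,
      weighted_volume f E = v%:E &
      forall F : set (R * R), measurable F -> weighted_volume f F = v%:E ->
        weighted_perimeter f E <= weighted_perimeter f F].

(* The representative must be open: otherwise any set could be made connected
   by adding null sets such as segments joining its pieces. *)
Definition essentially_connected (R : realType) (E : set (R * R)) : Prop :=
  exists U : set (R * R), [/\ open U, area R (U `+` E) = 0 & connected U].

Definition strip_density (R : realType) (lambda : R) (p : R * R) : R :=
  if (`|p.2| <= 1)%R then 1%R else lambda.

(* Main.v *)
(* Write m(y) for the length of the horizontal slice of a set at height y.  For a smooth set, Cauchy--Crofton type
   counting of boundary points bounds the boundary length between two heights from below by
   |(2 |{m > 0}|, |m(y') - m(y)|)|, with further gains if slices have gaps or move sideways, and these bounds survive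
   L^1 limits in the form of a monotone function L.  Conversely any pair (m, L) satisfying them is nearly realised by a
   smooth set with symmetric slices: interpolate m linearly on a fine partition (the strip boundaries y = -1, 1 being
   nodes), keep the connected piece of best cost to volume ratio, translate it towards the strip, stretch it
   horizontally to the prescribed volume, and round it off.  This Steiner symmetrisation confines a minimising sequence
   to a fixed box, where the monotone functions L give compactness, whence existence.
   Given a minimiser, the strict form of the inequality shows that almost every slice is an interval, and strict
   subadditivity of the isoperimetric profile (horizontal stretching by t > 1 costs less than the factor t) shows that
   slices just below and just above a height with volume on both sides must overlap.  Hence the open set of points with
   a neighbourhood almost contained in the minimiser is connected and has full measure in it. *)

Require Import Defs.
From HB Require Import structures.
From mathcomp Require Import all_boot all_order all_algebra.
From mathcomp Require Import all_classical all_reals all_analysis.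
From mathcomp Require Import measurable_realfun ring lra zify.

Import Order.TTheory GRing.Theory Num.Theory.
Import numFieldNormedType.Exports.

Local Open Scope classical_set_scope.
Local Open Scope ring_scope.

(** * Method II measures *)

Section MethodII.
Context {R : realType}.
Implicit Types (g : set (R * R) -> \bar R) (A B : set (R * R)) (d : R).

(** The perimeter is a relaxation over smooth sets, so every lower bound has to survive their L^1
    limits. For fixed c, s >= 0 with c^2 + s^2 <= 1 the linear gauge c (height) + s (width) is
    locally dominated by the diameter on a smooth curve, and Carathéodory's Method II turns this
    into a bound that is linear in (c, s). The direction is optimised only after the limit, which
    produces the square root. From there on a set is represented by its pair (m, L). Stretching,
    cutting at a height and ignoring gaps act on functions of one variable, each gain being an
    elementary estimate between two hypotenuses with a free parameter theta; [data_set] converts the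
    outcome back into a smooth competitor. The infimum is attained because the symmetrised sets are
    smooth, hence themselves admissible in the definition of the perimeter of their limit. The
    density jumps at heights -1 and 1, which may fail to be generic: data there are borrowed from
    neighbouring generic heights outside the strip, so that the increments are charged to the
    cheaper side. *)

Definition thin_cover d A (C : nat -> set (R * R)) :=
  A `<=` \bigcup_i C i /\ forall i, (diameter (C i) <= d%:E)%E.

Definition methodII_delta g d A : \bar R :=
  ereal_inf [set (\sum_(0 <= i <oo) g (C i))%E | C in thin_cover d A].

Definition methodII g A : \bar R :=
  ereal_sup [set methodII_delta g d A | d in [set d : R | 0 < d]].

Lemma diameter_ge0 A : (0 <= diameter A)%E.
Proof. by rewrite /diameter le_max lexx. Qed.

Lemma diameter_set0 : diameter (@set0 (R * R)) = 0%E.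
Proof.
rewrite /diameter; have -> : [set (euclidean_dist p.1 p.2)%:E | p in
   (@set0 (R * R)) `*` (@set0 (R * R))] = set0.
  by rewrite -subset0 => x [p [/= []]].
by rewrite ereal_sup0 /maxe ltNge leNye.
Qed.

Lemma diameter_leP A d : 0 <= d ->
  (diameter A <= d%:E)%E <-> forall p q, A p -> A q -> euclidean_dist p q <= d.
Proof.
move=> d0; rewrite /diameter ge_max lee_fin d0 /=; split.
  move=> h p q Ap Aq; rewrite -lee_fin; apply: le_trans h.
  by apply: ereal_sup_ubound; exists (p, q).
by move=> h; apply: ge_ereal_sup => _ [[p q] [/= Ap Aq] <-]; rewrite lee_fin; exact: h.
Qed.

Lemma le_diameter A B : A `<=` B -> (diameter A <= diameter B)%E.
Proof.
move=> AB; rewrite /diameter ge_max !le_max lexx /=; apply/orP; right.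
by apply: le_ereal_sup => _ [p [A1 A2] <-]; exists p => //; split; exact: AB.
Qed.

Lemma dist_le_diameter A p q : A p -> A q -> ((euclidean_dist p q)%:E <= diameter A)%E.
Proof.
move=> Ap Aq; rewrite /diameter le_max; apply/orP; right.
by apply: ereal_sup_ubound; exists (p, q).
Qed.

Section gauge.
Variable g : set (R * R) -> \bar R.
Hypothesis g_ge0 : forall A, (0 <= g A)%E.

Lemma methodII_delta_ge0 d A : (0 <= methodII_delta g d A)%E.
Proof. by apply: le_ereal_inf_tmp => _ [C _ <-]; apply: nneseries_ge0. Qed.

Lemma methodII_ge0 A : (0 <= methodII g A)%E.
Proof.
apply: le_trans (methodII_delta_ge0 1 A) _.
by apply: ereal_sup_ubound; exists 1 => //=.
Qed.

Lemma methodII_delta_le d A : 0 < d -> (methodII_delta g d A <= methodII g A)%E.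
Proof. by move=> d0; apply: ereal_sup_ubound; exists d. Qed.

Lemma le_methodII A B : A `<=` B -> (methodII g A <= methodII g B)%E.
Proof.
move=> AB; apply: ge_ereal_sup => _ [d /= d0 <-].
apply: le_trans (methodII_delta_le d B d0).
apply: le_ereal_inf => _ [C [BC Cd] <-]; exists C => //; split=> //.
exact: subset_trans AB BC.
Qed.

Lemma methodII_set0 : g set0 = 0%E -> methodII g set0 = 0%E.
Proof.
move=> g0; apply/eqP; rewrite eq_le methodII_ge0 andbT.
apply: ge_ereal_sup => _ [d /= d0 <-]; apply: ereal_inf_lbound.
exists (fun=> set0); last by rewrite eseries0// => i _ _.
by split=> // i; rewrite diameter_set0 lee_fin ltW.
Qed.

(** Near-optimal covers with errors e / 2^(n+1) are merged into one sequence by a bijection between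
    nat and pairs; the bound on diameters is inherited piece by piece. *)
Lemma methodII_delta_sub d (A : nat -> set (R * R)) :
  (methodII_delta g d (\bigcup_n A n) <= \sum_(0 <= n <oo) methodII_delta g d (A n))%E.
Proof.
have [[i ioo]|] := pselect (exists i, methodII_delta g d (A i) = +oo%E).
  rewrite (eseries_pinfty _ _ ioo) ?leey// => n _.
  by rewrite -ltNye (lt_le_trans _ (methodII_delta_ge0 _ _)).
rewrite -forallNE => Aoo.
apply/lee_addgt0Pr => e e0.
rewrite (le_trans _ (epsilon_trick _ _ (ltW e0)))//; last first.
  by move=> n; exact: methodII_delta_ge0.
pose P n (B : (set (R * R))^nat) := thin_cover d (A n) B /\
  (\sum_(0 <= k <oo) g (B k) <= methodII_delta g d (A n) + (e / (2 ^ n.+1)%:R)%:E)%E.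
have [G PG] : {G : ((set (R * R))^nat)^nat & forall n, P n (G n)}.
  apply: (@choice _ _ P) => n.
  have fn : methodII_delta g d (A n) \is a fin_num.
    by rewrite ge0_fin_numE ?methodII_delta_ge0// ltey; apply/eqP; exact: Aoo.
  have en1 : 0 < e / (2 ^ n.+1)%:R by rewrite divr_gt0.
  have [x [B AB xS] xle] := lb_ereal_inf_adherent en1 fn.
  by exists B; split => //; rewrite xS; exact/ltW.
apply: (@le_trans _ _ (\esum_(i in setT) (g \o uncurry G) i)%E).
  apply: ereal_inf_lbound => /=.
  have /card_esym/ppcard_eqP[f] := card_nat2.
  exists (uncurry G \o f).
    split => [|i]; last by have := (PG (f i).1).1.2 (f i).2; rewrite /= /uncurry; case: (f i).
    apply: (@subset_trans _  (\bigcup_n \bigcup_k G n k)) => [t [i _]|].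
      by move=> /((PG i).1.1) -[j _ ?]; exists i => //; exists j.
    move=> t [i _ [j _ Bijt]]; exists (f^-1%FUN (i, j)) => //=.
    by rewrite invK ?inE.
  rewrite -(esum_pred_image (g \o uncurry G) _ xpredT) ?[fun=> _]set_true//.
    by rewrite image_eq.
  by move=> n _; exact: g_ge0.
rewrite (_ : esum _ _ = \sum_(0 <= i <oo) \sum_(0 <= j <oo ) g (G i j))%E; last first.
  pose J : nat -> set (nat * nat) := fun i => [set (i, j) | j in setT].
  rewrite (_ : setT = \bigcup_k J k); last first.
    by rewrite predeqE => -[a b]; split => // _; exists a => //; exists b.
  rewrite esum_bigcupT /=; last 2 first.
    - apply/trivIsetP => i j _ _ ij.
      rewrite predeqE => -[n m] /=; split => //= -[] [_] _ [<-{n} _].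
      by move=> [m' _] [] /esym/eqP; rewrite (negbTE ij).
    - by move=> /= [n m]; exact: g_ge0.
  rewrite -(image_id [set: nat]) -fun_true esum_pred_image//; last first.
    by move=> n _; exact: esum_ge0.
  apply: eq_eseriesr => /= j _.
  rewrite -(esum_pred_image (g \o uncurry G) (pair j) predT)//=; last first.
    by move=> ? ? _ _; exact: (@can_inj _ _ _ snd).
  by congr esum; rewrite predeqE => -[a b]; split; move=> [i _ <-]; exists i.
apply: lee_nneseries => [n _ _|n _]; first by apply: nneseries_ge0 => m _ _; exact: g_ge0.
exact: (PG n).2.
Qed.

Lemma methodII_sigma_subadditive : sigma_subadditive (methodII g).
Proof.
move=> A; apply: ge_ereal_sup => _ [d /= d0 <-].
apply: le_trans (methodII_delta_sub d A) _.
apply: lee_nneseries => [n _ _|n _]; first exact: methodII_delta_ge0.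
exact: methodII_delta_le.
Qed.

(* A set of the cover of diameter less than the distance meets only one of the two sets. *)
Lemma methodII_separated A B d : 0 < d -> (g set0 = 0)%E ->
  (forall p q, A p -> B q -> d <= euclidean_dist p q) ->
  (methodII g A + methodII g B <= methodII g (A `|` B))%E.
Proof.
move=> d0 g0 sep.
have key e : 0 < e -> e < d ->
    (methodII_delta g e A + methodII_delta g e B <= methodII_delta g e (A `|` B))%E.
  move=> e0 ed; apply: le_ereal_inf_tmp => _ [C [ABC Cd] <-].
  pose CA i := if `[< exists2 p, A p & C i p >] then C i else set0.
  pose CB i := if `[< exists2 p, A p & C i p >] then set0 else C i.
  apply: (@le_trans _ _ (\sum_(0 <= i <oo) g (CA i) + \sum_(0 <= i <oo) g (CB i))%E).
    apply: leeD; apply: ereal_inf_lbound.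
      exists CA => //; split.
        move=> p Ap; have [i _ Cip] := ABC p (or_introl Ap).
        by exists i => //; rewrite /CA; case: asboolP => // -[]; exists p.
      move=> i; rewrite /CA; case: asboolP => _; first exact: Cd.
      by rewrite diameter_set0 lee_fin ltW.
    exists CB => //; split.
      move=> p Bp; have [i _ Cip] := ABC p (or_intror Bp).
      exists i => //; rewrite /CB; case: asboolP => // -[q Aq Ciq]; exfalso.
      have /diameter_leP := Cd i => /(_ (ltW e0) q p Ciq Cip).
      by have := sep _ _ Aq Bp; lra.
    move=> i; rewrite /CB; case: asboolP => _; last exact: Cd.
    by rewrite diameter_set0 lee_fin ltW.
  rewrite -nneseriesD//; apply: lee_nneseries => [i _ _|i _]; first exact: adde_ge0.
  by rewrite /CA /CB; case: asboolP => _; rewrite g0 ?adde0 ?add0e.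
(* Finer covers cost more, so two different scales can be replaced by a common one that is also
   smaller than [d]. *)
have mono e1 e2 X : 0 < e1 -> e1 <= e2 ->
    (methodII_delta g e2 X <= methodII_delta g e1 X)%E.
  move=> e10 e12; apply: le_ereal_inf => _ [C [XC Cd] <-]; exists C => //; split=> // i.
  by apply: le_trans (Cd i) _; rewrite lee_fin.
have [AB|ABoo] := eqVneq (methodII g (A `|` B)) +oo%E; first by rewrite AB leey.
have fAB : methodII g (A `|` B) \is a fin_num.
  by rewrite ge0_fin_numE ?methodII_ge0// ltey.
have leA : (methodII g A <= methodII g (A `|` B))%E by apply: le_methodII.
have leB : (methodII g B <= methodII g (A `|` B))%E by apply: le_methodII.
have fA : methodII g A \is a fin_num.
  by rewrite ge0_fin_numE ?methodII_ge0// (le_lt_trans leA)// ltey.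
(* The two suprema are bounded one after the other; the other summand is finite and can be moved
   across. *)
rewrite addeC -leeBrDr//; apply: ge_ereal_sup => _ [e1 /= e10 <-].
rewrite leeBrDr// addeC -leeBrDr; last first.
  have := methodII_delta_le e1 B e10 => h; rewrite ge0_fin_numE ?methodII_delta_ge0//.
  by rewrite (le_lt_trans h)// (le_lt_trans leB)// ltey.
apply: ge_ereal_sup => _ [e2 /= e20 <-].
rewrite leeBrDr; last first.
  have := methodII_delta_le e1 B e10 => h; rewrite ge0_fin_numE ?methodII_delta_ge0//.
  by rewrite (le_lt_trans h)// (le_lt_trans leB)// ltey.
pose e := Num.min (d / 2) (Num.min e1 e2).
have e0 : 0 < e by rewrite /e !lt_min e10 e20 divr_gt0.
have ed : e < d by rewrite /e gt_min ltr_pdivrMr//; apply/orP; left; lra.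
apply: le_trans (methodII_delta_le e _ e0); apply: le_trans (key e e0 ed).
by apply: leeD; apply: mono => //; rewrite /e !ge_min lexx ?orbT.
Qed.

End gauge.

(** [hausdorff1] is convertible with [methodII] for the gauge [diameter], so the general facts apply
    as they are. *)
HB.instance Definition _ := isOuterMeasure.Build R (R * R)%type (@hausdorff1 R)
  (methodII_set0 _ diameter_ge0 diameter_set0)
  (methodII_ge0 _ diameter_ge0)
  (le_methodII _)
  (methodII_sigma_subadditive _ diameter_ge0).

End MethodII.

(** * The Hausdorff measure on Borel sets *)

Section HausdorffMeasure.
Context {R : realType}.
Implicit Types (X : set (R * R)) (c : R).
Local Notation H := (@hausdorff1 R).

Lemma hausdorff1_separated (A B : set (R * R)) d : 0 < d ->
  (forall p q, A p -> B q -> d <= euclidean_dist p q) ->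
  (H A + H B <= H (A `|` B))%E.
Proof. by move=> d0 sep; exact: methodII_separated _ diameter_ge0 A B d d0 diameter_set0 sep. Qed.

Section halfspace.
Variable phi : R * R -> R.
Hypothesis phi_lip : forall p q, phi q - phi p <= euclidean_dist p q.
Variables (c : R) (X : set (R * R)).

(** Shells that accumulate at the level [c] from below. *)
Let S k := X `&` [set p | c - k.+1%:R^-1 < phi p <= c - k.+2%:R^-1].

Let le_inv k l : (k <= l)%N -> l.+1%:R^-1 <= k.+1%:R^-1 :> R.
Proof. by move=> kl; rewrite lef_pV2 ?posrE// ler_nat. Qed.

Let lt_inv k : k.+2%:R^-1 < k.+1%:R^-1 :> R.
Proof. by rewrite ltf_pV2 ?posrE// ltr_nat. Qed.

(** Only every other shell is taken: the one in between has positive thickness and [phi] is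
    1-Lipschitz, so the chosen pieces are at positive distance and their measures add. The offset
    [b] selects the parity. *)
Lemma shell_sum n b : (\sum_(k < n) H (S (k.*2 + b)) <= H X)%E.
Proof.
pose U n := X `&` [set p | phi p <= c - (n.*2 + b).+2%:R^-1].
case: n => [|n]; first by rewrite big_ord0; exact: outer_measure_ge0.
suff h : (\sum_(k < n.+1) H (S (k.*2 + b)) <= H (U n))%E.
  by apply: le_trans h _; apply: le_outer_measure => p [].
elim: n => [|n IH].
  by rewrite big_ord_recr big_ord0 /= add0e; apply: le_outer_measure => p [Xp /= /andP[]].
rewrite big_ord_recr /=; apply: le_trans (leeD2r _ IH) _.
rewrite doubleS !addSn.
set j := (n.*2 + b)%N.
apply: (@le_trans _ _ (H (U n `|` S j.+2))).
  apply: (@hausdorff1_separated _ _ (j.+2%:R^-1 - j.+3%:R^-1)).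
    by rewrite subr_gt0.
  move=> p q [_ /= hp] [_ /= /andP[hq _]]; apply: le_trans (phi_lip p q).
  by move: hp hq; rewrite -/j; move: (_^-1) (_^-1) => u w hp hq; lra.
apply: le_outer_measure => p [[Xp /= hp]|[Xp /= /andP[_ hp]]]; split=> //=.
  apply: le_trans hp _; rewrite lerB// lef_pV2 ?posrE// ler_nat doubleS !addSn; lia.
Qed.

Lemma shell_cvg : (H X < +oo)%E -> (\sum_(0 <= k <oo) H (S k) < +oo)%E.
Proof.
move=> Xoo; apply: (@le_lt_trans _ _ (H X + H X)%E); last exact: lte_add_pinfty.
apply: lime_le.
  by apply: is_cvg_nneseries => n _ _; exact: outer_measure_ge0.
apply: nearW => n.
apply: (@le_trans _ _ (\sum_(0 <= k < n.*2) H (S k))%E).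
  by apply: lee_sum_nneg_natr => // [k _ _|]; [exact: outer_measure_ge0|rewrite -addnn leq_addr].
have -> : (\sum_(0 <= k < n.*2) H (S k) =
    \sum_(k < n) H (S (k.*2 + 0)) + \sum_(k < n) H (S (k.*2 + 1)))%E.
  elim: n => [|n IH]; first by rewrite !big_ord0 big_geq// adde0.
  rewrite doubleS big_nat_recr//= big_nat_recr//= IH !big_ord_recr/= addn0 addn1.
  by rewrite -!addeA; congr (_ + _)%E; rewrite addeCA.
by apply: leeD; exact: shell_sum.
Qed.

Let L : set (R * R) := [set p | phi p < c].

(** Carathéodory's argument for metric outer measures: the part of [X] with phi <= c - 1/(n+1) is at
    positive distance from the part with phi >= c, and the remainder lies in a tail of the
    convergent series of shells. *)
Lemma halfspace_cut : (H (X `&` L) + H (X `&` ~` L) <= H X)%E.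
Proof.
have [Xoo|Xoo] := ltP (H X) +oo%E; last first.
  by move: Xoo; rewrite leye_eq => /eqP ->; rewrite leey.
have fX : H X \is a fin_num by rewrite ge0_fin_numE// outer_measure_ge0.
set B := X `&` ~` _.
have fB : H B \is a fin_num.
  rewrite ge0_fin_numE ?outer_measure_ge0//; apply: le_lt_trans Xoo.
  by apply: le_outer_measure => p [].
pose A n := X `&` [set p | phi p <= c - n.+1%:R^-1].
have AB n : (H (A n) + H B <= H X)%E.
  apply: (@le_trans _ _ (H (A n `|` B))).
    apply: (@hausdorff1_separated _ _ n.+1%:R^-1) => // p q [_ /= hp] [_ /= /negP hq].
    by apply: le_trans (phi_lip p q); move: hp hq; rewrite -leNgt; move: (_^-1) => u *; lra.
  by apply: le_outer_measure => p [[]|[]].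
have tail n : (H (X `&` L) <= H (A n) + \sum_(n <= k <oo) H (S k))%E.
  have sub : X `&` L `<=` A n `|` \bigcup_(k in [set k | (n <= k)%N]) S k.
    move=> p [Xp /= pc]; have [h|h] := leP (phi p) (c - n.+1%:R^-1); first by left.
    right; pose P k := phi p <= c - k.+1%:R^-1.
    have exP : exists k, P k.
      exists (Num.truncn (c - phi p)^-1); rewrite /P lerBrDl -lerBrDr.
      rewrite -[leRHS]invrK lef_pV2 ?posrE ?invr_gt0 ?subr_gt0//.
      by apply: ltW; exact: truncnS_gt.
    (* The least index with [P] is a successor, and its predecessor is the index of the shell
       containing [p]. *)
    case: (ex_minnP exP) => -[|k] Pk kmin.
      exfalso; move: Pk; rewrite /P leNgt; apply/negP; rewrite negbK; apply: le_lt_trans h.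
      by rewrite lerB// le_inv.
    exists k => /=; last first.
      split=> //=; move: Pk; rewrite /P => ->; rewrite andbT ltNge; apply/negP => Pk'.
      by have := kmin _ Pk'; rewrite ltnn.
    rewrite leqNgt; apply/negP => kn; move: Pk; rewrite /P leNgt => /negP; apply.
    by apply: le_lt_trans h; rewrite lerB// le_inv.
  apply: le_trans (le_outer_measure _ _ _ sub) _.
  apply: le_trans (outer_measureU2 _ _ _) _; apply: leeD2l.
  rewrite (_ : \bigcup_(k in _) _ = \bigcup_k S (k + n)%N); last first.
    apply/seteqP; split=> p [k /= nk Sp].
      by exists (k - n)%N => //; rewrite subnK.
    by exists (k + n)%N => //=; rewrite leq_addl.
  apply: le_trans (outer_measure_sigma_subadditive _ _) _.
  by rewrite -nneseries_addn// => i; exact: outer_measure_ge0.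
have := nneseries_tail_cvg (shell_cvg Xoo) (fun k _ => outer_measure_ge0 _ (S k)).
move=> /fine_cvgP[tfin /cvgrPdist_lt tlt].
apply/lee_addgt0Pr => e e0.
pose T n := (\sum_(n <= k <oo) H (S k))%E.
have [n tn2] : exists n, (T n <= e%:E)%E.
  near \oo => n; exists n; have fn : T n \is a fin_num by near: n.
  rewrite -(fineK fn) lee_fin.
  have : `|0 - (fine \o T) n| < e by near: n; exact: tlt.
  by rewrite sub0r normrN => /ltW; apply: le_trans; rewrite /= ler_norm.
apply: le_trans (leeD2r _ (tail n)) _.
by rewrite addeAC; exact: leeD.
Unshelve. all: by end_near. Qed.

End halfspace.

Lemma hausdorff1_halfspace phi c :
  (forall p q, phi q - phi p <= euclidean_dist p q) ->
  H.-caratheodory [set p : R * R | phi p < c].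
Proof. by move=> lip; apply: le_caratheodory_measurable => X; exact: halfspace_cut. Qed.

Lemma dist_ge_fst (p q : R * R) : `|q.1 - p.1| <= euclidean_dist p q.
Proof.
rewrite /euclidean_dist -sqrtr_sqr ler_wsqrtr// -[(q.1 - p.1) ^+ 2]sqrrN opprB.
by rewrite lerDl sqr_ge0.
Qed.

Lemma dist_ge_snd (p q : R * R) : `|q.2 - p.2| <= euclidean_dist p q.
Proof.
rewrite /euclidean_dist -sqrtr_sqr ler_wsqrtr// -[(q.2 - p.2) ^+ 2]sqrrN opprB.
by rewrite lerDr sqr_ge0.
Qed.

Lemma caratheodory_preimage (phi : R * R -> R) :
  (forall p q, phi q - phi p <= euclidean_dist p q) ->
  forall B : set (measurableTypeR R), measurable B ->
  H.-caratheodory (phi @^-1` B).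
Proof.
move=> lip B mB.
have : measurable_fun [set: caratheodory_type H] (phi : caratheodory_type H -> measurableTypeR R).
  apply: (measurability _ (measurable_realfun.RGenInftyO.measurableE R)) => _ [_ [x ->] <-].
  rewrite setTI; have := @hausdorff1_halfspace phi x lip.
  by congr (_.-caratheodory _); apply/seteqP; split=> p; rewrite /= in_itv.
by move=> /(_ measurableT B mB); rewrite setTI.
Qed.

Lemma hausdorff1_borel (A : set (R * R)) : measurable A -> H.-caratheodory A.
Proof.
rewrite measurable_prod_measurableType.
apply: (@smallest_sub _ (sigma_algebra setT) _ (@measurable _ (caratheodory_type H))).
  exact: sigma_algebra_measurable.
move=> _ [B mB [C mC <-]].
have -> : B `*` C = fst @^-1` B `&` snd @^-1` C by apply/seteqP; split=> p [].
apply: caratheodory_measurable_setI; apply: caratheodory_preimage => // p q.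
  exact: le_trans (ler_norm _) (dist_ge_fst p q).
exact: le_trans (ler_norm _) (dist_ge_snd p q).
Qed.

Lemma hausdorff1_sigma_additive : semi_sigma_additive (H : set (R * R) -> \bar R).
Proof.
move=> A mA tA mUA.
apply: caratheodory_measure_sigma_additive => //.
- by move=> n; exact: hausdorff1_borel (mA n).
- exact: hausdorff1_borel mUA.
Qed.

HB.instance Definition _ := isMeasure.Build _ (R * R)%type R (@hausdorff1 R)
  (outer_measure0 _) (outer_measure_ge0 _) hausdorff1_sigma_additive.

End HausdorffMeasure.

(** * Smooth sets and chords of their boundaries *)

Section Chord.
Context {R : realType}.
Implicit Types (p q : R * R) (g : R * R -> R) (E : set (R * R)).

Lemma smooth_differentiable g : smooth_function g -> forall p, differentiable g p.
Proof. by move=> sg p; have [] := sg 1%N. Qed.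

Lemma smooth_continuous g : smooth_function g -> continuous g.
Proof. by move=> sg; exact: (sg 0%N). Qed.

Lemma smooth_derive_continuous g v : smooth_function g -> continuous ('D_v g).
Proof. by move=> sg; have [_ /(_ v)] := sg 1%N. Qed.

Lemma derive_pairE g p v : differentiable g p ->
  'D_v g p = v.1 * 'D_(1, 0) g p + v.2 * 'D_(0, 1) g p.
Proof.
move=> dg; rewrite !deriveE//.
have {1}-> : v = v.1 *: ((1, 0) : R * R) + v.2 *: ((0, 1) : R * R).
  by case: v => a b; congr (_, _); rewrite /= /GRing.scale/= ?mulr1 ?mulr0 ?addr0 ?add0r.
by rewrite linearD !linearZ.
Qed.

Lemma mean_value_plane g q q' : (forall p, differentiable g p) ->
  exists2 t, 0 <= t <= 1 & g q' - g q = 'D_(q' - q) g (q + t *: (q' - q)).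
Proof.
move=> dg; pose w := q' - q; pose phi (t : R) := g (q + t *: w).
have phiE t : (fun h => h^-1 *: (phi (h *: (1 : R) + t) - phi t)) =
    (fun h => h^-1 *: (g (h *: w + (q + t *: w)) - g (q + t *: w))).
  apply/funext => h; rewrite /phi; congr (_ *: (g _ - _)).
  by rewrite (_ : h *: (1 : R) = h) ?scalerDl 1?addrCA//; exact: mulr1.
have dphi (t : R) : is_derive t (1 : R) phi ('D_w g (q + t *: w)).
  apply: DeriveDef; last by rewrite /derive/= phiE.
  by rewrite /derivable phiE; apply: diff_derivable.
have [|t t01] := @MVT_segment R phi (fun t => 'D_w g (q + t *: w)) 0 1 ler01.
  apply: derivable_within_continuous => t _; exact: ex_derive.
rewrite subr0 mulr1 /phi scale1r scale0r addr0 (_ : q + w = q') ?[q + w]addrC ?subrK// => h.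
by exists t; [move: t01; rewrite in_itv|].
Qed.

Lemma boundary_open E p : open E -> boundary E p <-> closure E p /\ ~ E p.
Proof. by move=> /interior_id oE; rewrite /boundary oE. Qed.

(** The chord (d1, d2) is orthogonal to a gradient b close to a, hence nearly orthogonal to a. Let r
    be the scalar product of d and a, and s the determinant of a and d. Lagrange's identity r^2 +
    s^2 = N^2 d^2 bounds s, and N^2 d2 = a2 r + a1 s gives the claim. *)
Lemma chord_direction (a1 a2 eta d1 d2 b1 b2 N d : R) : 0 <= eta ->
  N = Num.sqrt (a1 ^+ 2 + a2 ^+ 2) -> 0 < N ->
  d = Num.sqrt (d1 ^+ 2 + d2 ^+ 2) ->
  `|b1 - a1| <= eta * N / 2 -> `|b2 - a2| <= eta * N / 2 ->
  d1 * b1 + d2 * b2 = 0 ->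
  `|d2| <= (`|a1| / N + eta) * d.
Proof.
move=> eta0 NE N0 dE h1 h2 h0.
have d0 : 0 <= d by rewrite dE sqrtr_ge0.
have dd : d ^+ 2 = d1 ^+ 2 + d2 ^+ 2 by rewrite dE sqr_sqrtr// addr_ge0 ?sqr_ge0.
have NN : N ^+ 2 = a1 ^+ 2 + a2 ^+ 2 by rewrite NE sqr_sqrtr// addr_ge0 ?sqr_ge0.
have l1 : `|d1| <= d by rewrite dE -sqrtr_sqr ler_wsqrtr// lerDl sqr_ge0.
have l2 : `|d2| <= d by rewrite dE -sqrtr_sqr ler_wsqrtr// lerDr sqr_ge0.
have la2 : `|a2| <= N by rewrite NE -sqrtr_sqr ler_wsqrtr// lerDr sqr_ge0.
pose r := d1 * a1 + d2 * a2.
have rle : `|r| <= eta * N * d.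
  have -> : r = - (d1 * (b1 - a1)) - d2 * (b2 - a2) by rewrite /r; lra.
  apply: le_trans (ler_normB _ _) _; rewrite normrN !normrM.
  have -> : eta * N * d = d * (eta * N / 2) + d * (eta * N / 2) by lra.
  by apply: lerD; apply: ler_pM.
pose s := a1 * d2 - a2 * d1.
have sle : `|s| <= N * d.
  rewrite -(@ler_pXn2r _ 2)// ?nnegrE ?normr_ge0 ?mulr_ge0 ?(ltW N0)//.
  rewrite real_normK ?num_real// exprMn dd NN -subr_ge0.
  have -> : (a1 ^+ 2 + a2 ^+ 2) * (d1 ^+ 2 + d2 ^+ 2) - s ^+ 2 = r ^+ 2.
    by rewrite /s /r; ring.
  exact: sqr_ge0.
have key : N ^+ 2 * d2 = a2 * r + a1 * s by rewrite NN /r /s; ring.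
have : N ^+ 2 * `|d2| <= N ^+ 2 * ((`|a1| / N + eta) * d).
  have -> : N ^+ 2 * `|d2| = `|N ^+ 2 * d2|.
    by rewrite normrM ger0_norm// sqr_ge0.
  rewrite key; apply: le_trans (ler_normD _ _) _; rewrite !normrM.
  have -> : N ^+ 2 * ((`|a1| / N + eta) * d) = N * (eta * N * d) + `|a1| * (N * d).
    by field; rewrite gt_eqF.
  by apply: lerD; apply: ler_pM.
by rewrite ler_pM2l// exprn_gt0.
Qed.

(** (n1, n2) is the unit normal at [p] with signs dropped, so the tangent has height component n1
    and width component n2. By the mean value theorem a short chord of the boundary is orthogonal to
    a gradient taken near [p]. *)
Lemma chord E p : smooth_set E -> boundary E p ->
  exists n1 n2 : R, [/\ 0 <= n1, 0 <= n2, n1 ^+ 2 + n2 ^+ 2 = 1 &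
  forall eta, 0 < eta -> \forall r \near 0^'+, forall q q',
    boundary E q -> boundary E q' -> ball p r q -> ball p r q' ->
    `|q.2 - q'.2| <= (n1 + eta) * euclidean_dist q q' /\
    `|q.1 - q'.1| <= (n2 + eta) * euclidean_dist q q'].
Proof.
move=> [oE sE] bp; have [g [sg [v dv] Eg]] := sE p bp.
have dg := smooth_differentiable _ sg.
set a1 := 'D_(1, 0) g p; set a2 := 'D_(0, 1) g p.
pose N := Num.sqrt (a1 ^+ 2 + a2 ^+ 2).
have N0 : 0 < N.
  rewrite sqrtr_gt0 lt_neqAle addr_ge0 ?sqr_ge0// andbT eq_sym paddr_eq0 ?sqr_ge0//.
  apply/negP => /andP[]; rewrite !sqrf_eq0 => /eqP h1 /eqP h2.
  by move: dv; rewrite -deriveE// derive_pairE// -/a1 -/a2 h1 h2 !mulr0 addr0 eqxx.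
exists (`|a1| / N), (`|a2| / N); split.
- by rewrite divr_ge0// ltW.
- by rewrite divr_ge0// ltW.
- rewrite !expr_div_n !real_normK ?num_real// -mulrDl sqr_sqrtr ?addr_ge0 ?sqr_ge0//.
  rewrite divff// -(@sqr_sqrtr _ (_ + _)) ?addr_ge0 ?sqr_ge0// -/N.
  by rewrite expf_eq0 /= gt_eqF.
move=> eta eta0.
have e0 : 0 < eta * N / 2 by rewrite divr_gt0// mulr_gt0.
have n1 : \forall q \near p, `|'D_(1, 0) g q - a1| <= eta * N / 2.
  have /cvgrPdist_le /(_ _ e0) := smooth_derive_continuous _ (1, 0) sg p.
  by apply: filterS => q; rewrite distrC.
have n2 : \forall q \near p, `|'D_(0, 1) g q - a2| <= eta * N / 2.
  have /cvgrPdist_le /(_ _ e0) := smooth_derive_continuous _ (0, 1) sg p.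
  by apply: filterS => q; rewrite distrC.
have /nbhs_ballP [r0 /= r00 br0] : \forall q \near p,
    [/\ E q <-> g q < 0, `|'D_(1, 0) g q - a1| <= eta * N / 2 &
     `|'D_(0, 1) g q - a2| <= eta * N / 2].
  by apply: filterS3 Eg n1 n2 => q.
(* A boundary point is outside the open set [E], so g >= 0 there, and g > 0 would keep [E] away from
   a whole neighbourhood. *)
have g0 q : boundary E q -> ball p r0 q -> g q = 0.
  move=> /(boundary_open _ _ oE)[cq nEq] bq; apply/eqP; rewrite eq_le.
  have [iff _ _] := br0 q bq.
  rewrite [X in _ && X]leNgt; apply/andP; split; last by apply/negP => /iff.
  rewrite leNgt; apply/negP => gq.
  have : nbhs q (ball p r0 `&` [set z | 0 < g z]).
    apply: filterI; first by apply: open_nbhs_nbhs; split=> //; exact: ball_open.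
    apply: open_nbhs_nbhs; split => //.
    apply: (@open_comp _ _ g [set x | 0 < x]); last exact: open_gt.
    by move=> z _; exact: smooth_continuous.
  move=> /cq [z [Ez [bz /= gz]]]; have [[/(_ Ez) gz' _] _ _] := br0 z bz.
  by have := lt_trans gz gz'; rewrite ltxx.
near=> r => q q' bq bq' rq rq'.
have rr0 : r <= r0 by near: r; apply: nbhs_right_le.
have b0 z : ball p r z -> ball p r0 z by apply: le_ball.
have [t /andP[t0 t1]] := mean_value_plane g q q' dg.
rewrite (g0 q bq (b0 _ rq)) (g0 q' bq' (b0 _ rq')) subr0 => /esym.
(* Balls of the sup norm are convex. *)
set xi := q + _; have bxi : ball p r0 xi.
  have : forall a b c : R, ball a r0 b -> ball a r0 c -> ball a r0 (b + t *: (c - b)).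
    move=> a b c; rewrite /ball/= => hb hc.
    have -> : a - (b + t *: (c - b)) = (1 - t) * (a - b) + t * (a - c).
      by rewrite /GRing.scale/=; ring.
    apply: le_lt_trans (ler_normD _ _) _; rewrite !normrM.
    rewrite (ger0_norm t0) ger0_norm ?subr_ge0//.
    have [->|tn0] := eqVneq t 0; first by rewrite subr0 mul1r mul0r addr0.
    have tt : 0 < t by rewrite lt_neqAle eq_sym tn0.
    have -> : r0 = (1 - t) * r0 + t * r0 by ring.
    by apply: ler_ltD; [apply: ler_wpM2l; rewrite ?subr_ge0// ltW|rewrite ltr_pM2l].
  move=> h; have [h1 h2] := b0 _ rq; have [h3 h4] := b0 _ rq'.
  by split; [exact: h h1 h3|exact: h h2 h4].
have [_ h1 h2] := br0 xi bxi.
rewrite derive_pairE//= => hxi.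
have eta0' := ltW eta0.
have distE : euclidean_dist q q' = Num.sqrt ((q' - q).1 ^+ 2 + (q' - q).2 ^+ 2).
  rewrite /euclidean_dist /= -[(q.1 - _) ^+ 2]sqrrN -[(q.2 - _) ^+ 2]sqrrN.
  by rewrite !opprB.
split.
  rewrite distrC.
  exact: (@chord_direction a1 a2 eta (q' - q).1 (q' - q).2 _ _ _ _ eta0' _ N0 distE h1 h2 hxi).
rewrite distrC.
apply: (@chord_direction a2 a1 eta (q' - q).2 (q' - q).1 _ _ _ _ eta0' _ N0 _ h2 h1).
- by rewrite addrC.
- by rewrite addrC.
- by rewrite addrC.
Unshelve. all: by end_near. Qed.

End Chord.

(** * Gauges *)

Section Crossing.
Context {R : realType}.
Implicit Types (p q : R * R) (E C : set (R * R)) (S : set R).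
Local Notation leb := (@lebesgue_measure R).
Local Notation H := (@hausdorff1 R).

Definition slice E (t : R) : set R := [set x | E (x, t)].

Lemma ysection_slice E t : ysection E t = slice E t.
Proof. by apply/seteqP; split=> x; rewrite /ysection /slice /= inE. Qed.

Definition width S : \bar R :=
  maxe 0%E (ereal_sup [set `|p.1 - p.2|%:E | p in S `*` S]).

Lemma width_ge0 S : (0 <= width S)%E.
Proof. by rewrite /width le_max lexx. Qed.

Lemma width_set0 : width set0 = 0%E.
Proof.
rewrite /width; have -> : [set `|p.1 - p.2|%:E | p in (@set0 R) `*` (@set0 R)] = set0.
  by rewrite -subset0 => x [p [/= []]].
by rewrite ereal_sup0 /maxe ltNge leNye.
Qed.

Lemma width_leP S (w : \bar R) : (0 <= w)%E ->
  (width S <= w)%E <-> forall a b, S a -> S b -> (`|a - b|%:E <= w)%E.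
Proof.
move=> w0; rewrite /width ge_max w0 /=; split.
  move=> h a b Sa Sb; apply: le_trans h.
  by apply: ereal_sup_ubound; exists (a, b).
by move=> h; apply: ge_ereal_sup => _ [[a b] [/= Sa Sb] <-]; exact: h.
Qed.

(** Projections of covering sets need not be measurable; they are replaced by a closed interval that
    starts at their infimum and is no longer than their width. *)
Lemma width_itv S : (width S < +oo)%E ->
  exists J : set (measurableTypeR R), [/\ measurable J, S `<=` J & (leb J <= width S)%E].
Proof.
move=> Soo; have [->|/set0P[a Sa]] := eqVneq S set0.
  by exists set0; split=> //; rewrite measure0 width_set0.
have fS : width S \is a fin_num by rewrite ge0_fin_numE// width_ge0.
set w := fine (width S); have wE : width S = w%:E by rewrite fineK.
have w0 : 0 <= w by rewrite fine_ge0// width_ge0.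
have dw b c : S b -> S c -> `|b - c| <= w.
  by move=> Sb Sc; rewrite -lee_fin -wE; exact: (width_leP S _ (width_ge0 S)).1.
have hS : has_inf S.
  split; [by exists a|exists (a - w) => b Sb].
  by have := dw _ _ Sa Sb; rewrite ler_norml => /andP[_]; rewrite lerBlDr => h; lra.
exists `[inf S, inf S + w]%classic; split.
- exact: measurable_itv.
- move=> b Sb; rewrite /= in_itv /=; apply/andP; split.
    by apply: inf_lbound => //; exact: hS.2.
  rewrite -lerBlDr; apply: lb_le_inf; first exact: hS.1.
  move=> c Sc; have := dw _ _ Sb Sc; rewrite ler_norml => /andP[_] h; lra.
- rewrite wE lebesgue_measure_itv /= lte_fin; case: ifPn => _; last by rewrite lee_fin.
  by rewrite -EFinB lee_fin; lra.
Qed.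

(** A linear form in height and width; its supremum over unit vectors (c, s) is the length of a
    straight piece. *)
Definition gauge (c s : R) C : \bar R :=
  (c%:E * width (snd @` C) + s%:E * width (fst @` C))%E.

Section gauge.
Variables c s : R.
Hypotheses (c0 : 0 <= c) (s0 : 0 <= s) (cs1 : c ^+ 2 + s ^+ 2 <= 1).

Lemma gauge_ge0 C : (0 <= gauge c s C)%E.
Proof. by rewrite adde_ge0// mule_ge0 ?lee_fin// width_ge0. Qed.

(** A small piece of the boundary nearly has the direction (n2, n1), and c n1 + s n2 <= 1 by
    Cauchy-Schwarz. The slack eta/2 in either coordinate adds up to at most eta because c and s are
    at most 1. *)
Lemma gauge_local E p eta : smooth_set E -> boundary E p -> 0 < eta ->
  \forall r \near 0^'+, forall C, C `<=` boundary E `&` ball p r ->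
    (gauge c s C <= (1 + eta)%:E * diameter C)%E.
Proof.
move=> sE bp eta0; have [n1 [n2 [n10 n20 n12 h]]] := chord E p sE bp.
have e20 : 0 < eta / 2 by rewrite divr_gt0.
have c1 : c <= 1.
  by rewrite -(@ler_pXn2r _ 2)// ?nnegrE// expr1n; move: cs1 (sqr_ge0 s); lra.
have s1 : s <= 1.
  by rewrite -(@ler_pXn2r _ 2)// ?nnegrE// expr1n; move: cs1 (sqr_ge0 c); lra.
apply: filterS (h _ e20) => r hr C Cb.
have w (x : R) : 0 <= x -> (0 <= x%:E * diameter C)%E.
  by move=> x0; rewrite mule_ge0 ?lee_fin ?diameter_ge0.
have e20' := ltW e20.
have W2 : (width (snd @` C) <= (n1 + eta / 2)%:E * diameter C)%E.
  apply/width_leP; first by rewrite w// addr_ge0.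
  move=> _ _ [q Cq <-] [q' Cq' <-]; have [bq rq] := Cb _ Cq; have [bq' rq'] := Cb _ Cq'.
  have [h1 _] := hr q q' bq bq' rq rq'.
  apply: (@le_trans _ _ ((n1 + eta / 2) * euclidean_dist q q')%:E); first by rewrite lee_fin.
  by rewrite EFinM lee_wpmul2l ?lee_fin ?addr_ge0//; exact: dist_le_diameter.
have W1 : (width (fst @` C) <= (n2 + eta / 2)%:E * diameter C)%E.
  apply/width_leP; first by rewrite w// addr_ge0.
  move=> _ _ [q Cq <-] [q' Cq' <-]; have [bq rq] := Cb _ Cq; have [bq' rq'] := Cb _ Cq'.
  have [_ h1] := hr q q' bq bq' rq rq'.
  apply: (@le_trans _ _ ((n2 + eta / 2) * euclidean_dist q q')%:E); first by rewrite lee_fin.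
  by rewrite EFinM lee_wpmul2l ?lee_fin ?addr_ge0//; exact: dist_le_diameter.
apply: (@le_trans _ _ (c%:E * ((n1 + eta / 2)%:E * diameter C) +
    s%:E * ((n2 + eta / 2)%:E * diameter C))%E).
  by apply: leeD; apply: lee_wpmul2l; rewrite ?lee_fin.
rewrite !muleA -!EFinM -ge0_muleDl ?lee_fin ?mulr_ge0 ?addr_ge0//.
rewrite lee_wpmul2r ?diameter_ge0// lee_fin.
have cs : c * n1 + s * n2 <= 1.
  by move: cs1 n12 (sqr_ge0 (c - n1)) (sqr_ge0 (s - n2)); rewrite !sqrrB; lra.
have : (c + s) * (eta / 2) <= 2 * (eta / 2) by rewrite ler_wpM2r//; lra.
by rewrite !mulrDr mulrDl; lra.
Qed.

(** Intersecting a cover with [A] puts every piece inside the small ball, where the two gauges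
    compare. *)
Lemma methodII_gauge_local E p eta : smooth_set E -> boundary E p -> 0 < eta ->
  \forall r \near 0^'+, forall A, A `<=` boundary E `&` ball p r ->
    (methodII (gauge c s) A <= (1 + eta)%:E * H A)%E.
Proof.
move=> sE bp eta0; apply: filterS (gauge_local E p eta sE bp eta0) => r hr A Ab.
have eta1 : 0 < 1 + eta by rewrite addr_gt0.
apply: ge_ereal_sup => _ [d /= d0 <-].
rewrite muleC -lee_pdivrMr//.
apply: le_trans (methodII_delta_le (@diameter R) d A d0).
apply: le_ereal_inf_tmp => _ [C [AC Cd] <-].
rewrite lee_pdivrMr// muleC -nneseriesZl; last by move=> i _; exact: diameter_ge0.
apply: (@le_trans _ _ (\sum_(0 <= i <oo) gauge c s (C i `&` A))%E).
  apply: ereal_inf_lbound; exists (fun i => C i `&` A) => //; split.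
    by move=> q Aq; have [i _ Ci] := AC q Aq; exists i.
  by move=> i; apply: le_trans (Cd i); exact: le_diameter.
apply: lee_nneseries => [i _ _|i _]; first exact: gauge_ge0.
apply: le_trans (hr _ _) _; first by move=> q [_ /Ab].
by apply: lee_wpmul2l; [rewrite lee_fin ltW|apply: le_diameter; exact: subIsetl].
Qed.

Lemma rational_ball p (r : R) : 0 < r -> exists abc : rat * rat * rat,
  ball ((ratr abc.1.1 : R), (ratr abc.1.2 : R)) (ratr abc.2) p /\
  ball ((ratr abc.1.1 : R), (ratr abc.1.2 : R)) (ratr abc.2) `<=` ball p r.
Proof.
move=> r0; have [u /andP[u1 u2]] : exists u : rat, r / 4 < ratr u < r / 2.
  have [|u] := @rat_in_itvoo R (r / 4) (r / 2); first by lra.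
  by rewrite in_itv /=; exists u.
have near (x : R) : exists a : rat, `|ratr a - x| < r / 4.
  have [|a] := @rat_in_itvoo R (x - r / 4) (x + r / 4); first by lra.
  by rewrite in_itv /= => /andP[h1 h2]; exists a; rewrite ltr_norml; lra.
have [a ha] := near p.1; have [b hb] := near p.2.
exists (a, b, u); split => /=.
  by split; rewrite /ball/=; [apply: lt_trans ha _|apply: lt_trans hb _].
move=> q [/= h1 h2]; split; rewrite /ball/=.
  have -> : p.1 - q.1 = (ratr a - q.1) - (ratr a - p.1) by ring.
  by apply: le_lt_trans (ler_normB _ _) _; move: h1; rewrite /ball/= => h1; lra.
have -> : p.2 - q.2 = (ratr b - q.2) - (ratr b - p.2) by ring.
by apply: le_lt_trans (ler_normB _ _) _; move: h2; rewrite /ball/= => h2; lra.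
Qed.

Lemma measurable_ball2 p (r : R) : measurable (ball p r : set (R * R)).
Proof.
have -> : (ball p r : set (R * R)) = ball p.1 r `*` ball p.2 r by [].
by apply: measurableX; exact: measurable_ball.
Qed.

Lemma open_measurable2 E : open E -> measurable E.
Proof.
move=> oE.
pose O (abc : rat * rat * rat) : set (R * R) :=
  let B := ball ((ratr abc.1.1 : R), (ratr abc.1.2 : R)) (ratr abc.2) in
  if `[< B `<=` E >] then B else set0.
have -> : E = \bigcup_abc O abc.
  apply/seteqP; split=> [p Ep|p [abc _]]; last by rewrite /O; case: asboolP => // h /h.
  have /nbhs_ballP[r /= r0 rE] : nbhs p E by apply: open_nbhs_nbhs.
  have [abc [h1 h2]] := rational_ball p r r0; exists abc => //; rewrite /O; case: asboolP => //.
  by case; exact: subset_trans h2 rE.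
apply: countable_bigcupT_measurable; first exact: countableP.
move=> abc; rewrite /O; case: asboolP => _; last exact: measurable0.
exact: measurable_ball2.
Qed.

Lemma closed_measurable2 E : closed E -> measurable E.
Proof. by move=> cE; rewrite -[E]setCK; apply: measurableC; apply: open_measurable2; exact: closed_openC. Qed.

Lemma boundary_measurable E : measurable (boundary E).
Proof.
apply: measurableD; first by apply: closed_measurable2; exact: closed_closure.
by apply: open_measurable2; exact: open_interior.
Qed.

(** The local comparison is summed over countably many rational balls made disjoint: the Hausdorff
    measure is additive on the Borel pieces, and the gauge measure is subadditive. *)
Lemma methodII_gauge E A : smooth_set E -> measurable A -> A `<=` boundary E ->
  (methodII (gauge c s) A <= H A)%E.
Proof.
move=> sE mA AE; apply/lee_addgt0Pr => e0 e00.
suff key eta : 0 < eta -> (methodII (gauge c s) A <= (1 + eta)%:E * H A)%E.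
  (* If the length is infinite the bound is trivial; otherwise eta is [e0] over the length plus 1,
     the summand 1 avoiding a zero denominator. *)
  have [Aoo|Aoo] := ltP (H A) +oo%E; last first.
    by move: Aoo; rewrite leye_eq => /eqP ->; rewrite addye// leey.
  have fA : H A \is a fin_num by rewrite ge0_fin_numE// outer_measure_ge0.
  have A0 : 0 <= fine (H A) by rewrite fine_ge0// outer_measure_ge0.
  have A1 : 0 < fine (H A) + 1 by rewrite ltr_wpDl.
  apply: le_trans (key (e0 / (fine (H A) + 1)) _) _; first exact: divr_gt0.
  rewrite -(fineK fA) -EFinM -EFinD lee_fin mulrDl mul1r lerD2l.
  by rewrite mulrAC ler_pdivrMr// ler_wpM2l ?(ltW e00)// lerDl.
move=> eta0.
pose B (abc : rat * rat * rat) := ball ((ratr abc.1.1 : R), (ratr abc.1.2 : R)) (ratr abc.2).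
pose good abc := forall A, A `<=` boundary E `&` B abc ->
    (methodII (gauge c s) A <= (1 + eta)%:E * H A)%E.
pose O (k : nat) : set (R * R) :=
  if unpickle k is Some abc then if `[< good abc >] then B abc else set0 else set0.
have mO k : measurable (O k).
  rewrite /O; case: unpickle => [abc|]; last exact: measurable0.
  by case: asboolP => _; [exact: measurable_ball2|exact: measurable0].
have bO : boundary E `<=` \bigcup_k O k.
  move=> p bp; have := methodII_gauge_local E p eta sE bp eta0.
  move=> near_p; have [r [r0 hr]] : exists r, 0 < r /\ forall A, A `<=` boundary E `&` ball p r ->
      (methodII (gauge c s) A <= (1 + eta)%:E * H A)%E.
    near (0 : R)^'+ => r; exists r; split; first by near: r; exact: nbhs_right_gt.
    by near: r.
  have [abc [h1 h2]] := rational_ball p r r0.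
  have gabc : good abc by move=> A' hA'; apply: hr => q /hA'[bq Bq]; split=> //; exact: h2.
  have Op k : unpickle k = Some abc -> O k p by rewrite /O => ->; case: asboolP.
  have [k hk] : exists k, unpickle k = Some abc by exists (pickle abc); exact: pickleK.
  by exists k; last exact: Op.
have AU : A = \bigcup_k (A `&` seqDU O k).
  by rewrite -setI_bigcupr -seqDU_bigcup_eq; apply/seteqP; split=> [p Ap|p []//]; split=> //; exact/bO/AE.
have mAk k : measurable (A `&` seqDU O k).
  by apply: measurableI => //; apply: measurableD => //; exact: bigsetU_measurable.
have -> : H A = (\sum_(0 <= k <oo) H (A `&` seqDU O k))%E.
  rewrite {1}AU measure_semi_bigcup//.
    by apply: trivIset_setIl; exact: trivIset_seqDU.
  by rewrite -AU.
rewrite -nneseriesZl; last by move=> k _; exact: outer_measure_ge0.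
rewrite {1}AU; apply: le_trans (methodII_sigma_subadditive _ gauge_ge0 _) _.
apply: lee_nneseries => [k _ _|k _]; first exact/methodII_ge0/gauge_ge0.
have sub : A `&` seqDU O k `<=` boundary E `&` O k.
  by move=> p [Ap [Ok _]]; split=> //; exact: AE.
move: sub; rewrite {2}/O; case: unpickle => [abc|].
  case: asboolP => [ga sub|_ sub]; first exact: ga.
  have -> : A `&` seqDU O k = set0 by rewrite -subset0 => p /sub[].
  by rewrite methodII_set0 ?mule_ge0 ?outer_measure_ge0 ?lee_fin ?addr_ge0 ?(ltW eta0)//;
    [exact: gauge_ge0|rewrite /gauge !image_set0 width_set0 !mule0 adde0].
move=> sub; have -> : A `&` seqDU O k = set0 by rewrite -subset0 => p /sub[].
by rewrite methodII_set0 ?mule_ge0 ?outer_measure_ge0 ?lee_fin ?addr_ge0 ?(ltW eta0)//;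
  [exact: gauge_ge0|rewrite /gauge !image_set0 width_set0 !mule0 adde0].
Unshelve. all: by end_near. Qed.

End gauge.
End Crossing.

(** * Slices and boundary points *)

Section Crossing2.
Context {R : realType}.
Implicit Types (p q : R * R) (E C : set (R * R)) (S : set R).
Local Notation leb := (@lebesgue_measure R).
Local Notation H := (@hausdorff1 R).

(** [u] is the infimum of the times outside [E]: it is itself such a time because [E] is open, and
    it is a limit of earlier times inside [E]. *)
Lemma exit_point E (phi : R -> R * R) a b : open E -> continuous phi -> a <= b ->
  E (phi a) -> ~ E (phi b) -> exists2 u, a < u <= b & boundary E (phi u).
Proof.
move=> oE cphi ab Ea nEb.
pose N := [set t | a <= t <= b /\ ~ E (phi t)].
have Nb : N b by split=> //; rewrite ab lexx.
have hN : has_inf N by split; [exists b|exists a => t [/andP[]]].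
pose u := inf N.
have au : a <= u by apply: lb_le_inf; [exact: hN.1|move=> t [/andP[]]].
have ub : u <= b by apply: inf_lbound => //; exact: hN.2.
have lt_u s : a <= s -> s < u -> E (phi s).
  move=> as_ su; apply: contrapT => nE; move: (su); rewrite ltNge => /negP; apply.
  by apply: inf_lbound; [exact: hN.2|split=> //; rewrite as_/=; apply: ltW; exact: lt_le_trans su ub].
have nEu : ~ E (phi u).
  move=> Eu; have /nbhs_ballP[e /= e0 ue] : \forall t \near u, E (phi t).
    by apply: cphi; exact: open_nbhs_nbhs.
  have /(inf_adherent e0)[t [tab nEt]] := hN; rewrite -/u => tu.
  have ut : u <= t by apply: inf_lbound => //; exact: hN.2.
  by apply: nEt; apply: ue; rewrite /ball/= ler0_norm ?subr_le0//; lra.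
have au' : a < u.
  by rewrite lt_neqAle au andbT; apply/negP => /eqP au'; apply: nEu; rewrite -au'.
exists u; first by rewrite au' ub.
apply/(boundary_open _ _ oE); split=> // V.
move=> /cphi /nbhs_ballP[e /= e0 ue].
pose s := Num.max a (u - e / 2).
have su : s < u by rewrite gt_max au'/=; lra.
exists (phi s); split; first by apply: lt_u; rewrite // le_max lexx.
apply: ue; rewrite /ball/= gtr0_norm ?subr_gt0//.
have : u - e / 2 <= s by rewrite le_max lexx orbT.
by lra.
Qed.

(** The exit point of the path run backwards. *)
Lemma enter_point E (phi : R -> R * R) a b : open E -> continuous phi -> a <= b ->
  ~ E (phi a) -> E (phi b) -> exists2 u, a <= u < b & boundary E (phi u).
Proof.
move=> oE cphi ab nEa Eb.
have [||||u /andP[u1 u2] bu] := @exit_point E (phi \o -%R) (- b) (- a) oE.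
- by move=> x; apply: continuous_comp; [exact: opp_continuous|exact: cphi].
- by rewrite lerN2.
- by rewrite /= opprK.
- by rewrite /= opprK.
by exists (- u) => //; lra.
Qed.

Lemma hline_continuous (t : R) : continuous (fun x : R => (x, t)).
Proof.
by move=> x; apply/cvg_ballP => e e0; exists e => //= y xy; split=> //=; exact: ballxx.
Qed.

Lemma vline_continuous (x : R) : continuous (fun t : R => (x, t)).
Proof.
by move=> t; apply/cvg_ballP => e e0; exists e => //= y xy; split=> //=; exact: ballxx.
Qed.

Lemma slice_measurable E t : measurable E -> measurable (slice E t : set (measurableTypeR R)).
Proof. by move=> mE; rewrite -ysection_slice; exact: measurable_ysection. Qed.

(** Otherwise the width of [S] is at most [d], and [S] fits into an interval of that length. *)
Lemma spread_points S (d : R) : 0 < d -> measurable (S : set (measurableTypeR R)) ->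
  (d%:E < leb S)%E -> exists a b, [/\ S a, S b & d < b - a].
Proof.
move=> d0 mS dS; apply: contrapT => h.
have h' a b : S a -> S b -> b - a <= d.
  by move=> Sa Sb; rewrite leNgt; apply/negP => dab; apply: h; exists a, b.
have wS : (width S <= d%:E)%E.
  apply/width_leP; first by rewrite lee_fin ltW.
  by move=> a b Sa Sb; rewrite lee_fin ler_norml h'// andbT lerNl opprB h'.
have [|J [mJ SJ lJ]] := width_itv S; first by rewrite (le_lt_trans wS)// ltey.
move: dS; rewrite ltNge => /negP; apply.
apply: le_trans (le_trans lJ wS).
by apply: le_measure => //; rewrite inE.
Qed.

Lemma ray_escape S (e : R) : (leb S < +oo)%E -> measurable (S : set (measurableTypeR R)) ->
  (exists2 n, n < e & ~ S n) /\ (exists2 n, e < n & ~ S n).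
Proof.
move=> Soo mS; split; apply: contrapT => h.
  have sub : `]-oo, e[ `<=` S.
    by move=> x; rewrite /= in_itv /= => xe; apply: contrapT => nS; apply: h; exists x.
  have : (leb `]-oo, e[%classic <= leb S)%E.
    by apply: le_measure => //; rewrite inE //; exact: measurable_itv.
  by rewrite lebesgue_measure_itv /= ltNye /= addey// leye_eq => /eqP SE; rewrite SE ltxx in Soo.
have sub : `]e, +oo[ `<=` S.
  by move=> x; rewrite /= in_itv /= andbT => xe; apply: contrapT => nS; apply: h; exists x.
have : (leb `]e, +oo[%classic <= leb S)%E.
  by apply: le_measure => //; rewrite inE //; exact: measurable_itv.
by rewrite lebesgue_measure_itv /= ltry /= leye_eq => /eqP SE; rewrite SE ltxx in Soo.
Qed.

(** Start from two points of the slice more than [d] apart and leave the slice outwards from both;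
    finite measure guarantees that both rays do leave it. *)
Lemma two_boundary_points E t (d : R) : open E -> 0 < d ->
  (d%:E < leb (slice E t))%E -> (leb (slice E t) < +oo)%E ->
  exists x1 x2, [/\ boundary E (x1, t), boundary E (x2, t) & d < x2 - x1].
Proof.
move=> oE d0 dS Soo; have mS := slice_measurable E t (open_measurable2 E oE).
have [e [e' [Ee Ee' ee']]] := spread_points _ d d0 mS dS.
have [[n ne nE] _] := ray_escape _ e Soo mS.
have [_ [n' en' nE']] := ray_escape _ e' Soo mS.
have [x1 /andP[h1 h2] bx1] := enter_point E _ n e oE (hline_continuous t) (ltW ne) nE Ee.
have [x2 /andP[h3 h4] bx2] := exit_point E _ e' n' oE (hline_continuous t) (ltW en') Ee' nE'.
by exists x1, x2; split=> //; lra.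
Qed.

(** A hole in measure, which forces four boundary points on the line. Fixing the interval (r1, r2)
    makes the condition open under small changes of measure, and later allows countably many
    intervals to be treated together. *)
Definition gap (d r1 r2 : R) S := [/\ (d%:E < leb (S `&` `]-oo, r1[))%E,
  (d%:E < leb (`]r1, r2[ `\` S))%E & (d%:E < leb (S `&` `]r2, +oo[))%E].

Lemma four_boundary_points E t (d r1 r2 : R) : open E -> 0 < d ->
  gap d r1 r2 (slice E t) -> (leb (slice E t) < +oo)%E ->
  exists x1 x2 x3 x4, [/\ boundary E (x1, t), boundary E (x2, t),
     boundary E (x3, t) & boundary E (x4, t)] /\
     [/\ d < x2 - x1, d < x3 - x2 & d < x4 - x3].
Proof.
move=> oE d0 [g1 g2 g3] Soo; have mS := slice_measurable E t (open_measurable2 E oE).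
have [|e [e' [[Ee e1] [Ee' e1'] ee']]] := spread_points _ d d0 _ g1.
  by apply: measurableI => //; exact: measurable_itv.
have [|h [h' [[Eh e2] [Eh' e2'] hh']]] := spread_points _ d d0 _ g3.
  by apply: measurableI => //; exact: measurable_itv.
have [|g [g' [[e3 nEg] [e3' nEg'] gg']]] := spread_points _ d d0 _ g2.
  by apply: measurableD => //; exact: measurable_itv.
move: e1 e1' e2 e2' e3 e3'; rewrite /= !in_itv/= !andbT.
move=> e1 e1' e2 e2' /andP[e3 e4] /andP[e3' e4'].
have [[n ne nE] _] := ray_escape _ e Soo mS.
have [_ [n' en' nE']] := ray_escape _ h' Soo mS.
have [x1 /andP[h1 h2] bx1] := enter_point E _ n e oE (hline_continuous t) (ltW ne) nE Ee.
have [x4 /andP[h3 h4] bx4] := exit_point E _ h' n' oE (hline_continuous t) (ltW en') Eh' nE'.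
have eg : e' <= g by apply: ltW; apply: lt_trans e3.
have gh : g' <= h by apply: ltW; apply: lt_trans e2.
have [x2 /andP[h5 h6] bx2] := exit_point E _ e' g oE (hline_continuous t) eg Ee' nEg.
have [x3 /andP[h7 h8] bx3] := enter_point E _ g' h oE (hline_continuous t) gh nEg' Eh.
by exists x1, x2, x3, x4; split; split=> //; lra.
Qed.

(** Points more than [d] apart lie in different pieces of a cover of mesh [d], and the projection of
    each of these pieces contains [t]. *)
Lemma count_cover E (C : nat -> set (R * R)) (J : nat -> set (measurableTypeR R)) (d t : R)
    (xs : seq R) : 0 <= d ->
  (forall i, (diameter (C i) <= d%:E)%E) -> (forall i, snd @` C i `<=` J i) ->
  (forall x, x \in xs -> (\bigcup_i C i) (x, t)) ->
  uniq xs -> (forall x x', x \in xs -> x' \in xs -> x != x' -> d < `|x - x'|) ->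
  ((size xs)%:R%:E <= \sum_(0 <= i <oo) (\1_(J i) t : R)%:E)%E.
Proof.
move=> d0 Cd CJ xsC uxs sep.
have /choice[k hk] : forall x, exists i, x \in xs -> C i (x, t).
  move=> x; have [/xsC[i _ Ci]|_] := boolP (x \in xs); first by exists i.
  by exists 0%N.
have kinj : {in xs &, injective k}.
  move=> x x' xxs xxs' kk; apply/eqP/negPn/negP => /(sep _ _ xxs xxs').
  apply/negP; rewrite -leNgt.
  have Cx := hk _ xxs; have := hk _ xxs'; rewrite -kk => Cx'.
  by apply: le_trans (dist_ge_fst (x', t) (x, t)) _; have /diameter_leP := Cd (k x); apply.
pose ks := map k xs.
have uks : uniq ks by rewrite map_inj_in_uniq.
pose M := (\max_(i <- ks) i).+1.
apply: le_trans (nneseries_lim_ge M _); last by move=> i _ _; rewrite lee_fin.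
rewrite sumEFin lee_fin.
have -> : (size xs)%:R = \sum_(i <- ks) (\1_(J i) t : R).
  rewrite -(size_map k xs) -/ks big_seq_cond (eq_bigr (fun=> 1 : R)); last first.
    move=> i; rewrite andbT => /mapP[x xxs ->]; rewrite indicE mem_set//.
    by apply: CJ; exists (x, t) => //; exact: hk.
  by rewrite -big_seq_cond big_const_seq count_predT iter_addr_0.
have perm : perm_eq ks [seq i <- index_iota 0 M | i \in ks].
  apply: uniq_perm => //; first by rewrite filter_uniq// iota_uniq.
  move=> i; rewrite mem_filter; have [iks|//] := boolP (i \in ks).
  by rewrite mem_index_iota /= ltnS; apply/esym; exact: leq_bigmax_seq.
rewrite (perm_big _ perm) big_filter [leRHS](bigID (mem ks)) /= lerDl.
by apply: sumr_ge0.
Qed.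

End Crossing2.

(** * The crossing estimate in two directions at once *)

Section Crossing3.
Context {R : realType}.
Implicit Types (p q : R * R) (E C : set (R * R)) (S : set R).
Local Notation leb := (@lebesgue_measure R).
Local Notation H := (@hausdorff1 R).

Lemma width_snd_le C (d : R) : 0 <= d -> (diameter C <= d%:E)%E ->
  (width (snd @` C) <= d%:E)%E.
Proof.
move=> d0 /(diameter_leP _ _ d0) Cd; apply/width_leP; first by rewrite lee_fin.
move=> _ _ [q Cq <-] [q' Cq' <-]; rewrite lee_fin.
exact: le_trans (dist_ge_snd q' q) (Cd _ _ Cq' Cq).
Qed.

Lemma width_fst_le C (d : R) : 0 <= d -> (diameter C <= d%:E)%E ->
  (width (fst @` C) <= d%:E)%E.
Proof.
move=> d0 /(diameter_leP _ _ d0) Cd; apply/width_leP; first by rewrite lee_fin.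
move=> _ _ [q Cq <-] [q' Cq' <-]; rewrite lee_fin.
exact: le_trans (dist_ge_fst q' q) (Cd _ _ Cq' Cq).
Qed.

Lemma vertical_crossing E (y y' x : R) : open E -> y < y' ->
  ~ boundary E (x, y) -> ~ boundary E (x, y') ->
  (slice E y `+` slice E y') x ->
  exists2 u, y < u < y' & boundary E (x, u).
Proof.
move=> oE yy' by1 by2 [[Ey nEy']|[Ey' nEy]].
  have [u /andP[h1 h2] bu] := exit_point E _ y y' oE (vline_continuous x) (ltW yy') Ey nEy'.
  exists u => //; rewrite h1 lt_neqAle h2 andbT; apply/negP => /eqP uy'.
  by apply: by2; rewrite -uy'.
have [u /andP[h1 h2] bu] := enter_point E _ y y' oE (vline_continuous x) (ltW yy') nEy Ey'.
exists u => //; rewrite h2 lt_neqAle h1 !andbT; apply/negP => /eqP uy'.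
by apply: by1; rewrite uy'.
Qed.

Definition hstrip (y y' : R) : set (R * R) := [set p | y < p.2 < y'].

Lemma hstrip_measurable y y' : measurable (hstrip y y').
Proof.
have -> : hstrip y y' = setT `*` `]y, y'[%classic.
  by apply/seteqP; split=> p; rewrite /hstrip /= in_itv/=; [split|case].
by apply: measurableX => //; exact: measurable_itv.
Qed.

Lemma symdiff_measurable {d} {T : measurableType d} (S S' : set T) : measurable S -> measurable S' ->
  measurable (S `+` S').
Proof. by move=> mS mS'; apply: measurableU; exact: measurableD. Qed.

(** Cauchy-Crofton counting for covers of mesh [d]: the heights of the pieces sum to at least the
    integral of the number of boundary points on horizontal lines (two, or four over [B]), while
    their widths cover almost all of the symmetric difference of the end slices, above which every
    vertical line meets the boundary. *)
Lemma crossing E (c s y y' d r1 r2 : R) (A B : set (measurableTypeR R)) : smooth_set E ->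
  0 <= c -> 0 <= s -> c ^+ 2 + s ^+ 2 <= 1 -> y < y' -> 0 < d ->
  measurable A -> measurable B -> A `<=` `]y, y'[ -> B `<=` A ->
  (forall t, A t -> (d%:E < leb (slice E t))%E /\ (leb (slice E t) < +oo)%E) ->
  (forall t, B t -> gap d r1 r2 (slice E t)) ->
  leb (slice (boundary E) y) = 0%E -> leb (slice (boundary E) y') = 0%E ->
  (c%:E * (2%:E * leb A + 2%:E * leb B) + s%:E * leb (slice E y `+` slice E y') <=
   H (boundary E `&` hstrip y y'))%E.
Proof.
move=> sE c0 s0 cs1 yy' d0 mA mB Ayy BA hA hB ny ny'; have oE := sE.1.
have mbE := boundary_measurable E.
have mD : measurable (boundary E `&` hstrip y y').
  by apply: measurableI => //; exact: hstrip_measurable.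
apply: le_trans (methodII_gauge c s c0 s0 cs1 E _ sE mD (@subIsetl _ _ _)).
apply: le_trans (methodII_delta_le _ d _ d0).
apply: le_ereal_inf_tmp => _ [C [DC Cd] <-].
have d0' := ltW d0.
have /choice[J hJ] : forall i, exists J : set (measurableTypeR R),
    [/\ measurable J, snd @` C i `<=` J & (leb J <= width (snd @` C i))%E].
  by move=> i; apply: width_itv; apply: le_lt_trans (width_snd_le _ _ d0' (Cd i)) _; rewrite ltey.
have /choice[K hK] : forall i, exists J : set (measurableTypeR R),
    [/\ measurable J, fst @` C i `<=` J & (leb J <= width (fst @` C i))%E].
  by move=> i; apply: width_itv; apply: le_lt_trans (width_fst_le _ _ d0' (Cd i)) _; rewrite ltey.
have w0 S : (0 <= width S :> \bar R)%E by exact: width_ge0.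
rewrite /gauge nneseriesD; last 2 first.
- by move=> i _ _; rewrite mule_ge0 ?lee_fin.
- by move=> i _ _; rewrite mule_ge0 ?lee_fin.
rewrite !nneseriesZl//; apply: leeD; apply: lee_wpmul2l; rewrite ?lee_fin//.
  apply: (@le_trans _ _ (\sum_(0 <= i <oo) leb (J i))%E); last first.
    by apply: lee_nneseries => // i _; have [] := hJ i.
  have mJ i : measurable (J i) by have [] := hJ i.
  have JE i : leb (J i) = (\int[leb]_t (\1_(J i) t : R)%:E)%E.
    by rewrite integral_indic// setIT.
  (* The sum of the lengths of the [J i] is the integral over t of the number of [J i] containing
     t. *)
  rewrite (eq_eseriesr (fun i _ => JE i)).
  rewrite -integral_nneseries//; last first.
    by move=> i; apply/measurable_EFinP; exact: measurable_indic.
  have IE (S : set (measurableTypeR R)) : measurable S ->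
      (2%:E * leb S = \int[leb]_t (2%:E * (\1_S t : R)%:E))%E.
    move=> mS; rewrite ge0_integralZl//=; first by rewrite integral_indic// setIT.
    by apply/measurable_EFinP; exact: measurable_indic.
  have mI (S : set (measurableTypeR R)) : measurable S ->
      measurable_fun setT (fun t => (2%:E * (\1_S t : R)%:E)%E).
    by move=> mS; apply: measurable_funeM; apply/measurable_EFinP; exact: measurable_indic.
  rewrite !IE// -ge0_integralD//; try exact: mI; try by move=> t _; rewrite mule_ge0 ?lee_fin.
  apply: ge0_le_integral => //.
  - by move=> t _; rewrite adde_ge0// mule_ge0 ?lee_fin.
  - by apply: emeasurable_funD; exact: mI.
  - apply: (@ge0_emeasurable_sum _ _ R setT (fun i t => (\1_(J i) t : R)%:E) xpredT).
      by move=> i t _ _; rewrite lee_fin.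
    by move=> i _; apply/measurable_EFinP; exact: measurable_indic.
  move=> t _; rewrite -!EFinM -EFinD !indicE.
  have [tA|tA] := boolP (t \in A); last first.
    have /negbTE -> : t \notin B by apply: contraNN tA => /set_mem/BA/mem_set.
    by rewrite !mulr0 addr0; apply: nneseries_ge0 => i _ _; rewrite lee_fin.
  have At := set_mem tA; have [At1 At2] := hA t At.
  have tyy : y < t < y' by have := Ayy t At; rewrite /= in_itv.
  have cov x : boundary E (x, t) -> (\bigcup_i C i) (x, t) by move=> bx; apply: DC.
  have SJ i : snd @` C i `<=` J i by have [] := hJ i.
  have [tB|tB] := boolP (t \in B).
    have [x1 [x2 [x3 [x4 [[b1 b2 b3 b4] [l1 l2 l3]]]]]] :=
      four_boundary_points E t d r1 r2 oE d0 (hB t (set_mem tB)) At2.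
    have := @count_cover R E C J d t [:: x1; x2; x3; x4] d0' Cd SJ.
    rewrite /= !mulr1 (_ : (2 + 2 : R) = 4%:R); last by rewrite -natrD.
    apply.
    + by move=> x; rewrite !inE => /or4P[] /eqP ->; exact: cov.
    + by rewrite !inE !negb_or; apply/and4P; split=> //; rewrite ?andbT; try apply/and3P; try split;
       rewrite ?lt_eqF//; lra.
    + by move=> x x'; rewrite !inE => /or4P[] /eqP -> /or4P[] /eqP ->; rewrite ?eqxx// => _;
        rewrite lter_normr; apply/orP; (left; lra) || (right; lra).
  have [x1 [x2 [b1 b2 l1]]] := two_boundary_points E t d oE d0 At1 At2.
  have := @count_cover R E C J d t [:: x1; x2] d0' Cd SJ.
  rewrite /= mulr1 mulr0 addr0; apply.
  + by move=> x; rewrite !inE => /orP[] /eqP ->; exact: cov.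
  + by rewrite !inE andbT lt_eqF//; lra.
  + by move=> x x'; rewrite !inE => /orP[] /eqP -> /orP[] /eqP ->; rewrite ?eqxx// => _;
      rewrite lter_normr; apply/orP; (left; lra) || (right; lra).
apply: (@le_trans _ _ (\sum_(0 <= i <oo) leb (K i))%E); last first.
  by apply: lee_nneseries => // i _; have [] := hK i.
have mK i : measurable (K i) by have [] := hK i.
(* The strip is open, so abscissae with a boundary point on one of its end lines are set aside; they
   are null by assumption. *)
pose N : set (measurableTypeR R) := slice (boundary E) y `|` slice (boundary E) y'.
have mN : measurable N by apply: measurableU; exact: slice_measurable.
have N0 : leb N = 0%E.
  apply/eqP; rewrite eq_le measure_ge0 andbT.
  by apply: le_trans (outer_measureU2 _ _ _) _; rewrite -[leRHS](adde0 0%E) -{1}ny -ny'.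
have sub : slice E y `+` slice E y' `<=` N `|` \bigcup_i K i.
  move=> x hx; have [Nx|Nx] := pselect (N x); [by left|right].
  have [u yu bu] := vertical_crossing E y y' x oE yy'
     (fun b => Nx (or_introl b)) (fun b => Nx (or_intror b)) hx.
  have [i _ Ci] : (\bigcup_i C i) (x, u) by apply: DC.
  by exists i => //; have [_ + _] := hK i; apply; exists (x, u).
have mE := open_measurable2 E oE.
apply: (@le_trans _ _ (leb (N `|` \bigcup_i K i))).
  apply: le_measure => //; rewrite inE.
    by apply: symdiff_measurable; exact: slice_measurable.
  by apply: measurableU => //; exact: bigcupT_measurable.
apply: (@le_trans _ _ (leb N + leb (\bigcup_i K i))%E); first exact: outer_measureU2.
rewrite N0 add0e; exact: outer_measure_sigma_subadditive.
Qed.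

End Crossing3.

(** * Slicing the area *)

Section Slicing.
Context {R : realType}.
Implicit Types (p q : R * R) (E C : set (R * R)) (S : set R).
Local Notation leb := (@lebesgue_measure R).
Local Notation H := (@hausdorff1 R).
Local Notation RT := (measurableTypeR R).

Lemma width_snd_diameter C : (width (snd @` C) <= diameter C)%E.
Proof.
apply/width_leP; first exact: diameter_ge0.
move=> _ _ [q Cq <-] [q' Cq' <-]; apply: le_trans (dist_le_diameter _ _ _ Cq' Cq).
by rewrite lee_fin; exact: dist_ge_snd.
Qed.

Lemma width_fst_diameter C : (width (fst @` C) <= diameter C)%E.
Proof.
apply/width_leP; first exact: diameter_ge0.
move=> _ _ [q Cq <-] [q' Cq' <-]; apply: le_trans (dist_le_diameter _ _ _ Cq' Cq).
by rewrite lee_fin; exact: dist_ge_fst.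
Qed.

Lemma area_rect (A B : set RT) : measurable A -> measurable B ->
  area R (A `*` B) = (leb A * leb B)%E.
Proof. by move=> mA mB; exact: product_measure1E. Qed.

(** Every covering set fits into a rectangle with sides at most its diameter, itself at most [d], so
    the area is at most [d] times the total diameter, for every scale [d]. *)
Lemma area_finite_length E : measurable E -> (H E < +oo)%E -> area R E = 0%E.
Proof.
move=> mE Eoo; apply/eqP; rewrite eq_le measure_ge0 andbT.
have HE : H E \is a fin_num by rewrite ge0_fin_numE// outer_measure_ge0.
have H0 : 0 <= fine (H E) by rewrite fine_ge0// outer_measure_ge0.
suff key d : 0 < d -> (area R E <= (d * (fine (H E) + 1))%:E)%E.
  apply/lee_addgt0Pr => e e0; rewrite add0e.
  apply: le_trans (key (e / (fine (H E) + 1)) _) _; first by rewrite divr_gt0// ltr_wpDl.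
  by rewrite divfK// gt_eqF// ltr_wpDl.
move=> d0.
have dH := methodII_delta_le (@diameter R) d E d0.
have fd : methodII_delta (@diameter R) d E \is a fin_num.
  rewrite ge0_fin_numE; last exact/methodII_delta_ge0/diameter_ge0.
  exact: le_lt_trans dH Eoo.
have [x [C [EC Cd] <-] xle] := lb_ereal_inf_adherent ltr01 fd.
have Soo i : (diameter (C i) < +oo)%E by rewrite (le_lt_trans (Cd i))// ltey.
have /choice[J hJ] : forall i, exists J : set RT,
    [/\ measurable J, snd @` C i `<=` J & (leb J <= diameter (C i))%E].
  move=> i; have [|J [mJ SJ lJ]] := @width_itv R (snd @` C i).
    exact: le_lt_trans (width_snd_diameter _) (Soo i).
  by exists J; split=> //; exact: le_trans lJ (width_snd_diameter _).
have /choice[K hK] : forall i, exists J : set RT,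
    [/\ measurable J, fst @` C i `<=` J & (leb J <= diameter (C i))%E].
  move=> i; have [|J' [mJ SJ lJ]] := @width_itv R (fst @` C i).
    exact: le_lt_trans (width_fst_diameter _) (Soo i).
  by exists J'; split=> //; exact: le_trans lJ (width_fst_diameter _).
pose Q i : set (RT * RT) := K i `*` J i.
have mQ i : measurable (Q i) by apply: measurableX; [have [] := hK i|have [] := hJ i].
have EQ : E `<=` \bigcup_i Q i.
  move=> p /EC[i _ Ci]; exists i => //; split; [have [_ h _] := hK i|have [_ h _] := hJ i];
  by apply: h; exists p.
apply: (@le_trans _ _ (area R (\bigcup_i Q i))).
  by apply: le_measure; rewrite ?inE//; exact: bigcupT_measurable.
apply: (@le_trans _ _ (\sum_(0 <= i <oo) area R (Q i))%E).
  by apply: measure_sigma_subadditive => //; exact: bigcupT_measurable.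
apply: (@le_trans _ _ (\sum_(0 <= i <oo) (d%:E * diameter (C i)))%E).
  apply: lee_nneseries => [i _ _|i _]; first exact: measure_ge0.
  rewrite area_rect; [|by have [] := hK i|by have [] := hJ i].
  apply: lee_pmul; rewrite ?measure_ge0//; last by have [] := hJ i.
  by apply: le_trans (Cd i); have [] := hK i.
rewrite nneseriesZl; last by move=> i _; exact: diameter_ge0.
rewrite EFinM lee_wpmul2l ?lee_fin ?(ltW d0)//.
apply: le_trans (ltW xle) _; rewrite EFinD leeD2r// fineK//.
Qed.

Lemma integral_slices (w : RT -> R) (E : set (RT * RT)) :
  measurable_fun setT w -> (forall y, 0 <= w y) -> measurable E ->
  (\int[area R]_(p in E) (w p.2)%:E = \int[leb]_y ((w y)%:E * leb (slice E y)))%E.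
Proof.
move=> mw w0 mE; rewrite integral_mkcond /area.
pose F (p : RT * RT) : \bar R := ((fun p => (w p.2)%:E) \_ E) p.
have FE : F = (fun p => ((w p.2)%:E * (\1_E p : R)%:E)%E).
  apply/funext => p; rewrite /F patchE indicE; case: ifPn => _; first by rewrite mule1.
  by rewrite mule0.
have mF : measurable_fun setT F.
  rewrite FE; apply: emeasurable_funM; apply/measurable_EFinP; last exact: measurable_indic.
  by apply: measurableT_comp => //; exact: measurable_snd.
rewrite (fubini_tonelli2 F)//; last first.
  by move=> p; rewrite FE mule_ge0 ?lee_fin.
apply: eq_integral => y _; rewrite /fubini_G.
under eq_integral do rewrite FE /=.
have sE x : (\1_E (x, y) : R) = \1_(slice E y) x.
  by rewrite !indicE; congr (nat_of_bool _)%:R; apply/idP/idP; rewrite !inE.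
under eq_integral do rewrite sE.
have mS := slice_measurable E y mE.
transitivity ((w y)%:E * \int[leb]_x (\1_(slice E y) x : R)%:E)%E.
  apply: ge0_integralZl => //; last by rewrite lee_fin.
    by apply/measurable_EFinP; exact: measurable_indic.
by rewrite (integral_indic leb measurableT mS) setIT.
Qed.

Lemma slice_volume_measurable (E : set (RT * RT)) : measurable E ->
  measurable_fun setT (fun y : RT => leb (slice E y)).
Proof.
move=> mE; rewrite (_ : (fun y => _) = leb \o ysection E).
  exact: measurable_fun_ysection.
by apply/funext => y /=; rewrite ysection_slice.
Qed.

Lemma area_slices (E : set (RT * RT)) : measurable E ->
  area R E = (\int[leb]_y leb (slice E y))%E.
Proof.
move=> mE; have := @integral_slices (cst 1) E (measurable_cst _) (fun=> ler01) mE.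
rewrite /= integral_cst// mul1e => ->.
by apply: eq_integral => y _; rewrite mul1e.
Qed.

Lemma slice_null (E : set (RT * RT)) : measurable E -> area R E = 0%E ->
  {ae leb, forall y, leb (slice E y) = 0%E}.
Proof.
move=> mE; rewrite area_slices// => h0.
have := @ae_eq_integral_abs _ _ R leb setT measurableT _ (slice_volume_measurable E mE).
rewrite (_ : (\int[leb]_x `|leb (slice E x)|)%E = 0%E); last first.
  by rewrite -h0; apply: eq_integral => y _; rewrite gee0_abs.
by move=> [+ _] => /(_ erefl); apply: filterS => y; apply.
Qed.

End Slicing.

(** * The strip density *)

Section Density.
Context {R : realType}.
Variable lambda : R.
Hypothesis hlambda : 1 < lambda.
Implicit Types (p q : R * R) (E C : set (R * R)) (S : set R).
Local Notation leb := (@lebesgue_measure R).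
Local Notation H := (@hausdorff1 R).
Local Notation RT := (measurableTypeR R).
Local Notation f := (strip_density lambda).

Lemma density_ge1 p : 1 <= f p.
Proof. by rewrite /strip_density; case: ifP => // _; exact: ltW. Qed.

Lemma density_ge0 p : 0 <= f p.
Proof. exact: le_trans ler01 (density_ge1 p). Qed.

Lemma density_le p : f p <= lambda.
Proof. by rewrite /strip_density; case: ifP => // _; exact: ltW. Qed.

Lemma density_measurable (D : set (R * R)) : measurable_fun D (f : R * R -> R).
Proof.
apply: (@measurable_funS _ _ _ _ setT) => //.
have -> : (f : R * R -> R) = (fun y : R => if `|y| <= 1 then 1 else lambda) \o snd by [].
apply: measurableT_comp; last exact: measurable_snd.
apply: measurable_fun_ifT => //.
by apply: measurable_fun_ler => //; exact: measurableT_comp.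
Qed.

Lemma densityE_measurable (D : set (R * R)) : measurable_fun D (fun p => (f p)%:E).
Proof. by apply/measurable_EFinP; exact: density_measurable. Qed.

Definition fiber_density (y : R) : R := if `|y| <= 1 then 1 else lambda.

(* The infimum of the density over the strip between the heights y and y'. *)
Definition low_density (y y' : R) : R := if (1 < y) || (y' < -1) then lambda else 1.

Lemma low_density_ge1 y y' : 1 <= low_density y y'.
Proof. by rewrite /low_density; case: ifP => // _; exact: ltW. Qed.

Lemma low_density_ge0 y y' : 0 <= low_density y y'.
Proof. exact: le_trans ler01 (low_density_ge1 y y'). Qed.

Lemma low_density_le y y' p : y <= p.2 <= y' -> low_density y y' <= f p.
Proof.
move=> /andP[h1 h2]; rewrite /low_density; case: ifP => h; last exact: density_ge1.
rewrite /strip_density ler_norml; case: ifP => // /andP[h3 h4]; lra.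
Qed.

Section SmoothSet.
Variable E : set (R * R).
Hypothesis bE : (boundary_integral f E < +oo)%E.

Lemma length_le_boundary_integral : (H (boundary E) <= boundary_integral f E)%E.
Proof.
have -> : H (boundary E) = (\int[H]_(p in boundary E) 1%:E)%E.
  by rewrite integral_cst ?mul1e//; exact: boundary_measurable.
apply: ge0_le_integral => //.
- exact: boundary_measurable.
- exact: densityE_measurable.
- by move=> p _; rewrite lee_fin density_ge1.
Qed.

Definition below (c : R) : set (R * R) := [set p | p.2 < c].

Lemma below_measurable c : measurable (below c).
Proof.
have -> : below c = setT `*` `]-oo, c[%classic.
  by apply/seteqP; split=> p; rewrite /below /= in_itv/=; [split|case].
by apply: measurableX => //; exact: measurable_itv.
Qed.

(** The function L of a smooth set; that of a general set is obtained as a limit of these. *)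
Definition Phi (c : R) : R := fine (\int[H]_(p in boundary E `&` below c) (f p)%:E).

Lemma PhiE c : (Phi c)%:E = (\int[H]_(p in boundary E `&` below c) (f p)%:E)%E.
Proof.
rewrite fineK// ge0_fin_numE; last by apply: integral_ge0 => p _; rewrite lee_fin density_ge0.
apply: le_lt_trans bE; apply: ge0_subset_integral => //.
- by apply: measurableI; [exact: boundary_measurable|exact: below_measurable].
- exact: boundary_measurable.
- exact: densityE_measurable.
- by move=> p _; rewrite lee_fin density_ge0.
Qed.

Lemma Phi_ge0 c : 0 <= Phi c.
Proof. by rewrite -lee_fin PhiE; apply: integral_ge0 => p _; rewrite lee_fin density_ge0. Qed.

Lemma Phi_le c : ((Phi c)%:E <= boundary_integral f E)%E.
Proof.
rewrite PhiE; apply: ge0_subset_integral => //.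
- by apply: measurableI; [exact: boundary_measurable|exact: below_measurable].
- exact: boundary_measurable.
- exact: densityE_measurable.
- by move=> p _; rewrite lee_fin density_ge0.
Qed.

Lemma Phi_strip y y' : y <= y' ->
  ((low_density y y')%:E * H (boundary E `&` hstrip y y') <= (Phi y' - Phi y)%:E)%E.
Proof.
move=> yy'; rewrite EFinB leeBrDr// !PhiE.
have mB := boundary_measurable E.
have m1 : measurable (boundary E `&` hstrip y y').
  by apply: measurableI => //; exact: hstrip_measurable.
have m2 c : measurable (boundary E `&` below c).
  by apply: measurableI => //; exact: below_measurable.
have dis : [disjoint boundary E `&` hstrip y y' & boundary E `&` below y].
  apply/disj_setPS => p [[_ /andP[h1 _]] [_ h2]]; move: h1 h2; rewrite /below/= => h1 h2.
  by have := lt_trans h1 h2; rewrite ltxx.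
apply: (@le_trans _ _ (\int[H]_(p in (boundary E `&` hstrip y y') `|` (boundary E `&` below y)) (f p)%:E)%E).
  rewrite ge0_integral_setU//; last 2 first.
  - exact: densityE_measurable.
  - by move=> p _; rewrite lee_fin density_ge0.
  apply: leeD2r.
  rewrite -integral_cst//; apply: ge0_le_integral => //.
  - by move=> p _; rewrite lee_fin low_density_ge0.
  - exact: densityE_measurable.
  - by move=> p [_ /andP[h1 h2]]; rewrite lee_fin low_density_le// !ltW.
apply: ge0_subset_integral => //.
- exact: measurableU.
- exact: densityE_measurable.
- by move=> p _; rewrite lee_fin density_ge0.
- move=> p [[bp /andP[h1 h2]]|[bp h]]; split=> //; move: h; rewrite /below/= => h.
  exact: lt_le_trans h yy'.
Qed.

End SmoothSet.

Lemma limn_einf_lt (u : nat -> \bar R) (x : \bar R) N : (limn_einf u < x)%E ->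
  exists2 n, (N <= n)%N & (u n < x)%E.
Proof.
move=> ux; apply: contrapT => h; move: ux; rewrite ltNge => /negP; apply.
rewrite /limn_einf leeNr; apply: (@le_trans _ _ (ereal_sup [set (- u n)%E | n in [set n | (N <= n)%N]])).
  by apply: ereal_inf_lbound; exists [set n | (N <= n)%N] => //; exists N.
apply: ge_ereal_sup => _ [n /= Nn <-]; rewrite leeN2 leNgt; apply/negP => un.
by apply: h; exists n.
Qed.

Lemma perimeter_approx (F : set (R * R)) (P e : R) : weighted_perimeter f F = P%:E -> 0 < e ->
  exists E, [/\ smooth_set E, (boundary_integral f E <= (P + e)%:E)%E &
    (area R (E `+` F) <= e%:E)%E].
Proof.
move=> PF e0.
have : (weighted_perimeter f F < (P + e)%:E)%E by rewrite PF lte_fin ltrDl.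
move=> /ereal_inf_lt[_ [Eh [sE cE] <-] hE].
move: cE => /fine_cvgP[tfin /cvgrPdist_lt /(_ e e0) [N _ hN]].
case: tfin => N' _ hN'.
have [n Nn bn] := limn_einf_lt _ _ (maxn N N') hE.
exists (Eh n); split=> //; first exact: ltW.
have fn := hN' n (leq_trans (leq_maxr _ _) Nn).
have := hN n (leq_trans (leq_maxl _ _) Nn).
rewrite /= sub0r normrN => /ltW h; rewrite -(fineK fn) lee_fin.
exact: le_trans (ler_norm _) h.
Qed.

(** Fatou's lemma for sets: the points of [A] missed by some [An n] with n >= N decrease to a null
    set as N grows. *)
Lemma eventually_measure (A : set RT) (An : nat -> set RT) (e : R) : 0 < e ->
  measurable A -> (leb A < +oo)%E -> (forall n, measurable (An n)) ->
  {ae leb, forall t, A t -> exists N, forall n, (N <= n)%N -> An n t} ->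
  exists N, forall n, (N <= n)%N -> (leb A <= leb (An n) + e%:E)%E.
Proof.
move=> e0 mA Aoo mAn ev.
pose D N := \bigcup_(n in [set n | (N <= n)%N]) (A `\` An n).
have mD N : measurable (D N) by apply: bigcup_measurable => n _; exact: measurableD.
have mcap : measurable (\bigcap_N D N) by exact: bigcapT_measurable.
have D0 : leb (\bigcap_N D N) = 0%E.
  apply/negligibleP => //.
  apply: negligibleS ev => t ht /= h.
  have At : A t by have [n _ []] := ht 0%N I.
  have [N hN] := h At; have [n Nn [_]] := ht N I; apply; exact: hN.
have cD : leb (D n) @[n --> \oo] --> leb (\bigcap_N D N).
  apply: nonincreasing_cvg_mu => //.
  - apply: le_lt_trans Aoo; apply: le_measure; rewrite ?inE// => t [n _ []//].
  - move=> n m nm; apply/subsetPset => t [k /= mk ht]; exists k => //=; exact: leq_trans nm mk.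
rewrite D0 in cD; move: cD => /fine_cvgP[[N1 _ hN1] /cvgrPdist_lt /(_ e e0) [N2 _ hN2]].
exists (maxn N1 N2) => n Nn.
have f1 := hN1 n (leq_trans (leq_maxl _ _) Nn).
have := hN2 n (leq_trans (leq_maxr _ _) Nn); rewrite /= sub0r normrN => /ltW h.
apply: (@le_trans _ _ (leb (An n `|` D n))).
  apply: le_measure; rewrite ?inE//; first exact: measurableU.
  move=> t At; have [Ant|Ant] := pselect (An n t); [by left|right].
  by exists n => //=.
apply: (@le_trans _ _ (leb (An n) + leb (D n))%E); first exact: outer_measureU2.
apply: leeD2l; rewrite -(fineK f1) lee_fin; exact: le_trans (ler_norm _) h.
Qed.

End Density.

(** * Lower bound for the perimeter *)

Section LowerBound.
Context {R : realType}.
Variable lambda : R.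
Hypothesis hlambda : 1 < lambda.
Implicit Types (p q : R * R) (E C F : set (R * R)) (S : set R).
Local Notation leb := (@lebesgue_measure R).
Local Notation H := (@hausdorff1 R).
Local Notation RT := (measurableTypeR R).
Local Notation f := (strip_density lambda).

(** Along an ultrafilter all bounded sequences converge simultaneously, which plays the role of
    Helly's selection: [Phi] gets a limit at every height. *)
Lemma ultra_bounded_cvg (U : set_system nat) (u : nat -> R) M : UltraFilter U ->
  (forall n, 0 <= u n <= M) -> exists2 l, 0 <= l <= M & u n @[n --> U] --> l.
Proof.
move=> UF uM; have PU : ProperFilter (u @ U) by apply: fmap_proper_filter.
have [] := @segment_compact R 0 M (u @ U) PU.
  by apply: (@filterS _ U _ setT _ _ filterT) => n _ /=; rewrite in_itv /=; exact: uM.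
move=> l [lM cl]; exists l; first by move: lM; rewrite /= in_itv.
move=> V Vl; rewrite /fmap/=.
have [//|h] := in_ultra_setVsetC (u @^-1` V) UF.
by have [z [/= nV Vz]] := cl (~` V) V h Vl.
Qed.

Lemma ae_finite (g : RT -> \bar R) : measurable_fun setT g -> (forall y, 0 <= g y)%E ->
  (\int[leb]_y g y < +oo)%E -> {ae leb, forall y, (g y < +oo)%E}.
Proof.
move=> mg g0 ig; have : leb.-integrable setT g.
  apply/integrableP; split=> //; rewrite (_ : (\int[_]_(x in _) _)%E = (\int[leb]_y g y)%E)//.
  by apply: eq_integral => y _; rewrite gee0_abs.
move=> /(integrable_ae measurableT); apply: filterS => y /(_ I).
by rewrite ge0_fin_numE.
Qed.

Lemma ae_slice_finite (F : set (RT * RT)) : measurable F -> (area R F < +oo)%E ->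
  {ae leb, forall y, (leb (slice F y) < +oo)%E}.
Proof.
move=> mF aF; apply: ae_finite => //; first exact: slice_volume_measurable.
by rewrite -area_slices.
Qed.

(** The sum of all slice measures has finite integral, so it is finite at almost every height and
    its terms tend to 0 there. *)
Lemma ae_slice_cvg (D : nat -> set (RT * RT)) : (forall n, measurable (D n)) ->
  (forall n, (area R (D n) <= (2^-1 ^+ n.+1)%:E)%E) ->
  {ae leb, forall y, forall e, 0 < e ->
     exists N, forall n, (N <= n)%N -> (leb (slice (D n) y) <= e%:E)%E}.
Proof.
move=> mD aD.
have : (\int[leb]_y (\sum_(0 <= n <oo) leb (slice (D n) y)) < +oo)%E.
  rewrite integral_nneseries//; last by move=> n; exact: slice_volume_measurable.
  apply: (@le_lt_trans _ _ 1%:E); last by rewrite ltey.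
  apply: le_trans (epsilon_trick0 xpredT (@ler01 R)).
  apply: lee_nneseries => [n _ _|n _]; first by apply: integral_ge0.
  by rewrite -area_slices//; apply: le_trans (aD n) _; rewrite lee_fin div1r exprVn natrX.
move=> /ae_finite h.
have {h} hs : {ae leb, forall y, (\sum_(0 <= n <oo) leb (slice (D n) y) < +oo)%E}.
  apply: h; last by move=> y; apply: nneseries_ge0.
  apply: (@ge0_emeasurable_sum _ _ R setT (fun n y => leb (slice (D n) y)) xpredT) => //.
  by move=> n _; exact: slice_volume_measurable.
have FF := ae_filter_ringOfSetsType leb.
apply: filterS hs => y sy e e0.
have := nneseries_tail_cvg sy (fun k _ => measure_ge0 _ _).
move=> /fine_cvgP[[N1 _ hN1] /cvgrPdist_lt /(_ e e0) [N2 _ hN2]].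
exists (maxn N1 N2) => n Nn.
have f1 := hN1 n (leq_trans (leq_maxl _ _) Nn).
have := hN2 n (leq_trans (leq_maxr _ _) Nn); rewrite /= sub0r normrN => /ltW h.
apply: (@le_trans _ _ (\sum_(n <= k <oo) leb (slice (D k) y))%E).
  by apply: le_trans (nneseries_lim_ge n.+1 _) => //; rewrite big_nat1.
by rewrite -(fineK f1) lee_fin; exact: le_trans (ler_norm _) h.
Qed.

Lemma measure_symdiff (X Y : set RT) : measurable X -> measurable Y ->
  (leb X <= leb Y + leb (X `+` Y))%E.
Proof.
move=> mX mY; apply: (@le_trans _ _ (leb (Y `|` (X `+` Y)))); last exact: outer_measureU2.
have := symdiff_measurable X Y mX mY => mXY.
apply: le_measure; rewrite ?inE//; first exact: measurableU.
by move=> x Xx; have [Yx|Yx] := pselect (Y x); [left|right; left].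
Qed.

Lemma measure_gt_stable (d : R) (X : \bar R) : (d%:E < X)%E ->
  exists2 e, 0 < e & forall Y u : \bar R, (X <= Y + u)%E -> (u <= e%:E)%E -> (d%:E < Y)%E.
Proof.
move=> dX; have [e e0 eX] : exists2 e, 0 < e & ((d + e)%:E < X)%E.
  case: X dX => [x|_|//]; last by exists 1 => //; rewrite ltry.
  rewrite lte_fin => dx; exists ((x - d) / 2); first by lra.
  by rewrite lte_fin; lra.
exists e => // Y u XY ue; rewrite ltNge; apply/negP => Yd.
by move: eX; rewrite ltNge => /negP; apply; apply: le_trans XY _; rewrite EFinD leeD.
Qed.

Lemma gap_stable (d r1 r2 : R) (X : set RT) : measurable X -> gap d r1 r2 X ->
  exists2 e, 0 < e & forall Y : set RT, measurable Y -> (leb (Y `+` X) <= e%:E)%E -> gap d r1 r2 Y.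
Proof.
move=> mX [g1 g2 g3].
have [e1 e10 h1] := measure_gt_stable _ _ g1.
have [e2 e20 h2] := measure_gt_stable _ _ g2.
have [e3 e30 h3] := measure_gt_stable _ _ g3.
have m1 : measurable (`]-oo, r1[ : set RT) by exact: measurable_itv.
have m2 : measurable (`]r1, r2[ : set RT) by exact: measurable_itv.
have m3 : measurable (`]r2, +oo[ : set RT) by exact: measurable_itv.
exists (Num.min e1 (Num.min e2 e3)); first by rewrite !lt_min e10 e20.
move=> Y mY hY.
have mS := symdiff_measurable Y X mY mX.
have [l1 l2 l3] : [/\ (leb (Y `+` X) <= e1%:E)%E, (leb (Y `+` X) <= e2%:E)%E & (leb (Y `+` X) <= e3%:E)%E].
  by split; apply: le_trans hY _; rewrite lee_fin !ge_min lexx ?orbT.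
have sub (A B : set RT) : measurable A -> measurable B -> A `+` B `<=` Y `+` X ->
    (leb A <= leb B + leb (Y `+` X))%E.
  move=> mA mB s; apply: le_trans (measure_symdiff A B mA mB) _; apply: leeD2l.
  by apply: le_measure; rewrite ?inE//; exact: symdiff_measurable.
split.
- apply: h1 l1; apply: sub; [exact: measurableI|exact: measurableI|].
  by move=> x [[[Xx rx] nY]|[[Yx rx] nX]]; [right|left]; split=> // h; [exact: nY|exact: nX].
- apply: h2 l2; apply: sub; [exact: measurableD|exact: measurableD|].
  by move=> x [[[rx nX] nY]|[[rx nY] nX]]; [left|right]; split=> //; apply: contrapT => h;
    [apply: nY|apply: nX].
- apply: h3 l3; apply: sub; [exact: measurableI|exact: measurableI|].
  by move=> x [[[Xx rx] nY]|[[Yx rx] nX]]; [right|left]; split=> // h; [exact: nY|exact: nX].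
Qed.

(** Slices of infinite measure are left out because leaving the set along a horizontal ray relies on
    finiteness. *)
Definition thick (d y y' : R) F : set RT :=
  [set t | y < t < y' /\ (d%:E < leb (slice F t))%E /\ (leb (slice F t) < +oo)%E].

Definition gapped (d y y' r1 r2 : R) F : set RT :=
  thick d y y' F `&` [set t | gap d r1 r2 (slice F t)].

Lemma thick_measurable d y y' F : measurable F -> measurable (thick d y y' F).
Proof.
move=> mF; have mS := slice_volume_measurable F mF.
rewrite (_ : thick d y y' F = `]y, y'[ `&` ((setT `&` [set t | (d%:E < leb (slice F t))%E])
   `&` (setT `&` [set t | (leb (slice F t) < +oo)%E]))).
  apply: measurableI; first exact: measurable_itv.
  by apply: measurableI; [exact: emeasurable_fun_o_infty|exact: emeasurable_fun_infty_o].
by apply/seteqP; split=> t; rewrite /thick /= in_itv/=; [case=> ? []|case=> ? [[_ ?] [_ ?]]].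
Qed.

Lemma gapped_measurable d y y' r1 r2 F : measurable F -> measurable (gapped d y y' r1 r2 F).
Proof.
move=> mF; apply: measurableI; first exact: thick_measurable.
have part (G : set (RT * RT)) : measurable G ->
    measurable [set t : RT | (d%:E < leb (slice G t))%E].
  move=> mG; rewrite -[X in measurable X]setTI.
  by apply: emeasurable_fun_o_infty => //; exact: slice_volume_measurable.
rewrite (_ : [set t | _] = [set t | (d%:E < leb (slice (F `&` (`]-oo, r1[ `*` setT)) t))%E] `&`
  ([set t | (d%:E < leb (slice ((`]r1, r2[ `*` setT) `\` F) t))%E] `&`
   [set t | (d%:E < leb (slice (F `&` (`]r2, +oo[ `*` setT)) t))%E])).
  have mI (I : set RT) : measurable I -> measurable (I `*` setT : set (RT * RT)).
    by move=> mI; apply: measurableX.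
  have m1 := mI _ (measurable_itv `]-oo, r1[).
  have m2 := mI _ (measurable_itv `]r1, r2[).
  have m3 := mI _ (measurable_itv `]r2, +oo[).
  apply: measurableI; first by apply: part; exact: measurableI.
  by apply: measurableI; apply: part; [exact: measurableD|exact: measurableI].
have e1 t : slice (F `&` (`]-oo, r1[ `*` setT)) t = slice F t `&` `]-oo, r1[.
  by apply/seteqP; split=> x; [case=> ? [? _]|case].
have e2 t : slice ((`]r1, r2[ `*` setT) `\` F) t = `]r1, r2[ `\` slice F t.
  by apply/seteqP; split=> x; [case=> [[? _] ?]|case].
have e3 t : slice (F `&` (`]r2, +oo[ `*` setT)) t = slice F t `&` `]r2, +oo[.
  by apply/seteqP; split=> x; [case=> ? [? _]|case].
by apply/seteqP; split=> t; rewrite /gap /= e1 e2 e3; [case|case=> ? []].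
Qed.

Lemma thick_finite d y y' F : (leb (thick d y y' F) < +oo)%E.
Proof.
apply: (@le_lt_trans _ _ (leb `]y, y'[%classic)).
  by apply: le_outer_measure => t [h _]; rewrite /= in_itv.
by rewrite lebesgue_measure_itv/=; case: ifP => _; rewrite ltey.
Qed.

End LowerBound.

Section LowerBound2.
Context {R : realType}.
Variable lambda : R.
Hypothesis hlambda : 1 < lambda.
Implicit Types (p q : R * R) (E C F : set (R * R)) (S : set R).
Local Notation leb := (@lebesgue_measure R).
Local Notation H := (@hausdorff1 R).
Local Notation RT := (measurableTypeR R).
Local Notation f := (strip_density lambda).
Local Notation low := (low_density lambda).

Let bi := boundary_integral f.

Lemma smooth_cell E (c s y y' d r1 r2 : R) : smooth_set E -> (bi E < +oo)%E ->
  0 <= c -> 0 <= s -> c ^+ 2 + s ^+ 2 <= 1 -> y < y' -> 0 < d ->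
  leb (slice (boundary E) y) = 0%E -> leb (slice (boundary E) y') = 0%E ->
  ((low y y')%:E * (c%:E * (2%:E * leb (thick d y y' E) + 2%:E * leb (gapped d y y' r1 r2 E)) +
     s%:E * leb (slice E y `+` slice E y')) <= (Phi lambda E y' - Phi lambda E y)%:E)%E.
Proof.
move=> sE bE c0 s0 cs yy' d0 n1 n2.
have mE := open_measurable2 E sE.1.
apply: le_trans (Phi_strip lambda hlambda E bE y y' (ltW yy')).
apply: lee_wpmul2l; first by rewrite lee_fin low_density_ge0.
apply: (@crossing R E c s y y' d r1 r2) => //.
- exact: thick_measurable.
- exact: gapped_measurable.
- by move=> t [h _]; rewrite /= in_itv.
- exact: subIsetl.
- by move=> t [].
- by move=> t [].
Qed.

Lemma symdiff_slices_stable (X X' Y Y' : set RT) (e : R) :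
  measurable X -> measurable X' -> measurable Y -> measurable Y' ->
  (leb (Y `+` X) <= e%:E)%E -> (leb (Y' `+` X') <= e%:E)%E ->
  (leb (X `+` X') <= leb (Y `+` Y') + (2 * e)%:E)%E.
Proof.
move=> mX mX' mY mY' h h'.
have m := symdiff_measurable.
apply: (@le_trans _ _ (leb ((Y `+` Y') `|` ((Y `+` X) `|` (Y' `+` X'))))).
  apply: le_measure; rewrite ?inE//; first exact: m.
    by apply: measurableU; [exact: m|apply: measurableU; exact: m].
  move=> x hx; have [Yx|Yx] := pselect (Y x); have [Y'x|Y'x] := pselect (Y' x);
  have [Xx|Xx] := pselect (X x); have [X'x|X'x] := pselect (X' x);
  by move: hx; rewrite /setY /setU /setD /=; tauto.
apply: le_trans (outer_measureU2 _ _ _) _; apply: leeD2l.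
apply: le_trans (outer_measureU2 _ _ _) _.
by rewrite mulr_natl mulr2n EFinD leeD.
Qed.

(** For a fixed direction (c, s) the bound on a cell is linear, hence stable under limits; the
    square root comes from taking (c, s) proportional to the two lengths at the very end. [Z]
    consists of the heights at which [F] has a slice of finite measure, the approximating slices
    converge and the approximating boundaries have null slices. *)
Lemma lower_bound F (P : R) : measurable F -> (area R F < +oo)%E ->
  weighted_perimeter f F = P%:E ->
  exists (L : R -> R) (Z : set RT), [/\ forall y, 0 <= L y <= P,
    {ae leb, forall y, Z y}, forall y, Z y -> (leb (slice F y) < +oo)%E &
    forall y y' r1 r2, Z y -> Z y' -> y < y' ->
      low y y' * Num.sqrt ((2 * fine (leb (thick 0 y y' F)) +
         2 * fine (leb (gapped 0 y y' r1 r2 F))) ^+ 2 +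
         fine (leb (slice F y `+` slice F y')) ^+ 2) <= L y' - L y].
Proof.
move=> mF aF PF.
have eps0 n : 0 < 2^-1 ^+ n.+1 :> R by rewrite exprn_gt0.
have /choice[E hE] := fun n => perimeter_approx lambda F P _ PF (eps0 n).
have sE n : smooth_set (E n) by have [] := hE n.
have bE n : (bi (E n) <= (P + 2^-1 ^+ n.+1)%:E)%E by have [] := hE n.
have aE n : (area R (E n `+` F) <= (2^-1 ^+ n.+1)%:E)%E by have [] := hE n.
have mE n : measurable (E n) by exact: open_measurable2 (sE n).1.
have mD n : measurable (E n `+` F).
  by apply: measurableU; apply: measurableD.
have boo n : (bi (E n) < +oo)%E by rewrite (le_lt_trans (bE n))// ltey.
pose U0 := ultraFilterLemma (eventually_filter : ProperFilter \oo).
have [U [UF oU]] := U0.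
have PU : ProperFilter U by exact: ultra_proper.
have eps1 n : 2^-1 ^+ n.+1 <= 1 :> R.
  by rewrite exprn_ile1// ?invr_ge0// invf_le1// ler1n.
have /choice[L hL] : forall y, exists l, 0 <= l <= P + 1 /\ Phi lambda (E n) y @[n --> U] --> l.
  move=> y; have [|l h1 h2] := @ultra_bounded_cvg R U (fun n => Phi lambda (E n) y) (P + 1) UF.
    move=> n; rewrite Phi_ge0//= -lee_fin; apply: le_trans (Phi_le lambda hlambda _ (boo n) y) _.
    by apply: le_trans (bE n) _; rewrite lee_fin lerD2l.
  by exists l.
pose Z : set RT := [set y | [/\ (leb (slice F y) < +oo)%E,
  forall n, leb (slice (boundary (E n)) y) = 0%E &
  forall e, 0 < e -> exists N, forall n, (N <= n)%N -> (leb (slice (E n `+` F) y) <= e%:E)%E]].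
have FF := ae_filter_ringOfSetsType leb.
have aeS := @ae_slice_cvg R (fun n => E n `+` F) mD aE.
exists L, Z; split.
- move=> y; have [/andP[L0 _] cL] := hL y; rewrite L0/=.
  apply/ler_addgt0Pr => e e0.
  have cst_cvg : (cst (P + e) : nat -> R) @ U --> P + e by exact: cvg_cst.
  apply: (ler_cvg_to cL cst_cvg).
  apply: oU; have : (fun n => (2^-1 : R) ^+ n) @ \oo --> (0 : R).
    by apply: cvg_expr; rewrite ger0_norm ?invr_ge0// invf_lt1// ltr1n.
  move=> /cvgrPdist_le /(_ e e0) [N _ hN]; exists N => // n /= Nn.
  rewrite -lee_fin; apply: le_trans (Phi_le lambda hlambda _ (boo n) y) _.
  apply: le_trans (bE n) _; rewrite lee_fin lerD2l.
  have := hN n.+1 (leq_trans Nn (leqnSn _)); rewrite /= sub0r normrN ger0_norm ?exprn_ge0 ?invr_ge0//.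
- have h1 := ae_slice_finite F mF aF.
  have h2 : {ae leb, forall y, forall n, leb (slice (boundary (E n)) y) = 0%E}.
    apply/ae_foralln => n; apply: slice_null; first exact: boundary_measurable.
    apply: area_finite_length; first exact: boundary_measurable.
    exact: le_lt_trans (length_le_boundary_integral lambda hlambda _) (boo n).
  by apply: filterS3 h1 h2 aeS => y; split.
- by move=> y [].
move=> y y' r1 r2 [Fy ny cy] [Fy' ny' cy'] yy'.
have mS t : measurable (slice F t : set RT) by exact: slice_measurable.
have mSn n t : measurable (slice (E n) t : set RT) by exact: slice_measurable.
set V := leb (slice F y `+` slice F y').
have Voo : (V < +oo)%E.
  apply: (@le_lt_trans _ _ (leb (slice F y) + leb (slice F y'))%E); last exact: lte_add_pinfty.
  apply: (@le_trans _ _ (leb (slice F y `|` slice F y'))); last exact: outer_measureU2.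
  by apply: le_outer_measure => x [[? _]|[? _]]; [left|right].
have V0 : (0 <= V)%E by exact: measure_ge0.
have gfin d : (leb (gapped d y y' r1 r2 F) < +oo)%E.
  by apply: le_lt_trans (thick_finite d y y' F); apply: le_outer_measure; exact: subIsetl.
have low0 := low_density_ge0 lambda hlambda y y'.
(* First for a positive threshold [d]: slices thicker than [d] stay so for the approximating sets,
   and the covers of mesh [d] detect them. *)
have main c s d : 0 <= c -> 0 <= s -> c ^+ 2 + s ^+ 2 <= 1 -> 0 < d ->
    low y y' * (c * (2 * fine (leb (thick d y y' F)) + 2 * fine (leb (gapped d y y' r1 r2 F))) +
      s * fine V) <= L y' - L y.
  move=> c0 s0 cs d0; apply/ler_addgt0Pr => e e0.
  (* Coefficient of the error eta: both measures of heights enter with weight 2 c and the symmetric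
     difference with weight s. The summand 1 makes it positive. *)
  pose K := low y y' * (4 * c + s) + 1.
  have K0 : 0 < K by rewrite ltr_wpDl// mulr_ge0// addr_ge0// mulr_ge0.
  pose eta := e / K / 2.
  have eta0 : 0 < eta by rewrite !divr_gt0.
  have [N1 hN1] : exists N, forall n, (N <= n)%N ->
      (leb (thick d y y' F) <= leb (thick d y y' (E n)) + eta%:E)%E.
    apply: eventually_measure => //; first exact: thick_measurable.
    - exact: thick_finite.
    - by move=> n; exact: thick_measurable.
    apply: filterS aeS => t ht [yt [dt ot]].
    have [e1 e10 h1] := measure_gt_stable _ _ dt.
    have [N hN] := ht e1 e10; exists N => n Nn; split=> //; split.
      apply: (h1 _ _ _ (hN n Nn)).
      apply: le_trans (measure_symdiff _ (slice (E n) t) (mS t) (mSn n t)) _.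
      by rewrite setYC.
    apply: le_lt_trans (measure_symdiff _ (slice F t) (mSn n t) (mS t)) _.
    by apply: lte_add_pinfty => //; apply: le_lt_trans (hN n Nn) _; rewrite ltey.
  have [N2 hN2] : exists N, forall n, (N <= n)%N ->
      (leb (gapped d y y' r1 r2 F) <= leb (gapped d y y' r1 r2 (E n)) + eta%:E)%E.
    apply: eventually_measure => //; first exact: gapped_measurable.
    - by move=> n; exact: gapped_measurable.
    apply: filterS aeS => t ht [[yt [dt ot]] gt].
    have [e1 e10 h1] := measure_gt_stable _ _ dt.
    have [e2 e20 h2] := gap_stable d r1 r2 _ (mS t) gt.
    have [N hN] := ht e1 e10; have [N' hN'] := ht e2 e20.
    exists (maxn N N') => n; rewrite geq_max => /andP[Nn Nn']; split.
      split=> //; split.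
        apply: (h1 _ _ _ (hN n Nn)).
        apply: le_trans (measure_symdiff _ (slice (E n) t) (mS t) (mSn n t)) _.
        by rewrite setYC.
      apply: le_lt_trans (measure_symdiff _ (slice F t) (mSn n t) (mS t)) _.
      by apply: lte_add_pinfty => //; apply: le_lt_trans (hN n Nn) _; rewrite ltey.
    by apply: h2 => //; exact: hN'.
  have eta20 : 0 < eta / 2 by rewrite divr_gt0.
  have [N3 hN3] := cy (eta / 2) eta20.
  have [N4 hN4] := cy' (eta / 2) eta20.
  have cdiff : Phi lambda (E n) y' - Phi lambda (E n) y + e @[n --> U] --> L y' - L y + e.
    by apply: cvgD; [apply: cvgB; [exact: (hL y').2|exact: (hL y).2]|exact: cvg_cst].
  set X := low y y' * _.
  have cst_cvg : (cst X : nat -> R) @ U --> X by exact: cvg_cst.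
  apply: (ler_cvg_to cst_cvg cdiff).
  apply: oU; exists (maxn (maxn N1 N2) (maxn N3 N4)) => // n /=.
  rewrite !geq_max => /andP[/andP[n1 n2] /andP[n3 n4]].
  rewrite -lee_fin EFinD.
  apply: (@le_trans _ _ ((low y y')%:E * (c%:E * (2%:E * leb (thick d y y' (E n)) +
       2%:E * leb (gapped d y y' r1 r2 (E n))) +
     s%:E * leb (slice (E n) y `+` slice (E n) y')) + e%:E)%E); last first.
    by apply: leeD2r; apply: smooth_cell.
  have tf : (leb (thick d y y' F)) \is a fin_num by rewrite ge0_fin_numE//; exact: thick_finite.
  have gf : (leb (gapped d y y' r1 r2 F)) \is a fin_num by rewrite ge0_fin_numE//; exact: gfin.
  have Vf : V \is a fin_num by rewrite ge0_fin_numE.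
  rewrite /X EFinM EFinD !EFinM EFinD !EFinM !fineK//.
  set A' := leb (thick d y y' (E n)); set B' := leb (gapped d y y' r1 r2 (E n)).
  set V' := leb (slice (E n) y `+` slice (E n) y').
  have hA := hN1 n n1; have hB := hN2 n n2; rewrite -/A' -/B' in hA hB.
  have hV : (V <= V' + eta%:E)%E.
    have -> : eta = 2 * (eta / 2) by lra.
    by apply: symdiff_slices_stable => //; [exact: hN3|exact: hN4].
  have [A'0 B'0 V'0] : [/\ 0 <= A', 0 <= B' & 0 <= V']%E by split; exact: measure_ge0.
  have A'f : A' \is a fin_num by rewrite ge0_fin_numE//; exact: thick_finite.
  have B'f : B' \is a fin_num.
    rewrite ge0_fin_numE//; apply: le_lt_trans (thick_finite d y y' (E n)).
    by apply: le_outer_measure; exact: subIsetl.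
  have V'f : V' \is a fin_num.
    rewrite ge0_fin_numE//; apply: (@le_lt_trans _ _ (V + (2 * (eta / 2))%:E)%E).
      by apply: symdiff_slices_stable => //; rewrite setYC; [exact: hN3|exact: hN4].
    by rewrite -(fineK Vf) -EFinD ltey.
  move: hA hB hV; rewrite -(fineK tf) -(fineK gf) -(fineK Vf) -(fineK A'f) -(fineK B'f) -(fineK V'f).
  rewrite !(=^~ EFinM, =^~ EFinD) !lee_fin.
  move: (fine A') (fine B') (fine V') (fine (leb (thick d y y' F))) (fine (leb (gapped d y y' r1 r2 F))) (fine V).
  move=> a' b' v' a b w ha hb hw.
  apply: (@le_trans _ _ (low y y' * (c * (2 * (a' + eta) + 2 * (b' + eta)) + s * (v' + eta)))).
    by apply: ler_wpM2l => //; apply: lerD; apply: ler_wpM2l => //; apply: lerD; apply: ler_wpM2l.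
  have -> : low y y' * (c * (2 * (a' + eta) + 2 * (b' + eta)) + s * (v' + eta)) =
     low y y' * (c * (2 * a' + 2 * b') + s * v') + (K - 1) * eta by rewrite /K; ring.
  rewrite lerD2l; apply: (@le_trans _ _ (K * eta)); first by rewrite ler_wpM2r ?(ltW eta0)//; lra.
  by rewrite /eta; have -> : K * (e / K / 2) = e / 2; [field; rewrite gt_eqF|lra].
have inv0 n : 0 < n.+1%:R^-1 :> R by rewrite invr_gt0.
have invle n m : (n <= m)%N -> m.+1%:R^-1 <= n.+1%:R^-1 :> R.
  by move=> nm; rewrite lef_pV2 ?posrE// ler_nat.
have arch (x : R) : 0 < x -> exists n, n.+1%:R^-1 <= x.
  move=> x0; exists (Num.truncn x^-1); rewrite -[leRHS]invrK lef_pV2 ?posrE ?invr_gt0//.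
  by apply: ltW; exact: truncnS_gt.
have gt_inv (X : \bar R) : (0 < X)%E -> exists N, forall n, (N <= n)%N -> (n.+1%:R^-1%:E < X)%E.
  move=> X0; have [e e0 h] := measure_gt_stable _ _ X0.
  have [N hN] := arch (e / 2) (divr_gt0 e0 (ltr0Sn _ 1)).
  exists N => n Nn; rewrite ltNge; apply/negP => Xn.
  have : (0%:E < 0%:E :> \bar R)%E; last by rewrite ltxx.
  apply: (h 0%E n.+1%:R^-1%:E); first by rewrite add0e.
  by rewrite lee_fin; apply: le_trans (invle _ _ Nn) _; apply: le_trans hN _; lra.
(* Then the threshold 1/(n+1) tends to 0: every height with a slice of positive measure is
   eventually counted. *)
have main0 c s : 0 <= c -> 0 <= s -> c ^+ 2 + s ^+ 2 <= 1 ->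
    low y y' * (c * (2 * fine (leb (thick 0 y y' F)) + 2 * fine (leb (gapped 0 y y' r1 r2 F))) +
      s * fine V) <= L y' - L y.
  move=> c0 s0 cs; apply/ler_addgt0Pr => e e0.
  pose K := low y y' * (4 * c) + 1.
  have K0 : 0 < K by rewrite ltr_wpDl// mulr_ge0// mulr_ge0.
  pose eta := e / K.
  have eta0 : 0 < eta by rewrite divr_gt0.
  have [N1 hN1] : exists N, forall n, (N <= n)%N ->
      (leb (thick 0 y y' F) <= leb (thick n.+1%:R^-1 y y' F) + eta%:E)%E.
    apply: eventually_measure => //; first exact: thick_measurable.
    - exact: thick_finite.
    - by move=> n; exact: thick_measurable.
    apply: aeW => t [yt [dt ot]]; have [N hN] := gt_inv _ dt; exists N => n Nn.
    by split=> //; split=> //; exact: hN.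
  have [N2 hN2] : exists N, forall n, (N <= n)%N ->
      (leb (gapped 0 y y' r1 r2 F) <= leb (gapped n.+1%:R^-1 y y' r1 r2 F) + eta%:E)%E.
    apply: eventually_measure => //; first exact: gapped_measurable.
    - by move=> n; exact: gapped_measurable.
    apply: aeW => t [[yt [dt ot]] [g1 g2 g3]].
    have [N hN] := gt_inv _ dt; have [M1 hM1] := gt_inv _ g1.
    have [M2 hM2] := gt_inv _ g2; have [M3 hM3] := gt_inv _ g3.
    exists (maxn N (maxn M1 (maxn M2 M3))) => n; rewrite !geq_max => /and4P[h1 h2 h3 h4].
    split; first by split=> //; split=> //; exact: hN.
    by split; [exact: hM1|exact: hM2|exact: hM3].
  pose n := maxn N1 N2.
  have := hN1 n (leq_maxl _ _); have := hN2 n (leq_maxr _ _).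
  have fin (x : \bar R) : (0 <= x)%E -> (x < +oo)%E -> x \is a fin_num by move=> ? ?; rewrite ge0_fin_numE.
  have gfin' d : leb (gapped d y y' r1 r2 F) \is a fin_num by apply: fin.
  have tfin' d : leb (thick d y y' F) \is a fin_num by apply: fin => //; exact: thick_finite.
  rewrite -(fineK (gfin' 0)) -(fineK (gfin' n.+1%:R^-1)) -(fineK (tfin' 0)) -(fineK (tfin' n.+1%:R^-1)).
  rewrite -!EFinD !lee_fin => hb ha.
  apply: le_trans (_ : _ <= low y y' * (c * (2 * fine (leb (thick n.+1%:R^-1 y y' F)) +
     2 * fine (leb (gapped n.+1%:R^-1 y y' r1 r2 F))) + s * fine V) + e) _; last first.
    by rewrite lerD2r; exact: main.
  move: ha hb; rewrite -/n.
  move: (fine (leb (thick n.+1%:R^-1 y y' F))) (fine (leb (gapped n.+1%:R^-1 y y' r1 r2 F))).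
  move: (fine (leb (thick 0 y y' F))) (fine (leb (gapped 0 y y' r1 r2 F))) (fine V).
  move=> a b w a' b' ha hb.
  apply: (@le_trans _ _ (low y y' * (c * (2 * (a' + eta) + 2 * (b' + eta)) + s * w))).
    by apply: ler_wpM2l => //; apply: lerD => //; apply: ler_wpM2l => //; apply: lerD; apply: ler_wpM2l.
  have -> : low y y' * (c * (2 * (a' + eta) + 2 * (b' + eta)) + s * w) =
     low y y' * (c * (2 * a' + 2 * b') + s * w) + (K - 1) * eta by rewrite /K; ring.
  rewrite lerD2l; apply: (@le_trans _ _ (K * eta)); first by rewrite ler_wpM2r ?(ltW eta0)//; lra.
  by rewrite /eta mulrC divfK// gt_eqF.
set X := 2 * _ + 2 * _; set w := fine V.
have X0 : 0 <= X by rewrite /X addr_ge0// mulr_ge0// fine_ge0//; exact: measure_ge0.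
have w0 : 0 <= w by rewrite /w fine_ge0.
pose N := Num.sqrt (X ^+ 2 + w ^+ 2).
have N0 : 0 <= N by exact: sqrtr_ge0.
have NN : N ^+ 2 = X ^+ 2 + w ^+ 2 by rewrite sqr_sqrtr// addr_ge0 ?sqr_ge0.
(* If both lengths vanish, the direction (0, 0) gives that [L] does not decrease. *)
have [N00|Nn0] := eqVneq N 0.
  rewrite -/N N00 mulr0; have := main0 0 0 (lexx _) (lexx _).
  by rewrite !mul0r addr0 mulr0; apply; rewrite expr0n/= addr0.
have Np : 0 < N by rewrite lt_neqAle eq_sym Nn0.
have := main0 (X / N) (w / N) (divr_ge0 X0 N0) (divr_ge0 w0 N0).
rewrite -/X -/w !expr_div_n -mulrDl NN divff ?lexx; last by rewrite -NN expf_neq0.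
move=> /(_ isT); rewrite -/N; congr (_ * _ <= _).
have -> : X / N * X + w / N * w = N ^+ 2 / N by rewrite NN; field.
by rewrite expr2 mulfK.
Qed.

End LowerBound2.

(** * Smooth expressions *)

Section SmoothExpressions.
Context {R : realType}.
Implicit Types (g h : R * R -> R) (p v : R * R).

(** A syntactic class closed under directional derivatives, so that smoothness of every order
    follows by induction on the order. Inverses and roots ask for positivity everywhere, which keeps
    the class differentiable on the whole plane. *)
Inductive smooth_expr : (R * R -> R) -> Prop :=
| smooth_cst c : smooth_expr (fun=> c)
| smooth_fst : smooth_expr fst
| smooth_snd : smooth_expr snd
| smooth_add g h : smooth_expr g -> smooth_expr h -> smooth_expr (fun p => g p + h p)
| smooth_mul g h : smooth_expr g -> smooth_expr h -> smooth_expr (fun p => g p * h p)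
| smooth_inv g : smooth_expr g -> (forall p, 0 < g p) -> smooth_expr (fun p => (g p)^-1)
| smooth_sqrt g : smooth_expr g -> (forall p, 0 < g p) -> smooth_expr (fun p => Num.sqrt (g p)).

Lemma fst_continuous2 : continuous (fst : R * R -> R).
Proof. by move=> p; exact: cvg_fst. Qed.

Lemma snd_continuous2 : continuous (snd : R * R -> R).
Proof. by move=> p; exact: cvg_snd. Qed.

Lemma differentiable_sqrt (x : R) : 0 < x -> differentiable (@Num.sqrt R) x.
Proof. by move=> x0; apply/derivable1_diffP; have := is_derive1_sqrt x0 => -[]. Qed.

Lemma smooth_expr_differentiable g : smooth_expr g -> forall p, differentiable g p.
Proof.
elim=> [c|||g' h' _ dg _ dh|g' h' _ dg _ dh|g' _ dg g0|g' _ dg g0] p.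
- exact: differentiable_cst.
- exact/linear_differentiable/fst_continuous2.
- exact/linear_differentiable/snd_continuous2.
- exact: differentiableD.
- exact: differentiableM.
- by apply: differentiableV; rewrite ?gt_eqF.
- by apply: differentiable_comp => //; exact: differentiable_sqrt.
Qed.

Lemma smooth_expr_derive g v : smooth_expr g -> smooth_expr ('D_v g).
Proof.
elim=> [c|||g' h' sg dg sh dh|g' h' sg dg sh dh|g' sg dg g0|g' sg dg g0].
- rewrite (_ : 'D_v _ = fun=> 0); first exact: smooth_cst.
  by apply/funext => p; exact: derive_cst.
- rewrite (_ : 'D_v _ = fun=> v.1); first exact: smooth_cst.
  apply/funext => p; rewrite deriveE; last exact/linear_differentiable/fst_continuous2.
  by rewrite diff_lin//; exact: fst_continuous2.
- rewrite (_ : 'D_v _ = fun=> v.2); first exact: smooth_cst.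
  apply/funext => p; rewrite deriveE; last exact/linear_differentiable/snd_continuous2.
  by rewrite diff_lin//; exact: snd_continuous2.
- rewrite (_ : 'D_v _ = fun p => 'D_v g' p + 'D_v h' p); first exact: smooth_add.
  apply/funext => p; apply: deriveD; apply: diff_derivable; exact: smooth_expr_differentiable.
- rewrite (_ : 'D_v _ = fun p => g' p * 'D_v h' p + h' p * 'D_v g' p).
    by apply: smooth_add; apply: smooth_mul.
  apply/funext => p; apply: deriveM; apply: diff_derivable; exact: smooth_expr_differentiable.
- rewrite (_ : 'D_v _ = fun p => -1 * ((g' p)^-1 * (g' p)^-1) * 'D_v g' p).
    apply: smooth_mul => //; apply: smooth_mul; first exact: smooth_cst.
    by apply: smooth_mul; exact: smooth_inv.
  apply/funext => p; rewrite deriveV ?gt_eqF//; last first.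
    by apply: diff_derivable; exact: smooth_expr_differentiable.
  by rewrite mulN1r -exprVn -expr2.
- rewrite (_ : 'D_v _ = fun p => 'D_v g' p * (2 * Num.sqrt (g' p))^-1).
    apply: smooth_mul => //; apply: smooth_inv => [|p].
      by apply: smooth_mul; [exact: smooth_cst|exact: smooth_sqrt].
    by rewrite mulr_gt0// sqrtr_gt0.
  apply/funext => p; have dgp := smooth_expr_differentiable _ sg p.
  have ds := differentiable_sqrt _ (g0 p).
  rewrite deriveE; last exact: differentiable_comp.
  rewrite (diff_comp dgp ds) /= diff1E// derive1E.
  by have := is_derive1_sqrt (g0 p) => -[_ ->]; rewrite -deriveE.
Qed.

Lemma smooth_expr_smooth g : smooth_expr g -> smooth_function g.
Proof.
move=> sg n; elim: n g sg => [|n IH] g sg /=.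
  by move=> p; apply: differentiable_continuous; exact: smooth_expr_differentiable.
split; first exact: smooth_expr_differentiable.
by move=> v; apply: IH; exact: smooth_expr_derive.
Qed.

Lemma smooth_expr_stretch g (a : R) : smooth_expr g -> smooth_expr (fun p => g (a * p.1, p.2)).
Proof.
elim=> [c|||g' h' _ dg _ dh|g' h' _ dg _ dh|g' _ dg g0|g' _ dg g0] /=.
- exact: smooth_cst.
- by apply: smooth_mul; [exact: smooth_cst|exact: smooth_fst].
- exact: smooth_snd.
- exact: (smooth_add _ _ dg dh).
- exact: (smooth_mul _ _ dg dh).
- exact: (smooth_inv _ dg (fun p => g0 _)).
- exact: (smooth_sqrt _ dg (fun p => g0 _)).
Qed.

Lemma sublevel_boundary g : continuous g ->
  boundary [set p | g p < 0] `<=` [set p | g p = 0].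
Proof.
move=> cg p; have oE : open [set p | g p < 0].
  by apply: (@open_comp _ _ g [set x | x < 0]) => [q _|]; [exact: cg|exact: open_lt].
move=> /(boundary_open _ _ oE) [cp np].
apply/eqP; rewrite eq_le; apply/andP; split; last by rewrite leNgt; apply/negP.
rewrite leNgt; apply/negP => gp.
have /cp [q [/= q1 q2]] : nbhs p [set q | 0 < g q].
  by apply: open_nbhs_nbhs; split=> //; apply: (@open_comp _ _ g [set x | 0 < x]) => [q _|];
    [exact: cg|exact: open_gt].
by have := lt_trans q1 q2; rewrite ltxx.
Qed.

Lemma sublevel_smooth g : smooth_expr g ->
  (forall p, g p = 0 -> exists v, 'D_v g p != 0) -> smooth_set [set p | g p < 0].
Proof.
move=> sg reg; have cg : continuous g := smooth_expr_smooth _ sg 0%N.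
split=> [|p bp].
  by apply: (@open_comp _ _ g [set x | x < 0]) => [p _|]; [exact: cg|exact: open_lt].
have [v hv] := reg p (sublevel_boundary g cg p bp); exists g; split.
- exact: smooth_expr_smooth.
- by exists v; rewrite -deriveE//; exact: smooth_expr_differentiable.
- by near=> q.
Unshelve. all: by end_near. Qed.

End SmoothExpressions.

(** * Upper bounds for boundary integrals *)

Section LengthBounds.
Context {R : realType}.
Variable lambda : R.
Hypothesis hlambda : 1 < lambda.
Implicit Types (p q : R * R) (A E G : set (R * R)).
Local Notation leb := (@lebesgue_measure R).
Local Notation H := (@hausdorff1 R).
Local Notation f := (strip_density lambda).

(** [A] is cut into [n] pieces along the parameter, each of diameter at most [c * h], with [n] so
    large that this is at most the given scale. *)
Lemma param_length A (t : R * R -> R) (a b c : R) : a <= b -> 0 <= c ->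
  (forall p, A p -> a <= t p <= b) ->
  (forall p q, A p -> A q -> euclidean_dist p q <= c * `|t p - t q|) ->
  (H A <= (c * (b - a))%:E)%E.
Proof.
move=> ab c0 tA dA; apply: ge_ereal_sup => _ [d /= d0 <-].
have cba : 0 <= c * (b - a) by rewrite mulr_ge0// subr_ge0.
pose n := (Num.truncn (c * (b - a) / d)).+1.
have n0 : 0 < n%:R :> R by rewrite ltr0n.
pose h := (b - a) / n%:R.
have h0 : 0 <= h by rewrite divr_ge0// ?subr_ge0// ltW.
have nh : n%:R * h = b - a by rewrite /h mulrC divfK// gt_eqF.
have chd : c * h <= d.
  rewrite /h mulrA ler_pdivrMr// [d * _]mulrC -ler_pdivrMr//.
  by apply: ltW; exact: truncnS_gt.
pose C (i : nat) : set (R * R) := if (i < n)%N then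
   A `&` [set p | a + i%:R * h <= t p <= a + i.+1%:R * h] else set0.
have Cd i : (diameter (C i) <= (c * h)%:E)%E.
  apply/diameter_leP; first by rewrite mulr_ge0.
  move=> p q; rewrite /C; case: ifP => // _ [Ap /andP[p1 p2]] [Aq /andP[q1 q2]].
  apply: le_trans (dA p q Ap Aq) _; rewrite ler_wpM2l//.
  have e1 : i.+1%:R * h = i%:R * h + h by rewrite -natr1 mulrDl mul1r.
  by rewrite ler_norml; rewrite e1 in p2 q2; lra.
apply: (@le_trans _ _ (\sum_(0 <= i <oo) diameter (C i))%E).
  apply: ereal_inf_lbound; exists C => //; split; last first.
    by move=> i; apply: le_trans (Cd i) _; rewrite lee_fin.
  move=> p Ap; have /andP[tp1 tp2] := tA p Ap.
  (* Degenerate parameter interval: the first piece is everything. *)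
  have [hz|hn] := eqVneq h 0.
    have eab : b = a by move: nh; rewrite hz mulr0; lra.
    exists 0%N => //; rewrite /C /=; split=> //=; rewrite hz !mulr0 addr0 tp1 /=.
    by move: tp2; rewrite eab.
  have hp : 0 < h by rewrite lt_neqAle eq_sym hn.
  pose k := Num.truncn ((t p - a) / h).
  have tk0 : 0 <= (t p - a) / h by rewrite divr_ge0// subr_ge0.
  have /andP[k1 k2] : k%:R <= (t p - a) / h < k.+1%:R by rewrite truncn_itv.
  have k1' : k%:R * h <= t p - a by rewrite -ler_pdivlMr.
  have k2' : t p - a < k.+1%:R * h by rewrite -ltr_pdivrMr.
  have [kn|kn] := ltnP k n.
    by exists k => //; rewrite /C kn; split=> //=; lra.
  (* Only the right end of the parameter interval reaches the index [n]; it belongs to the last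
     piece. *)
  exists n.-1 => //; rewrite /C prednK// leqnn; split=> //=.
  have : n%:R * h <= k%:R * h by rewrite ler_wpM2r// ler_nat.
  have : n.-1%:R * h <= n%:R * h by rewrite ler_wpM2r// ler_nat leq_pred.
  by move=> *; apply/andP; split; lra.
rewrite (@nneseries_split _ (fun i => diameter (C i)) 0 n)//; last by move=> k _; exact: diameter_ge0.
rewrite add0n [X in (_ + X)%E]eseries0 ?adde0; last first.
  by move=> i ni _; rewrite /C ltnNge ni/= diameter_set0.
apply: (@le_trans _ _ (\sum_(0 <= i < n) (c * h)%:E)%E); first exact: lee_sum.
rewrite sumEFin lee_fin big_const_nat iter_addr_0 subn0 -mulr_natl.
by rewrite mulrCA nh.
Qed.

Lemma lipschitz_image A (phi : R * R -> R * R) :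
  (forall p q, euclidean_dist (phi p) (phi q) <= euclidean_dist p q) ->
  (H (phi @` A) <= H A)%E.
Proof.
move=> lip; apply: ge_ereal_sup => _ [d /= d0 <-].
apply: le_trans (methodII_delta_le _ d A d0).
apply: le_ereal_inf_tmp => _ [C [AC Cd] <-].
have dphi i : (diameter (phi @` C i) <= diameter (C i))%E.
  rewrite {1}/diameter ge_max diameter_ge0/=.
  apply: ge_ereal_sup => _ [[_ _] [/= [p Cp <-] [q Cq <-]] <-].
  by apply: le_trans (dist_le_diameter _ _ _ Cp Cq); rewrite lee_fin.
apply: (@le_trans _ _ (\sum_(0 <= i <oo) diameter (phi @` C i))%E).
  apply: ereal_inf_lbound; exists (fun i => phi @` C i) => //; split.
    by move=> _ [p /AC[i _ Ci] <-]; exists i => //; exists p.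
  by move=> i; exact: le_trans (dphi i) (Cd i).
by apply: lee_nneseries => [i _ _|i _]; [exact: diameter_ge0|exact: dphi].
Qed.

Lemma boundary_integral_cover G N (B : nat -> set (R * R)) (M : nat -> R) :
  (forall i, measurable (B i)) -> (forall i, 0 <= M i) ->
  (forall i p, (i < N)%N -> B i p -> f p <= M i) ->
  (forall p, boundary G p -> exists2 i, (i < N)%N & B i p) ->
  (boundary_integral f G <= \sum_(i < N) (M i)%:E * H (boundary G `&` B i))%E.
Proof.
move=> mB M0 fM cov; have mG := boundary_measurable G.
have mBi i : measurable_fun (boundary G) (fun p : R * R => ((M i)%:E * (\1_(B i) p : R)%:E)%E).
  by apply: measurable_funeM; apply/measurable_EFinP; exact: measurable_indic.
have e i : ((M i)%:E * H (boundary G `&` B i) =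
    \int[H]_(p in boundary G) ((M i)%:E * (\1_(B i) p : R)%:E))%E.
  rewrite ge0_integralZl//.
  - by rewrite integral_indic// setIC.
  - by apply/measurable_EFinP; exact: measurable_indic.
  - by rewrite lee_fin.
rewrite (eq_bigr _ (fun (i : 'I_N) _ => e i)) -ge0_integral_sum//; last first.
  by move=> i p _; rewrite mule_ge0 ?lee_fin.
apply: ge0_le_integral => //.
- by move=> p _; rewrite lee_fin density_ge0.
- exact: densityE_measurable.
- exact: emeasurable_sum.
move=> p bp; have [i iN Bip] := cov p bp.
rewrite (bigD1 (Ordinal iN))//= -[leLHS]adde0; apply: leeD.
  by rewrite indicE mem_set// mule1 lee_fin; exact: fM.
by apply: sume_ge0 => j _; rewrite mule_ge0 ?lee_fin.
Qed.

(** It acts on sets by preimage, so a >= 1 makes them narrower. *)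
Definition stretch (a : R) p : R * R := (a * p.1, p.2).

Lemma stretch_continuous a : continuous (stretch a).
Proof.
move=> p; apply/cvg_ballP => e e0; have a1 : 0 < `|a| + 1 by rewrite ltr_wpDl.
have r0 : 0 < e / (`|a| + 1) by exact: divr_gt0.
apply: filterS (nbhsx_ballx p _ r0) => q [+ +]; rewrite /ball /= !ltr_pdivlMr// => h1 h2; split; rewrite /ball/=.
  rewrite -mulrBr normrM; apply: le_lt_trans h1; rewrite mulrC ler_wpM2l// lerDl//.
by apply: le_lt_trans h2; rewrite ler_peMr// lerDr.
Qed.

Lemma boundary_preimage G (psi : R * R -> R * R) : continuous psi ->
  boundary (psi @^-1` G) `<=` psi @^-1` boundary G.
Proof.
move=> cpsi p [cp np]; split.
  by move=> V /cpsi /cp [q [Gq Vq]]; exists (psi q).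
by move=> h; apply: np; exact: (cpsi p G h).
Qed.

(** The map that narrows the set is 1-Lipschitz and preserves heights, so the lengths inside and
    outside the strip decrease separately. *)
Lemma boundary_integral_contract G a : 1 <= a ->
  (boundary_integral f (stretch a @^-1` G) <= boundary_integral f G)%E.
Proof.
move=> a1; have a0 : 0 < a by exact: lt_le_trans a1.
pose S : set (R * R) := [set p | `|p.2| <= 1].
have mS : measurable S.
  have -> : S = setT `*` `[-1, 1]%classic.
    by apply/seteqP; split=> p; rewrite /S /= in_itv/= ler_norml; [split|case].
  by apply: measurableX => //; exact: measurable_itv.
have bE E : (boundary_integral f E = H (boundary E `&` S) + lambda%:E * H (boundary E `\` S))%E.
  have mE := boundary_measurable E.
  have DE : boundary E = (boundary E `&` S) `|` (boundary E `\` S).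
    apply/seteqP; split=> [p bp|p [[]|[]]//]; have [Sp|Sp] := pselect (S p); [by left|by right].
  rewrite /boundary_integral {1}DE ge0_integral_setU//.
  - congr (_ + _)%E.
      rewrite (eq_integral (cst 1%E)); last first.
        by move=> p; rewrite inE => -[_ h]; rewrite /strip_density h.
      by rewrite integral_cst ?mul1e//; exact: measurableI.
    rewrite (eq_integral (cst lambda%:E)); last first.
      by move=> p; rewrite inE => -[_ /negP h]; rewrite /strip_density (negbTE h).
    by rewrite integral_cst//; exact: measurableD.
  - exact: measurableI.
  - exact: measurableD.
  - exact: densityE_measurable.
  - by move=> p _; rewrite lee_fin density_ge0.
  - by apply/disj_setPS => p [[_ ?] [_ ]].
rewrite !bE.
have key (T : R -> bool) : (H (boundary (stretch a @^-1` G) `&` [set p | T p.2]) <=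
    H (boundary G `&` [set p | T p.2]))%E.
  apply: le_trans (lipschitz_image (boundary G `&` [set p | T p.2]) (stretch a^-1) _).
    apply: le_outer_measure => p [bp Tp]; exists (stretch a p).
      by split=> //; exact: boundary_preimage (stretch_continuous a) _ bp.
    by rewrite /stretch /= mulKf ?gt_eqF//; case: (p).
  move=> p q; rewrite /euclidean_dist ler_wsqrtr// lerD2r /= -mulrBr exprMn.
  rewrite ler_piMl ?sqr_ge0// exprn_ile1 ?invr_ge0 ?(ltW a0) ?invf_le1//.
apply: leeD; first exact: (key (fun y => `|y| <= 1)).
apply: lee_wpmul2l; first by rewrite lee_fin ltW// (lt_trans ltr01).
have SD E : E `\` S = E `&` [set p | ~~ (`|p.2| <= 1)].
  by apply/seteqP; split=> p [Ep Sp]; split=> //; apply/negP.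
by rewrite !SD; exact: (key (fun y => ~~ (`|y| <= 1))).
Qed.

End LengthBounds.

(** * Smoothed profiles *)

Section SmoothedProfile.
Context {R : realType}.
Local Notation H := (@hausdorff1 R).
Implicit Types (p : R * R) (A : set (R * R)) (eps d y w tau mu : R).

(** Serves twice: with [eps] it rounds the corners of a profile in y, with [tau] it rounds the tips
    of the set in x. *)
Definition smooth_abs eps d : R := Num.sqrt (d ^+ 2 + eps ^+ 2).

Lemma smooth_abs0 d : smooth_abs 0 d = `|d|.
Proof. by rewrite /smooth_abs expr0n addr0 sqrtr_sqr. Qed.

Lemma smooth_abs_sqr eps d : smooth_abs eps d ^+ 2 = d ^+ 2 + eps ^+ 2.
Proof. by rewrite sqr_sqrtr// addr_ge0 ?sqr_ge0. Qed.

Lemma smooth_abs_ge eps d : `|d| <= smooth_abs eps d.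
Proof. by rewrite -sqrtr_sqr ler_wsqrtr// lerDl sqr_ge0. Qed.

Lemma smooth_abs_ge0 eps d : 0 <= smooth_abs eps d.
Proof. exact: sqrtr_ge0. Qed.

Lemma smooth_abs_le eps d : 0 <= eps -> smooth_abs eps d <= `|d| + eps.
Proof.
move=> e0; have h : 0 <= `|d| + eps by rewrite addr_ge0.
rewrite -(@ler_pXn2r _ 2) ?nnegrE ?smooth_abs_ge0// smooth_abs_sqr sqrrD real_normK ?num_real//.
by rewrite -addrA lerD2l lerDr mulrn_wge0// mulr_ge0.
Qed.

Lemma smooth_abs_lip eps d d' : `|smooth_abs eps d - smooth_abs eps d'| <= `|d - d'|.
Proof.
set a := smooth_abs eps d; set b := smooth_abs eps d'.
have a0 : 0 <= a by exact: smooth_abs_ge0. have b0 : 0 <= b by exact: smooth_abs_ge0.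
rewrite -(@ler_pXn2r _ 2) ?nnegrE// !real_normK ?num_real// !sqrrB !smooth_abs_sqr -/a -/b.
have : d * d' + eps ^+ 2 <= a * b.
  apply: le_trans (ler_norm _) _.
  rewrite -(@ler_pXn2r _ 2) ?nnegrE ?mulr_ge0// real_normK ?num_real// exprMn !smooth_abs_sqr.
  rewrite -subr_ge0; have -> : (d ^+ 2 + eps ^+ 2) * (d' ^+ 2 + eps ^+ 2) - (d * d' + eps ^+ 2) ^+ 2 =
    (eps * (d - d')) ^+ 2 by ring.
  exact: sqr_ge0.
move=> h; rewrite -subr_ge0.
have -> : d ^+ 2 - d * d' *+ 2 + d' ^+ 2 - (d ^+ 2 + eps ^+ 2 - a * b *+ 2 + (d' ^+ 2 + eps ^+ 2)) =
  2 * (a * b - (d * d' + eps ^+ 2)) by ring.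
by rewrite mulr_ge0// subr_ge0.
Qed.

Lemma smooth_abs_far eps w d d' : 0 <= eps -> 0 < w -> w <= d -> w <= d' ->
  `|smooth_abs eps d - smooth_abs eps d' - (d - d')| <= eps / w * `|d - d'|.
Proof.
move=> e0 w0 wd wd'; set a := smooth_abs eps d; set b := smooth_abs eps d'.
have ha := smooth_abs_ge eps d; have hb := smooth_abs_ge eps d'.
have ha' := smooth_abs_le eps d e0; have hb' := smooth_abs_le eps d' e0.
have d0 : 0 < d by apply: lt_le_trans wd.
have d0' : 0 < d' by apply: lt_le_trans wd'.
rewrite -/a -/b ger0_norm in ha ha'; last exact: ltW.
rewrite -/a -/b ger0_norm in hb hb'; last exact: ltW.
have ab0 : 0 < a + b by lra.
have e : (a - b) * (a + b) = (d - d') * (d + d').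
  by rewrite -!subr_sqr !smooth_abs_sqr; ring.
have -> : a - b - (d - d') = (d - d') * ((d + d') - (a + b)) / (a + b).
  apply: (mulIf (lt0r_neq0 ab0)); rewrite divfK ?gt_eqF// mulrBl e; ring.
rewrite !normrM -mulrA [leLHS]mulrC ler_wpM2r//.
rewrite normfV (gtr0_norm ab0) ler_pdivrMr// mulrAC ler_pdivlMr//.
have D : `|d + d' - (a + b)| <= eps * 2 by rewrite ler_norml; lra.
apply: (@le_trans _ _ (eps * 2 * w)); first by rewrite ler_wpM2r// ltW.
by rewrite -mulrA ler_wpM2l//; lra.
Qed.

Lemma smooth_abs_farN eps w d d' : 0 <= eps -> 0 < w -> d <= - w -> d' <= - w ->
  `|smooth_abs eps d - smooth_abs eps d' + (d - d')| <= eps / w * `|d - d'|.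
Proof.
move=> e0 w0 wd wd'; have := @smooth_abs_far eps w (- d) (- d') e0 w0.
rewrite /smooth_abs !sqrrN -opprD normrN opprK => h; apply: h; lra.
Qed.

Lemma hypotenuse_le (x y K : R) : 0 <= K -> `|x| <= K * `|y| ->
  Num.sqrt (x ^+ 2 + y ^+ 2) <= Num.sqrt (1 + K ^+ 2) * `|y|.
Proof.
move=> K0 xy; rewrite -[X in _ * X]sqrtr_sqr -sqrtrM ?addr_ge0 ?sqr_ge0//.
rewrite ler_wsqrtr// mulrDl mul1r addrC lerD2l.
rewrite -[leLHS]real_normK ?num_real// -[y ^+ 2]real_normK ?num_real// -exprMn.
by rewrite ler_pXn2r// nnegrE mulr_ge0.
Qed.

(* On a profile curve sqrt(x^2 + tau^2) = Q(y) the abscissa x has almost the slope of Q where Q >> tau. *)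
Lemma profile_slab_length A (Q : R -> R) (s s' tau mu k : R) : s <= s' -> 0 <= k -> 0 <= tau ->
  0 < mu -> tau < mu ->
  (forall p, A p -> [/\ s <= p.2 <= s', mu <= Q p.2 & smooth_abs tau p.1 = Q p.2]) ->
  (forall p p', A p -> A p' -> `|Q p.2 - Q p'.2| <= k * `|p.2 - p'.2|) ->
  (H A <= (2 * (Num.sqrt (1 + (k / (1 - (tau / mu) ^+ 2)) ^+ 2) * (s' - s)))%:E)%E.
Proof.
move=> ss' k0 tau0 mu0 taumu hA hk; set K := k / _.
have eta1 : 0 < 1 - (tau / mu) ^+ 2.
  by rewrite subr_gt0 exprn_ilt1 ?divr_ge0 ?(ltW mu0)// ltr_pdivrMr// mul1r.
have etage : 1 - (tau / mu) ^+ 2 <= 1 by rewrite lerBlDr lerDl sqr_ge0.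
have K0 : 0 <= K by rewrite divr_ge0// ltW.
have c0 : 0 <= Num.sqrt (1 + K ^+ 2) by exact: sqrtr_ge0.
have low p : A p -> (1 - (tau / mu) ^+ 2) * Q p.2 <= `|p.1|.
  move=> /hA [_ mQ eQ].
  have Q0 : 0 < Q p.2 by exact: lt_le_trans mQ.
  rewrite -(@ler_pXn2r _ 2) ?nnegrE ?mulr_ge0 ?(ltW eta1) ?(ltW Q0)//.
  rewrite real_normK ?num_real// (_ : p.1 ^+ 2 = Q p.2 ^+ 2 - tau ^+ 2); last first.
    by rewrite -eQ smooth_abs_sqr addrK.
  apply: (@le_trans _ _ ((1 - (tau / mu) ^+ 2) * Q p.2 ^+ 2)).
    by rewrite exprMn ler_wpM2r ?sqr_ge0// expr2 ler_piMl ?(ltW eta1).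
  rewrite mulrBl mul1r lerD2l lerN2 expr_div_n mulrAC ler_pdivlMr ?exprn_gt0//.
  by rewrite ler_wpM2l ?sqr_ge0// ler_pXn2r ?nnegrE ?(ltW mu0) ?(ltW Q0).
have half (B : set (R * R)) : B `<=` A -> (forall p p', B p -> B p' -> 0 <= p.1 * p'.1) ->
    (H B <= (Num.sqrt (1 + K ^+ 2) * (s' - s))%:E)%E.
  move=> BA sgn; apply: (param_length B snd) => //.
    by move=> p /BA /hA [].
  move=> p p' Bp Bp'; have Ap := BA _ Bp; have Ap' := BA _ Bp'.
  have [_ mQ eQ] := hA p Ap; have [_ mQ' eQ'] := hA p' Ap'.
  have QQ0 : 0 < Q p.2 + Q p'.2 by rewrite addr_gt0// (lt_le_trans mu0).
  have xx : `|p.1 - p'.1| * (`|p.1| + `|p'.1|) = `|Q p.2 - Q p'.2| * (Q p.2 + Q p'.2).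
    rewrite -[X in _ = _ * X]ger0_norm ?(ltW QQ0)//.
    have -> : `|p.1| + `|p'.1| = `|p.1 + p'.1|.
      have := sgn _ _ Bp Bp'; have [p0|p0|<-] := ltgtP 0 p.1.
      - by rewrite pmulr_rge0// => p0'; rewrite (gtr0_norm p0) (ger0_norm p0') ger0_norm// addr_ge0// ltW.
      - rewrite nmulr_rge0// => p0'; rewrite (ltr0_norm p0) (ler0_norm p0').
        by rewrite ler0_norm ?opprD//; lra.
      - by rewrite normr0 !add0r.
    rewrite -!normrM -!subr_sqr -eQ -eQ' !smooth_abs_sqr; congr (`|_|); ring.
  have dx : `|p.1 - p'.1| <= K * `|p.2 - p'.2|.
    apply: (@le_trans _ _ (`|Q p.2 - Q p'.2| / (1 - (tau / mu) ^+ 2))); last first.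
      by rewrite /K mulrAC ler_wpM2r ?invr_ge0 ?(ltW eta1)//; exact: hk.
    rewrite ler_pdivlMr// -(ler_pM2r QQ0) -xx -mulrA ler_wpM2l// mulrDr.
    by apply: lerD; exact: low.
  exact: hypotenuse_le.
apply: (@le_trans _ _ (H ((A `&` [set p | 0 <= p.1]) `|` (A `&` [set p | p.1 <= 0])))).
  apply: le_outer_measure => p Ap; have [h|h] := leP 0 p.1; [by left|right].
  by split=> //; exact: ltW.
apply: le_trans (outer_measureU2 _ _ _) _; rewrite mulrDl mul1r EFinD; apply: leeD; apply: half.
- by move=> p [].
- by move=> p p' [_ /= h] [_ /= h']; exact: mulr_ge0.
- by move=> p [].
- by move=> p p' [_ /= h] [_ /= h']; exact: mulr_le0.
Qed.

(** At a tip the curve becomes horizontal, so the abscissa is the right parameter: [Q] has slope at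
    least theta and [smooth_abs] is 1-Lipschitz, hence the height is a Lipschitz function of x. *)
Lemma profile_tip_length A (Q : R -> R) (tau X theta : R) : 0 <= X -> 0 < theta ->
  (forall p, A p -> `|p.1| <= X /\ smooth_abs tau p.1 = Q p.2) ->
  (forall p p', A p -> A p' -> theta * `|p.2 - p'.2| <= `|Q p.2 - Q p'.2|) ->
  (H A <= (Num.sqrt (1 + theta^-1 ^+ 2) * (2 * X))%:E)%E.
Proof.
move=> X0 th0 hA hth; have -> : 2 * X = X - - X by ring.
have XX : - X <= X by lra.
apply: (param_length A fst) => //.
  by move=> p /hA [+ _]; rewrite ler_norml.
move=> p p' Ap Ap'; have [_ eQ] := hA p Ap; have [_ eQ'] := hA p' Ap'.
have dy : `|p.2 - p'.2| <= theta^-1 * `|p.1 - p'.1|.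
  rewrite -(ler_pM2l th0) mulrA divff ?gt_eqF// mul1r; apply: le_trans (hth _ _ Ap Ap') _.
  by rewrite -eQ -eQ'; exact: smooth_abs_lip.
rewrite /euclidean_dist addrC; apply: hypotenuse_le => //.
by rewrite invr_ge0 ltW.
Qed.

Section nodes.
Variables (N : nat) (z q : nat -> R).
Hypothesis hz : forall i, (i < N)%N -> z i < z i.+1.

Definition slope i := (q i.+1 - q i) / (z i.+1 - z i).

(** For eps = 0 this is 0 before cell i, of slope 1 on it and constant after it. *)
Definition ramp eps i y :=
  (smooth_abs eps (y - z i) - smooth_abs eps (y - z i.+1) + (z i.+1 - z i)) / 2.

(* eps = 0 gives the piecewise linear interpolation of the data when q vanishes at both ends. *)
Definition profile eps y := \sum_(i < N) slope i * ramp eps i y.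

(** A Lipschitz constant for all smoothings of the profile; the summand 1 makes it positive even if
    all slopes vanish. *)
Definition total_slope := \sum_(i < N) `|slope i| + 1.

Lemma total_slope_gt0 : 0 < total_slope.
Proof. by rewrite ltr_wpDl// sumr_ge0. Qed.

Lemma slope_le i : (i < N)%N -> `|slope i| <= total_slope.
Proof.
move=> iN; rewrite /total_slope (bigD1 (Ordinal iN))//= -addrA lerDl.
by rewrite addr_ge0// sumr_ge0.
Qed.

Lemma node_le i j : (i <= j <= N)%N -> z i <= z j.
Proof.
elim: j => [|j IH]; first by rewrite leqn0 => /andP[/eqP ->].
move=> /andP[]; rewrite leq_eqVlt => /orP[/eqP -> //|ij jN].
by apply: le_trans (IH _) (ltW (hz j jN)); rewrite -ltnS ij ltnW.
Qed.

Lemma profile_weighted (u : nat -> R) (c : R) : 0 <= c ->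
  (forall i, (i < N)%N -> `|u i| <= c) -> `|\sum_(i < N) slope i * u i| <= total_slope * c.
Proof.
move=> c0 uc; apply: le_trans (ler_norm_sum _ _ _) _.
apply: (@le_trans _ _ (\sum_(i < N) `|slope i| * c)).
  by apply: ler_sum => i _; rewrite normrM ler_wpM2l// uc.
by rewrite -mulr_suml /total_slope mulrDl mul1r lerDl.
Qed.

Lemma profile_approx eps y : 0 <= eps -> `|profile eps y - profile 0 y| <= total_slope * eps.
Proof.
move=> e0; rewrite /profile -sumrB.
rewrite (eq_bigr (fun i : 'I_N => slope i * (ramp eps i y - ramp 0 i y))); last first.
  by move=> i _; rewrite mulrBr.
apply: (@profile_weighted (fun i => ramp eps i y - ramp 0 i y)) => // i iN.
have h d : 0 <= smooth_abs eps d - `|d| <= eps.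
  by rewrite subr_ge0 smooth_abs_ge lerBlDl smooth_abs_le.
rewrite /ramp !smooth_abs0; have := h (y - z i); have := h (y - z i.+1).
rewrite ler_norml; lra.
Qed.

Lemma profile_lip eps y y' : `|profile eps y - profile eps y'| <= total_slope * `|y - y'|.
Proof.
rewrite /profile -sumrB.
rewrite (eq_bigr (fun i : 'I_N => slope i * (ramp eps i y - ramp eps i y'))); last first.
  by move=> i _; rewrite mulrBr.
apply: (@profile_weighted (fun i => ramp eps i y - ramp eps i y')) => // i iN.
have h c : `|smooth_abs eps (y - c) - smooth_abs eps (y' - c)| <= `|y - y'|.
  by apply: le_trans (smooth_abs_lip _ _ _) _; rewrite (_ : y - c - (y' - c) = y - y')//; ring.
rewrite /ramp; have := h (z i); have := h (z i.+1); rewrite !ler_norml; lra.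
Qed.

(** At distance [w] from the nodes every smoothed absolute value has slope 1 or -1 up to eps / w,
    and within the ramp of a cell other than j the two slopes cancel. *)
Lemma profile_slope eps w j y y' : (j < N)%N -> 0 <= eps -> 0 < w ->
  z j + w <= y <= z j.+1 - w -> z j + w <= y' <= z j.+1 - w ->
  `|profile eps y - profile eps y' - slope j * (y - y')| <=
    total_slope * (eps / w * `|y - y'|).
Proof.
move=> jN e0 w0 /andP[y1 y2] /andP[y1' y2'].
pose u i := ramp eps i y - ramp eps i y' - (if i == j then y - y' else 0).
have -> : profile eps y - profile eps y' - slope j * (y - y') = \sum_(i < N) slope i * u i.
  transitivity (\sum_(i < N) (slope i * ramp eps i y - slope i * ramp eps i y' -
      slope i * (if i == j :> nat then y - y' else 0))); last first.
    by apply: eq_bigr => i _; rewrite /u !mulrBr.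
  rewrite !sumrB; congr (_ - _).
  rewrite (bigD1 (Ordinal jN))//= eqxx big1 ?addr0// => i ij.
  rewrite ifF ?mulr0//; apply/negbTE; apply: contraNN ij => /eqP ij; exact/eqP/val_inj.
have W0 : 0 <= eps / w * `|y - y'| by rewrite mulr_ge0// divr_ge0// ltW.
apply: profile_weighted => // i iN; rewrite /u /ramp.
have dd c : y - c - (y' - c) = y - y' by ring.
have far c : c + w <= y -> c + w <= y' ->
    `|smooth_abs eps (y - c) - smooth_abs eps (y' - c) - (y - y')| <= eps / w * `|y - y'|.
  by move=> h h'; rewrite -(dd c); apply: smooth_abs_far => //; lra.
have farN c : y <= c - w -> y' <= c - w ->
    `|smooth_abs eps (y - c) - smooth_abs eps (y' - c) + (y - y')| <= eps / w * `|y - y'|.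
  by move=> h h'; rewrite -(dd c); apply: smooth_abs_farN => //; lra.
have zi : z i < z i.+1 by exact: hz.
have [ij|ij|->] := ltngtP i j.
- have zij : z i.+1 <= z j by apply: node_le; rewrite ij ltnW.
  have := far (z i); have := far (z i.+1).
  move=> h1 h2; have {}h1 := h1 _ _; have {}h2 := h2 _ _.
  have := h1 ltac:(lra) ltac:(lra); have := h2 ltac:(lra) ltac:(lra).
  rewrite !ler_norml; lra.
- have zij : z j.+1 <= z i by apply: node_le; rewrite ij ltnW.
  have h1 := farN (z i) ltac:(lra) ltac:(lra); have h2 := farN (z i.+1) ltac:(lra) ltac:(lra).
  move: h1 h2; rewrite !ler_norml; lra.
- have h1 := far (z j) ltac:(lra) ltac:(lra); have h2 := farN (z j.+1) ltac:(lra) ltac:(lra).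
  move: h1 h2; rewrite !ler_norml; lra.
Qed.

Lemma ramp0_left i y : (i < N)%N -> y <= z i -> ramp 0 i y = 0.
Proof.
move=> iN yz; have := hz i iN; rewrite /ramp !smooth_abs0 => h.
rewrite !ler0_norm; lra.
Qed.

Lemma ramp0_right i y : (i < N)%N -> z i.+1 <= y -> ramp 0 i y = z i.+1 - z i.
Proof.
move=> iN yz; have := hz i iN; rewrite /ramp !smooth_abs0 => h.
rewrite !ger0_norm; lra.
Qed.

Lemma ramp0_mid i y : (i < N)%N -> z i <= y <= z i.+1 -> ramp 0 i y = y - z i.
Proof.
move=> iN /andP[y1 y2]; rewrite /ramp !smooth_abs0 ger0_norm ?ler0_norm; lra.
Qed.

Lemma slopeK i : (i < N)%N -> slope i * (z i.+1 - z i) = q i.+1 - q i.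
Proof. by move=> iN; rewrite divfK// gt_eqF// subr_gt0 hz. Qed.

Lemma profile_cell j y : q 0 = 0 -> (j < N)%N -> z j <= y <= z j.+1 ->
  profile 0 y = q j + slope j * (y - z j).
Proof.
move=> q0 jN yj; have /andP[y1 y2] := yj; rewrite /profile.
rewrite -(big_mkord xpredT (fun i => slope i * ramp 0 i y)).
rewrite (@big_cat_nat _ _ _ j)//=; last exact: ltnW.
rewrite [X in _ + X]big_ltn// ramp0_mid//.
have -> : \sum_(j.+1 <= i < N) slope i * ramp 0 i y = 0.
  rewrite big_nat_cond big1// => i /andP[/andP[ji iN] _]; rewrite ramp0_left ?mulr0//.
  by apply: le_trans y2 (node_le _ _ _); rewrite ji ltnW.
rewrite addr0.
congr (_ + _); rewrite big_nat_cond (eq_bigr (fun i => q i.+1 - q i)); last first.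
  move=> i /andP[/andP[_ ij] _]; have iN := ltn_trans ij jN.
  rewrite ramp0_right// ?slopeK//.
  by apply: le_trans y1; apply: node_le; rewrite ij ltnW.
by rewrite -big_nat_cond telescope_sumr// q0 subr0.
Qed.

Lemma profile_below y : y <= z 0 -> profile 0 y = 0.
Proof.
move=> y0; rewrite /profile big1// => i _; rewrite ramp0_left ?mulr0//.
by apply: le_trans y0 (node_le _ _ _); rewrite /= ltnW.
Qed.

Lemma profile_above y : q 0 = 0 -> q N = 0 -> z N <= y -> profile 0 y = 0.
Proof.
move=> q0 qN yN; rewrite /profile -(big_mkord xpredT (fun i => slope i * ramp 0 i y)).
rewrite big_nat_cond (eq_bigr (fun i => q i.+1 - q i)); last first.
  move=> i /andP[/andP[_ iN] _]; rewrite ramp0_right// ?slopeK//.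
  by apply: le_trans (node_le _ _ _) yN; rewrite iN leqnn.
by rewrite -big_nat_cond telescope_sumr// qN q0 subrr.
Qed.

End nodes.
End SmoothedProfile.

(** * Bounds for the piecewise linear profile *)

Section ProfileSet.
Context {R : realType}.
Variable lambda : R.
Hypothesis hlambda : 1 < lambda.
Local Notation H := (@hausdorff1 R).
Local Notation f := (strip_density lambda).
Implicit Types (p : R * R).

(** A decrease at linear rate along [v] shows regularity of a level set without a formula for the
    derivative of the smoothed profile. *)
Lemma derive_neq0 (g : R * R -> R) p v (c r : R) : differentiable g p -> 0 < c -> 0 < r ->
  (forall h, 0 < h -> h < r -> g (h *: v + p) - g p <= - (c * h)) -> 'D_v g p != 0.
Proof.
move=> dg c0 r0 hg; apply/negP => /eqP D0.
have dv : derivable g p v by exact: diff_derivable.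
have := dv => /cvg_ex [l hl].
have lE : l = 0 by rewrite -D0 /derive; apply/esym/cvg_lim.
rewrite {}lE in hl; move: hl => /cvgrPdist_lt /(_ c c0).
rewrite /dnbhs /within/= => /nbhs_ballP[e /= e0 he].
pose h := Num.min (e / 2) (r / 2).
have h0 : 0 < h by rewrite /h lt_min !divr_gt0.
have hr : h < r by rewrite /h gt_min; apply/orP; right; lra.
have he' : ball 0 e h.
  by rewrite /ball/= sub0r normrN gtr0_norm// /h gt_min; apply/orP; left; lra.
have := he h he' (lt0r_neq0 h0); rewrite sub0r normrN ltr_norml => /andP[+ _].
apply/negP; rewrite -leNgt.
have -> : h^-1 *: (g (h *: v + p) - g p) = (g (h *: v + p) - g p) / h by exact: mulrC.
by rewrite ler_pdivrMr// mulNr; exact: hg.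
Qed.

Lemma finite_lower_bound (u : nat -> R) n : (forall i, (i < n)%N -> 0 < u i) ->
  exists2 m, 0 < m & forall i, (i < n)%N -> m <= u i.
Proof.
elim: n => [|n IH] u0; first by exists 1.
have [|m m0 hm] := IH; first by move=> i ni; apply: u0; exact: ltnW.
exists (Num.min m (u n)); first by rewrite lt_min m0 u0.
move=> i; rewrite ltnS leq_eqVlt => /orP[/eqP ->|/hm h]; first by rewrite ge_min lexx orbT.
by rewrite ge_min h.
Qed.

Section construction.
Variables (N : nat) (z q : nat -> R).
Hypothesis N1 : (1 < N)%N.
Hypothesis hz : forall i, (i < N)%N -> z i < z i.+1.
Hypothesis q0 : q 0 = 0.
Hypothesis qN : q N = 0.
Hypothesis qpos : forall i, (0 < i < N)%N -> 0 < q i.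

Local Notation kap := (total_slope N z q).
Local Notation slope := (slope z q).
Local Notation Q := (profile N z q).

Let N0 : (0 < N)%N := ltnW N1.

Lemma find_cell y : z 0 <= y <= z N -> exists2 i, (i < N)%N & z i <= y <= z i.+1.
Proof.
move=> /andP[y0 yN].
have : forall n, (n <= N)%N -> y <= z n -> (0 < n)%N -> exists2 i, (i < n)%N & z i <= y <= z i.+1.
  elim=> [//|n IH] nN yn _; have [h|h] := leP (z n) y; first by exists n; rewrite ?h.
  case: n IH nN yn h => [|n] IH nN yn h; first by move: h; rewrite ltNge y0.
  have [i ni yi] := IH (ltnW nN) (ltW h) isT; exists i => //; exact: ltnW.
by apply.
Qed.

Lemma slope_first : 0 < slope 0.
Proof. by rewrite divr_gt0 ?subr_gt0 ?hz// q0 qpos. Qed.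

Lemma slope_last : slope N.-1 < 0.
Proof.
have NK : N.-1.+1 = N by rewrite prednK.
rewrite /slope NK qN sub0r mulNr oppr_lt0 divr_gt0//; last first.
  by rewrite subr_gt0 -{2}NK hz// NK.
by apply: qpos; rewrite prednK// leqnn andbT -ltnS NK.
Qed.

Lemma cell_min i y : (i < N)%N -> z i <= y <= z i.+1 ->
  Num.min (q i) (q i.+1) <= Q 0 y <= Num.max (q i) (q i.+1).
Proof.
move=> iN yi; have /andP[y1 y2] := yi; rewrite (@profile_cell _ _ _ _ hz i)//.
have d0 : 0 < z i.+1 - z i by rewrite subr_gt0 hz.
pose t := (y - z i) / (z i.+1 - z i).
have -> : q i + slope i * (y - z i) = (1 - t) * q i + t * q i.+1.
  rewrite /slope /t; field; exact: lt0r_neq0.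
have t0 : 0 <= t by rewrite divr_ge0 ?(ltW d0)// subr_ge0.
have t1 : 0 <= 1 - t by rewrite subr_ge0 ler_pdivrMr// mul1r lerD2r.
set m := Num.min _ _; set X := Num.max _ _.
have [m1 m2] : m <= q i /\ m <= q i.+1 by rewrite /m !ge_min !lexx orbT.
have [X1 X2] : q i <= X /\ q i.+1 <= X by rewrite /X !le_max !lexx orbT.
have -> : m = (1 - t) * m + t * m by ring.
have -> : X = (1 - t) * X + t * X by ring.
by rewrite !lerD// ler_wpM2l.
Qed.

Lemma cell_first y : z 0 <= y <= z 1 -> Q 0 y = slope 0 * (y - z 0).
Proof. by move=> yi; rewrite (@profile_cell _ _ _ _ hz 0%N)// q0 add0r. Qed.

Lemma cell_last y : z N.-1 <= y <= z N -> Q 0 y = - slope N.-1 * (z N - y).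
Proof.
have NK : N.-1.+1 = N by rewrite prednK.
have jN : (N.-1 < N)%N by rewrite NK.
move=> yi; have yi' : z N.-1 <= y <= z N.-1.+1 by rewrite NK.
rewrite (profile_cell _ _ _ hz N.-1 y q0 jN yi').
have := slopeK _ _ q hz _ jN.
rewrite NK qN => h; have -> : q N.-1 = - (slope N.-1 * (z N - z N.-1)) by rewrite h; ring.
by ring.
Qed.

End construction.
End ProfileSet.

Section SmoothExprClosure.
Context {R : realType}.

Lemma smooth_expr_sum n (u : 'I_n -> R * R -> R) :
  (forall i, smooth_expr (u i)) -> smooth_expr (fun p => \sum_(i < n) u i p).
Proof.
elim: n u => [|n IH] u hu.
  rewrite (_ : (fun p => _) = fun=> 0); first exact: smooth_cst.
  by apply/funext => p; rewrite big_ord0.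
rewrite (_ : (fun p => _) =
    fun p => \sum_(i < n) u (widen_ord (leqnSn n) i) p + u ord_max p).
  by apply: smooth_add => //; exact: IH.
by apply/funext => p; rewrite big_ord_recr.
Qed.

Lemma smooth_expr_abs (eps : R) g : eps != 0 -> smooth_expr g ->
  smooth_expr (fun p => smooth_abs eps (g p)).
Proof.
move=> e0 sg; apply: (smooth_sqrt (fun p => g p ^+ 2 + eps ^+ 2)).
  apply: smooth_add; last exact: smooth_cst.
  exact: smooth_mul.
by move=> p; rewrite ltr_wpDl ?sqr_ge0// exprn_even_gt0.
Qed.

End SmoothExprClosure.

(** * The smooth curve close to a polygonal profile *)

Section ProfileCurve.
Context {R : realType}.
Local Notation H := (@hausdorff1 R).
Implicit Types (p : R * R).
Variables (N : nat) (z q : nat -> R).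
Hypothesis N1 : (1 < N)%N.
Hypothesis hz : forall i, (i < N)%N -> z i < z i.+1.
Hypothesis q0 : q 0 = 0.
Hypothesis qN : q N = 0.
Hypothesis qpos : forall i, (0 < i < N)%N -> 0 < q i.

Local Notation kap := (total_slope N z q).
Local Notation slope := (slope z q).
Local Notation Q := (profile N z q).

(** Scales of the construction: [w] is the height of the zones set aside next to the nodes, [th]
    bounds the two end slopes from below, [mu] bounds the profile from below away from the tips,
    [rho] is the tolerated error in slope, [tau] rounds the tips and [eps] the nodes. They can be
    chosen in the order th, rho, w, mu, tau, eps. *)
Variables (w th mu rho tau eps : R).
Hypotheses (w0 : 0 < w) (wz : forall i, (i < N)%N -> 3 * w <= z i.+1 - z i).
Hypotheses (th0 : 0 < th) (th1 : th <= slope 0) (th2 : th <= - slope N.-1).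
Hypotheses (mu0 : 0 < mu) (muq : forall i, (0 < i < N)%N -> 2 * mu <= q i).
Hypothesis muth : 2 * mu <= th * w.
Hypotheses (rho0 : 0 < rho) (rho1 : rho <= 1).
Hypotheses (tau0 : 0 < tau) (taumu : tau < mu).
Hypothesis taurho : (kap + rho) * (tau / mu) ^+ 2 <= rho / 2.
(** On the curve the profile is at least tau / 2, and its slope is at most [kap]; hence the curve
    stays at distance [w'] from both end heights. *)
Let w' := tau / (2 * kap).
Hypotheses (eps0 : 0 < eps) (epstau : kap * eps <= tau / 2).
Hypotheses (epsrho : kap * (eps / w) <= rho / 2) (epsth : kap * (eps / w') <= th / 2).

Let kap0 : 0 < kap := total_slope_gt0 N z q.
Let N0 : (0 < N)%N := ltnW N1.
Let NK : N.-1.+1 = N. Proof. by rewrite prednK. Qed.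
Let jN : (N.-1 < N)%N. Proof. by rewrite NK. Qed.

Definition curve p := smooth_abs tau p.1 = Q eps p.2.

Lemma th_kap : th <= kap.
Proof. by apply: le_trans th1 (le_trans (ler_norm _) (slope_le _ _ _ _ N0)). Qed.

Lemma w'_gt0 : 0 < w'.
Proof. by rewrite divr_gt0// mulr_gt0. Qed.

Lemma w'_le : w' <= w.
Proof.
rewrite ler_pdivrMr ?mulr_gt0//.
have : th * w <= kap * w by rewrite ler_wpM2r ?(ltW w0) ?th_kap.
move: muth taumu mu0; lra.
Qed.

Lemma profile_close y : Q 0 y - tau / 2 <= Q eps y <= Q 0 y + tau / 2.
Proof.
have := profile_approx N z q eps y (ltW eps0); rewrite ler_norml => /andP[h1 h2].
move: epstau; lra.
Qed.

Lemma curve_ge p : curve p -> tau / 2 <= Q 0 p.2.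
Proof.
move=> cp; have := profile_close p.2; rewrite -cp.
have : tau <= smooth_abs tau p.1.
  rewrite -(@ler_pXn2r _ 2) ?nnegrE ?smooth_abs_ge0 ?(ltW tau0)// smooth_abs_sqr.
  by rewrite lerDr sqr_ge0.
lra.
Qed.

Lemma curve_range p : curve p -> z 0 < p.2 < z N.
Proof.
move=> /curve_ge h; rewrite !ltNge; apply/andP; split; apply/negP => h'.
  by move: h; rewrite (profile_below _ _ _ hz)//; move: tau0; lra.
by move: h; rewrite (profile_above _ _ _ hz)//; move: tau0; lra.
Qed.

Lemma curve_first p : curve p -> p.2 <= z 1 -> z 0 + w' <= p.2.
Proof.
move=> cp p1; have := curve_ge p cp; have /andP[p0 _] := curve_range p cp.
rewrite (cell_first _ _ _ N1 hz q0) ?(ltW p0)// => h.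
have : tau / 2 <= kap * (p.2 - z 0).
  apply: le_trans h _; rewrite ler_wpM2r ?subr_ge0 ?(ltW p0)//.
  exact: le_trans (ler_norm _) (slope_le _ _ _ _ N0).
have -> : tau / 2 = kap * w' by rewrite /w'; field; rewrite gt_eqF.
by rewrite ler_pM2l// lerBrDl.
Qed.

Lemma curve_last p : curve p -> z N.-1 <= p.2 -> p.2 <= z N - w'.
Proof.
move=> cp p1; have := curve_ge p cp; have /andP[_ pN] := curve_range p cp.
rewrite (cell_last _ _ _ N1 hz q0 qN) ?p1 ?(ltW pN)// => h.
have : tau / 2 <= kap * (z N - p.2).
  apply: le_trans h _; rewrite ler_wpM2r ?subr_ge0 ?(ltW pN)//.
  by apply: le_trans (ler_norm _) _; rewrite normrN slope_le.
have -> : tau / 2 = kap * w' by rewrite /w'; field; rewrite gt_eqF.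
by rewrite ler_pM2l//; lra.
Qed.

Lemma profile_thick i y : (i < N)%N -> z i <= y <= z i.+1 ->
  (i = 0%N -> z 0 + w <= y) -> (i.+1 = N -> y <= z N - w) -> 2 * mu <= Q 0 y.
Proof.
move=> iN yi hf hl; have /andP[y1 y2] := yi.
case: i iN yi hf hl y1 y2 => [|i] iN yi hf hl y1 y2.
  rewrite (cell_first _ _ _ N1 hz q0)//; apply: le_trans muth _.
  by apply: ler_pM; rewrite ?(ltW th0) ?(ltW w0)//; move: (hf erefl); lra.
have [iN'|iN'] := eqVneq i.+2 N.
  have e : N.-1 = i.+1 by rewrite -iN'.
  rewrite (cell_last _ _ _ N1 hz q0 qN); last by rewrite e y1/= -iN'.
  apply: le_trans muth _; apply: ler_pM; rewrite ?(ltW th0) ?(ltW w0)//.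
  by move: (hl iN'); lra.
have /andP[h _] := cell_min _ _ _ hz q0 _ _ iN yi; apply: le_trans h.
rewrite le_min !muq//=.
by rewrite ltn_neqAle iN' iN.
Qed.

Lemma profile_thick_eps i y : (i < N)%N -> z i <= y <= z i.+1 ->
  (i = 0%N -> z 0 + w <= y) -> (i.+1 = N -> y <= z N - w) -> mu <= Q eps y.
Proof.
move=> iN yi hf hl; have := profile_thick i y iN yi hf hl; have := profile_close y.
move: taumu mu0; lra.
Qed.

Lemma tip_slope i y y' : (i < N)%N -> th <= `|slope i| ->
  z i + w' <= y <= z i.+1 - w' -> z i + w' <= y' <= z i.+1 - w' ->
  th / 2 * `|y - y'| <= `|Q eps y - Q eps y'|.
Proof.
move=> iN thi yi yi'.
have h := profile_slope N z q hz eps w' i y y' iN (ltW eps0) w'_gt0 yi yi'.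
have h1 : kap * (eps / w' * `|y - y'|) <= th / 2 * `|y - y'|.
  by rewrite mulrA ler_wpM2r.
have h2 : th * `|y - y'| <= `|slope i * (y - y')| by rewrite normrM ler_wpM2r.
have h3 : `|slope i * (y - y')| <= `|Q eps y - Q eps y'| + `|Q eps y - Q eps y' - slope i * (y - y')|.
  rewrite -{1}[slope i * (y - y')](subKr (Q eps y - Q eps y')).
  exact: ler_normB.
have h4 := le_trans h h1; have h5 := le_trans h2 h3.
move: h4 h5; move: `|_ - slope i * _| `|Q eps y - _| `|y - y'| => a b c h4 h5.
have -> : th / 2 * c = th * c - th / 2 * c by field.
lra.
Qed.

(** One half of [rho] is spent on the smoothing of the nodes; the other half absorbs the factor lost
    in [profile_slab_length]. *)
Lemma slab_factor k : 0 <= k -> k <= kap ->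
  (k + rho / 2) / (1 - (tau / mu) ^+ 2) <= k + rho.
Proof.
move=> k0 kk.
have eta1 : 0 < 1 - (tau / mu) ^+ 2.
  by rewrite subr_gt0 exprn_ilt1 ?divr_ge0 ?(ltW mu0) ?(ltW tau0)// ltr_pdivrMr// mul1r.
rewrite ler_pdivrMr// mulrBr mulr1.
have : (k + rho) * (tau / mu) ^+ 2 <= (kap + rho) * (tau / mu) ^+ 2.
  by rewrite ler_wpM2r ?sqr_ge0// lerD2r.
move: taurho; lra.
Qed.

Definition slab s s' : set (R * R) := [set p | curve p /\ s <= p.2 <= s'].

(** [c1] bounds the length of one branch per unit of height next to an inner node, [c2] the length
    per unit of width near a tip. *)
Let c1 := Num.sqrt (1 + (kap + 1) ^+ 2).
Let c2 := Num.sqrt (1 + (th / 2)^-1 ^+ 2).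

Lemma slab_length i s s' k : (i < N)%N -> s <= s' -> z i <= s -> s' <= z i.+1 ->
  (i = 0%N -> z 0 + w <= s) -> (i.+1 = N -> s' <= z N - w) -> 0 <= k -> k <= kap ->
  (forall y y', s <= y <= s' -> s <= y' <= s' -> `|Q eps y - Q eps y'| <= (k + rho / 2) * `|y - y'|) ->
  (H (slab s s') <= (2 * (Num.sqrt (1 + (k + rho) ^+ 2) * (s' - s)))%:E)%E.
Proof.
move=> iN ss' zs zs' hf hl k0 kk lip.
apply: le_trans (profile_slab_length _ (Q eps) s s' tau mu (k + rho / 2) ss' _ (ltW tau0) mu0 taumu _ _) _.
- by rewrite addr_ge0// divr_ge0// ltW.
- move=> p [cp /andP[p1 p2]]; split; [by rewrite p1| |by []].
  apply: (profile_thick_eps i) => //.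
  + by rewrite (le_trans zs p1) (le_trans p2 zs').
  + by move=> i0; exact: le_trans (hf i0) p1.
  + by move=> i0; exact: le_trans p2 (hl i0).
- by move=> p p' [_ h] [_ h']; exact: lip.
have sf := slab_factor k k0 kk.
have eta1 : 0 < 1 - (tau / mu) ^+ 2.
  by rewrite subr_gt0 exprn_ilt1 ?divr_ge0 ?(ltW mu0) ?(ltW tau0)// ltr_pdivrMr// mul1r.
rewrite lee_fin ler_wpM2l// ler_wpM2r ?subr_ge0// ler_wsqrtr// lerD2l.
have r2 : 0 <= rho / 2 by rewrite divr_ge0// ltW.
by rewrite ler_pXn2r ?nnegrE ?(addr_ge0 k0 (ltW rho0))// divr_ge0 ?(ltW eta1)// addr_ge0.
Qed.

Lemma node_length i s : (i < N)%N -> z i <= s -> s + w <= z i.+1 ->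
  (i = 0%N -> z 0 + w <= s) -> (i.+1 = N -> s + w <= z N - w) ->
  (H (slab s (s + w)%R) <= (2 * (c1 * w))%:E)%E.
Proof.
move=> iN zs zs' hf hl.
have ss : s <= s + w by rewrite lerDl ltW.
apply: le_trans (slab_length i s (s + w) kap iN ss zs zs' hf hl (ltW kap0) (lexx _) _) _.
  move=> y y' _ _; apply: le_trans (profile_lip N z q eps y y') _.
  by rewrite ler_wpM2r// lerDl divr_ge0// ltW.
have sK : s + w - s = w by ring.
rewrite lee_fin sK ler_wpM2l// ler_wpM2r ?(ltW w0)// ler_wsqrtr// lerD2l.
have k1 : 0 <= kap + rho by rewrite addr_ge0// ltW.
have k2 : kap + rho <= kap + 1 by rewrite lerD2l.
by rewrite ler_pXn2r ?nnegrE// (le_trans k1).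
Qed.

Lemma tip_length i s : (i < N)%N -> th <= `|slope i| ->
  z i <= s -> s + w <= z i.+1 ->
  (forall p, curve p -> s <= p.2 <= s + w ->
     z i + w' <= p.2 <= z i.+1 - w' /\ Q 0 p.2 <= kap * w) ->
  (H (slab s (s + w)%R) <= (c2 * (4 * kap * w))%:E)%E.
Proof.
move=> iN thi zs zs' hs.
have X0 : 0 <= 2 * kap * w by rewrite !mulr_ge0 ?(ltW kap0) ?(ltW w0).
have th20 : 0 < th / 2 by rewrite divr_gt0.
have -> : 4 * kap * w = 2 * (2 * kap * w) by ring.
apply: (profile_tip_length _ (Q eps) tau _ _ X0 th20).
  move=> p [cp ps]; have [_ hq] := hs p cp ps; split=> //.
  apply: le_trans (smooth_abs_ge tau p.1) _; rewrite cp.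
  have := profile_close p.2.
  have : th * w <= kap * w by rewrite ler_wpM2r ?(ltW w0) ?th_kap.
  move: muth taumu mu0; lra.
move=> p p' [cp ps] [cp' ps']; apply: (tip_slope i) => //.
  by have [] := hs p cp ps.
by have [] := hs p' cp' ps'.
Qed.

(** In the middle of the cell the curve follows the straight edge up to [rho]. The two end zones of
    height [w] contribute O(w): by the Lipschitz bound next to an inner node, and by the
    parametrisation in x at a tip. *)
Lemma cell_length i : (i < N)%N ->
  (H (slab (z i) (z i.+1)) <= (2 * Num.sqrt ((z i.+1 - z i) ^+ 2 + (q i.+1 - q i) ^+ 2) +
     2 * (z i.+1 - z i) * rho + 2 * (2 * (c1 * w) + c2 * (4 * kap * w)))%:E)%E.
Proof.
move=> iN; have wi := wz i iN; have kap00 := ltW kap0; have w00 := ltW w0.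
pose S := slab.
have c10 : 0 <= c1 by exact: sqrtr_ge0. have c20 : 0 <= c2 by exact: sqrtr_ge0.
have n0 : 0 <= 2 * (c1 * w) by rewrite !mulr_ge0.
have t0 : 0 <= c2 * (4 * kap * w) by rewrite !mulr_ge0.
have w'w := w'_le; have w'0 := w'_gt0; have thw := ler_wpM2r w00 th_kap.
have L : (H (S (z i) (z i + w)%R) <= (2 * (c1 * w) + c2 * (4 * kap * w))%:E)%E.
  have [i0|i0] := eqVneq i 0%N.
    apply: (@le_trans _ _ (c2 * (4 * kap * w))%:E); last by rewrite lee_fin lerDr.
    apply: tip_length iN _ _ _ _ => //.
    - by rewrite i0; exact: le_trans th1 (ler_norm _).
    - lra.
    - move=> p cp /andP[p1 p2]; rewrite i0 in wi p1 p2 *.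
      have h1 : p.2 <= z 1 by lra.
      split; first by rewrite (curve_first p cp h1)/=; lra.
      rewrite (cell_first _ _ _ N1 hz q0) ?p1//.
      apply: ler_pM; rewrite ?subr_ge0//; last by lra.
        by apply: le_trans th1; exact: ltW.
      exact: le_trans (ler_norm _) (slope_le _ _ _ _ N0).
  apply: (@le_trans _ _ (2 * (c1 * w))%:E); last by rewrite lee_fin lerDl.
  apply: node_length iN _ _ _ _ => //; first by lra.
    by move=> h; rewrite h eqxx in i0.
  by move=> <-; lra.
have Rt : (H (S (z i.+1 - w)%R (z i.+1 - w + w)%R) <= (2 * (c1 * w) + c2 * (4 * kap * w))%:E)%E.
  have [iL|iL] := eqVneq i.+1 N.
    have iE : i = N.-1 by rewrite -iL.
    apply: (@le_trans _ _ (c2 * (4 * kap * w))%:E); last by rewrite lee_fin lerDr.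
    apply: tip_length iN _ _ _ _ => //.
    - by rewrite iE; apply: le_trans th2 _; rewrite -normrN ler_norm.
    - lra.
    - lra.
    - move=> p cp /andP[p1 p2]; rewrite iL in wi p1 p2 *.
      have h1 : z N.-1 <= p.2 by rewrite -iE; lra.
      have h2 : p.2 <= z N by lra.
      split; first by rewrite (curve_last p cp h1) andbT; lra.
      rewrite (cell_last _ _ _ N1 hz q0 qN) ?h1//.
      apply: ler_pM; rewrite ?subr_ge0//; last by lra.
        by apply: le_trans th2; exact: ltW.
      by apply: le_trans (ler_norm _) _; rewrite normrN slope_le.
  apply: (@le_trans _ _ (2 * (c1 * w))%:E); last by rewrite lee_fin lerDl.
  apply: node_length iN _ _ _ _ => //; first by lra.
  - by rewrite subrK.
  - by move=> <-; lra.
  - by move=> h; rewrite h eqxx in iL.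
have M : (H (S (z i + w)%R (z i.+1 - w)%R) <= (2 * Num.sqrt ((z i.+1 - z i) ^+ 2 + (q i.+1 - q i) ^+ 2) +
     2 * (z i.+1 - z i) * rho)%:E)%E.
  apply: le_trans (slab_length i (z i + w) (z i.+1 - w) `|slope i| iN _ _ _ _ _ _ _ _) _ => //.
  - lra.
  - lra.
  - lra.
  - by move=> <-.
  - by move=> <-.
  - exact: slope_le.
  - move=> y y' hy hy'.
    have h := profile_slope N z q hz eps w i y y' iN (ltW eps0) w0 hy hy'.
    have -> : Q eps y - Q eps y' = slope i * (y - y') + (Q eps y - Q eps y' - slope i * (y - y')) by ring.
    apply: le_trans (ler_normD _ _) _; rewrite normrM mulrDl lerD2l.
    by apply: le_trans h _; rewrite mulrA ler_wpM2r.
  set D := z i.+1 - z i; have D0 : 0 < D by rewrite subr_gt0 hz.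
  have D00 := ltW D0.
  have e : Num.sqrt (D ^+ 2 + (q i.+1 - q i) ^+ 2) = D * Num.sqrt (1 + slope i ^+ 2).
    rewrite -{2}[D]gtr0_norm// -sqrtr_sqr -sqrtrM ?sqr_ge0// mulrDr mulr1 -exprMn mulrC.
    by rewrite (slopeK N z q hz).
  rewrite lee_fin e.
  (* The function sqrt(1 + d^2) is [smooth_abs 1], hence 1-Lipschitz in d. *)
  have h1 : Num.sqrt (1 + (`|slope i| + rho) ^+ 2) <= Num.sqrt (1 + slope i ^+ 2) + rho.
    have := smooth_abs_lip 1 (`|slope i| + rho) `|slope i|.
    rewrite /smooth_abs expr1n addrAC subrr add0r (gtr0_norm rho0) real_normK ?num_real//.
    by rewrite ![_ + 1]addrC ler_norml => /andP[_]; rewrite lerBlDl.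
  have h2 : Num.sqrt (1 + (`|slope i| + rho) ^+ 2) * (z i.+1 - w - (z i + w)) <=
      (Num.sqrt (1 + slope i ^+ 2) + rho) * D.
    apply: ler_pM => //; rewrite ?sqrtr_ge0// /D; lra.
  apply: le_trans (ler_wpM2l _ h2) _ => //.
  by rewrite mulrDl [_ * D]mulrC; lra.
apply: (@le_trans _ _ (H ((S (z i) (z i + w)%R `|` S (z i.+1 - w)%R (z i.+1 - w + w)%R) `|` S (z i + w)%R (z i.+1 - w)%R))).
  apply: le_outer_measure => p [cp /andP[p1 p2]].
  have [h1|h1] := leP p.2 (z i + w); first by left; left; split=> //; rewrite p1.
  have [h2|h2] := leP p.2 (z i.+1 - w); first by right; split=> //; rewrite (ltW h1).
  by left; right; split=> //; rewrite (ltW h2) subrK.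
have U A B : (H (A `|` B) <= H A + H B)%E by exact: outer_measureU2.
set X := 2 * (c1 * w) + _ in L Rt *; set Y := 2 * Num.sqrt _ + _ * rho in M *.
have -> : Y + 2 * X = (X + X) + Y by ring.
rewrite !EFinD; apply: (le_trans (U _ _)); apply: leeD => //.
by apply: (le_trans (U _ _)); exact: leeD.
Qed.

Definition hump p := smooth_abs tau p.1 - Q eps p.2.

Definition tent : set (R * R) := [set p | hump p < 0].

Definition half_width y := if tau < Q eps y then Num.sqrt (Q eps y ^+ 2 - tau ^+ 2) else 0.

Lemma hump_expr : smooth_expr hump.
Proof.
have tauN : tau != 0 by rewrite gt_eqF. have epsN : eps != 0 by rewrite gt_eqF.
apply: (smooth_add (fun p => smooth_abs tau p.1) (fun p => - Q eps p.2)).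
  exact: (smooth_expr_abs _ _ tauN smooth_fst).
rewrite (_ : (fun p => - _) = fun p => (-1) * Q eps p.2); last first.
  by apply/funext => p; rewrite mulN1r.
apply: smooth_mul; first exact: smooth_cst.
apply: smooth_expr_sum => i; apply: smooth_mul; first exact: smooth_cst.
have h c : smooth_expr (fun p : R * R => smooth_abs eps (p.2 - c)).
  apply: (smooth_expr_abs _ (fun p : R * R => p.2 - c)) => //.
  by apply: smooth_add; [exact: smooth_snd|exact: smooth_cst].
apply: smooth_mul; last exact: smooth_cst.
apply: smooth_add; last exact: smooth_cst.
apply: (smooth_add _ (fun p : R * R => - smooth_abs eps (p.2 - z i.+1))) => //.
rewrite (_ : (fun p => - _) = fun p : R * R => (-1) * smooth_abs eps (p.2 - z i.+1)); last first.
  by apply/funext => p; rewrite mulN1r.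
by apply: smooth_mul => //; exact: smooth_cst.
Qed.

(** These are the heights at which the curve meets the axis. Outside the two end zones the profile
    is too large, since [mu] exceeds [tau]. *)
Lemma thin_tip y : Q eps y = tau -> (y <= z 0 + w /\ z 0 + w' <= y) \/ (z N - w <= y /\ y <= z N - w').
Proof.
move=> Qy; have cp : curve (0, y) by rewrite /curve/= Qy /smooth_abs expr0n add0r sqrtr_sqr gtr0_norm.
have /andP[y0 yN] := curve_range _ cp.
have [|i iN yi] := find_cell N z N1 y; first by rewrite !ltW.
have [h|h] := ltP (Q 0 y) (2 * mu); last first.
  by have /andP[] := profile_close y; rewrite Qy; move: taumu mu0 h tau0; lra.
have /andP[yi1 yi2] := yi.
have [[i0 yw]|hf] := pselect (i = 0%N /\ y <= z 0 + w).
  left; split=> //; apply: (curve_first _ cp); rewrite /=; move: yi2; by rewrite i0.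
have [[i0 yw]|hl] := pselect (i.+1 = N /\ z N - w <= y).
  by right; split=> //; apply: (curve_last _ cp); rewrite /= -i0.
suff : 2 * mu <= Q 0 y by rewrite leNgt h.
apply: (profile_thick i y iN yi) => [i0|i0]; rewrite leNgt; apply/negP => hh.
  by apply: hf; split=> //; exact: ltW.
by apply: hl; split=> //; exact: ltW.
Qed.

(** The gradient does not vanish on the curve: off the axis, moving towards the axis decreases
    [hump]; on the axis one is at a tip, and moving into the set decreases it because the end slopes
    are at least [th]. *)
Lemma hump_stretch_smooth a : 0 < a -> smooth_set (stretch a @^-1` tent).
Proof.
move=> a0; have se := smooth_expr_stretch hump a hump_expr.
apply: (sublevel_smooth _ se) => -[x y] /eqP; rewrite subr_eq0 /= => /eqP gp.
have dg := smooth_expr_differentiable _ se (x, y).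
have [x0|x0] := eqVneq x 0; last first.
  have ax : 0 < (a * x) ^+ 2 by rewrite exprn_even_gt0//= mulf_neq0// gt_eqF.
  have sx : 0 < smooth_abs tau (a * x).
    apply: lt_le_trans (smooth_abs_ge _ _); by rewrite normr_gt0 mulf_neq0// gt_eqF.
  exists (- x, 0); apply: (derive_neq0 _ _ _ ((a * x) ^+ 2 / (2 * smooth_abs tau (a * x))) 1) => //.
    by rewrite divr_gt0// mulr_gt0.
  move=> h h0 h1; rewrite /hump /= scaler0 add0r.
  have -> : a * (h *: - x + x) = (1 - h) * (a * x) by rewrite /GRing.scale/=; ring.
  have hh : smooth_abs tau ((1 - h) * (a * x)) <= smooth_abs tau (a * x).
    rewrite -(@ler_pXn2r _ 2) ?nnegrE ?smooth_abs_ge0// !smooth_abs_sqr lerD2r exprMn.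
    rewrite ler_piMl ?(ltW ax)// exprn_ile1//; lra.
  have e : (smooth_abs tau ((1 - h) * (a * x)) - smooth_abs tau (a * x)) *
      (smooth_abs tau ((1 - h) * (a * x)) + smooth_abs tau (a * x)) = - (2 * h - h ^+ 2) * (a * x) ^+ 2.
    by rewrite -subr_sqr !smooth_abs_sqr; ring.
  have s1 := smooth_abs_ge0 tau ((1 - h) * (a * x)).
  set u := smooth_abs tau (a * x) in sx hh e *; set u' := smooth_abs tau ((1 - h) * (a * x)) in hh e s1 *.
  have -> : u' - Q eps y - (u - Q eps y) = u' - u by ring.
  have su : 0 < u' + u by rewrite ltr_wpDl.
  set X := (a * x) ^+ 2 in ax e *.
  rewrite -(ler_pM2r su) e mulNr mulNr lerN2.
  apply: (@le_trans _ _ (X * h)).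
    rewrite (_ : X / (2 * u) * h * (u' + u) = X * h * ((u' + u) / (2 * u))); last by field; rewrite gt_eqF.
    have Xh : 0 <= X * h by rewrite mulr_ge0// ltW.
    have u2 : 0 < 2 * u by rewrite mulr_gt0.
    apply: ler_piMr => //; rewrite ler_pdivrMr//; lra.
  have hh' : h <= 2 * h - h ^+ 2.
    have : h * h <= h * 1 by rewrite ler_wpM2l// ltW.
    rewrite expr2; lra.
  by rewrite mulrC ler_wpM2r// ltW.
have Qy : Q eps y = tau by rewrite -gp x0 mulr0 /smooth_abs expr0n add0r sqrtr_sqr gtr0_norm.
have w'0 := w'_gt0; have w'w := w'_le; have epsk h : kap * (eps / w' * h) = kap * (eps / w') * h by rewrite mulrA.
(* A displacement [d] within the cell changes the profile by the slope times [d], up to an error of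
   half the guaranteed slope. *)
have key i h d : (i < N)%N -> `|d| = h -> z i + w' <= y <= z i.+1 - w' -> z i + w' <= d + y <= z i.+1 - w' ->
    Q eps (d + y) - Q eps y >= slope i * d - th / 2 * h.
  move=> iN dh yi yi'; have := profile_slope N z q hz eps w' i _ _ iN (ltW eps0) w'0 yi' yi.
  rewrite addrK dh epsk ler_norml => /andP[h1 _].
  have : kap * (eps / w') * h <= th / 2 * h by rewrite ler_wpM2r// -dh.
  lra.
have [[y1 y2]|[y1 y2]] := thin_tip y Qy.
  have wi := wz 0 N0.
  exists (0, 1); apply: (derive_neq0 _ _ _ (th / 2) w) => //; first by rewrite divr_gt0.
  move=> h h0 hw; rewrite /hump /= scaler0 add0r.
  have -> : h *: (1 : R) = h by rewrite /GRing.scale/= mulr1.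
  have := key 0%N h h N0 (gtr0_norm h0).
  have : th * h <= slope 0 * h by rewrite ler_wpM2r// ltW.
  have -> : th / 2 * h = th * h - th / 2 * h by field.
  move=> h1 h2; have := h2 _ _; lra.
have wi := wz _ jN; rewrite NK in wi.
exists (0, - 1); apply: (derive_neq0 _ _ _ (th / 2) w) => //; first by rewrite divr_gt0.
move=> h h0 hw; rewrite /hump /= scaler0 add0r.
have -> : h *: (- 1 : R) = - h by rewrite /GRing.scale/= mulrN1.
have := key N.-1 h (- h) jN; rewrite normrN NK => /(_ (gtr0_norm h0)).
have : th * h <= - slope N.-1 * h by rewrite ler_wpM2r// ltW.
have -> : th / 2 * h = th * h - th / 2 * h by field.
rewrite mulrN mulNr => h1 h2; have := h2 _ _; lra.
Qed.

Lemma hump_slice y : slice tent y = `]- half_width y, half_width y[%classic.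
Proof.
apply/seteqP; split=> x; rewrite /slice /tent /hump /half_width /= in_itv/= subr_lt0 -ltr_norml.
  move=> h; have h0 := smooth_abs_ge0 tau x.
  have tx : tau <= smooth_abs tau x.
    rewrite -(@ler_pXn2r _ 2) ?nnegrE ?h0 ?(ltW tau0)// smooth_abs_sqr lerDr; exact: sqr_ge0.
  rewrite (le_lt_trans tx h) -sqrtr_sqr ltr_sqrt; last first.
    by rewrite subr_gt0 ltr_pXn2r ?nnegrE ?(ltW tau0)// ?(le_lt_trans tx h)// ltW// (le_lt_trans h0).
  by rewrite ltrBrDr -smooth_abs_sqr ltr_pXn2r ?nnegrE// ltW// (le_lt_trans h0).
case: ifPn => [tQ|_]; last by rewrite ltNge normr_ge0.
have Q0 : 0 < Q eps y by exact: lt_trans tQ.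
rewrite -sqrtr_sqr ltr_sqrt; last by rewrite subr_gt0 ltr_pXn2r ?nnegrE ?(ltW tau0) ?(ltW Q0).
by rewrite ltrBrDr -smooth_abs_sqr ltr_pXn2r ?nnegrE ?smooth_abs_ge0// ltW.
Qed.

Lemma half_width_ge0 y : 0 <= half_width y.
Proof. by rewrite /half_width; case: ifP => // _; exact: sqrtr_ge0. Qed.

Lemma half_width_bounds y : Q 0 y - 2 * tau <= half_width y /\ (half_width y = 0 \/ half_width y <= Q 0 y + tau).
Proof.
have /andP[c1' c2'] := profile_close y; rewrite /half_width; case: ifPn => [tQ|]; last first.
  by rewrite -leNgt => h; split; [lra|left].
have Q0 : 0 < Q eps y by exact: lt_trans tQ.
have rad : 0 <= Q eps y ^+ 2 - tau ^+ 2.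
  by rewrite subr_ge0 ler_pXn2r ?nnegrE ?(ltW Q0) ?(ltW tau0)// ltW.
split.
  apply: (@le_trans _ _ (Q eps y - tau)); first by move: tau0; lra.
  rewrite -(@ler_pXn2r _ 2) ?nnegrE ?sqrtr_ge0 ?subr_ge0 ?(ltW tQ)// sqr_sqrtr//.
  rewrite -subr_ge0; have -> : Q eps y ^+ 2 - tau ^+ 2 - (Q eps y - tau) ^+ 2 = 2 * tau * (Q eps y - tau) by ring.
  by rewrite !mulr_ge0 ?subr_ge0 ?ltW.
right; apply: (@le_trans _ _ (Q eps y)); last by move: tau0; lra.
rewrite -(@ler_pXn2r _ 2) ?nnegrE ?sqrtr_ge0 ?(ltW Q0)// sqr_sqrtr//.
by rewrite lerBlDr lerDl sqr_ge0.
Qed.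

Lemma half_width_out y : y <= z 0 \/ z N <= y -> half_width y = 0.
Proof.
move=> h; have Q0 : Q 0 y = 0.
  by case: h => h; [exact: (profile_below _ _ _ hz)|exact: (profile_above _ _ _ hz)].
rewrite /half_width ifF//; apply/negbTE; rewrite -leNgt.
by have := profile_close y; rewrite Q0; move: tau0; lra.
Qed.

Lemma hump_boundary_integral lambda (hlambda : 1 < lambda) (M : nat -> R) : (forall i, 0 <= M i) ->
  (forall i p, (i < N)%N -> z i <= p.2 <= z i.+1 -> strip_density lambda p <= M i) ->
  (boundary_integral (strip_density lambda) tent <=
    (\sum_(i < N) M i * (2 * Num.sqrt ((z i.+1 - z i) ^+ 2 + (q i.+1 - q i) ^+ 2) +
     2 * (z i.+1 - z i) * rho + 2 * (2 * (c1 * w) + c2 * (4 * kap * w))))%:E)%E.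
Proof.
move=> M0 fM; pose B i : set (R * R) := [set p | z i <= p.2 <= z i.+1].
have cg : continuous hump := smooth_expr_smooth _ hump_expr 0%N.
have bc : boundary tent `<=` curve.
  by move=> p /(sublevel_boundary _ cg) /eqP; rewrite subr_eq0 => /eqP.
apply: le_trans (boundary_integral_cover lambda hlambda _ N B M _ M0 _ _) _.
- move=> i; have -> : B i = setT `*` `[z i, z i.+1]%classic.
    by apply/seteqP; split=> p; rewrite /B /= in_itv/=; [split|case].
  by apply: measurableX => //; exact: measurable_itv.
- by move=> i p iN; exact: fM.
- move=> p /bc /curve_range /andP[p0 pN].
  by have [|i iN hi] := find_cell N z N1 p.2; [rewrite !ltW|exists i].
rewrite -sumEFin; apply: lee_sum => i _; rewrite EFinM; apply: lee_wpmul2l; first by rewrite lee_fin.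
apply: le_trans (cell_length i (ltn_ord i)); apply: le_outer_measure => p [bp hp]; split=> //.
exact: bc.
Qed.

End ProfileCurve.

(** * Choice of the smoothing parameters *)

Section ProfileSmoothSet.
Context {R : realType}.
Variable lambda : R.
Hypothesis hlambda : 1 < lambda.
Local Notation f := (strip_density lambda).
Implicit Types (p : R * R).

Lemma exists_min2 (a b : R) : 0 < a -> 0 < b -> exists c, [/\ 0 < c, c <= a & c <= b].
Proof.
move=> a0 b0; exists (Num.min a b); split; first by rewrite lt_min a0.
  by rewrite ge_min lexx.
by rewrite ge_min lexx orbT.
Qed.

Lemma exists_small (C b : R) : 0 <= C -> 0 < b -> exists2 c, 0 < c & C * c <= b.
Proof.
move=> C0 b0; have C1 : 0 < C + 1 by rewrite ltr_wpDl.
exists (b / (C + 1)); first exact: divr_gt0.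
rewrite mulrCA ler_piMr ?(ltW b0)// ler_pdivrMr// mul1r lerDl ler01//.
Qed.

(** The length error is kept below [e'] in every cell, where [e'] is [e] divided by one plus the sum
    of the weights [M]. *)
Lemma profile_smooth_set N (z q M : nat -> R) (e : R) : (1 < N)%N ->
  (forall i, (i < N)%N -> z i < z i.+1) -> q 0 = 0 -> q N = 0 ->
  (forall i, (0 < i < N)%N -> 0 < q i) -> (forall i, 0 <= M i) ->
  (forall i p, (i < N)%N -> z i <= p.2 <= z i.+1 -> f p <= M i) -> 0 < e ->
  exists (G : set (R * R)) (W : R -> R),
  [/\ forall a, 0 < a -> smooth_set (stretch a @^-1` G),
      (boundary_integral f G <=
        (\sum_(i < N) M i * (2 * Num.sqrt ((z i.+1 - z i) ^+ 2 + (q i.+1 - q i) ^+ 2)) + e)%:E)%E,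
      forall y, slice G y = `]- W y, W y[%classic /\ 0 <= W y,
      forall y, y <= z 0 \/ z N <= y -> W y = 0 &
      forall i y, (i < N)%N -> z i <= y <= z i.+1 ->
        Num.min (q i) (q i.+1) - e <= W y <= Num.max (q i) (q i.+1) + e].
Proof.
move=> N1 hz q0 qN qpos M0 fM e0; have N0 : (0 < N)%N := ltnW N1.
have [D D0 hD] : exists2 D, 0 < D & forall i, (i < N)%N -> D <= z i.+1 - z i.
  by apply: finite_lower_bound => i iN; rewrite subr_gt0 hz.
have [m m0 hm] : exists2 m, 0 < m & forall i, (0 < i < N)%N -> m <= q i.
  have [|m m0 hm] := finite_lower_bound (fun i => if i == 0%N then 1 else q i) N.
    by case=> // i iN; rewrite /= qpos.
  by exists m => // -[//|i] /andP[_ iN]; exact: hm _ iN.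
have sf := slope_first _ _ _ N1 hz q0 qpos; have sl := slope_last _ _ _ N1 hz qN qpos.
have [th [th0 th1 th2]] : exists th, [/\ 0 < th, th <= slope z q 0 & th <= - slope z q N.-1].
  by apply: exists_min2; rewrite ?oppr_gt0.
set kap := total_slope N z q; have kap0 : 0 < kap := total_slope_gt0 N z q.
have kap00 := ltW kap0.
pose SM := \sum_(i < N) M i + 1.
have SM0 : 0 < SM by rewrite ltr_wpDl// sumr_ge0.
pose e' := e / SM; have e'0 : 0 < e' by exact: divr_gt0.
pose ZL := 2 * (z N - z 0).
have hZ i : (i < N)%N -> z i.+1 - z i <= z N - z 0.
  move=> iN; apply: lerB; first by apply: (node_le N z hz); rewrite iN/=.
  by apply: (node_le N z hz); rewrite /= ltnW.
have ZL0 : 0 <= ZL by rewrite mulr_ge0// subr_ge0 (node_le N z hz)/=.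
have e'2 : 0 < e' / 2 by exact: divr_gt0.
have [rho' rho'0 hrho'] := exists_small ZL (e' / 2) ZL0 e'2.
have [rho [rho0 rho1 rhole]] := exists_min2 1 rho' ltr01 rho'0.
pose c1 := Num.sqrt (1 + (kap + 1) ^+ 2).
pose c2 := Num.sqrt (1 + (th / 2)^-1 ^+ 2).
(* The coefficient of [w] in the bound of [cell_length]. *)
pose C := 2 * (2 * c1 + c2 * (4 * kap)).
have C0 : 0 <= C.
  have c10 : 0 <= c1 by exact: sqrtr_ge0. have c20 : 0 <= c2 by exact: sqrtr_ge0.
  by rewrite mulr_ge0// addr_ge0// mulr_ge0// mulr_ge0.
have [w1 w10 hw1] := exists_small C (e' / 2) C0 e'2.
have [w [w0 ww1 wD]] : exists w, [/\ 0 < w, w <= w1 & w <= D / 3] by apply: exists_min2 => //; exact: divr_gt0.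
have [mu [mu0 mum muw]] : exists mu, [/\ 0 < mu, mu <= m / 2 & mu <= th * w / 2].
  by apply: exists_min2; rewrite divr_gt0// mulr_gt0.
have [s1 s10 hs1] := exists_small (kap + rho) (rho / 2) (addr_ge0 kap00 (ltW rho0)) (divr_gt0 rho0 (ltr0n _ 2)).
have [s [s0 ss1 s2]] : exists s, [/\ 0 < s, s <= s1 & s <= 1 / 2] by apply: exists_min2; rewrite ?divr_gt0.
have [tau [tau0 taue taus]] : exists tau, [/\ 0 < tau, tau <= e / 2 & tau <= mu * s].
  by apply: exists_min2; rewrite ?divr_gt0 ?mulr_gt0.
have taumu : tau < mu.
  by apply: le_lt_trans taus _; rewrite gtr_pMr//; lra.
have w'0 : 0 < tau / (2 * kap) by rewrite divr_gt0// mulr_gt0.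
have rw0 : 0 < rho / 2 * w by rewrite mulr_gt0// divr_gt0.
have tw0 : 0 < th / 2 * (tau / (2 * kap)) by rewrite mulr_gt0// divr_gt0.
have [b1 [b10 b1t b1r]] := exists_min2 (tau / 2) (rho / 2 * w) (divr_gt0 tau0 (ltr0n _ 2)) rw0.
have [b2 [b20 b2b b2t]] := exists_min2 b1 (th / 2 * (tau / (2 * kap))) b10 tw0.
have [eps eps0 heps] := exists_small kap b2 kap00 b20.
have tau_rho : (kap + rho) * (tau / mu) ^+ 2 <= rho / 2.
  have kr : 0 <= kap + rho by rewrite addr_ge0// ltW.
  apply: le_trans hs1; apply: ler_wpM2l => //; apply: le_trans ss1.
  have ts : tau / mu <= s by rewrite ler_pdivrMr// mulrC.
  have tm0 : 0 <= tau / mu by rewrite divr_ge0// ltW.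
  have tm1 : tau / mu <= 1 by clear -ts s2; lra.
  by apply: le_trans ts; rewrite expr2 ler_piMr.
have wz i : (i < N)%N -> 3 * w <= z i.+1 - z i by move=> /hD; clear -wD; lra.
have muq i : (0 < i < N)%N -> 2 * mu <= q i by move=> /hm; clear -mum; lra.
have muth : 2 * mu <= th * w by clear -muw; lra.
have epstau : kap * eps <= tau / 2 by clear -heps b2b b1t; lra.
have epsrho : kap * (eps / w) <= rho / 2 by rewrite mulrA ler_pdivrMr//; clear -heps b2b b1r; lra.
have epsth : kap * (eps / (tau / (2 * kap))) <= th / 2 by rewrite mulrA ler_pdivrMr//; clear -heps b2t; lra.
exists (tent N z q tau eps), (half_width N z q tau eps); split.
- move=> a a0; apply: (hump_stretch_smooth _ _ _ N1 hz q0 qN w th mu) => //.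
- apply: le_trans (hump_boundary_integral N z q N1 hz q0 qN w th mu rho tau eps
    w0 wz th0 th1 th2 mu0 muq muth rho0 rho1 tau0 taumu tau_rho eps0 epstau epsrho epsth lambda hlambda M M0 fM) _.
  rewrite lee_fin; apply: (@le_trans _ _ (\sum_(i < N) (M i * (2 * Num.sqrt ((z i.+1 - z i) ^+ 2 + (q i.+1 - q i) ^+ 2)) + M i * e'))).
    apply: ler_sum => i _; rewrite -mulrDr ler_wpM2l// -addrA lerD2l.
    have -> : 2 * (2 * (c1 * w) + c2 * (4 * kap * w)) = C * w by rewrite /C; ring.
    have h1 : C * w <= e' / 2 by apply: le_trans hw1; rewrite ler_wpM2l.
    have h2 : 2 * (z i.+1 - z i) * rho <= e' / 2.
      apply: le_trans hrho'; apply: ler_pM; rewrite ?(ltW rho0)//.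
        by rewrite mulr_ge0// subr_ge0 ltW// hz.
      by rewrite ler_wpM2l// hZ.
    by clear -h1 h2; lra.
  rewrite big_split/= lerD2l -mulr_suml /e' mulrCA ler_piMr ?(ltW e0)// ler_pdivrMr// mul1r.
  by rewrite lerDl.
- move=> y; split; last exact: half_width_ge0.
  by apply: hump_slice.
- exact: (half_width_out _ _ _ hz q0 qN tau eps).
- move=> i y iN yi; have /andP[h1 h2] := cell_min _ _ _ hz q0 _ _ iN yi.
  have qi0 j : (j <= N)%N -> 0 <= q j.
    case: j => [|j] jN; first by rewrite q0.
    move: jN; rewrite leq_eqVlt => /orP[/eqP ->|jN]; first by rewrite qN.
    by rewrite ltW// qpos.
  have mx : 0 <= Num.max (q i) (q i.+1) by rewrite le_max qi0// ltnW.
  have [h3 h4] := half_width_bounds N z q tau eps tau0 eps0 epstau y.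
  by clear -h1 h2 h3 h4 mx taue tau0 e0; apply/andP; split; [lra|case: h4 => h4; lra].
Qed.

End ProfileSmoothSet.

(** * Polygons *)

Section Polygons.
Context {R : realType}.
Variable lambda : R.
Hypothesis hlambda : 1 < lambda.
Local Notation leb := (@lebesgue_measure R).
Local Notation RT := (measurableTypeR R).
Local Notation f := (strip_density lambda).
Local Notation psi := (fiber_density lambda).
Implicit Types (p : R * R) (G : set (R * R)).

(** Induction on the length: if [q] vanishes strictly inside, one of the two parts has a positive
    sum. A run of a single cell has two zero ends and thus no positive sum. *)
Lemma find_run (g q : nat -> R) :
  (forall i, q i = 0 -> q i.+1 = 0 -> g i <= 0) -> (forall i, 0 <= q i) ->
  forall n a, q a = 0 -> q (a + n)%N = 0 -> 0 < \sum_(a <= i < a + n) g i ->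
  exists b k, [/\ (a <= b)%N, (b + k <= a + n)%N, (1 < k)%N &
    [/\ q b = 0, q (b + k)%N = 0, forall i, (0 < i < k)%N -> 0 < q (b + i)%N &
        0 < \sum_(b <= i < b + k) g i]].
Proof.
move=> g0 q0 n; elim/ltn_ind: n => n IH a qa qan gpos.
have [/existsP[k /andP[k0 /eqP qk]]|/existsPn nk] :=
    boolP [exists k : 'I_n, (0 < k)%N && (q (a + k)%N == 0)]; last first.
  have n1 : (1 < n)%N.
    case: n IH qan gpos nk => [|[|n]]//= _ qan gpos _.
      by move: gpos; rewrite addn0 big_geq ?ltxx.
    by move: gpos; rewrite addn1 big_nat1 ltNge g0// -addn1.
  exists a, n; split=> //; split=> // i /andP[i0 iN]; rewrite lt_neqAle q0 andbT eq_sym.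
  by have := nk (Ordinal iN); rewrite /= i0.
have kn := ltn_ord k.
have akn : (a + n = a + k + (n - k))%N by rewrite -addnA subnKC// ltnW.
move: gpos; rewrite (@big_cat_nat _ _ _ (a + k)%N)/= ?leq_addr ?leq_add2l ?(ltnW kn)// => gpos.
have [s1|s1] := ltP 0 (\sum_(a <= i < a + k) g i).
  have [b [l [h1 h2 h3 h4]]] := IH k kn a qa qk s1.
  exists b, l; split=> //; apply: leq_trans h2 _; by rewrite leq_add2l ltnW.
have s2 : 0 < \sum_(a + k <= i < a + k + (n - k)) g i by rewrite -akn; lra.
have nk' : (n - k < n)%N by rewrite ltn_subrL k0 (leq_trans _ kn).
have [||b [l [h1 h2 h3 h4]]] := IH (n - k)%N nk' (a + k)%N _ _ s2 => //.
  by rewrite -akn.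
exists b, l; split=> //; first by apply: leq_trans h1; rewrite leq_addr.
by rewrite akn.
Qed.

Lemma fiber_density_measurable : measurable_fun setT (psi : RT -> R).
Proof.
apply: measurable_fun_ifT => //.
by apply: measurable_fun_ler => //; exact: measurableT_comp.
Qed.

Lemma volume_slices G : measurable G ->
  (weighted_volume f G = \int[leb]_y ((psi y)%:E * leb (slice G y)))%E.
Proof.
move=> mG; apply: integral_slices => //; first exact: fiber_density_measurable.
by move=> y; exact: (density_ge0 lambda hlambda (0, y)).
Qed.

Lemma volume_intervals G (W : RT -> R) : measurable G ->
  (forall y, slice G y = `]- W y, W y[%classic /\ 0 <= W y) ->
  measurable_fun setT W /\ (weighted_volume f G = \int[leb]_y (psi y * (2 * W y))%:E)%E.
Proof.
move=> mG sG.
have lW y : leb (slice G y) = (2 * W y)%:E.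
  have [-> W0] := sG y; rewrite lebesgue_measure_itv/= lte_fin.
  case: ltP => h; first by rewrite -EFinB; congr _%:E; ring.
  by congr _%:E; lra.
split; last first.
  by rewrite volume_slices//; apply: eq_integral => y _; rewrite lW -EFinM.
rewrite (_ : W = (fun y => 2 * W y / 2)); last by apply/funext => y; field.
apply: measurable_funM => //; apply/measurable_EFinP.
rewrite (_ : EFin \o _ = fun y : RT => leb (slice G y)); first exact: slice_volume_measurable.
by apply/funext => y; rewrite lW.
Qed.

(** The booleans select closed cells, for upper bounds, or open and hence disjoint ones, for lower
    bounds. *)
Lemma step_integral N (z c : nat -> R) b1 b2 :
  (forall i, (i < N)%N -> z i < z i.+1) -> (forall i, 0 <= c i) ->
  (\int[leb]_y (\sum_(i < N) c i * (\1_[set` Interval (BSide b1 (z i)) (BSide b2 (z i.+1))] (y : R) : R))%:E =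
    (\sum_(i < N) c i * (z i.+1 - z i))%:E)%E.
Proof.
move=> hz c0.
pose J i : set RT := [set` Interval (BSide b1 (z i)) (BSide b2 (z i.+1))].
have mJ i : measurable (J i) by exact: measurable_itv.
transitivity (\int[leb]_y \sum_(i < N) (c i * (\1_(J i) y : R))%:E)%E.
  by apply: eq_integral => y _; rewrite sumEFin.
have mi i : measurable_fun setT (fun y : RT => (c i * (\1_(J i) y : R))%:E).
  by apply/measurable_EFinP; apply: measurable_funM => //; exact: measurable_indic.
rewrite ge0_integral_sum//; last first.
  by move=> i y _; rewrite lee_fin mulr_ge0.
rewrite -sumEFin; apply: eq_bigr => i _.
transitivity (\int[leb]_y ((c i)%:E * (\1_(J i) y : R)%:E))%E.
  by apply: eq_integral => y _; rewrite EFinM.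
rewrite ge0_integralZl_EFin//; last first.
  by apply/measurable_EFinP; exact: measurable_indic.
rewrite integral_indic// setIT EFinM; congr (_ * _)%E.
have lJ : leb [set` Interval (BSide b1 (z i)) (BSide b2 (z i.+1))] = (z i.+1 - z i)%:E.
  by rewrite lebesgue_measure_itv/= lte_fin hz.
exact: lJ.
Qed.

(** An upper bound for the density on the closed cell; on a [separated] cell it is also the density
    in the interior, so cost and volume carry the same constant. *)
Definition cell_density (y y' : R) : R := if (-1 <= y) && (y' <= 1) then 1 else lambda.

Definition separated (y y' : R) := [|| (-1 <= y) && (y' <= 1), 1 <= y | y' <= -1].

Lemma cell_density_ge1 y y' : 1 <= cell_density y y'.
Proof. by rewrite /cell_density; case: ifP => // _; exact: ltW. Qed.

Lemma cell_density_ge0 y y' : 0 <= cell_density y y'.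
Proof. exact: le_trans ler01 (cell_density_ge1 y y'). Qed.

Lemma cell_density_le y y' : cell_density y y' <= lambda.
Proof. by rewrite /cell_density; case: ifP => // _; exact: ltW. Qed.

Lemma density_cell_le y y' p : y <= p.2 <= y' -> f p <= cell_density y y'.
Proof.
move=> /andP[h1 h2]; rewrite /cell_density; case: ifP => h; last exact: density_le.
by rewrite /strip_density ler_norml; case: ifP => // /negP[]; lra.
Qed.

Lemma density_cell y y' t : separated y y' -> y < t < y' -> psi t = cell_density y y'.
Proof.
rewrite /separated /fiber_density /cell_density ler_norml => h1 h2.
by case: ifP => h3; case: ifP => h4 //; exfalso; lra.
Qed.

End Polygons.

(** * Smooth sets of prescribed volume from a run of cells *)

Section RunSet.
Context {R : realType}.
Variable lambda : R.
Hypothesis hlambda : 1 < lambda.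
Local Notation leb := (@lebesgue_measure R).
Local Notation RT := (measurableTypeR R).
Local Notation f := (strip_density lambda).
Local Notation psi := (fiber_density lambda).
Local Notation cell_density := (cell_density lambda).
Implicit Types (p : R * R) (G : set (R * R)).

(** The profile set is built with volume at least [V] and then narrowed by the exact ratio of the
    volumes, which does not increase the boundary integral. This is what smoothness for every
    horizontal scaling is for. *)
Lemma run_set N (z q : nat -> R) (V t e B : R) : (1 < N)%N ->
  (forall i, (i < N)%N -> z i < z i.+1) ->
  (forall i, (i < N)%N -> separated (z i) (z i.+1)) -> q 0 = 0 -> q N = 0 ->
  (forall i, (0 < i < N)%N -> 0 < q i) -> (forall i, (i <= N)%N -> t * q i <= B) ->
  0 < V -> 0 < t -> 0 < e ->
  V < t * \sum_(i < N) cell_density (z i) (z i.+1) * (z i.+1 - z i) * (2 * Num.min (q i) (q i.+1)) ->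
  exists (G : set (R * R)) (W : R -> R), [/\ smooth_set G,
    (boundary_integral f G <= (\sum_(i < N) cell_density (z i) (z i.+1) *
       (2 * Num.sqrt ((z i.+1 - z i) ^+ 2 + (t * q i.+1 - t * q i) ^+ 2)) + e)%:E)%E,
    weighted_volume f G = V%:E,
    forall y, slice G y = `]- W y, W y[%classic /\ 0 <= W y <= B + e &
    forall y, y <= z 0 \/ z N <= y -> W y = 0].
Proof.
move=> N1 hz sep q0 qN qpos qB V0 t0 e0 hV.
pose M i := cell_density (z i) (z i.+1).
have M0 i : 0 <= M i by exact: cell_density_ge0.
pose q' i := t * q i.
have B0 : 0 <= B by have := qB 0%N isT; rewrite q0 mulr0.
set U := \sum_(i < N) _ in hV.
have SM0 : 0 <= 2 * \sum_(i < N) M i * (z i.+1 - z i).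
  rewrite mulr_ge0// sumr_ge0// => i _; rewrite mulr_ge0// subr_ge0 ltW// hz//.
have gap0 : 0 < t * U - V by rewrite subr_gt0.
(* Shrinking every half-width by [e1'] costs at most the excess of volume over [V]. *)
have [e1' e1'0 he1] := exists_small _ _ SM0 gap0.
have [e1 [e10 e1e1 e1e]] := exists_min2 e1' e e1'0 e0.
have fM i p : (i < N)%N -> z i <= p.2 <= z i.+1 -> f p <= M i.
  by move=> _; exact: density_cell_le.
have q'0 : q' 0 = 0 by rewrite /q' q0 mulr0.
have q'N : q' N = 0 by rewrite /q' qN mulr0.
have q'pos i : (0 < i < N)%N -> 0 < q' i by move=> /qpos qi; rewrite mulr_gt0.
have [G0 [W0 [sG0 bG0 slG0 outG0 cellG0]]] :=
  profile_smooth_set lambda hlambda N z q' M e1 N1 hz q'0 q'N q'pos M0 fM e10.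
have W0B y : W0 y <= (B + e) * (\1_(`[z 0, z N]%classic) (y : R) : R).
  have [y0|y0] := leP y (z 0); first by rewrite (outG0 y (or_introl y0)) mulr_ge0// addr_ge0 ?(ltW e0).
  have [yN|yN] := leP (z N) y; first by rewrite (outG0 y (or_intror yN)) mulr_ge0// addr_ge0 ?(ltW e0).
  have yi : z 0 <= y <= z N by rewrite !ltW.
  rewrite indicE mem_set ?mulr1; last by rewrite /= in_itv/= yi.
  have [i iN hi] := find_cell N z N1 y yi.
  have /andP[_ h] := cellG0 i y iN hi; apply: le_trans h _; apply: lerD => //.
  by rewrite ge_max !qB// ltnW.
have mG0 : measurable G0.
  have [oG _] := sG0 1 ltr01; apply: open_measurable2.
  by rewrite (_ : G0 = stretch 1 @^-1` G0)//; apply/seteqP; split=> -[x y]; rewrite /stretch /= mul1r.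
have slG0' y : slice G0 y = `]- W0 y, W0 y[%classic /\ 0 <= W0 y by exact: slG0.
have [mW0 vG0] := volume_intervals lambda hlambda G0 W0 mG0 slG0'.
have psi0 y : 0 <= psi y by exact: (density_ge0 lambda hlambda (0, y)).
have mint (c : R) : measurable_fun setT (fun y : RT => (psi y * (2 * (c * W0 y)))%:E).
  apply/measurable_EFinP; apply: measurable_funM; first exact: fiber_density_measurable.
  by apply: measurable_funM => //; apply: measurable_funM.
have mint1 : measurable_fun setT (fun y : RT => (psi y * (2 * W0 y))%:E).
  by have := mint 1; under eq_fun do rewrite mul1r.
have low : (V%:E <= weighted_volume f G0)%E.
  rewrite vG0.
  pose c i := M i * (2 * Num.max 0 (t * Num.min (q i) (q i.+1) - e1)).
  have c0 i : 0 <= c i by rewrite !mulr_ge0// le_max lexx.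
  apply: (@le_trans _ _ (\sum_(i < N) c i * (z i.+1 - z i))%:E).
    rewrite lee_fin; apply: (@le_trans _ _ (t * U - (2 * \sum_(i < N) M i * (z i.+1 - z i)) * e1)).
      have : (2 * \sum_(i < N) M i * (z i.+1 - z i)) * e1 <= (2 * \sum_(i < N) M i * (z i.+1 - z i)) * e1' by rewrite ler_wpM2l.
      lra.
    rewrite /U !mulr_sumr mulr_suml -sumrB; apply: ler_sum => i _; rewrite -/(M i) /c.
    set mm := Num.min _ _; have dz : 0 <= z i.+1 - z i by rewrite subr_ge0 ltW// hz.
    rewrite (_ : _ - _ = M i * (2 * (t * mm - e1)) * (z i.+1 - z i)); last by ring.
    by rewrite ler_wpM2r// ler_wpM2l// ler_wpM2l// le_max lexx orbT.
  rewrite -(step_integral N z c false true hz c0).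
  apply: ge0_le_integral => //.
  - by move=> y _; rewrite lee_fin sumr_ge0// => i _; rewrite mulr_ge0.
  - apply/measurable_EFinP; apply: measurable_sum => i.
    by apply: measurable_funM => //; apply: measurable_indic; exact: measurable_itv.
  move=> y _; rewrite lee_fin.
  have [[i iN hi]|none] := pselect (exists2 i, (i < N)%N & z i < y < z i.+1); last first.
    rewrite big1 ?mulr_ge0//; first by have [] := slG0 y.
    move=> i _; rewrite indicE memNset ?mulr0//= in_itv/= => h; apply: none; by exists i.
  rewrite (bigD1 (Ordinal iN))//= big1 ?addr0; last first.
    move=> j ji; rewrite indicE memNset ?mulr0//= in_itv/= => hj.
    have ij : (j : nat) != i by [].
    have := ltn_ord j; move: hi hj => /andP[hi1 hi2] /andP[hj1 hj2] jN.
    move: ij; rewrite neq_ltn => /orP[ij|ij].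
      have : z j.+1 <= z i by apply: (node_le N z hz); rewrite ij ltnW.
      by rewrite leNgt (lt_trans hi1 hj2).
    have : z i.+1 <= z j by apply: (node_le N z hz); rewrite ij ltnW.
    by rewrite leNgt (lt_trans hj1 hi2).
  rewrite indicE mem_set ?mulr1; last by rewrite /= in_itv.
  rewrite (density_cell lambda _ _ y (sep i iN) hi) /c ler_wpM2l// ler_wpM2l//.
  rewrite ge_max; have [_ ->] := slG0 y; rewrite /=.
  have /andP[hi1 hi2] := hi.
  have /andP[h _] := cellG0 i y iN (introT andP (conj (ltW hi1) (ltW hi2))).
  by apply: le_trans h; rewrite lerB// /q' le_min !ler_wpM2l ?(ltW t0)// ge_min lexx ?orbT.
have up : (weighted_volume f G0 < +oo)%E.
  have zN : z 0 < z N.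
    by apply: lt_le_trans (hz 0%N (ltnW N1)) _; apply: (node_le N z hz); rewrite ltnW//=.
  pose z' i := if i is 0%N then z 0 else z N.
  have hz' i : (i < 1)%N -> z' i < z' i.+1 by case: i.
  have C0 (i : nat) : 0 <= lambda * (2 * (B + e)).
    by rewrite !mulr_ge0 ?addr_ge0 ?(ltW e0)// ltW// (lt_trans ltr01).
  have := step_integral 1 z' (fun=> lambda * (2 * (B + e))) true false hz' C0.
  rewrite vG0 => h.
  apply: (@le_lt_trans _ _ (\sum_(i < 1) lambda * (2 * (B + e)) * (z' i.+1 - z' i))%:E); last exact: ltry.
  rewrite -h; apply: ge0_le_integral => //.
  - by move=> y _; rewrite lee_fin !mulr_ge0//; have [] := slG0 y.
  - apply/measurable_EFinP; apply: measurable_sum => i.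
    by apply: measurable_funM => //; apply: measurable_indic; exact: measurable_itv.
  move=> y _; rewrite lee_fin big_ord1/= -!mulrA.
  apply: ler_pM => //; first by rewrite mulr_ge0//; have [] := slG0 y.
    exact: (density_le lambda hlambda (0, y)).
  by rewrite ler_wpM2l// W0B.
have vfin : (weighted_volume f G0 = (fine (weighted_volume f G0))%:E)%E.
  by rewrite fineK// ge0_fin_numE//; apply: integral_ge0 => p _; rewrite lee_fin density_ge0.
set v0 := fine _ in vfin.
have Vv0 : V <= v0 by move: low; rewrite vfin lee_fin.
pose a := v0 / V.
have a1 : 1 <= a by rewrite ler_pdivlMr// mul1r.
have a0 : 0 < a by exact: lt_le_trans a1.
have W0W y : 0 <= W0 y / a <= B + e.
  have [_ W00] := slG0 y; rewrite divr_ge0 ?(ltW a0)//= ler_pdivrMr//.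
  have := W0B y; rewrite indicE => h.
  have Be : 0 <= B + e by rewrite addr_ge0// ltW.
  have h1 : W0 y <= B + e by apply: le_trans h _; case: (_ \in _); rewrite ?mulr1// mulr0.
  by apply: le_trans h1 _; rewrite ler_peMr.
have slG y : slice (stretch a @^-1` G0) y = `]- (W0 y / a), W0 y / a[%classic.
  have [e2 _] := slG0 y.
  transitivity ((fun x => a * x) @^-1` slice G0 y); first by [].
  rewrite e2; apply/seteqP; split=> x; rewrite /= !in_itv/= ltr_pdivlMr// -mulNr ltr_pdivrMr// ![x * a]mulrC//.
exists (stretch a @^-1` G0), (fun y => W0 y / a); split.
- exact: sG0.
- apply: le_trans (boundary_integral_contract lambda hlambda G0 a a1) _; apply: le_trans bG0 _.
  by rewrite lee_fin lerD2l.
- have mG : measurable (stretch a @^-1` G0) by apply: open_measurable2; have [] := sG0 a a0.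
  have [|_ ->] := volume_intervals lambda hlambda _ (fun y => W0 y / a) mG.
    by move=> y; split=> //; have /andP[] := W0W y.
  transitivity (\int[leb]_y ((a^-1)%:E * (psi y * (2 * W0 y))%:E))%E.
    by apply: eq_integral => y _; rewrite -EFinM; congr _%:E; ring.
  rewrite ge0_integralZl_EFin ?invr_ge0 ?(ltW a0)//; last first.
    by move=> y _; rewrite lee_fin !mulr_ge0//; have [] := slG0 y.
  rewrite -vG0 vfin -EFinM /a invf_div divfK// gt_eqF//; exact: lt_le_trans Vv0.
- by move=> y; split; [exact: slG|exact: W0W].
- by move=> y /outG0 ->; rewrite mul0r.
Qed.

End RunSet.

(** * Selecting, moving and stretching a run *)

Section PolygonSet.
Context {R : realType}.
Variable lambda : R.
Hypothesis hlambda : 1 < lambda.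
Local Notation f := (strip_density lambda).
Local Notation cell_density := (cell_density lambda).
Implicit Types (p : R * R) (G : set (R * R)).

Lemma edge_scale (t x y : R) : 1 <= t ->
  Num.sqrt (x ^+ 2 + (t * y) ^+ 2) <= t * Num.sqrt (x ^+ 2 + y ^+ 2).
Proof.
move=> t1; have t0 : 0 <= t by exact: le_trans t1.
rewrite -{2}[t]ger0_norm// -sqrtr_sqr -sqrtrM ?sqr_ge0// ler_wsqrtr// mulrDr !exprMn.
by rewrite lerD2r ler_peMl ?sqr_ge0// exprn_ege1.
Qed.

(* Moves a run of cells that misses the strip so that it touches it. *)
Lemma run_shift k (z : nat -> R) L : (0 < k)%N ->
  (forall i, (i < k)%N -> z i < z i.+1) ->
  (forall i, (i < k)%N -> separated (z i) (z i.+1)) -> z k - z 0 <= L ->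
  exists c, [/\ forall i, (i < k)%N -> separated (z i + c) (z i.+1 + c) /\
      cell_density (z i + c) (z i.+1 + c) = cell_density (z i) (z i.+1),
    - (1 + L) <= z 0 + c & z k + c <= 1 + L].
Proof.
move=> k0 hz sep zL.
have z0k : z 0 <= z k by apply: (node_le k z hz); rewrite leqnn.
have L0 : 0 <= L by lra.
have [h1|h1] := leP 1 (z 0).
  exists (1 - z 0); split; [|lra|lra] => i ik.
  have zi : z 0 <= z i by apply: (node_le k z hz); rewrite /= ltnW.
  have zi' := hz i ik.
  rewrite /separated /cell_density (_ : 1 <= z i + (1 - z 0)) ?orbT; last by lra.
  by split=> //; case: ifP => h; case: ifP => h' //; exfalso; lra.
have [h2|h2] := leP (z k) (-1).
  exists (-1 - z k); split; [|lra|lra] => i ik.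
  have zi : z i.+1 <= z k by apply: (node_le k z hz); rewrite ik/=.
  have zi' := hz i ik.
  rewrite /separated /cell_density (_ : z i.+1 + (-1 - z k) <= -1) ?orbT; last by lra.
  by split=> //; case: ifP => h; case: ifP => h' //; exfalso; lra.
exists 0; rewrite !addr0; split; [|lra|lra] => i ik; rewrite !addr0; split=> //; exact: sep.
Qed.

(** The total cost is below [kappa] times the total volume, so some run of positive nodes has the
    same property. A run of too small volume is stretched and then costs about [kappa * V] at most;
    otherwise its own cost, at most [C], is kept. *)
Lemma polygon_set N (z q cst len : nat -> R) (C L kappa V e : R) :
  (forall i, (i < N)%N -> z i < z i.+1) ->
  (forall i, (i < N)%N -> separated (z i) (z i.+1)) ->
  (forall i, 0 <= q i) -> q 0 = 0 -> q N = 0 ->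
  (forall i, 0 <= cst i) -> (forall i, (i < N)%N -> 0 < q i \/ 0 < q i.+1 ->
    cell_density (z i) (z i.+1) *
      (2 * Num.sqrt ((z i.+1 - z i) ^+ 2 + (q i.+1 - q i) ^+ 2)) <= cst i) ->
  \sum_(i < N) cst i <= C ->
  (forall i, 0 <= len i) -> (forall i, (i < N)%N -> 0 < q i \/ 0 < q i.+1 -> z i.+1 - z i <= len i) ->
  \sum_(i < N) len i <= L -> 0 < V -> 0 < e -> 0 < kappa ->
  C < kappa * \sum_(i < N) cell_density (z i) (z i.+1) * (z i.+1 - z i) * (2 * Num.min (q i) (q i.+1)) ->
  exists (G : set (R * R)) (W : R -> R), [/\ smooth_set G,
    (boundary_integral f G <= (Num.max C (kappa * V) + e)%:E)%E,
    weighted_volume f G = V%:E,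
    forall y, slice G y = `]- W y, W y[%classic /\ 0 <= W y <= Num.max C (kappa * V) + e &
    forall y, 1 + L < `|y| -> W y = 0].
Proof.
move=> hz sep qge0 q0 qN cst0 hcst sumC len0 hlen sumL V0 e0 ka0 hC.
pose vol i := cell_density (z i) (z i.+1) * (z i.+1 - z i) * (2 * Num.min (q i) (q i.+1)).
pose g i := kappa * vol i - cst i.
have [||b [k [_ bkN k1 [qb qbk qpos gpos]]]] := @find_run R g q _ qge0 N 0%N q0 qN.
- by move=> i qi qi1; rewrite /g /vol qi qi1 minxx !mulr0 sub0r oppr_le0.
- rewrite add0n big_mkord sumrB subr_gt0 -mulr_sumr; exact: le_lt_trans sumC hC.
rewrite add0n in bkN.
have shiftE (F : nat -> R) : \sum_(b <= i < b + k) F i = \sum_(i < k) F (b + i)%N.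
  rewrite -{1}[b]add0n big_addn addKn big_mkord; by apply: eq_bigr => i _; rewrite addnC.
have subE (F : nat -> R) : (forall i, 0 <= F i) -> \sum_(i < k) F (b + i)%N <= \sum_(i < N) F i.
  move=> F0; rewrite -shiftE -(big_mkord xpredT F).
  rewrite (@big_cat_nat _ _ _ b 0 N)//=; last by apply: leq_trans bkN; rewrite leq_addr.
  rewrite (@big_cat_nat _ _ _ (b + k)%N b N)//= ?leq_addr// addrCA lerDl.
  by rewrite addr_ge0// sumr_ge0.
have iN i : (i < k)%N -> (b + i < N)%N by move=> ik; apply: leq_trans bkN; rewrite ltn_add2l.
have pos i : (i < k)%N -> 0 < q (b + i)%N \/ 0 < q (b + i).+1.
  move=> ik; case: i ik => [|i] ik; last by left; apply: qpos.
  by right; rewrite addn0 -addn1; apply: qpos.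
pose z1 i := z (b + i)%N.
have hz1 i : (i < k)%N -> z1 i < z1 i.+1 by move=> ik; rewrite /z1 addnS hz// iN.
have sep1 i : (i < k)%N -> separated (z1 i) (z1 i.+1) by move=> ik; rewrite /z1 addnS sep// iN.
have zL : z1 k - z1 0 <= L.
  rewrite -(telescope_sumr z1 (leq0n k)) big_mkord; apply: le_trans sumL.
  apply: le_trans (subE len len0); apply: ler_sum => i _.
  by rewrite /z1 addnS hlen ?iN//; exact: pos.
have [c [hc cl cr]] := run_shift k z1 L (ltnW k1) hz1 sep1 zL.
pose z' i := z1 i + c. pose q' i := q (b + i)%N.
have dz i : z' i.+1 - z' i = z (b + i).+1 - z (b + i)%N by rewrite /z' /z1 addnS; ring.
have cd i : (i < k)%N -> cell_density (z' i) (z' i.+1) = cell_density (z (b + i)%N) (z (b + i).+1).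
  by move=> ik; have [_ ->] := hc i ik; rewrite /z1 addnS.
pose volr := \sum_(i < k) vol (b + i)%N. pose cstr := \sum_(i < k) cst (b + i)%N.
have cstr0 : 0 <= cstr by rewrite sumr_ge0.
have gr : cstr < kappa * volr.
  by move: gpos; rewrite shiftE sumrB subr_gt0 -mulr_sumr.
have volr0 : 0 < volr by rewrite -(pmulr_rgt0 _ ka0); exact: le_lt_trans gr.
(* The margin [th] makes the stretched volume strictly larger than [V], at an extra cost kappa * th
   = e / 4. *)
pose th := e / 4 / kappa.
have th0 : 0 < th by rewrite !divr_gt0.
pose t := Num.max 1 ((V + th) / volr).
have t1 : 1 <= t by rewrite le_max lexx.
have t0 : 0 < t by exact: lt_le_trans t1.
have tvol : V < t * volr.
  apply: (@lt_le_trans _ _ (V + th)); first by rewrite ltrDl.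
  by rewrite -ler_pdivrMr// le_max lexx orbT.
have tcst : t * cstr <= Num.max C (kappa * V) + e / 4.
  rewrite /t; case: (leP 1) => h.
    rewrite -mulrAC ler_pdivrMr//; apply: (@le_trans _ _ ((V + th) * (kappa * volr))).
      by rewrite ler_wpM2l// ?addr_ge0 ?(ltW V0) ?(ltW th0)// ltW.
    rewrite mulrA ler_pM2r// mulrDl [V * _]mulrC /th divfK ?gt_eqF// lerD2r.
    by rewrite le_max lexx orbT.
  rewrite mul1r; apply: (@le_trans _ _ C); first exact: le_trans (subE cst cst0) sumC.
  by rewrite -[leLHS]addr0; apply: lerD; rewrite ?le_max ?lexx// divr_ge0// ltW.
have edges : \sum_(i < k) cell_density (z' i) (z' i.+1) *
    (2 * Num.sqrt ((z' i.+1 - z' i) ^+ 2 + (t * q' i.+1 - t * q' i) ^+ 2)) <= t * cstr.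
  rewrite mulr_sumr; apply: ler_sum => i _; rewrite cd// dz /q' addnS.
  apply: (@le_trans _ _ (t * (cell_density (z (b + i)%N) (z (b + i).+1) *
     (2 * Num.sqrt ((z (b + i).+1 - z (b + i)%N) ^+ 2 + (q (b + i).+1 - q (b + i)%N) ^+ 2))))).
    rewrite [leRHS]mulrCA ler_wpM2l ?cell_density_ge0// [leRHS]mulrCA ler_wpM2l// -mulrBr.
    exact: edge_scale.
  by rewrite ler_pM2l// hcst ?iN//; exact: pos.
(* The profile starts at 0 and each of its increments is at most the cost of the edge, so it never
   exceeds the total cost. *)
have qB i : (i <= k)%N -> t * q' i <= Num.max C (kappa * V) + e / 4.
  move=> ik; apply: le_trans tcst; apply: le_trans edges.
  have -> : t * q' i = \sum_(0 <= j < i) (t * q' j.+1 - t * q' j).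
    by rewrite (telescope_sumr (fun j => t * q' j) (leq0n i)) /q' addn0 qb mulr0 subr0.
  pose E j := cell_density (z' j) (z' j.+1) *
    (2 * Num.sqrt ((z' j.+1 - z' j) ^+ 2 + (t * q' j.+1 - t * q' j) ^+ 2)).
  have E0 j : 0 <= E j by rewrite mulr_ge0 ?cell_density_ge0// mulr_ge0// sqrtr_ge0.
  apply: (@le_trans _ _ (\sum_(0 <= j < i) E j)).
    apply: ler_sum => j _; apply: le_trans (ler_norm _) _; rewrite -sqrtr_sqr.
    apply: (@le_trans _ _ (Num.sqrt ((z' j.+1 - z' j) ^+ 2 + (t * q' j.+1 - t * q' j) ^+ 2))).
      by rewrite ler_wsqrtr// lerDr sqr_ge0.
    have s0 := sqrtr_ge0 ((z' j.+1 - z' j) ^+ 2 + (t * q' j.+1 - t * q' j) ^+ 2).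
    rewrite /E mulrA ler_peMl//; have := cell_density_ge1 lambda hlambda (z' j) (z' j.+1); lra.
  apply: (@le_trans _ _ (\sum_(i < k) E i)); last exact: lexx.
  by rewrite -(big_mkord xpredT E) (@big_cat_nat _ _ _ i 0 k)//= lerDl sumr_ge0.
have e2 : 0 < e / 2 by rewrite divr_gt0.
have [||||||G [W [sG bG vG slG outG]]] := run_set lambda hlambda k z' q' V t (e / 2)
    (Num.max C (kappa * V) + e / 4) k1 _ _ _ _ _ qB V0 t0 e2.
- by move=> i ik; rewrite /z' ltrD2r hz1.
- by move=> i /hc [].
- by rewrite /q' addn0.
- by [].
- by move=> i /qpos.
- apply: lt_le_trans tvol _; rewrite ler_pM2l//; apply: ler_sum => i _.
  by rewrite cd// dz /q' addnS.
exists G, W; split=> //.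
- apply: le_trans bG _; rewrite lee_fin; apply: (@le_trans _ _ (t * cstr + e / 2)).
    by rewrite lerD2r.
  by move: tcst; lra.
- move=> y; have [h1 /andP[h2 h3]] := slG y; split=> //; rewrite h2/=; apply: le_trans h3 _; lra.
- move=> y; rewrite ltNge ler_norml => hy; apply: outG.
  have [h|h] := leP y (z' 0); first by left.
  right; rewrite leNgt; apply/negP => h'; move/negP: hy; apply.
  by rewrite (le_trans cl (ltW h))/= (le_trans (ltW h') cr).
Qed.

End PolygonSet.

(** * Profiles of slice lengths *)

Section SliceData.
Context {R : realType}.
Variable lambda : R.
Hypothesis hlambda : 1 < lambda.
Local Notation leb := (@lebesgue_measure R).
Local Notation RT := (measurableTypeR R).
Local Notation low := (low_density lambda).

Definition window (n : nat) : set RT := `[- n%:R, n%:R]%classic.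

Definition live (m : R -> R) : set RT := [set t | 0 < m t].

(* [m] is the profile of slice lengths of a plane set, [L] the weighted length of its boundary below a
   given height, and [Z] a set of generic heights. *)
Record slice_data (m L : R -> R) (Z : set R) (P : R) : Prop := SliceData {
  slice_ge0 : forall y, 0 <= m y;
  slice_mfun : measurable_fun setT (m : RT -> R);
  slice_generic : {ae leb, forall y, Z y};
  slice_total : forall y y', Z y -> Z y' -> y <= y' -> L y' - L y <= P;
  slice_edge : forall y y', Z y -> Z y' -> y < y' ->
    low y y' * Num.sqrt ((2 * fine (leb (live m `&` `]y, y'[%classic))) ^+ 2 + (m y' - m y) ^+ 2)
      <= L y' - L y }.

Lemma generic_avoid (Z : set R) (A : set RT) (a b : R) : {ae leb, forall y, Z y} -> measurable A ->
  (leb A < (b - a)%:E)%E -> exists y, [/\ Z y, a < y < b & ~ A y].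
Proof.
move=> [X [mX X0 hX]] mA hA; apply: contrapT => no.
have : (leb (`]a, b[%classic : set RT) <= leb A + leb X)%E.
  apply: (@le_trans _ _ (leb (A `|` X))); last exact: outer_measureU2.
  apply: le_outer_measure => y /=; rewrite in_itv/= => yab.
  have [Ay|nAy] := pselect (A y); [by left|right].
  by apply: hX => Zy; apply: no; exists y.
rewrite X0 adde0 lebesgue_measure_itv/= lte_fin; case: ifPn => ab.
  by rewrite -EFinB leNgt hA.
by have := lt_le_trans hA (_ : (_ <= 0)%E); rewrite lee_fin subr_le0 leNgt ab => /(_ isT); rewrite ltNge measure_ge0.
Qed.

Lemma generic_point (Z : set R) (a b : R) : {ae leb, forall y, Z y} -> a < b ->
  exists2 y, Z y & a < y < b.
Proof.
move=> hZ ab; have [||y [Zy yab _]] := generic_avoid Z set0 a b hZ; last by exists y.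
  exact: measurable0.
by rewrite measure0 lte_fin subr_gt0.
Qed.

Lemma window_cvg (S : set RT) : measurable S -> leb (S `&` window n) @[n --> \oo] --> leb S.
Proof.
move=> mS; have mA n : measurable (S `&` window n).
  by apply: measurableI => //; exact: measurable_itv.
have {2}-> : S = \bigcup_n (S `&` window n).
  apply/seteqP; split=> t; last by move=> [n _ []].
  move=> mt; exists (Num.truncn `|t|).+1 => //; split=> //; rewrite /window/= in_itv/= -ler_norml.
  by rewrite ltW// truncnS_gt.
apply: nondecreasing_cvg_mu => //; first by apply: bigcupT_measurable.
move=> n k nk; apply/subsetPset => t [mt]; rewrite /window/= in_itv/= -ler_norml => h; split=> //.
by rewrite /= in_itv/= -ler_norml (le_trans h)// ler_nat.
Qed.

Lemma finite_tail (S : set RT) (d : R) : measurable S -> (leb S < +oo)%E -> 0 < d ->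
  exists K, forall n, (K <= n)%N -> (leb (S `\` window n) < d%:E)%E.
Proof.
move=> mS Soo d0; have fl : leb S \is a fin_num by rewrite ge0_fin_numE.
have := window_cvg S mS; rewrite -(fineK fl) => /fine_cvgP[_ /cvgrPdist_lt /(_ d d0)] [K _ hK].
exists K => n Kn; have := hK n Kn.
have fA : leb (S `&` window n) \is a fin_num.
  by rewrite ge0_fin_numE// (le_lt_trans _ Soo)//; apply: le_outer_measure => t [].
have -> : leb (S `\` window n) = (leb S - leb (S `&` window n))%E.
  by apply: measureD => //; exact: measurable_itv.
rewrite -{2}(fineK fl) -(fineK fA) -EFinB lte_fin => h; apply: le_lt_trans h.
exact: ler_norm.
Qed.

Section one.
Variables (m L : R -> R) (Z : set R) (P : R).
Hypothesis D : slice_data m L Z P.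
Let m0 := slice_ge0 _ _ _ _ D.
Let mm := slice_mfun _ _ _ _ D.
Let hZ := slice_generic _ _ _ _ D.
Let hL := slice_total _ _ _ _ D.
Let edge := slice_edge _ _ _ _ D.

Lemma live_measurable : measurable (live m).
Proof.
rewrite (_ : live m = m @^-1` `]0, +oo[%classic); last first.
  by apply/seteqP; split=> t; rewrite /live /= in_itv/= andbT.
by rewrite -[X in measurable X]setTI; apply: mm => //; exact: measurable_itv.
Qed.

Lemma total_ge0 : 0 <= P.
Proof.
by have [y Zy _] := generic_point Z 0 1 hZ ltr01; have := hL y y Zy Zy (lexx y); rewrite subrr.
Qed.

Lemma live_cell_finite y y' : (leb (live m `&` `]y, y'[%classic) < +oo)%E.
Proof.
apply: (@le_lt_trans _ _ (leb (`]y, y'[%classic : set RT))); last first.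
  by rewrite lebesgue_measure_itv/=; case: ifP => _; rewrite ?ltry// -EFinB ltry.
by apply: le_outer_measure => t [].
Qed.

Lemma slice_lip y y' : Z y -> Z y' -> y <= y' ->
  low y y' * `|m y' - m y| <= L y' - L y.
Proof.
move=> Zy Zy'; rewrite le_eqVlt => /orP[/eqP ->|yy']; first by rewrite !subrr normr0 mulr0.
apply: le_trans (edge _ _ Zy Zy' yy'); rewrite ler_wpM2l ?low_density_ge0// -sqrtr_sqr ler_wsqrtr//.
by rewrite lerDr sqr_ge0.
Qed.

Lemma slice_diff y y' : Z y -> Z y' -> y <= y' -> `|m y' - m y| <= L y' - L y.
Proof.
move=> Zy Zy' yy'; apply: le_trans (slice_lip _ _ Zy Zy' yy').
by rewrite ler_peMl// low_density_ge1.
Qed.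

Lemma slice_total_mono y y' : Z y -> Z y' -> y <= y' -> L y <= L y'.
Proof. by move=> Zy Zy' /(slice_diff _ _ Zy Zy') h; rewrite -subr_ge0; exact: le_trans h. Qed.

Lemma live_cell y y' : Z y -> Z y' -> y < y' ->
  2 * fine (leb (live m `&` `]y, y'[%classic)) <= L y' - L y.
Proof.
move=> Zy Zy' yy'; have f0 : 0 <= 2 * fine (leb (live m `&` `]y, y'[%classic)).
  by rewrite mulr_ge0// fine_ge0.
apply: le_trans (edge _ _ Zy Zy' yy').
apply: (@le_trans _ _ (Num.sqrt ((2 * fine (leb (live m `&` `]y, y'[%classic))) ^+ 2 + (m y' - m y) ^+ 2))).
  by rewrite -{1}[2 * _]ger0_norm// -sqrtr_sqr ler_wsqrtr// lerDl sqr_ge0.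
by rewrite ler_peMl ?sqrtr_ge0// low_density_ge1.
Qed.

Let A n : set RT := live m `&` window n.

Let A_le n : (leb (A n) <= (P / 2)%:E)%E.
Proof.
have [|y Zy /andP[_ yn]] := generic_point Z (- n%:R - 1) (- n%:R) hZ; first by rewrite ltrBlDr ltrDl.
have [|y' Zy' /andP[ny' _]] := generic_point Z n%:R (n%:R + 1) hZ; first by rewrite ltrDl.
have n0 : 0 <= n%:R :> R by [].
have yy' : y < y' by lra.
have h := live_cell y y' Zy Zy' yy'.
apply: (@le_trans _ _ (leb (live m `&` `]y, y'[%classic))).
  apply: le_outer_measure => t [mt]; rewrite /window /= in_itv/= => /andP[t1 t2]; split=> //.
  by rewrite /= in_itv/= (lt_le_trans yn t1)/= (le_lt_trans t2 ny').
rewrite -[leLHS]fineK ?ge0_fin_numE ?live_cell_finite// lee_fin.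
have := hL y y' Zy Zy' (ltW yy'); lra.
Qed.

Lemma live_le : (leb (live m) <= (P / 2)%:E)%E.
Proof.
have h := window_cvg (live m) live_measurable.
rewrite -(cvg_lim _ h)//; apply: lime_le; first by apply/cvg_ex; eexists; exact: h.
by apply: nearW.
Qed.

Lemma live_finite : (leb (live m) < +oo)%E.
Proof. exact: le_lt_trans live_le (ltry _). Qed.

(** The live set has measure at most P / 2, so some generic height in (0, P + 1) has m = 0; from
    there [L] controls the variation of m. *)
Lemma slice_le y : Z y -> m y <= P.
Proof.
move=> Zy; have [|y0 [Zy0 _ ny0]] := generic_avoid Z (live m) 0 (P + 1) hZ live_measurable.
  by apply: le_lt_trans live_le _; rewrite lte_fin subr0; have := total_ge0; lra.
have my0 : m y0 = 0 by apply/eqP; rewrite eq_le m0 andbT leNgt; apply/negP.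
have [h|h] := leP y y0.
  have := hL y y0 Zy Zy0 h; by have := slice_diff _ _ Zy Zy0 h; rewrite my0 sub0r normrN ger0_norm//; lra.
have := hL y0 y Zy0 Zy (ltW h); by have := slice_diff _ _ Zy0 Zy (ltW h); rewrite my0 subr0 ger0_norm//; lra.
Qed.

End one.
End SliceData.

(** * Grids with nodes on the boundary of the strip *)

Section Grid.
Context {R : realType}.
Variable lambda : R.
Hypothesis hlambda : 1 < lambda.
Local Notation leb := (@lebesgue_measure R).
Local Notation RT := (measurableTypeR R).
Local Notation low := (low_density lambda).
Local Notation cell_density := (cell_density lambda).
Local Notation slice_data := (slice_data lambda).

Lemma low_density_above (y y' : R) : 1 < y -> low y y' = lambda.
Proof. by move=> h; rewrite /low_density h. Qed.

Lemma low_density_below (y y' : R) : y' < -1 -> low y y' = lambda.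
Proof. by move=> h; rewrite /low_density h orbT. Qed.

Lemma cell_density_strip (y y' : R) : -1 <= y -> y' <= 1 -> cell_density y y' = 1.
Proof. by move=> h1 h2; rewrite /cell_density h1 h2. Qed.

(* The heights -1 and 1 need not be generic, but they have to be nodes since the density jumps there: [x i] is
   the generic height whose data are used at the node [y i], and [sp] marks the cells affected by this. *)
Lemma grid_nodes (m L : R -> R) (Z : set R) (P : R) (n K : nat) : slice_data m L Z P ->
  (1 < n)%N -> (1 < K)%N -> (leb (live m `\` window K.-1) < ((2 * n%:R)^-1)%:E)%E ->
  exists (y x sp : nat -> R), let N := (2 * K * n)%N in
  [/\ forall i, y i < y i.+1 /\ y i.+1 - y i <= 3 / 2 / n%:R,
      forall i, separated (y i) (y i.+1),
      forall i, Z (x i) /\ (x i = x i.+1 \/ x i < x i.+1 /\ cell_density (y i) (y i.+1) <= low (x i) (x i.+1)),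
      [/\ m (x 0) = 0, m (x N) = 0, y 0 <= - (K.-1)%:R & (K.-1)%:R <= y N] &
      [/\ forall i, 0 <= sp i, \sum_(i < N) sp i <= 4 &
          forall i, 1 <= sp i \/ x i = y i /\ x i.+1 = y i.+1] ].
Proof.
move=> D n1 K1 tail; have hZ := slice_generic _ _ _ _ _ D.
have n0 : 0 < n%:R :> R by rewrite ltr0n ltnW.
pose eta : R := n%:R^-1; have eta0 : 0 < eta by rewrite invr_gt0.
have neta : n%:R * eta = 1 by rewrite divff// gt_eqF.
have eta2 : eta <= 1 / 2.
  by rewrite mul1r lef_pV2 ?posrE// ler_nat.
pose N := (2 * K * n)%N. pose jm := (K.-1 * n)%N. pose jp := (K.+1 * n)%N.
pose s (j : nat) : R := - K%:R + j%:R * eta.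
have sjm : s jm = -1.
  rewrite /s /jm natrM -mulrA neta mulr1 -{1}(prednK (ltnW K1)) -natr1; ring.
have sjp : s jp = 1 by rewrite /s /jp natrM -mulrA neta mulr1 -natr1; ring.
have sN : s N = K%:R by rewrite /s /N !natrM -mulrA neta mulr1; ring.
have s0 : s 0%N = - K%:R by rewrite /s mul0r addr0.
have sS j : s j.+1 = s j + eta by rewrite /s -natr1 mulrDl mul1r addrA.
have KE : K%:R = (K.-1)%:R + 1 :> R by rewrite natr1 prednK// ltnW.
have jm0 : (0 < jm)%N by rewrite muln_gt0 (ltnW n1) andbT; lia.
have jmp : (jm + n + n = jp)%N.
  by rewrite /jm /jp -!mulSnr prednK// ltnW.
have jpN : (jp < N)%N by rewrite ltn_mul2r (ltnW n1)/=; lia.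
(* Apart from -1 and 1, a node is a generic height within a quarter step of the regular grid; the
   two outermost ones also avoid the live set, which is small outside the window. *)
have /choice[y hy] : forall j, exists t : R, if j == jm then t = -1 else if j == jp then t = 1 else
    [/\ Z t, s j - eta / 4 < t < s j + eta / 4 & (j == 0%N) || (j == N) -> m t = 0].
  move=> j; case: (j == jm); first by exists (-1).
  case: (j == jp); first by exists 1.
  have [||t [Zt ht nt]] := @generic_avoid R Z (live m `\` window K.-1) (s j - eta / 4) (s j + eta / 4) hZ.
  - by apply: measurableD; [exact: live_measurable D|exact: measurable_itv].
  - apply: lt_le_trans tail _; rewrite lee_fin invfM -/eta; lra.
  exists t; split=> // hj; apply/eqP; rewrite eq_le (slice_ge0 _ _ _ _ _ D) andbT leNgt; apply/negP => mt.
  apply: nt; split=> //; rewrite /window/= in_itv/= => ht'.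
  by move: ht ht'; case/orP: hj => /eqP ->; rewrite ?s0 ?sN KE; lra.
have ynear j : s j - eta / 4 <= y j <= s j + eta / 4.
  have := hy j; case: ifP => [/eqP -> ->|_]; first by rewrite sjm; lra.
  by case: ifP => [/eqP -> ->|_ [_ + _]]; [rewrite sjp; lra|lra].
have yS i : y i < y i.+1 /\ y i.+1 - y i <= 3 / 2 / n%:R.
  have := ynear i; have := ynear i.+1; rewrite sS -/eta; lra.
have ylt i j : (i < j)%N -> y i < y j.
  elim: j => [//|j IH]; rewrite ltnS leq_eqVlt => /orP[/eqP ->|/IH h]; first by have [] := yS j.
  by apply: lt_trans h _; have [] := yS j.
have ym i j : (y i < y j) = (i < j)%N.
  case: (ltngtP i j) => [/ylt ->//|/ylt h|->]; last by rewrite ltxx.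
  by apply/negbTE; rewrite -leNgt ltW.
have yjm : y jm = -1 by have := hy jm; rewrite eqxx.
have jpm : (jp == jm) = false by apply/negbTE; lia.
have yjp : y jp = 1 by have := hy jp; rewrite jpm eqxx.
have yle i j : (i <= j)%N -> y i <= y j by rewrite leq_eqVlt => /orP[/eqP -> //|ij]; rewrite ltW// ym.
(* The data at -1 and 1 come from the next nodes outside the strip. The cell just outside then has
   no increment at all, and the one just inside has density 1, which is below every
   [low_density]. *)
pose r j := if j == jm then j.-1 else if j == jp then j.+1 else j.
have rN j : j != jm -> j != jp -> r j = j by rewrite /r => /negbTE -> /negbTE ->.
have Zy j : j != jm -> j != jp -> Z (y j).
  by move=> /negbTE h1 /negbTE h2; have := hy j; rewrite h1 h2 => -[].
have rm : r jm = jm.-1 by rewrite /r eqxx.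
have rp : r jp = jp.+1 by rewrite /r jpm eqxx.
(* The four cells that have an end at -1 or 1. *)
pose sp i : R := (i == jm.-1)%:R + (i == jm)%:R + (i == jp.-1)%:R + (i == jp)%:R.
exists y, (y \o r), sp; split=> /=.
- by [].
- move=> i; rewrite /separated; have [h|h] := leqP i.+1 jm.
    by rewrite -yjm (yle _ _ h) !orbT.
  have [h'|h'] := leqP i.+1 jp; first by rewrite -yjm -yjp (yle jm i h) (yle _ _ h').
  by rewrite -yjp (yle jp i h') !orbT.
- move=> i; split.
    rewrite /r; case: ifP => [/eqP ->|/negbT h]; first by apply: Zy; lia.
    by case: ifP => [/eqP ->|/negbT h']; apply: Zy => //; lia.
  have [->|h1] := eqVneq i jm.-1.
    by left; rewrite prednK// rm rN//; lia.
  have [->|h2] := eqVneq i jm.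
    right; rewrite rm rN; [|lia|lia]; split; first by rewrite ym; lia.
    rewrite cell_density_strip ?low_density_ge1//; first by rewrite yjm.
    by rewrite -yjp yle//; lia.
  have [->|h3] := eqVneq i jp.-1.
    right; rewrite prednK; last by lia.
    rewrite rp rN; [|lia|lia]; split; first by rewrite ym; lia.
    rewrite cell_density_strip ?low_density_ge1//; last by rewrite yjp.
    by rewrite -yjm yle//; lia.
  have [->|h4] := eqVneq i jp; first by left; rewrite rp rN//; lia.
  have e1 : r i.+1 = i.+1 by apply: rN; lia.
  right; rewrite e1 rN// ym; split=> //.
  have [h|h] := leqP i jm.
    rewrite low_density_below ?cell_density_le// -yjm ym; lia.
  have [h'|h'] := leqP i jp; last by rewrite low_density_above ?cell_density_le// -yjp ym.
  rewrite cell_density_strip ?low_density_ge1//; first by rewrite -yjm yle// ltnW.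
  by rewrite -yjp yle//; lia.
- have e0 : r 0%N = 0%N by apply: rN; lia.
  have eN : r N = N by apply: rN; lia.
  rewrite e0 eN; split.
  + have := hy 0%N; rewrite !ifF; [|by apply/negbTE; lia|by apply/negbTE; lia].
    by move=> [_ _ ->].
  + have := hy N; rewrite !ifF; [|by apply/negbTE; lia|by apply/negbTE; lia].
    by move=> [_ _ ->//]; rewrite eqxx orbT.
  + by have := ynear 0%N; rewrite s0 KE; lra.
  + by have := ynear N; rewrite sN KE; lra.
- split.
  + by move=> i; rewrite !addr_ge0.
  + have one j : \sum_(i < N) ((i : nat) == j)%:R <= 1 :> R.
      have [jN|jN] := ltnP j N.
        rewrite (bigD1 (Ordinal jN))//= eqxx big1 ?addr0// => i ij.
        by rewrite (_ : (i : nat) == j = false)//; apply/negbTE.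
      rewrite big1// => i _; have := ltn_ord i => iN.
      by rewrite (_ : (i : nat) == j = false)//; apply/negbTE; lia.
    rewrite !big_split/=; have := one jm.-1; have := one jm; have := one jp.-1; have := one jp; lra.
  + move=> i; have [h|h] := boolP [|| i == jm.-1, i == jm, i == jp.-1 | i == jp].
      left; rewrite /sp -!natrD ler1n; move: h.
      by case: (i == jm.-1); case: (i == jm); case: (i == jp.-1); case: (i == jp).
    by right; rewrite !rN//; lia.
Qed.

End Grid.

(** * Cost and volume of the interpolated profile *)

Section DataSet.
Context {R : realType}.
Variable lambda : R.
Hypothesis hlambda : 1 < lambda.
Local Notation leb := (@lebesgue_measure R).
Local Notation RT := (measurableTypeR R).
Local Notation f := (strip_density lambda).
Local Notation psi := (fiber_density lambda).
Local Notation low := (low_density lambda).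
Local Notation cell_density := (cell_density lambda).
Local Notation slice_data := (slice_data lambda).

Lemma hypotenuse_le_sum (x y : R) : Num.sqrt (x ^+ 2 + y ^+ 2) <= `|x| + `|y|.
Proof.
rewrite -(@ler_pXn2r _ 2) ?nnegrE ?sqrtr_ge0 ?addr_ge0// sqr_sqrtr ?addr_ge0 ?sqr_ge0//.
rewrite sqrrD !real_normK ?num_real// -addrA [_ *+ 2 + _]addrC addrA lerDl mulrn_wge0// mulr_ge0//.
Qed.

Section GridData.
Variables (m L : R -> R) (Z : set R) (P delta eta : R) (x y sp : nat -> R).
Hypothesis D : slice_data m L Z P.
Hypotheses (delta0 : 0 < delta) (eta0 : 0 < eta).
Hypothesis yS : forall i, y i < y i.+1 /\ y i.+1 - y i <= 3 / 2 * eta.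
Hypothesis sep : forall i, separated (y i) (y i.+1).
Hypothesis hx : forall i, Z (x i) /\ (x i = x i.+1 \/ x i < x i.+1 /\ cell_density (y i) (y i.+1) <= low (x i) (x i.+1)).
Hypothesis sp0 : forall i, 0 <= sp i.
Hypothesis hsp : forall i, 1 <= sp i \/ x i = y i /\ x i.+1 = y i.+1.

Local Notation M i := (cell_density (y i) (y i.+1)).

Definition growth i := L (x i.+1) - L (x i).

(** A value below 1 certifies that [L] grows by less than [delta] over the cell and that its ends
    carry their own data; the sum of all values bounds the number of other cells. *)
Definition badness i := growth i / delta + sp i.

(** Subtracting [delta] ensures that a good cell with a positive end value is live at every generic
    height; the division by 2 turns a slice length into a half-width. *)
Definition node_value i := Num.max 0 ((m (x i) - delta) / 2).

Lemma growth_edge i : M i * `|m (x i.+1) - m (x i)| <= growth i.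
Proof.
have [Zi [e|[xx h]]] := hx i; first by rewrite /growth -e !subrr normr0 mulr0.
have [Zi' _] := hx i.+1.
apply: le_trans (slice_lip lambda hlambda _ _ _ _ D _ _ Zi Zi' (ltW xx)).
by rewrite ler_wpM2r.
Qed.

Lemma growth_ge0 i : 0 <= growth i.
Proof. by apply: le_trans (growth_edge i); rewrite mulr_ge0 ?cell_density_ge0. Qed.

Lemma badness_ge0 i : 0 <= badness i.
Proof. by rewrite addr_ge0// divr_ge0 ?growth_ge0// ltW. Qed.

Lemma good_cell i : badness i < 1 ->
  [/\ x i = y i, x i.+1 = y i.+1, growth i < delta, Z (y i) & Z (y i.+1)].
Proof.
move=> b1; have gd : 0 <= growth i / delta by rewrite divr_ge0 ?growth_ge0// ltW.
have s0 := sp0 i.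
have [h|[e1 e2]] := hsp i; first by move: b1; rewrite /badness; lra.
have [Zi _] := hx i; have [Zi' _] := hx i.+1; split=> //; rewrite -?e1 -?e2//.
rewrite -[delta]mul1r -ltr_pdivrMr//; move: b1; rewrite /badness; lra.
Qed.

Lemma good_cell_close i t : badness i < 1 -> Z t -> y i <= t <= y i.+1 ->
  `|m t - m (y i)| < delta /\ `|m t - m (y i.+1)| < delta.
Proof.
move=> b1 Zt /andP[t1 t2]; have [e1 e2 gd Zi Zi'] := good_cell i b1.
have h1 := slice_diff lambda hlambda _ _ _ _ D _ _ Zi Zt t1.
have h2 := slice_diff lambda hlambda _ _ _ _ D _ _ Zt Zi' t2.
have n1 : 0 <= `|m t - m (y i)| by []. have n2 : 0 <= `|m (y i.+1) - m t| by [].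
move: gd; rewrite /growth e1 e2 => gd; rewrite [`|m t - m (y i.+1)|]distrC; split; lra.
Qed.

Lemma node_value_ge0 i : 0 <= node_value i.
Proof. by rewrite le_max lexx. Qed.

Lemma node_value_gt0 i : 0 < node_value i -> delta < m (x i).
Proof. by rewrite lt_max ltxx/= pmulr_lgt0// subr_gt0. Qed.

Lemma node_value_diff i : 2 * `|node_value i.+1 - node_value i| <= `|m (x i.+1) - m (x i)|.
Proof.
rewrite /node_value; set a := m (x i.+1); set b := m (x i).
rewrite -ler_pdivlMl//.
case: (leP 0 ((a - delta) / 2)) => ha; case: (leP 0 ((b - delta) / 2)) => hb;
  have := ler_norm (a - b); have := ler_norm (b - a); rewrite (distrC b a) ?ler_norml; lra.
Qed.

Lemma live_cell_full i : badness i < 1 -> 0 < node_value i \/ 0 < node_value i.+1 ->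
  fine (leb (live m `&` `]y i, y i.+1[%classic)) = y i.+1 - y i.
Proof.
move=> b1 pos; have [e1 e2 gd Zi Zi'] := good_cell i b1; have [yy _] := yS i.
have hZ := slice_generic _ _ _ _ _ D.
suff -> : leb (live m `&` `]y i, y i.+1[%classic) = leb (`]y i, y i.+1[%classic : set RT).
  by rewrite lebesgue_measure_itv/= lte_fin yy.
apply/eqP; rewrite eq_le; apply/andP; split; first by apply: le_outer_measure => t [].
have [X [mX X0 hX]] := hZ.
apply: (@le_trans _ _ (leb ((live m `&` `]y i, y i.+1[%classic) `|` X))).
  apply: le_outer_measure => t tI; have [Zt|nZt] := pselect (Z t); last by right; exact: hX.
  left; split=> //; move: tI; rewrite /= in_itv/= => /andP[t1 t2].
  have ti : y i <= t <= y i.+1 by rewrite !ltW.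
  have [h1 h2] := good_cell_close i t b1 Zt ti.
  rewrite /live/=; case: pos => /node_value_gt0; rewrite ?e1 ?e2 => h.
    by move: h1; rewrite ltr_norml; lra.
  by move: h2; rewrite ltr_norml; lra.
apply: (@le_trans _ _ (leb (live m `&` `]y i, y i.+1[%classic) + leb X)%E).
  exact: outer_measureU2.
by rewrite X0 adde0.
Qed.

(** A good cell is fully live, so the edge condition of the data applies. On a bad cell the edge is
    replaced by its two legs: the growth pays for the horizontal one, and the badness, at least 1,
    for the vertical one. *)
Lemma cell_cost i : 0 < node_value i \/ 0 < node_value i.+1 ->
  M i * (2 * Num.sqrt ((y i.+1 - y i) ^+ 2 + (node_value i.+1 - node_value i) ^+ 2)) <=
    growth i + 3 * lambda * eta * badness i.
Proof.
move=> pos; have [yy yd] := yS i.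
have l0 : 0 < lambda by exact: lt_trans hlambda.
have [b1|b1] := leP 1 (badness i).
  apply: (@le_trans _ _ (M i * (2 * (y i.+1 - y i) + 2 * `|node_value i.+1 - node_value i|))).
    rewrite ler_wpM2l ?cell_density_ge0// -mulrDr ler_wpM2l//.
    by apply: le_trans (hypotenuse_le_sum _ _) _; rewrite gtr0_norm ?subr_gt0.
  rewrite mulrDr addrC; apply: lerD.
    apply: le_trans (growth_edge i); rewrite ler_wpM2l ?cell_density_ge0//; exact: node_value_diff.
  apply: (@le_trans _ _ (lambda * (3 * eta))).
    by apply: ler_pM; rewrite ?cell_density_ge0 ?cell_density_le ?mulr_ge0 ?subr_ge0 ?(ltW yy)//; lra.
  rewrite mulrA [lambda * 3]mulrC ler_peMr// ltW// !mulr_gt0//.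
have le0 : 0 <= 3 * lambda * eta * badness i by rewrite !mulr_ge0 ?badness_ge0// ltW.
have [e1 e2 gd Zi Zi'] := good_cell i b1.
apply: (@le_trans _ _ (growth i)); last by rewrite lerDl.
have full := live_cell_full i b1 pos.
have [_ [e|[_ hM]]] := hx i; first by move: yy; rewrite -e1 -e2 e ltxx.
rewrite e1 e2 in hM.
rewrite /growth e1 e2; apply: le_trans (slice_edge _ _ _ _ _ D _ _ Zi Zi' yy).
rewrite full; apply: ler_pM => //; rewrite ?cell_density_ge0 ?mulr_ge0 ?sqrtr_ge0//.
have -> : 2 * Num.sqrt ((y i.+1 - y i) ^+ 2 + (node_value i.+1 - node_value i) ^+ 2) =
    Num.sqrt ((2 * (y i.+1 - y i)) ^+ 2 + (2 * (node_value i.+1 - node_value i)) ^+ 2).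
  rewrite !exprMn -mulrDr sqrtrM ?sqr_ge0// sqrtr_sqr ger0_norm//.
rewrite ler_wsqrtr// lerD2l -[leLHS]real_normK ?num_real// -[leRHS]real_normK ?num_real//.
rewrite ler_pXn2r ?nnegrE// normrM ger0_norm// -e1 -e2; exact: node_value_diff.
Qed.

Lemma cell_len i : 0 < node_value i \/ 0 < node_value i.+1 ->
  y i.+1 - y i <= growth i + 3 / 2 * eta * badness i.
Proof.
move=> pos; have [yy yd] := yS i; have g0 := growth_ge0 i.
have e0 : 0 <= 3 / 2 * eta by rewrite mulr_ge0// ltW.
have [b1|b1] := leP 1 (badness i).
  have : 3 / 2 * eta * 1 <= 3 / 2 * eta * badness i by rewrite ler_wpM2l.
  lra.
have [e1 e2 gd Zi Zi'] := good_cell i b1.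
have := live_cell lambda hlambda _ _ _ _ D _ _ Zi Zi' yy; rewrite live_cell_full// -e1 -e2 -/(growth i).
have : 0 <= 3 / 2 * eta * badness i by rewrite mulr_ge0// badness_ge0.
move: yy; rewrite -e1 -e2; lra.
Qed.

(** On a bad cell m <= P is used; on a good cell m exceeds twice the smaller node value by at most 2
    delta. *)
Lemma cell_volume i t : Z t -> y i <= t <= y i.+1 ->
  psi t * m t <= M i * (2 * Num.min (node_value i) (node_value i.+1)) + lambda * P * badness i + 2 * delta * lambda.
Proof.
move=> Zt ti; have l0 : 0 <= lambda by rewrite ltW// (lt_trans ltr01).
have P0 := total_ge0 _ _ _ _ _ D.
have m0 := slice_ge0 _ _ _ _ _ D t; have mP := slice_le lambda hlambda _ _ _ _ D t Zt.
have hpsi : psi t <= M i by exact: (density_cell_le lambda hlambda _ _ (0, t) ti).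
have psi0 : 0 <= psi t by exact: (density_ge0 lambda hlambda (0, t)).
have min0 : 0 <= Num.min (node_value i) (node_value i.+1) by rewrite le_min !node_value_ge0.
have M0 : 0 <= M i by exact: cell_density_ge0.
have Ml : M i <= lambda by exact: cell_density_le.
have d0 : 0 <= 2 * delta * lambda by rewrite !mulr_ge0// ltW.
have a0 : 0 <= M i * (2 * Num.min (node_value i) (node_value i.+1)) by rewrite !mulr_ge0.
have lP : 0 <= lambda * P by rewrite mulr_ge0.
have [b1|b1] := leP 1 (badness i).
  have : psi t * m t <= lambda * P by apply: ler_pM => //; exact: le_trans hpsi Ml.
  have : lambda * P * 1 <= lambda * P * badness i by rewrite ler_wpM2l.
  lra.
have [e1 e2 gd Zi Zi'] := good_cell i b1.
have [h1 h2] := good_cell_close i t b1 Zt ti.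
have c0 : 0 <= lambda * P * badness i by rewrite mulr_ge0// badness_ge0.
have : m t <= 2 * Num.min (node_value i) (node_value i.+1) + 2 * delta.
  rewrite -lerBlDr -ler_pdivrMl// le_min /node_value e1 e2 !le_max.
  move: h1 h2; rewrite !ltr_norml => h1 h2; apply/andP; split; apply/orP; right; lra.
move=> h; have k1 : psi t * m t <= M i * m t by rewrite ler_wpM2r.
have k2 : M i * m t <= M i * (2 * Num.min (node_value i) (node_value i.+1) + 2 * delta) by rewrite ler_wpM2l.
have k3 : M i * (2 * delta) <= lambda * (2 * delta) by rewrite ler_wpM2r// mulr_ge0// ltW.
rewrite mulrDr in k2; lra.
Qed.

End GridData.
End DataSet.

Section DataSetTheorem.
Context {R : realType}.
Variable lambda : R.
Hypothesis hlambda : 1 < lambda.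
Local Notation leb := (@lebesgue_measure R).
Local Notation RT := (measurableTypeR R).
Local Notation f := (strip_density lambda).
Local Notation psi := (fiber_density lambda).
Local Notation slice_data := (slice_data lambda).

(** Almost everywhere the integrand is dominated by the step function [c] on the cells, plus [a] on
    [A], plus [b] on the part [B] beyond the grid. *)
Lemma data_set_volume N (y c : nat -> R) (A B : set RT) (m : R -> R) (Z : set R) (a b V : R) : (1 < N)%N ->
  (forall i, (i < N)%N -> y i < y i.+1) -> (forall i, 0 <= c i) -> 0 <= a -> 0 <= b ->
  measurable A -> measurable B -> {ae leb, forall t, Z t} ->
  measurable_fun setT (m : RT -> R) -> (forall t, 0 <= m t) ->
  (forall i t, (i < N)%N -> Z t -> y i <= t <= y i.+1 -> A t -> psi t * m t <= c i + a) ->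
  (forall t, ~ A t -> m t = 0) ->
  (forall t, Z t -> A t -> ~ (y 0 <= t <= y N) -> B t /\ psi t * m t <= b) ->
  (\int[leb]_t (psi t * m t)%:E = V%:E)%E ->
  (V%:E <= (\sum_(i < N) c i * (y i.+1 - y i))%:E + a%:E * leb A + b%:E * leb B)%E.
Proof.
move=> N1 hy c0 a0 b0 mA mB hZ mm m0 cell mA0 out <-.
pose I (i : nat) : set RT := `[y i, y i.+1]%classic.
have mI i : measurable (I i) by exact: measurable_itv.
have psi0 t : 0 <= psi t by exact: (density_ge0 lambda hlambda (0, t)).
pose F (t : RT) : R := \sum_(i < N) c i * (\1_(I i) t : R).
have F0 t : 0 <= F t by rewrite sumr_ge0// => i _; rewrite mulr_ge0.
have mF : measurable_fun setT F.
  apply: measurable_sum => i; apply: measurable_funM => //; exact: measurable_indic.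
have mi (C : set RT) (k : R) : measurable C -> measurable_fun setT (fun t : RT => k * (\1_C t : R)).
  by move=> mC; apply: measurable_funM => //; exact: measurable_indic.
have ik (C : set RT) (k : R) : measurable C -> 0 <= k ->
    (\int[leb]_t (k * (\1_C t : R))%:E = k%:E * leb C)%E.
  move=> mC k0; under eq_integral do rewrite EFinM.
  rewrite ge0_integralZl_EFin//; last by apply/measurable_EFinP; exact: measurable_indic.
  by rewrite integral_indic// setIT.
rewrite -(step_integral N y c true false hy c0) -(ik A a)// -(ik B b)//.
rewrite -ge0_integralD//; last first.
- by apply/measurable_EFinP; exact: mi.
- by move=> t _; rewrite lee_fin mulr_ge0.
- by apply/measurable_EFinP.
- by move=> t _; rewrite lee_fin F0.
rewrite -ge0_integralD//; last first.
- by apply/measurable_EFinP; exact: mi.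
- by move=> t _; rewrite lee_fin mulr_ge0.
- by apply: emeasurable_funD; apply/measurable_EFinP => //; exact: mi.
- by move=> t _; rewrite -EFinD lee_fin addr_ge0 ?F0 ?mulr_ge0.
apply: ae_ge0_le_integral => //.
- by move=> t _; rewrite lee_fin mulr_ge0.
- apply/measurable_EFinP; apply: measurable_funM => //; exact: fiber_density_measurable.
- by move=> t _; rewrite -!EFinD lee_fin addr_ge0 ?addr_ge0 ?F0 ?mulr_ge0.
- by apply: emeasurable_funD; [apply: emeasurable_funD|]; apply/measurable_EFinP => //; exact: mi.
have FF := ae_filter_ringOfSetsType leb.
apply: filterS hZ => t Zt _; rewrite -!EFinD lee_fin -/(F t).
have [At|nAt] := pselect (A t); last first.
  by rewrite mA0// mulr0 addr_ge0 ?addr_ge0 ?F0 ?mulr_ge0.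
have [yt|nyt] := pselect (y 0 <= t <= y N); last first.
  have [Bt h] := out t Zt At nyt; apply: le_trans h _.
  by rewrite [X in _ + b * X]indicE mem_set// mulr1 lerDr addr_ge0 ?F0 ?mulr_ge0.
have [i iN hi] := find_cell N y N1 t yt.
rewrite -[leLHS]addr0; apply: lerD; last by rewrite mulr_ge0.
apply: le_trans (cell i t iN Zt hi At) _.
rewrite [X in _ + a * X]indicE mem_set// mulr1 lerD2r /F (bigD1 (Ordinal iN))//=.
rewrite indicE mem_set ?mulr1; last by rewrite /I/= in_itv/= hi.
by rewrite lerDl sumr_ge0// => j _; rewrite mulr_ge0.
Qed.

(** The polygon has cost at most P + e/8 and volume above V - e2, hence a ratio of cost to volume
    below [kappa]; and [e2] is so small that kappa V <= P + e/2. *)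
Theorem data_set (m L : R -> R) (Z : set R) (P V e : R) : slice_data m L Z P ->
  (\int[leb]_t (psi t * m t)%:E = V%:E)%E -> 0 < V -> 0 < e ->
  exists (G : set (R * R)) (W : R -> R), [/\ smooth_set G,
    (boundary_integral f G <= (P + e)%:E)%E, weighted_volume f G = V%:E,
    forall y, slice G y = `]- W y, W y[%classic /\ 0 <= W y <= P + e &
    forall y, 2 + P < `|y| -> W y = 0].
Proof.
move=> D hV V0 e0; have P0 := total_ge0 _ _ _ _ _ D.
have l0 : 0 < lambda by exact: lt_trans hlambda.
have l00 := ltW l0.
have lP0 : 0 <= lambda * P by rewrite mulr_ge0.
have Pe0 : 0 <= P + e / 2 by rewrite addr_ge0// divr_ge0// ltW.
have eV0 : 0 < e / 4 * V by rewrite mulr_gt0// divr_gt0.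
have V20 : 0 < V / 2 by rewrite divr_gt0.
have [e2' e2'0 he2'] := exists_small _ _ Pe0 eV0.
have [e2 [e20 e2e e2V]] := exists_min2 _ _ e2'0 V20.
have he2 : (P + e / 2) * e2 <= e / 4 * V by apply: le_trans he2'; rewrite ler_wpM2l.
pose kappa := (P + e / 4) / (V - e2).
have Ve2 : 0 < V - e2 by lra.
have kappa0 : 0 < kappa by rewrite divr_gt0// ltr_wpDl// divr_gt0.
have kappaV : kappa * V <= P + e / 2.
  rewrite /kappa -mulrAC ler_pdivrMr//.
  have -> : (P + e / 2) * (V - e2) = P * V + e / 2 * V - (P + e / 2) * e2 by ring.
  have -> : (P + e / 4) * V = P * V + e / 2 * V - e / 4 * V by field.
  by rewrite lerD2l lerN2.
have e24 : 0 < e2 / 4 by rewrite divr_gt0.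
(* Lowering the profile by [delta] loses volume at most 2 delta lambda times the live measure, which
   is at most P / 2. *)
have [delta delta0 hdelta] := exists_small _ _ lP0 e24.
(* Bound for the total badness: P / delta from the growth, 4 from the cells at the strip
   boundaries. *)
pose Nb := P / delta + 4.
have Nb0 : 0 <= Nb by rewrite addr_ge0// divr_ge0// ltW.
(* Collects the errors of the bad cells that are proportional to the mesh: in cost, in height and in
   volume. *)
pose Ct := 3 * lambda * Nb + 3 / 2 * Nb + lambda * P * Nb * (3 / 2).
have C1 : 0 <= 3 * lambda * Nb by rewrite !mulr_ge0.
have C2 : 0 <= 3 / 2 * Nb by rewrite mulr_ge0.
have C3 : 0 <= lambda * P * Nb * (3 / 2) by rewrite !mulr_ge0.
have Ct0 : 0 <= Ct by rewrite !addr_ge0.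
have [b1 [b10 b1e b11]] := exists_min2 (e / 8) 1 (divr_gt0 e0 (ltr0n _ 8)) ltr01.
have [b2 [b20 b2b b2e]] := exists_min2 _ _ b10 e24.
have [c c0 hc] := exists_small _ _ Ct0 b20.
pose n := (Num.truncn c^-1).+2.
have n0 : 0 < n%:R :> R by rewrite ltr0n.
pose eta : R := n%:R^-1; have eta0 : 0 < eta by rewrite invr_gt0.
have etac : eta <= c.
  rewrite -[c]invrK lef_pV2 ?posrE ?invr_gt0//.
  by apply: ltW; apply: lt_le_trans (truncnS_gt _) _; rewrite ler_nat.
have Cteta : Ct * eta <= b2 by apply: le_trans hc; rewrite ler_wpM2l.
have CtE : Ct * eta = 3 * lambda * eta * Nb + 3 / 2 * eta * Nb + lambda * P * Nb * (3 / 2 * eta) by rewrite /Ct; ring.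
have h1 : 0 <= 3 * lambda * eta * Nb by rewrite !mulr_ge0// ltW.
have h2 : 0 <= 3 / 2 * eta * Nb by rewrite !mulr_ge0// ltW.
have h3 : 0 <= lambda * P * Nb * (3 / 2 * eta) by rewrite !mulr_ge0// ltW.
have k1 : 3 * lambda * eta * Nb <= e / 8 by lra.
have k2 : 3 / 2 * eta * Nb <= 1 by lra.
have k3 : lambda * P * Nb * (3 / 2 * eta) <= e2 / 4 by lra.
have [t1 t10 ht1] := exists_small _ _ lP0 e24.
have tn0 : 0 < (2 * n%:R)^-1 :> R by rewrite invr_gt0 mulr_gt0.
have [t [t0 tt1 ttn]] := exists_min2 _ _ t10 tn0.
have [K0 hK0] := finite_tail (live m) t (live_measurable lambda m L Z P D) (live_finite lambda hlambda m L Z P D) t0.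
pose K := K0.+2.
have tail : (leb (live m `\` window K.-1) < t%:E)%E by exact: hK0.
have [|y [x [sp /= [yS sep hx [mx0 mxN y0 yN] [sp0 spN hsp]]]]] :=
  grid_nodes lambda hlambda m L Z P n K D isT isT.
  by apply: lt_le_trans tail _; rewrite lee_fin.
set N := (2 * K * n)%N in mxN yN spN.
have N1 : (1 < N)%N.
  by apply: (@leq_trans (2 * 1 * 1)%N) => //; rewrite /N -!mulnA leq_mul// leq_mul.
have hZx i : Z (x i) by have [] := hx i.
have yS' i : y i < y i.+1 by have [] := yS i.
pose bad := badness L delta x sp. pose q := node_value m delta x.
have bad0 i : 0 <= bad i by exact: (badness_ge0 lambda hlambda m L Z P delta x y sp D).
have g0 i : 0 <= growth L x i by exact: (growth_ge0 lambda hlambda m L Z P x y D).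
have sumg : \sum_(i < N) growth L x i <= P.
  rewrite -(big_mkord xpredT (growth L x)) /growth (telescope_sumr (fun i => L (x i)) (leq0n N)).
  apply: (slice_total _ _ _ _ _ D) => //; elim: (N) => [//|k IH]; apply: le_trans IH _.
  by have [_ [->//|[/ltW]]] := hx k.
have sumbad : \sum_(i < N) bad i <= Nb.
  by rewrite big_split/= -mulr_suml lerD// ler_wpM2r// invr_ge0 ltW.
pose c' i := cell_density lambda (y i) (y i.+1) * (2 * Num.min (q i) (q i.+1)) + lambda * P * bad i.
have c'0 i : 0 <= c' i.
  by rewrite addr_ge0// mulr_ge0 ?cell_density_ge0// mulr_ge0// le_min !node_value_ge0.
have q0 : q 0%N = 0 by apply/max_idPl; rewrite mx0 sub0r pmulr_lle0// oppr_le0 ltW.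
have qN : q N = 0 by apply/max_idPl; rewrite mxN sub0r pmulr_lle0// oppr_le0 ltW.
have mlive := live_measurable lambda m L Z P D.
have dl0 : 0 <= 2 * delta * lambda by rewrite !mulr_ge0// ltW.
have vol := data_set_volume N y c' (live m) (live m `\` window K.-1) m Z (2 * delta * lambda) (lambda * P) V
  N1 (fun i _ => yS' i) c'0 dl0 lP0 mlive.
have {}vol : (V%:E <= (\sum_(i < N) c' i * (y i.+1 - y i))%:E + (2 * delta * lambda)%:E * leb (live m) +
    (lambda * P)%:E * leb (live m `\` window K.-1))%E.
  apply: vol => //.
  - by apply: measurableD => //; exact: measurable_itv.
  - exact: slice_generic D.
  - exact: slice_mfun D.
  - exact: slice_ge0 D.
  - move=> i s _ Zs ys _.
    exact: (cell_volume lambda hlambda m L Z P delta x y sp D delta0 hx sp0 hsp i s Zs ys).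
  - move=> s ns; apply/eqP; rewrite eq_le (slice_ge0 _ _ _ _ _ D) andbT leNgt; exact/negP.
  - move=> s Zs ms nys; split.
      split=> //; rewrite /window/= in_itv/= => /andP[s1 s2]; apply: nys.
      by rewrite (le_trans y0 s1) (le_trans s2 yN).
    apply: ler_pM => //.
    + exact: (density_ge0 lambda hlambda (0, s)).
    + exact: slice_ge0 D s.
    + exact: (density_le lambda hlambda (0, s)).
    + exact: (slice_le lambda hlambda m L Z P D).
pose U := \sum_(i < N) cell_density lambda (y i) (y i.+1) * (y i.+1 - y i) * (2 * Num.min (q i) (q i.+1)).
have sumc' : \sum_(i < N) c' i * (y i.+1 - y i) <= U + lambda * P * Nb * (3 / 2 * eta).
  apply: (@le_trans _ _ (\sum_(i < N) (cell_density lambda (y i) (y i.+1) * (y i.+1 - y i) * (2 * Num.min (q i) (q i.+1)) +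
      lambda * P * bad i * (3 / 2 * eta)))).
    apply: ler_sum => i _; rewrite /c' mulrDl; apply: lerD; first by rewrite mulrAC.
    by rewrite ler_wpM2l ?mulr_ge0//; have [] := yS i.
  rewrite big_split/= lerD2l -mulr_suml -mulr_sumr ler_wpM2r ?mulr_ge0 ?(ltW eta0)//.
  by rewrite ler_wpM2l.
have volU : V - e2 < U.
  have hl : (leb (live m) <= (P / 2)%:E)%E by exact: live_le D.
  have : (V%:E <= (U + lambda * P * Nb * (3 / 2 * eta) + 2 * delta * lambda * (P / 2) + lambda * P * t)%:E)%E.
    apply: le_trans vol _; rewrite 2!EFinD; apply: leeD; first apply: leeD.
    + by rewrite lee_fin.
    + by rewrite [leRHS]EFinM; apply: lee_wpmul2l; rewrite // lee_fin.
    + by rewrite [leRHS]EFinM; apply: lee_wpmul2l; rewrite ?lee_fin//; exact: ltW.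
  rewrite lee_fin; have : lambda * P * t <= e2 / 4.
    by apply: le_trans ht1; rewrite ler_wpM2l.
  have -> : 2 * delta * lambda * (P / 2) = lambda * P * delta by field.
  lra.
pose cst i := growth L x i + 3 * lambda * eta * bad i.
pose len i := growth L x i + 3 / 2 * eta * bad i.
have e30 : 0 <= 3 * lambda * eta by rewrite !mulr_ge0// ltW.
have e320 : 0 <= 3 / 2 * eta by rewrite mulr_ge0// ltW.
have yS2 i : y i < y i.+1 /\ y i.+1 - y i <= 3 / 2 * eta by exact: yS.
have [||||||||G [W [sG bG vG slG outG]]] := polygon_set lambda hlambda N y q cst len (P + e / 8) (P + 1) kappa V (e / 2)
  (fun i _ => yS' i) (fun i _ => sep i) _ q0 qN _ _ _ _ _ _ V0 (divr_gt0 e0 (ltr0n _ 2)) kappa0.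
- by move=> i; exact: node_value_ge0.
- by move=> i; rewrite addr_ge0// mulr_ge0.
- move=> i _ pos.
  exact: (cell_cost lambda hlambda m L Z P delta eta x y sp D delta0 eta0 yS2 hx sp0 hsp i pos).
- rewrite big_split/= lerD// -mulr_sumr; apply: le_trans k1; by rewrite ler_wpM2l.
- by move=> i; rewrite addr_ge0// mulr_ge0.
- move=> i _ pos.
  exact: (cell_len lambda hlambda m L Z P delta eta x y sp D delta0 eta0 yS2 hx sp0 hsp i pos).
- rewrite big_split/= lerD// -mulr_sumr; apply: le_trans k2; by rewrite ler_wpM2l.
- apply: (@lt_trans _ _ (kappa * (V - e2))); last by rewrite ltr_pM2l.
  by rewrite /kappa divfK ?gt_eqF//; clear -e0; lra.
have mx : Num.max (P + e / 8) (kappa * V) + e / 2 <= P + e.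
  by rewrite -lerBrDr ge_max; clear -kappaV e0; apply/andP; split; lra.
exists G, W; split=> //.
- by apply: le_trans bG _; rewrite lee_fin.
- by move=> s; have [a1 /andP[a2 a3]] := slG s; rewrite a2 (le_trans a3).
- by move=> s hs; apply: outG; clear -hs; lra.
Qed.

End DataSetTheorem.

(** * Existence *)

Section PlaneSets.
Context {R : realType}.
Variable lambda : R.
Hypothesis hlambda : 1 < lambda.
Local Notation leb := (@lebesgue_measure R).
Local Notation RT := (measurableTypeR R).
Local Notation f := (strip_density lambda).
Local Notation psi := (fiber_density lambda).
Local Notation low := (low_density lambda).
Local Notation slice_data := (slice_data lambda).
Implicit Types (F G : set (RT * RT)).

Definition slice_length F (y : R) : R := fine (leb (slice F y)).

Lemma boundary_integral_ge0 F : (0 <= boundary_integral f F)%E.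
Proof. by apply: integral_ge0 => p _; rewrite lee_fin density_ge0. Qed.

Lemma area_le_volume F : measurable F -> (area R F <= weighted_volume f F)%E.
Proof.
move=> mF; have -> : area R F = (\int[area R]_(p in F) 1%:E)%E.
  by rewrite integral_cst ?mul1e.
apply: ge0_le_integral => //.
- exact: densityE_measurable.
- by move=> p _; rewrite lee_fin density_ge1.
Qed.

Lemma volume_le_area F : measurable F -> (weighted_volume f F <= lambda%:E * area R F)%E.
Proof.
move=> mF; have l0 : 0 <= lambda by rewrite ltW// (lt_trans ltr01).
rewrite -integral_cst//; apply: ge0_le_integral => //.
- by move=> p _; rewrite lee_fin density_ge0.
- exact: densityE_measurable.
- by move=> p _; rewrite lee_fin density_le.
Qed.

Lemma slice_finite_volume F (v : R) : measurable F -> weighted_volume f F = v%:E -> (area R F < +oo)%E.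
Proof. by move=> mF hv; apply: le_lt_trans (area_le_volume F mF) _; rewrite hv ltry. Qed.

Lemma slice_length_measurable F : measurable F -> measurable_fun setT (slice_length F : RT -> R).
Proof.
move=> mF; apply: (measurableT_comp (f := fine)); last exact: slice_volume_measurable.
exact: fine_measurable.
Qed.

Lemma volume_slice_length F : measurable F -> (area R F < +oo)%E ->
  (weighted_volume f F = \int[leb]_y (psi y * slice_length F y)%:E)%E.
Proof.
move=> mF aF; rewrite volume_slices//; apply: ae_eq_integral => //.
- apply: emeasurable_funM; last exact: slice_volume_measurable.
  by apply/measurable_EFinP; exact: fiber_density_measurable.
- apply/measurable_EFinP; apply: measurable_funM; first exact: fiber_density_measurable.
  exact: slice_length_measurable.
have FF := ae_filter_ringOfSetsType leb.
apply: filterS (ae_slice_finite F mF aF) => y fy _.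
by rewrite EFinM fineK// ge0_fin_numE.
Qed.

Lemma slice_length_symdiff F y y' : measurable F -> (leb (slice F y) < +oo)%E -> (leb (slice F y') < +oo)%E ->
  `|slice_length F y' - slice_length F y| <= fine (leb (slice F y `+` slice F y')).
Proof.
move=> mF fy fy'.
have my := slice_measurable F y mF; have my' := slice_measurable F y' mF.
have h1 := measure_symdiff _ _ my my'; have h2 := measure_symdiff _ _ my' my.
rewrite setYC in h2.
have fd : (leb (slice F y `+` slice F y') < +oo)%E.
  apply: (@le_lt_trans _ _ (leb (slice F y) + leb (slice F y'))%E); last exact: lte_add_pinfty.
  apply: (@le_trans _ _ (leb (slice F y `|` slice F y'))); last exact: outer_measureU2.
  by apply: le_outer_measure => x [[? _]|[? _]]; [left|right].
move: h1 h2; rewrite /slice_length.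
rewrite -(fineK (_ : leb (slice F y) \is a fin_num)) ?ge0_fin_numE//.
rewrite -(fineK (_ : leb (slice F y') \is a fin_num)) ?ge0_fin_numE//.
rewrite -(fineK (_ : leb (slice F y `+` slice F y') \is a fin_num)) ?ge0_fin_numE//.
rewrite -!EFinD !lee_fin /= ler_norml; lra.
Qed.

Lemma live_slice_length F y y' : live (slice_length F) `&` `]y, y'[%classic = thick 0 y y' F.
Proof.
apply/seteqP; split=> t; rewrite /live /slice_length /thick /= in_itv/=.
  move=> [h ->]; split=> //.
  have [foo|foo] := ltP (leb (slice F t)) +oo%E; last first.
    by move: h; move: foo; rewrite leye_eq => /eqP ->; rewrite /= ltxx.
  by split=> //; rewrite -[X in (_ < X)%E]fineK ?lte_fin// ge0_fin_numE.
move=> [-> [h foo]]; split=> //; rewrite -lte_fin fineK// ge0_fin_numE//.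
Qed.

Lemma perimeter_data F (P : R) : measurable F -> (area R F < +oo)%E ->
  weighted_perimeter f F = P%:E ->
  exists (L : R -> R) (Z : set RT), [/\ slice_data (slice_length F) L Z P, forall y, 0 <= L y <= P,
    forall y, Z y -> (leb (slice F y) < +oo)%E &
    forall y y' r1 r2, Z y -> Z y' -> y < y' ->
      low y y' * Num.sqrt ((2 * fine (leb (live (slice_length F) `&` `]y, y'[%classic)) +
         2 * fine (leb (gapped 0 y y' r1 r2 F))) ^+ 2 +
         fine (leb (slice F y `+` slice F y')) ^+ 2) <= L y' - L y].
Proof.
move=> mF aF PF; have [L [Z [hL hZ fZ edge]]] := lower_bound lambda hlambda F P mF aF PF.
exists L, Z; split=> //; last by move=> y y' r1 r2 Zy Zy' yy'; rewrite live_slice_length; exact: edge.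
split=> //.
- by move=> y; rewrite fine_ge0.
- exact: slice_length_measurable.
- by move=> y y' _ _ _; have := hL y; have := hL y'; lra.
move=> y y' Zy Zy' yy'; apply: le_trans (edge y y' 0 0 Zy Zy' yy').
rewrite ler_wpM2l ?low_density_ge0// ler_wsqrtr// live_slice_length.
have a0 : 0 <= fine (leb (thick 0 y y' F)) by rewrite fine_ge0.
have b0 : 0 <= fine (leb (gapped 0 y y' 0 0 F)) by rewrite fine_ge0.
apply: lerD; first by rewrite ler_pXn2r ?nnegrE ?addr_ge0 ?mulr_ge0// lerDl mulr_ge0.
rewrite -[leLHS]real_normK ?num_real// ler_pXn2r ?nnegrE ?fine_ge0//.
by apply: slice_length_symdiff => //; exact: fZ.
Qed.

Lemma weighted_perimeter_smooth G : smooth_set G ->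
  (weighted_perimeter f G <= boundary_integral f G)%E.
Proof.
move=> sG; apply: ereal_inf_lbound; exists (fun=> G); last first.
  have c : (fun _ : nat => boundary_integral f G) @ \oo --> boundary_integral f G by exact: cvg_cst.
  by rewrite is_cvg_limn_einfE; [exact: cvg_lim c|apply/cvg_ex; eexists; exact: c].
split=> //; rewrite /cvg_L1 (_ : (fun h => _) = cst 0%E); first exact: cvg_cst.
by apply/funext => h; rewrite setYK measure0.
Qed.

Lemma weighted_perimeter_ge0 F : (0 <= weighted_perimeter f F)%E.
Proof.
apply: le_ereal_inf_tmp => _ [Eh _ <-]; rewrite leNgt; apply/negP => h.
by have [n _] := limn_einf_lt _ _ 0%N h; rewrite ltNge boundary_integral_ge0.
Qed.

(** A rounded trapezoid above the strip, scaled to volume [v]; it shows that the infimum of the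
    perimeter is finite. *)
Lemma competitor (v : R) : 0 < v ->
  exists G : set (R * R), [/\ smooth_set G, (boundary_integral f G < +oo)%E & weighted_volume f G = v%:E].
Proof.
move=> v0; have l0 : 0 < lambda by exact: lt_trans hlambda.
pose z (i : nat) : R := i%:R + 1. pose q (i : nat) : R := if (i == 1%N) || (i == 2%N) then 1 else 0.
pose cst (i : nat) := lambda * (2 * Num.sqrt (1 + (q i.+1 - q i) ^+ 2)).
have zS i : z i.+1 - z i = 1 by rewrite /z -natr1; ring.
have hz i : z i < z i.+1 by rewrite -subr_gt0 zS.
have hz1 i : 1 <= z i by rewrite /z lerDr.
have cd i : (0 < i)%N -> cell_density lambda (z i) (z i.+1) = lambda.
  move=> i0; rewrite /cell_density ifF//; apply/negbTE; rewrite negb_and orbC -ltNge.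
  by rewrite (le_lt_trans (hz1 i)).
pose C := \sum_(i < 3) cst i.
have cst0 i : 0 <= cst i by rewrite !mulr_ge0 ?sqrtr_ge0// ltW.
have C0 : 0 <= C by rewrite sumr_ge0.
have [|||||||||G [W [sG bG vG _ _]]] := polygon_set lambda hlambda 3 z q cst (fun=> 1) C 3 (C + 1) v 1
  (fun i _ => hz i) _ _ erefl erefl cst0 _ _ _ _ _ v0 ltr01 _.
- by move=> i _; rewrite /separated hz1 orbT.
- by move=> i; rewrite /q; case: ifP.
- move=> i _ _; rewrite zS expr1n /cst ler_wpM2r ?mulr_ge0 ?sqrtr_ge0//; exact: cell_density_le.
- exact: lexx.
- by [].
- by move=> i _ _; rewrite zS.
- by rewrite sumr_const card_ord.
- by rewrite ltr_wpDl.
- apply: (@lt_le_trans _ _ ((C + 1) * 1)); first by rewrite mulr1 ltrDl.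
  rewrite ler_wpM2l ?addr_ge0// (bigD1 (Ordinal (isT : (1 < 3)%N)))//= cd// zS /q/= minxx !mulr1.
  rewrite -[leLHS]addr0; apply: lerD; first by move: hlambda; lra.
  rewrite sumr_ge0// => i _; rewrite zS !mulr_ge0 ?cell_density_ge0// le_min.
  by apply/andP; split; case: ifP.
by exists G; split=> //; exact: le_lt_trans bG (ltry _).
Qed.

End PlaneSets.

(** * Compactness of symmetrised minimising sequences *)

Section Existence.
Context {R : realType}.
Variable lambda : R.
Hypothesis hlambda : 1 < lambda.
Local Notation leb := (@lebesgue_measure R).
Local Notation RT := (measurableTypeR R).
Local Notation f := (strip_density lambda).
Local Notation slice_data := (slice_data lambda).
Implicit Types (F G : set (RT * RT)).

(** The limit is the set-theoretic lower limit: a point on which it disagrees with [G k] changes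
    membership at some step after k, and these steps have summable area. *)
Lemma L1_limit (G : nat -> set (RT * RT)) : (forall n, measurable (G n)) ->
  (forall n, (area R (G n `+` G n.+1) <= (2^-1 ^+ n.+1)%:E)%E) ->
  exists E, measurable E /\ forall n, (area R (G n `+` E) <= (2^-1 ^+ n)%:E)%E.
Proof.
move=> mG hG.
pose E := \bigcup_k \bigcap_l G (k + l)%N.
have mD n : measurable (G n `+` G n.+1) by exact: symdiff_measurable.
exists E; split.
  by apply: bigcupT_measurable => k; apply: bigcapT_measurable => l; exact: mG.
move=> k.
have sub : G k `+` E `<=` \bigcup_l (G (k + l)%N `+` G (k + l).+1).
  move=> p hp; apply: contrapT => np.
  have st l : G (k + l)%N p <-> G k p.
    elim: l => [|l IH]; first by rewrite addn0.
    rewrite addnS -IH; split=> h; apply: contrapT => h'; apply: np; exists l => //; [by right|by left].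
  case: hp => [[Gk nE]|[[j _ hj] nGk]].
    by apply: nE; exists k => // l _; apply/st.
  apply: nGk; apply/(st j); have := hj k I; by rewrite addnC.
have mE : measurable E.
  by apply: bigcupT_measurable => j; apply: bigcapT_measurable => l; exact: mG.
apply: (@le_trans _ _ (area R (\bigcup_l (G (k + l)%N `+` G (k + l).+1)))).
  apply: le_measure; rewrite ?inE//; first exact: symdiff_measurable.
  exact: bigcupT_measurable.
apply: (@le_trans _ _ (\sum_(0 <= l <oo) area R (G (k + l)%N `+` G (k + l).+1))%E).
  by apply: measure_sigma_subadditive => //; exact: bigcupT_measurable.
have k0 : 0 <= 2^-1 ^+ k :> R by rewrite exprn_ge0.
apply: le_trans (epsilon_trick0 xpredT k0).
apply: lee_nneseries => [n _ _|n _]; first exact: measure_ge0.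
by apply: le_trans (hG _) _; rewrite lee_fin -addnS exprD [X in _ * X]exprVn natrX.
Qed.

Lemma symmetric_intervals (a b : R) : 0 <= a -> 0 <= b ->
  let J (c : R) : set RT := `]- c, c[%classic in (leb (J a `+` J b) <= (2 * `|a - b|)%:E)%E.
Proof.
rewrite /=; wlog ab : a b / a <= b => [h|].
  move=> a0 b0; have [ab|ab] := leP a b; first exact: h.
  by rewrite setYC distrC; apply: h => //; exact: ltW.
move=> a0 b0; rewrite distrC ger0_norm ?subr_ge0//.
pose J1 : set RT := `[- b, - a]%classic; pose J2 : set RT := `[a, b]%classic.
apply: (@le_trans _ _ (leb (J1 `|` J2))).
  apply: le_outer_measure => x [[]|[]] /=; rewrite in_itv/= => /andP[h1 h2] h3.
    by exfalso; apply: h3; rewrite /= ?in_itv/=; apply/andP; split; lra.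
  have [h|h] := leP x (- a); first by left; rewrite /J1/= in_itv/= (ltW h1).
  right; rewrite /J2/= in_itv/= (ltW h2) andbT leNgt; apply/negP => h'; apply: h3; by rewrite /= ?in_itv/= h h'.
apply: (@le_trans _ _ (leb J1 + leb J2)%E).
  exact: outer_measureU2.
rewrite /J1 /J2 !lebesgue_measure_itv/= !lte_fin; do 2 (case: ifP => _); rewrite -?EFinB -?EFinD ?adde0 ?add0e lee_fin; lra.
Qed.

Lemma slab_nodes (Z : set R) (K n : nat) : {ae leb, forall y, Z y} -> (0 < n)%N ->
  exists y : nat -> R, let N := (2 * K * n).+1 in
  [/\ forall i, Z (y i), forall i, y i < y i.+1 /\ y i.+1 - y i <= 2 / n%:R,
      y 0 <= - K%:R & K%:R <= y N].
Proof.
move=> hZ n0; have n0' : 0 < n%:R :> R by rewrite ltr0n.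
pose eta : R := n%:R^-1; have eta0 : 0 < eta by rewrite invr_gt0.
pose s (j : nat) : R := - K%:R - eta + j%:R * eta.
have /choice[y hy] : forall j, exists t, Z t /\ s j < t < s j + eta.
  move=> j; have [|t Zt ht] := generic_point Z (s j) (s j + eta) hZ; first by rewrite ltrDl.
  by exists t.
have sS j : s j.+1 = s j + eta by rewrite /s -natr1 mulrDl mul1r addrA.
exists y; split=> [i|i||]; first by have [] := hy i.
- have [_ /andP[h1 h2]] := hy i; have [_ /andP[]] := hy i.+1; rewrite sS -/eta => h3 h4.
  split; lra.
- have [_ /andP[_]] := hy 0%N; rewrite /s mul0r; lra.
have [_ /andP[+ _]] := hy (2 * K * n).+1.
rewrite /s -natr1 mulrDl mul1r !natrM -mulrA divff ?gt_eqF//; lra.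
Qed.

(** At finitely many generic nodes the slice lengths converge along the ultrafilter. Between nodes
    they vary by at most the increment of [L], and the increments sum to at most [Q], so their
    contribution is of the order of the mesh times [Q]. For centred intervals the length determines
    the slice. *)
Lemma cauchy_ultra (U : set_system nat) (G : nat -> set (RT * RT)) (W L : nat -> R -> R)
    (Z : nat -> set R) (Q B e : R) : UltraFilter U ->
  (forall n, measurable (G n)) ->
  (forall n y, slice (G n) y = `]- W n y, W n y[%classic /\ 0 <= W n y) ->
  (forall n y, B < `|y| -> W n y = 0) ->
  (forall n, slice_data (slice_length (G n)) (L n) (Z n) Q) -> 0 < e ->
  exists2 A, U A & forall n k, A n -> A k -> (area R (G n `+` G k) <= e%:E)%E.
Proof.
move=> UF mG sG out D e0.
have PU : ProperFilter U by exact: ultra_proper.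
have Q0 := total_ge0 _ _ _ _ _ (D 0%N).
pose Zc : set R := [set y | forall n, Z n y].
have hZ : {ae leb, forall y, Zc y}.
  by apply: ae_foralln => n; exact: slice_generic (D n).
have mW n y : slice_length (G n) y = 2 * W n y.
  rewrite /slice_length; have [-> W0] := sG n y; rewrite lebesgue_measure_itv/= lte_fin.
  by case: ifPn => [_|]; rewrite -?EFinB/=; [ring|rewrite -leNgt => h; lra].
pose K := (Num.truncn B).+1.
have BK : B < K%:R by exact: truncnS_gt.
have Q80 : 0 <= 8 * Q by rewrite mulr_ge0.
have [c c0 hc] := exists_small _ _ Q80 e0.
pose n := (Num.truncn c^-1).+1.
have n0 : 0 < n%:R :> R by rewrite ltr0n.
pose eta : R := n%:R^-1; have eta0 : 0 < eta by rewrite invr_gt0.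
have etac : eta <= c.
  rewrite -[c]invrK lef_pV2 ?posrE ?invr_gt0//; exact/ltW/truncnS_gt.
have heta : 8 * Q * eta <= e by apply: le_trans hc; rewrite ler_wpM2l.
have [y /= [Zy yS y0 yN]] := slab_nodes Zc K n hZ isT.
set N := (2 * K * n).+1 in yN.
have N1 : (1 < N)%N by rewrite /N ltnS !muln_gt0.
have yS' i : y i < y i.+1 by have [] := yS i.
(* The tolerance at the nodes is chosen after their number, since it is paid once per cell. *)
have [th th0 hth] := exists_small (4 * eta * N%:R) e (mulr_ge0 (mulr_ge0 (ler0n _ 4) (ltW eta0)) (ler0n _ N)) e0.
have th2 : 0 < th / 2 by rewrite divr_gt0.
pose m k := slice_length (G k).
have /choice[l hl] : forall i : nat, exists l : R, m k (y i) @[k --> U] --> l.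
  move=> i; have [|l _ h] := @ultra_bounded_cvg R U (fun k => m k (y i)) Q UF; last by exists l.
  by move=> k; rewrite (slice_ge0 _ _ _ _ _ (D k))/= (slice_le lambda hlambda _ _ _ _ (D k))//; exact: Zy.
pose A : set nat := [set k | forall i, (i < N)%N -> `|l i - m k (y i)| < th / 2].
have UA : U A.
  rewrite /A; elim: (N) => [|N' IH]; first by apply: filterS filterT => k _ i.
  have := hl N' => /cvgrPdist_lt /(_ _ th2) h.
  apply: filterS2 IH h => k h1 h2 i; rewrite ltnS leq_eqVlt => /orP[/eqP -> //|]; exact: h1.
exists A => // j k Aj Ak.
pose g j i := L j (y i.+1) - L j (y i).
have close j' i t : Zc t -> y i <= t <= y i.+1 -> `|m j' t - m j' (y i)| <= g j' i.
  move=> Zt /andP[t1 t2].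
  have h1 := slice_diff lambda hlambda _ _ _ _ (D j') _ _ (Zy i j') (Zt j') t1.
  have h2 := slice_total_mono lambda hlambda _ _ _ _ (D j') _ _ (Zt j') (Zy i.+1 j') t2.
  by apply: le_trans h1 _; rewrite lerB.
have g0 j' i : 0 <= g j' i.
  by rewrite subr_ge0 (slice_total_mono lambda hlambda _ _ _ _ (D j'))//; [exact: Zy|exact: Zy|exact: ltW].
have sumg j' : \sum_(i < N) g j' i <= Q.
  rewrite -(big_mkord xpredT (g j')) /g (telescope_sumr (fun i => L j' (y i)) (leq0n N)).
  apply: (slice_total _ _ _ _ _ (D j')); [exact: Zy|exact: Zy|].
  by apply: (node_le N y (fun i _ => yS' i)); rewrite leqnn.
pose c' i := g j i + g k i + th.
have c'0 i : 0 <= c' i by rewrite addr_ge0 ?(ltW th0)// addr_ge0.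
have mGG : measurable (G j `+` G k) by exact: symdiff_measurable.
rewrite area_slices//.
apply: (@le_trans _ _ (\sum_(i < N) c' i * (y i.+1 - y i))%:E); last first.
  rewrite lee_fin; apply: (@le_trans _ _ (\sum_(i < N) c' i * (2 * eta))).
    by apply: ler_sum => i _; rewrite ler_wpM2l//; have [] := yS i.
  rewrite -mulr_suml 2!big_split/= sumr_const card_ord.
  apply: (@le_trans _ _ ((Q + Q + th *+ N) * (2 * eta))).
    have e20 : 0 <= 2 * eta by rewrite mulr_ge0// ltW.
    by apply: ler_wpM2r => //; rewrite lerD2r; exact: lerD (sumg j) (sumg k).
  rewrite -[th *+ N]mulr_natr.
  have -> : (Q + Q + th * N%:R) * (2 * eta) = (8 * Q * eta) / 2 + (4 * eta * N%:R * th) / 2 by field.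
  lra.
have mc (b : R) (I : interval R) : measurable_fun setT (fun t : RT => b * (\1_([set` I] : set RT) t : R)).
  by apply: measurable_funM => //; apply: measurable_indic; exact: measurable_itv.
rewrite -(step_integral N y c' true false (fun i _ => yS' i) c'0).
apply: ae_ge0_le_integral => //.
- exact: slice_volume_measurable.
- by move=> t _; rewrite lee_fin sumr_ge0// => i _; rewrite mulr_ge0.
- apply/measurable_EFinP; apply: measurable_sum => i; exact: mc.
have FF := ae_filter_ringOfSetsType leb.
apply: filterS hZ => t Zt _.
have -> : slice (G j `+` G k) t = slice (G j) t `+` slice (G k) t by [].
have [-> Wj0] := sG j t; have [-> Wk0] := sG k t.
apply: le_trans (symmetric_intervals _ _ Wj0 Wk0) _; rewrite lee_fin.
have [tB|tB] := ltP B `|t|.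
  by rewrite !out// subr0 normr0 mulr0 sumr_ge0// => i _; rewrite mulr_ge0.
have yt : y 0 <= t <= y N.
  have : - K%:R <= t <= K%:R by rewrite -ler_norml (le_trans tB)// ltW.
  move=> /andP[h1 h2]; by rewrite (le_trans y0 h1) (le_trans h2 yN).
have [i iN hi] := find_cell N y N1 t yt.
have -> : 2 * `|W j t - W k t| = `|m j t - m k t|.
  by rewrite /m !mW -mulrBr normrM ger0_norm.
apply: (@le_trans _ _ (c' i)).
  have h1 := close j i t Zt hi; have h2 := close k i t Zt hi.
  have h3 := Aj i iN; have h4 := Ak i iN; rewrite /c'.
  have -> : m j t - m k t = (m j t - m j (y i)) - (m k t - m k (y i)) - (l i - m j (y i)) + (l i - m k (y i)) by ring.
  apply: le_trans (ler_normD _ _) _; rewrite (_ : th = th / 2 + th / 2); last by field.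
  rewrite addrA; apply: lerD; last exact: ltW.
  apply: le_trans (ler_normB _ _) _; apply: lerD; last exact: ltW.
  by apply: le_trans (ler_normB _ _) _; apply: lerD.
rewrite (bigD1 (Ordinal iN))//= indicE mem_set ?mulr1; last by rewrite /= in_itv/= hi.
by rewrite lerDl sumr_ge0// => i' _; rewrite mulr_ge0.
Qed.

Lemma volume_symdiff F G : measurable F -> measurable G ->
  (weighted_volume f F <= weighted_volume f G + lambda%:E * area R (F `+` G))%E.
Proof.
move=> mF mG; have mD := symdiff_measurable F G mF mG.
apply: (@le_trans _ _ (weighted_volume f (G `|` (F `\` G)))).
  apply: ge0_subset_integral => //.
  - by apply: measurableU => //; exact: measurableD.
  - exact: densityE_measurable.
  - by move=> p _; rewrite lee_fin density_ge0.
  - by move=> p Fp; have [Gp|Gp] := pselect (G p); [left|right].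
rewrite /weighted_volume ge0_integral_setU//; last first.
- by apply/disj_setPS => p [Gp []].
- by move=> p _; rewrite lee_fin density_ge0.
- exact: densityE_measurable.
- exact: measurableD.
apply: leeD => //; apply: le_trans (volume_le_area lambda hlambda _ (measurableD mF mG)) _.
apply: lee_wpmul2l; first by rewrite lee_fin ltW// (lt_trans ltr01).
apply: le_measure; rewrite ?inE//; first exact: measurableD.
by move=> p [Fp Gp]; left.
Qed.

Lemma volume_limit (E : set (RT * RT)) (G : nat -> set (RT * RT)) (v : R) : measurable E ->
  (forall n, measurable (G n)) -> (forall n, weighted_volume f (G n) = v%:E) ->
  (forall n, (area R (G n `+` E) <= (2^-1 ^+ n)%:E)%E) -> weighted_volume f E = v%:E.
Proof.
move=> mE mG vG aG; have l0 : 0 < lambda by exact: lt_trans hlambda.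
have small (e : R) : 0 < e -> exists n, (lambda%:E * area R (G n `+` E) <= e%:E)%E.
  move=> e0; have [c c0 hc] := exists_small lambda e (ltW l0) e0.
  have /cvgrPdist_lt /(_ c c0) [N _ hN] : (fun n => 2^-1 ^+ n : R) @ \oo --> 0.
    by apply: cvg_expr; rewrite ger0_norm// invf_lt1// ltr1n.
  exists N; have := hN N (leqnn N); rewrite sub0r normrN ger0_norm ?exprn_ge0// => h.
  apply: (@le_trans _ _ (lambda%:E * c%:E)%E); last by rewrite -EFinM lee_fin.
  apply: lee_wpmul2l; first by rewrite lee_fin ltW.
  by apply: le_trans (aG N) _; rewrite lee_fin ltW.
apply/eqP; rewrite eq_le; apply/andP; split; apply/lee_addgt0Pr => e e0; have [n hn] := small e e0.
  apply: le_trans (volume_symdiff _ _ mE (mG n)) _; rewrite vG setYC; exact: leeD.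
rewrite -(vG n); apply: le_trans (volume_symdiff _ _ (mG n) mE) _; exact: leeD.
Qed.

Lemma limn_einf_le (u : nat -> \bar R) (I : R) :
  (forall n, (u n <= (I + 2 / n.+1%:R)%:E)%E) -> (limn_einf u <= I%:E)%E.
Proof.
move=> hu; apply/lee_addgt0Pr => e e0; rewrite leNgt; apply/negP => h.
have [N Ne] : exists N : nat, 2 / e < N.+1%:R by exists (Num.truncn (2 / e)); exact: truncnS_gt.
have lo n : (N <= n)%N -> (u n < I%:E + e%:E)%E.
  move=> Nn; apply: le_lt_trans (hu n) _; rewrite -EFinD lte_fin ltrD2l ltr_pdivrMr//.
  rewrite mulrC -ltr_pdivrMr//; apply: lt_le_trans Ne _; by rewrite ler_nat.
move: h; rewrite ltNge => /negP; apply.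
rewrite limn_einf_lim; apply: lime_le; first exact: is_cvg_einfs.
exists N => // n Nn; apply: (@le_trans _ _ (u n)); last exact/ltW/lo.
by apply: ereal_inf_lbound; exists n => //=.
Qed.

(** Each member of a minimising sequence is replaced by a smooth set with centred slices in a fixed
    box; a subsequence is Cauchy in L^1 and serves itself as the approximating sequence that bounds
    the perimeter of its limit by [I]. *)
Theorem isoperimetric_exists (v : R) : 0 < v -> exists E : set (R * R), isoperimetric f v E.
Proof.
move=> v0; pose S := [set weighted_perimeter f F | F in
  [set F : set (R * R) | measurable F /\ weighted_volume f F = v%:E]].
have [C [sC bC vC]] := competitor lambda hlambda v v0.
have mC : measurable (C : set (RT * RT)) by apply: open_measurable2; case: sC.
have S0 : (0 <= ereal_inf S)%E.
  by apply: le_ereal_inf_tmp => _ [F _ <-]; exact: weighted_perimeter_ge0.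
have Sfin : ereal_inf S \is a fin_num.
  rewrite ge0_fin_numE//; apply: le_lt_trans bC.
  apply: le_trans (weighted_perimeter_smooth lambda C sC).
  by apply: ereal_inf_lbound; exists C.
set I := fine (ereal_inf S).
have SI : ereal_inf S = I%:E by rewrite fineK.
have I0 : 0 <= I by rewrite fine_ge0.
have inv0 n : 0 < n.+1%:R^-1 :> R by rewrite invr_gt0.
have inv1 n : n.+1%:R^-1 <= 1 :> R by rewrite invf_le1// ler1n.
have /choice[G hG] : forall n : nat, exists G : set (RT * RT), exists W : R -> R, [/\ smooth_set G,
    (boundary_integral f G <= (I + 2 / n.+1%:R)%:E)%E, weighted_volume f G = v%:E,
    forall y, slice G y = `]- W y, W y[%classic /\ 0 <= W y & forall y, 4 + I < `|y| -> W y = 0].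
  move=> n; have [_ [F [mF vF] <-] hF] := lb_ereal_inf_adherent (inv0 n) Sfin.
  have aF := slice_finite_volume lambda hlambda F v mF vF.
  rewrite SI -EFinD in hF.
  have PF : weighted_perimeter f F \is a fin_num.
    by rewrite ge0_fin_numE ?weighted_perimeter_ge0// (lt_trans hF)// ltry.
  rewrite -(fineK PF) lte_fin in hF.
  have [L [Z [D _ _ _]]] := perimeter_data lambda hlambda F _ mF aF (esym (fineK PF)).
  have hv := volume_slice_length lambda hlambda F mF aF; rewrite vF in hv.
  have [G [W [sG bG vG slG oG]]] := data_set lambda hlambda _ _ _ _ v _ D (esym hv) v0 (inv0 n).
  exists G, W; split=> //.
  - apply: le_trans bG _; rewrite lee_fin; move: hF (inv0 n); move: (n.+1%:R^-1) (fine _) => x P hF hx; lra.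
  - by move=> y; have [? /andP[]] := slG y.
  - move=> y hy; apply: oG; move: hF (inv1 n) hy; move: (n.+1%:R^-1) (fine _) => x P hF hx hy; lra.
have /choice[W hW] := hG.
have sG n : smooth_set (G n) by have [] := hW n.
have bG n : (boundary_integral f (G n) <= (I + 2 / n.+1%:R)%:E)%E by have [] := hW n.
have vG n : weighted_volume f (G n) = v%:E by have [] := hW n.
have mG n : measurable (G n) by apply: open_measurable2; have [] := sG n.
have slG n y : slice (G n) y = `]- W n y, W n y[%classic /\ 0 <= W n y by have [_ _ _ h _] := hW n; exact: h.
have oG n y : 4 + I < `|y| -> W n y = 0 by have [_ _ _ _ h] := hW n; exact: h.
have /choice[L hL] : forall n : nat, exists L : R -> R, exists Z : set R, slice_data (slice_length (G n)) L Z (I + 2).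
  move=> n; have aG := slice_finite_volume lambda hlambda (G n) v (mG n) (vG n).
  have P0 := weighted_perimeter_ge0 lambda hlambda (G n).
  have PG : (weighted_perimeter f (G n) <= (I + 2)%:E)%E.
    apply: le_trans (weighted_perimeter_smooth lambda _ (sG n)) _; apply: le_trans (bG n) _.
    by rewrite lee_fin lerD2l -[leRHS]mulr1 ler_wpM2l.
  have PF : weighted_perimeter f (G n) \is a fin_num by rewrite ge0_fin_numE// (le_lt_trans PG)// ltry.
  have [L [Z [D _ _ _]]] := perimeter_data lambda hlambda (G n) _ (mG n) aG (esym (fineK PF)).
  exists L, Z; case: D => d1 d2 d3 d4 d5; split=> // y y' Zy Zy' yy'.
  by apply: le_trans (d4 y y' Zy Zy' yy') _; rewrite -lee_fin fineK.
have /choice[Z D] := hL.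
have [U [UF oU]] := ultraFilterLemma (eventually_filter : ProperFilter \oo).
have PU : ProperFilter U by exact: ultra_proper.
have pow0 n : 0 < 2^-1 ^+ n.+1 :> R by rewrite exprn_gt0.
have /choice[A hA] : forall j : nat, exists A : set nat, U A /\ forall n k, A n -> A k ->
    (area R (G n `+` G k) <= (2^-1 ^+ j.+1)%:E)%E.
  move=> j; have [A UA h] := cauchy_ultra U G W L Z (I + 2) (4 + I) _ UF mG slG oG D (pow0 j).
  by exists A.
(* Diagonal choice: [s j] and [s j.+1] both lie in [A j], so consecutive sets differ by area at most
   2^-(j+1), and s j >= j keeps the perimeters converging to [I]. *)
have /choice[s hs] : forall j, exists n, (j <= n)%N /\ forall i, (i <= j)%N -> A i n.
  move=> j.
  have h1 : U [set n | (j <= n)%N] by apply: oU; exists j.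
  have h2 : U [set n | forall i, (i <= j)%N -> A i n].
    elim: j {h1} => [|j IH]; first by apply: filterS (hA 0%N).1 => n An i; rewrite leqn0 => /eqP ->.
    apply: filterS2 IH (hA j.+1).1 => n h3 h4 i; rewrite leq_eqVlt => /orP[/eqP -> //|]; exact: h3.
  by have [n [h3 h4]] := filter_ex (filterI h1 h2); exists n.
have [|E [mE hE]] := L1_limit (fun j => G (s j)) (fun j => mG (s j)).
  move=> j; apply: (hA j).2; first by apply: (hs j).2.
  by apply: (hs j.+1).2.
have vE : weighted_volume f E = v%:E by exact: (volume_limit E (fun j => G (s j)) v mE).
exists E; split; [exact: mE|exact: vE|move=> F mF vF].
apply: (@le_trans _ _ I%:E); last by rewrite -SI; apply: ereal_inf_lbound; exists F.
apply: (@le_trans _ _ (limn_einf (fun j => boundary_integral f (G (s j))))); last first.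
  apply: limn_einf_le => j; apply: le_trans (bG (s j)) _.
  by rewrite lee_fin lerD2l ler_wpM2l// lef_pV2 ?posrE// ler_nat ltnS; exact: (hs j).1.
apply: ereal_inf_lbound; exists (fun j => G (s j)); last by [].
split; first by move=> j; exact: sG.
rewrite /cvg_L1; apply: (squeeze_cvge _ (cvg_cst 0%E)) (_ : (fun n => (2^-1 ^+ n)%:E) @ \oo --> 0%E).
  by apply: nearW => j; rewrite measure_ge0 hE.
apply: cvg_EFin; first exact: nearW.
by apply: cvg_expr; rewrite ger0_norm// invf_lt1// ltr1n.
Qed.

End Existence.

(** * Strict gains *)

Section Gains.
Context {R : realType}.
Variable lambda : R.
Hypothesis hlambda : 1 < lambda.
Local Notation leb := (@lebesgue_measure R).
Local Notation RT := (measurableTypeR R).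
Local Notation f := (strip_density lambda).
Local Notation psi := (fiber_density lambda).
Local Notation low := (low_density lambda).
Local Notation slice_data := (slice_data lambda).

(* Both gains come from (p - theta r)^2 >= 0 after multiplying by twice the longer hypotenuse. *)
Lemma hypotenuse_gain (theta r r' p : R) : 0 <= r' -> r' <= r -> p ^+ 2 <= r ^+ 2 - r' ^+ 2 ->
  r' <= (1 + theta ^+ 2 / 2) * r - theta * p.
Proof.
move=> r'0 r'r hp; have r0 : 0 <= r by exact: le_trans r'r.
move: r0; rewrite le_eqVlt => /orP[/eqP r0|r0].
  have r'e : r' = 0 by apply/eqP; rewrite eq_le r'0 r0 r'r.
  move: hp; rewrite -r0 r'e expr0n subrr => hp.
  have -> : p = 0 by apply/eqP; rewrite -sqrf_eq0 eq_le hp sqr_ge0.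
  by rewrite !mulr0 subr0.
have h1 : (r - r') * (r + r') <= (r - r') * (2 * r) by rewrite ler_wpM2l ?subr_ge0//; lra.
have h2 := sqr_ge0 (p - theta * r).
rewrite -(@ler_pM2r _ (2 * r)) ?mulr_gt0//.
have e1 : (r - r') * (r + r') = r ^+ 2 - r' ^+ 2 by ring.
have e2 : (p - theta * r) ^+ 2 = p ^+ 2 - 2 * (theta * p * r) + theta ^+ 2 * r ^+ 2 by ring.
have e3 : ((1 + theta ^+ 2 / 2) * r - theta * p) * (2 * r) =
   2 * r ^+ 2 + theta ^+ 2 * r ^+ 2 - 2 * (theta * p * r) by field.
have e4 : (r - r') * (2 * r) = 2 * r ^+ 2 - r' * (2 * r) by ring.
rewrite e3; rewrite e4 e1 in h1; rewrite e2 in h2.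
move: hp h1 h2; move: (p ^+ 2) (r ^+ 2) (r' ^+ 2) (theta * p * r) (r' * (2 * r)) => A B C D E.
move: (theta ^+ 2 * B) => X; lra.
Qed.

Lemma hypotenuse_extend (theta a p b : R) : 0 <= a -> 0 <= p ->
  Num.sqrt (a ^+ 2 + b ^+ 2) <=
    (1 + theta ^+ 2 / 2) * Num.sqrt ((a + p) ^+ 2 + b ^+ 2) - theta * p.
Proof.
move=> a0 p0; have ap : 0 <= 2 * a * p by rewrite !mulr_ge0.
have e : (a + p) ^+ 2 = a ^+ 2 + p ^+ 2 + 2 * a * p by ring.
apply: hypotenuse_gain; first exact: sqrtr_ge0.
  by rewrite ler_wsqrtr// lerD2r e -addrA lerDl addr_ge0// sqr_ge0.
rewrite !sqr_sqrtr ?addr_ge0 ?sqr_ge0// e.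
by have := sqr_ge0 p; move: (p ^+ 2) (a ^+ 2) (b ^+ 2) ap => P A B ap; lra.
Qed.

(** The square of t times the old hypotenuse exceeds the square of the stretched one by (t^2 - 1)
    a^2; linearising this difference with [hypotenuse_gain] gives the coefficient. *)
Definition stretch_gain (t : R) : R := (t ^+ 2 - 1) / (2 * t).

Lemma hypotenuse_stretch (t theta a b : R) : 1 <= t -> 0 <= a ->
  Num.sqrt (a ^+ 2 + (t * b) ^+ 2) <=
    (t + stretch_gain t * theta ^+ 2) * Num.sqrt (a ^+ 2 + b ^+ 2) - 2 * stretch_gain t * theta * a.
Proof.
move=> t1 a0; have t0 : 0 < t by exact: lt_le_trans t1.
have s2 : 0 <= t ^+ 2 - 1 by rewrite subr_ge0 exprn_ege1.
pose k := Num.sqrt (t ^+ 2 - 1).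
set r := Num.sqrt (a ^+ 2 + b ^+ 2).
have r0 : 0 <= r by exact: sqrtr_ge0.
have k0 : 0 <= k by exact: sqrtr_ge0.
have kk : k ^+ 2 = t ^+ 2 - 1 by rewrite sqr_sqrtr.
have := hypotenuse_gain (k / t * theta) (t * r) (Num.sqrt (a ^+ 2 + (t * b) ^+ 2)) (k * a) (sqrtr_ge0 _).
have -> : (1 + (k / t * theta) ^+ 2 / 2) * (t * r) - k / t * theta * (k * a) =
  (t + stretch_gain t * theta ^+ 2) * r - 2 * stretch_gain t * theta * a.
  by rewrite /stretch_gain -kk; field; rewrite gt_eqF.
apply.
  exact: edge_scale.
rewrite exprMn kk exprMn !sqr_sqrtr ?addr_ge0 ?sqr_ge0// exprMn le_eqVlt; apply/orP; left; apply/eqP; ring.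
Qed.

Definition cut (A : set RT) (y : R) : R := fine (leb (A `&` `]-oo, y[%classic)).

Lemma cut_diff (A : set RT) (y y' : R) : measurable A -> (leb A < +oo)%E -> y < y' ->
  cut A y' - cut A y = fine (leb (A `&` `]y, y'[%classic)).
Proof.
move=> mA Aoo yy'.
pose B : set RT := `]-oo, y[%classic; pose C : set RT := `[y, y'[%classic; pose C' : set RT := `]y, y'[%classic.
have mB : measurable B by exact: measurable_itv. have mC : measurable C by exact: measurable_itv.
have mC' : measurable C' by exact: measurable_itv.
have fin (D : set RT) : leb (A `&` D) \is a fin_num.
  by rewrite ge0_fin_numE// (le_lt_trans _ Aoo)//; apply: le_outer_measure => t [].
have e1 : (leb (A `&` `]-oo, y'[%classic) = leb (A `&` B) + leb (A `&` C))%E.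
  rewrite -measureU; [|exact: measurableI|exact: measurableI|].
    congr (leb _); rewrite -setIUr; congr (_ `&` _); apply/seteqP; split=> t; rewrite /B/C/= !in_itv/=.
      by move=> ty'; case: (ltP t y) => h; [left|right].
    by case=> [h|/andP[]//]; exact: lt_trans yy'.
  apply/seteqP; split=> // t [[_ Bt] [_ Ct]]; move: Bt Ct; rewrite /B /C /= !in_itv/= => h /andP[h' _].
  by move: (lt_le_trans h h'); rewrite ltxx.
have e2 : (leb (A `&` C) = leb (A `&` C'))%E.
  apply/eqP; rewrite eq_le; apply/andP; split; last first.
    by apply: le_outer_measure => t [At]; rewrite /C/C'/= !in_itv/= => /andP[h1 h2]; split=> //; rewrite /= ?in_itv/= ltW.
  apply: (@le_trans _ _ (leb ((A `&` C') `|` [set y]))).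
    apply: le_outer_measure => t [At]; rewrite /C/C'/= !in_itv/= => /andP[h1 h2].
    move: h1; rewrite le_eqVlt => /orP[/eqP <-|h1]; [by right|left; split=> //=].
    by rewrite ?in_itv/= h1.
  apply: (@le_trans _ _ (leb (A `&` C') + leb [set y])%E); first exact: outer_measureU2.
  by rewrite lebesgue_measure_set1 adde0.
by rewrite /cut e1 e2 fineD// addrAC subrr add0r.
Qed.

(** If every edge estimate improves by [eta] times the measure of [A] in its cell, then k L - eta
    [cut A] is still monotone on [Z], and the improvements add up to the whole measure of [A]. *)
Lemma gain_data (m m' L : R -> R) (Z : set R) (P k eta : R) (A : set RT) : slice_data m L Z P ->
  measurable A -> (leb A < +oo)%E -> 0 <= k -> 0 <= eta ->
  (forall y, 0 <= m' y) -> measurable_fun setT (m' : RT -> R) ->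
  (forall y y', Z y -> Z y' -> y < y' ->
    low y y' * Num.sqrt ((2 * fine (leb (live m' `&` `]y, y'[%classic))) ^+ 2 + (m' y' - m' y) ^+ 2)
      <= k * (L y' - L y) - eta * fine (leb (A `&` `]y, y'[%classic))) ->
  slice_data m' (fun y => k * L y - eta * cut A y) Z (k * P - eta * fine (leb A)).
Proof.
move=> D mA Aoo k0 eta0 m'0 mm' edge; have hZ := slice_generic _ _ _ _ _ D.
set L' := fun y => k * L y - eta * cut A y.
have L'E y y' : y < y' -> L' y' - L' y = k * (L y' - L y) - eta * fine (leb (A `&` `]y, y'[%classic)).
  by move=> yy'; rewrite -cut_diff// /L'; ring.
have mono y y' : Z y -> Z y' -> y < y' -> L' y <= L' y'.
  move=> Zy Zy' yy'; rewrite -subr_ge0 L'E//; apply: le_trans (edge y y' Zy Zy' yy').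
  by rewrite mulr_ge0 ?low_density_ge0 ?sqrtr_ge0.
split=> //; last by move=> y y' Zy Zy' yy'; rewrite L'E//; exact: edge.
move=> y y' Zy Zy' yy'; apply/ler_addgt0Pr => e e0.
have [d d0 hd] := exists_small eta e eta0 e0.
have [K hK] := finite_tail A d mA Aoo d0.
(* By monotonicity the interval may be enlarged until it contains [A] up to measure [d]. *)
have [|ym Zym /andP[_ ym1]] := generic_point Z (Num.min y (- K%:R) - 1) (Num.min y (- K%:R)) hZ.
  by rewrite ltrBlDr ltrDl.
have [|yp Zyp /andP[yp1 _]] := generic_point Z (Num.max y' K%:R) (Num.max y' K%:R + 1) hZ.
  by rewrite ltrDl.
move: ym1 yp1; rewrite lt_min gt_max => /andP[ymy ymK] /andP[y'yp Kyp].
have ymyp : ym < yp by apply: lt_trans ymy (le_lt_trans yy' y'yp).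
have h1 := mono _ _ Zym Zy ymy; have h2 := mono _ _ Zy' Zyp y'yp.
have h3 := slice_total _ _ _ _ _ D _ _ Zym Zyp (ltW ymyp).
apply: (@le_trans _ _ (L' yp - L' ym)); first by lra.
rewrite L'E// -addrA; apply: lerD; first by rewrite ler_wpM2l.
suff : eta * fine (leb A) <= eta * fine (leb (A `&` `]ym, yp[%classic)) + eta * d by move: hd; lra.
rewrite -mulrDr ler_wpM2l//.
have fA : leb A \is a fin_num by rewrite ge0_fin_numE.
have fI : leb (A `&` `]ym, yp[%classic) \is a fin_num.
  by rewrite ge0_fin_numE// (le_lt_trans _ Aoo)//; apply: le_outer_measure => t [].
rewrite -lee_fin EFinD !fineK//.
apply: (@le_trans _ _ (leb (A `&` `]ym, yp[%classic) + leb (A `\` window K))%E); last first.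
  by apply: leeD => //; exact/ltW/hK.
apply: (@le_trans _ _ (leb ((A `&` `]ym, yp[%classic) `|` (A `\` window K)))); last exact: outer_measureU2.
apply: le_outer_measure => t At; have [Wt|nWt] := pselect (window K t); [left|by right].
split=> //; move: Wt; rewrite /window/= !in_itv/= => /andP[w1 w2].
by rewrite (lt_le_trans ymK w1) (le_lt_trans w2 Kyp).
Qed.

Lemma live_scale (t : R) (m : R -> R) : 0 < t -> live (fun y => t * m y) = live m.
Proof. by move=> t0; apply/seteqP; split=> y; rewrite /live/= pmulr_rgt0. Qed.

(** Horizontal stretching leaves the vertical leg of every edge unchanged, which saves an amount
    proportional to the live measure compared with the factor [t]. *)
Lemma scale_data (m L : R -> R) (Z : set R) (P t theta : R) : slice_data m L Z P ->
  1 <= t -> 0 <= theta -> exists L', slice_data (fun y => t * m y) L' Z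
    ((t + stretch_gain t * theta ^+ 2) * P - 4 * stretch_gain t * theta * fine (leb (live m))).
Proof.
move=> D t1 th0; have t0 : 0 < t by exact: lt_le_trans t1.
have g0 : 0 <= stretch_gain t.
  by rewrite divr_ge0 ?mulr_ge0 ?(ltW t0)// subr_ge0 exprn_ege1.
have gt0 : 0 <= 4 * stretch_gain t * theta.
  by apply: mulr_ge0 => //; apply: mulr_ge0.
have k0 : 0 <= t + stretch_gain t * theta ^+ 2.
  by apply: addr_ge0; [exact: ltW|apply: mulr_ge0 => //; exact: sqr_ge0].
have ml := live_measurable _ _ _ _ _ D. have fl := live_finite lambda hlambda _ _ _ _ D.
eexists; apply: (gain_data m _ L Z P _ _ (live m) D) => //.
- by move=> y; rewrite mulr_ge0 ?(ltW t0)//; exact: slice_ge0 D y.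
- by apply: measurable_funM => //; exact: slice_mfun D.
move=> y y' Zy Zy' yy'; rewrite live_scale//.
have a0 : 0 <= fine (leb (live m `&` `]y, y'[%classic)) by rewrite fine_ge0.
set a := fine _ in a0 *.
have lw := low_density_ge1 lambda hlambda y y'.
rewrite -mulrBr; apply: (@le_trans _ _ (low y y' * ((t + stretch_gain t * theta ^+ 2) *
    Num.sqrt ((2 * a) ^+ 2 + (m y' - m y) ^+ 2) - 2 * stretch_gain t * theta * (2 * a)))).
  rewrite ler_wpM2l ?low_density_ge0//; apply: hypotenuse_stretch => //; by rewrite mulr_ge0.
rewrite mulrBr mulrCA; apply: lerB; first by rewrite ler_wpM2l//; exact: slice_edge D _ _ Zy Zy' yy'.
rewrite (_ : 2 * stretch_gain t * theta * (2 * a) = 4 * stretch_gain t * theta * a); last by ring.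
by rewrite ler_peMl// mulr_ge0.
Qed.

Section Minimizer.
Variables (F : set (RT * RT)) (v I : R).
Hypothesis v0 : 0 < v.
Hypothesis isoF : isoperimetric f v F.
Hypothesis perF : weighted_perimeter f F = I%:E.

Lemma minimal (m L : R -> R) (Z : set R) (P : R) : slice_data m L Z P ->
  (\int[leb]_t (psi t * m t)%:E = v%:E)%E -> I <= P.
Proof.
move=> D hv; apply/ler_addgt0Pr => e e0.
have [G [W [sG bG vG _ _]]] := data_set lambda hlambda m L Z P v e D hv v0 e0.
have [_ _ minF] := isoF.
rewrite -lee_fin -perF; apply: le_trans bG; apply: le_trans (weighted_perimeter_smooth lambda _ sG).
by apply: minF => //; apply: open_measurable2; case: sG.
Qed.

Lemma minimal_scale (m L : R -> R) (Z : set R) (P v' theta : R) : slice_data m L Z P ->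
  (\int[leb]_t (psi t * m t)%:E = v'%:E)%E -> 0 < v' -> v' <= v -> 0 <= theta -> let t := v / v' in
  I <= (t + stretch_gain t * theta ^+ 2) * P - 4 * stretch_gain t * theta * fine (leb (live m)).
Proof.
move=> D hv v'0 v'v th0 /=; set t := v / v'.
have t1 : 1 <= t by rewrite ler_pdivlMr// mul1r.
have [L' D'] := scale_data m L Z P t theta D t1 th0.
apply: (minimal _ _ _ _ D').
have psi0 y : 0 <= psi y by exact: (density_ge0 lambda hlambda (0, y)).
under eq_integral do rewrite mulrCA EFinM.
rewrite ge0_integralZl_EFin//.
- by rewrite hv -EFinM /t divfK// gt_eqF.
- by move=> y _; rewrite lee_fin mulr_ge0//; exact: slice_ge0 D y.
- apply/measurable_EFinP; apply: measurable_funM; first exact: fiber_density_measurable.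
  exact: slice_mfun D.
- exact: le_trans t1.
Qed.

(** The case theta = 0 of [minimal_scale]: at smaller volumes the cost per volume is never below I /
    v. *)
Lemma minimal_part (m L : R -> R) (Z : set R) (P v' : R) : slice_data m L Z P ->
  (\int[leb]_t (psi t * m t)%:E = v'%:E)%E -> 0 < v' -> v' <= v -> I * v' <= P * v.
Proof.
move=> D hv v'0 v'v; have := minimal_scale m L Z P v' 0 D hv v'0 v'v (lexx 0).
by rewrite /= expr0n /= !mulr0 mul0r addr0 subr0 mulrAC ler_pdivlMr// [v * P]mulrC.
Qed.

Lemma live_gt0 (m L : R -> R) (Z : set R) (P v' : R) : slice_data m L Z P ->
  (\int[leb]_t (psi t * m t)%:E = v'%:E)%E -> 0 < v' -> 0 < fine (leb (live m)).
Proof.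
move=> D hv v'0; have fl := live_finite lambda hlambda _ _ _ _ D.
rewrite lt_neqAle fine_ge0// andbT; apply/negP => /eqP l0.
have lz : leb (live m) = 0%E by rewrite -[LHS]fineK ?ge0_fin_numE// -l0.
have : (\int[leb]_t (psi t * m t)%:E = 0)%E.
  rewrite -(integral0 leb setT); apply: ae_eq_integral => //.
    apply/measurable_EFinP; apply: measurable_funM; first exact: fiber_density_measurable.
    exact: slice_mfun D.
  exists (live m); split=> //; first exact: live_measurable D.
  move=> t /= nt; rewrite /live/= lt_neqAle (slice_ge0 _ _ _ _ _ D) andbT; apply/negP => /eqP h.
  by apply: nt => _; rewrite -h mulr0.
by rewrite hv => -[] h; move: v'0; rewrite h ltxx.
Qed.

(** The gain [d] depends on the profile and the volumes but not on [L], [Z] or [P], so it can be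
    fixed before a cut is made. The value of [th] maximises 4 th s - th^2 (I + 1), where I + 1 is
    the allowed bound for [P]. *)
Lemma minimal_part_strict (m : R -> R) (v' : R) :
  (\int[leb]_t (psi t * m t)%:E = v'%:E)%E -> 0 < v' -> v' < v -> 0 <= I ->
  exists2 d, 0 < d & forall L Z P, slice_data m L Z P -> P <= I + 1 -> I * v' + d <= P * v.
Proof.
move=> hv v'0 v'v I0; have I1 : 0 < I + 1 by rewrite ltr_wpDl.
pose t := v / v'; pose s := fine (leb (live m)); pose th := 2 * s / (I + 1).
have t0 : 0 < t by rewrite divr_gt0.
have t1 : 1 < t by rewrite ltr_pdivlMr// mul1r.
have g0 : 0 < stretch_gain t.
  by apply: divr_gt0; [rewrite subr_gt0 exprn_egt1|rewrite mulr_gt0].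
have [s0|s0] := leP s 0.
  exists 1 => // L Z P D _.
  by have := live_gt0 m L Z P v' D hv v'0; rewrite ltNge -/s s0.
have th0 : 0 < th by rewrite divr_gt0// mulr_gt0.
exists (2 * stretch_gain t * th * s * v').
  do 3 (apply: mulr_gt0 => //); exact: mulr_gt0.
move=> L Z P D PI; have := minimal_scale m L Z P v' th D hv v'0 (ltW v'v) (ltW th0).
rewrite /= -/t -/s.
have h : th ^+ 2 * P <= 2 * th * s.
  apply: (@le_trans _ _ (th ^+ 2 * (I + 1))); first by rewrite ler_wpM2l ?sqr_ge0.
  have -> : th ^+ 2 * (I + 1) = th * (2 * s); last by rewrite mulrA [th * 2]mulrC.
  by rewrite expr2 -mulrA; congr (_ * _); rewrite /th divfK// gt_eqF.
have h' : stretch_gain t * (th ^+ 2 * P) <= stretch_gain t * (2 * th * s) by rewrite ler_wpM2l// ltW.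
have tv : t * v' = v by rewrite /t divfK// gt_eqF.
move=> h2; have : I * v' <= ((t * P - 2 * stretch_gain t * th * s)) * v'.
  rewrite ler_pM2r//; apply: le_trans h2 _; rewrite mulrDl -mulrA.
  move: h'; rewrite (_ : stretch_gain t * (2 * th * s) = 2 * stretch_gain t * th * s); last by ring.
  rewrite (_ : 4 * stretch_gain t * th * s = 2 * (2 * stretch_gain t * th * s)); last by ring.
  lra.
rewrite mulrBl mulrAC tv [v * P]mulrC; lra.
Qed.

End Minimizer.
End Gains.

(** * Gaps and horizontal cuts of a minimiser *)

Section NoPinch.
Context {R : realType}.
Variable lambda : R.
Hypothesis hlambda : 1 < lambda.
Local Notation leb := (@lebesgue_measure R).
Local Notation RT := (measurableTypeR R).
Local Notation f := (strip_density lambda).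
Local Notation psi := (fiber_density lambda).
Local Notation low := (low_density lambda).
Local Notation slice_data := (slice_data lambda).

Lemma hypotenuse_add (a b u w : R) : 0 <= a -> 0 <= b -> 0 <= u -> 0 <= w ->
  Num.sqrt ((a + u) ^+ 2 + (b + w) ^+ 2) <= Num.sqrt (a ^+ 2 + b ^+ 2) + u + w.
Proof.
move=> a0 b0 u0 w0; set r := Num.sqrt (a ^+ 2 + b ^+ 2).
have r0 : 0 <= r by exact: sqrtr_ge0.
have r2 : r ^+ 2 = a ^+ 2 + b ^+ 2 by rewrite sqr_sqrtr ?addr_ge0 ?sqr_ge0.
have ar : a <= r by rewrite -[a]ger0_norm// -sqrtr_sqr ler_wsqrtr// lerDl sqr_ge0.
have br : b <= r by rewrite -[b]ger0_norm// -sqrtr_sqr ler_wsqrtr// lerDr sqr_ge0.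
rewrite -(@ler_pXn2r _ 2) ?nnegrE ?sqrtr_ge0 ?addr_ge0// sqr_sqrtr ?addr_ge0 ?sqr_ge0//.
rewrite -subr_ge0.
have -> : (r + u + w) ^+ 2 - ((a + u) ^+ 2 + (b + w) ^+ 2) =
   (r ^+ 2 - (a ^+ 2 + b ^+ 2)) + 2 * (r - a) * u + 2 * (r - b) * w + 2 * u * w by ring.
by rewrite r2 subrr add0r !addr_ge0// !mulr_ge0// subr_ge0.
Qed.

Lemma low_density_sub (y y' t t' : R) : y <= t -> t' <= y' -> low y y' <= low t t'.
Proof.
move=> yt ty; rewrite /low_density; case: ifP => h; case: ifP => h' //; last exact: ltW.
by exfalso; move: h h' => /orP[h|h] /negbT; rewrite negb_or -!leNgt => /andP[h1 h2]; lra.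
Qed.

(** This covers c = -1 and c = 1, where both sides are 1: crossing such a height and closing a cut
    there are paid at the same, lower density. *)
Lemma low_density_near (c : R) : exists2 r, 0 < r & forall y y', c - r < y < c -> c < y' < c + r ->
  low y y' = psi c.
Proof.
rewrite /fiber_density /low_density; case: ifPn => hc.
  exists 1 => // y y' /andP[_ yc] /andP[cy' _]; rewrite ifF//; apply/negbTE.
  by move: hc; rewrite ler_norml negb_or -!leNgt => /andP[h1 h2]; apply/andP; split; lra.
move: hc; rewrite -ltNge ltr_normr => /orP[hc|hc].
  exists (c - 1); first by rewrite subr_gt0.
  by move=> y y' /andP[h1 h2] _; rewrite (_ : 1 < y)//; lra.
exists (- 1 - c); first by lra.
by move=> y y' _ /andP[h1 h2]; rewrite (_ : y' < -1) ?orbT//; lra.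
Qed.

Lemma low_density_at (c y y' : R) : y <= c <= y' -> low y y' <= psi c.
Proof. by move=> h; exact: (low_density_le lambda hlambda y y' (0, c)). Qed.

Section OneSet.
Variables (F : set (RT * RT)) (v I : R).
Hypothesis v0 : 0 < v.
Hypothesis isoF : isoperimetric f v F.
Hypothesis perF : weighted_perimeter f F = I%:E.
Variables (L : R -> R) (Z : set RT).
Local Notation m := (slice_length F).
Hypothesis D : slice_data m L Z I.
Hypothesis LI : forall y, 0 <= L y <= I.
Hypothesis Zfin : forall y, Z y -> (leb (slice F y) < +oo)%E.
Hypothesis edge : forall y y' r1 r2, Z y -> Z y' -> y < y' ->
  low y y' * Num.sqrt ((2 * fine (leb (live m `&` `]y, y'[%classic)) +
     2 * fine (leb (gapped 0 y y' r1 r2 F))) ^+ 2 +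
     fine (leb (slice F y `+` slice F y')) ^+ 2) <= L y' - L y.

Let mF : measurable F. Proof. by case: isoF. Qed.
Let hZ := slice_generic _ _ _ _ _ D.

(** The function [L] of the minimiser also pays for the extra boundary points of gaps. Ignoring them
    gives data with the same profile and total (1 + th^2 / 2) I - 2 th |A|, [A] being the set of
    heights with a gap; minimality for all small th forces |A| = 0. *)
Lemma no_gap (r1 r2 : R) : {ae leb, forall y, ~ gap 0 r1 r2 (slice F y)}.
Proof.
pose A : set RT := \bigcup_n gapped 0 (- n%:R) n%:R r1 r2 F.
have mA : measurable A by apply: bigcupT_measurable => n; exact: gapped_measurable.
have AE t : A t <-> [/\ (0 < leb (slice F t))%E, (leb (slice F t) < +oo)%E & gap 0 r1 r2 (slice F t)].
  split; first by move=> [n _ [[_ [h1 h2]] h3]].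
  move=> [h1 h2 h3]; exists (Num.truncn `|t|).+1 => //; split=> //; split=> //.
  by rewrite -ltr_norml truncnS_gt.
have gE y y' : gapped 0 y y' r1 r2 F = A `&` `]y, y'[%classic.
  apply/seteqP; split=> t.
    by move=> [[h1 [h2 h3]] h4]; split; [apply/AE|rewrite /= in_itv].
  by move=> [/AE[h1 h2 h3]]; rewrite /= in_itv/= => h4; split.
have lA : A `<=` live m.
  move=> t /AE[h1 h2 _]; rewrite /live/= /slice_length -lte_fin fineK// ge0_fin_numE//.
have Aoo : (leb A < +oo)%E.
  by apply: le_lt_trans (live_finite lambda hlambda _ _ _ _ D); exact: le_outer_measure.
have I0 := total_ge0 _ _ _ _ _ D.
have gain (th : R) : 0 < th -> 2 * th * fine (leb A) <= th ^+ 2 / 2 * I.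
  move=> th0.
  have k0 : 0 <= 1 + th ^+ 2 / 2 by rewrite addr_ge0// divr_ge0// sqr_ge0.
  have e0 : 0 <= 2 * th by rewrite mulr_ge0// ltW.
  have D' := gain_data lambda hlambda m m L Z I (1 + th ^+ 2 / 2) (2 * th) A D mA Aoo k0 e0
    (slice_ge0 _ _ _ _ _ D) (slice_mfun _ _ _ _ _ D).
  have {}D' : slice_data m (fun y => (1 + th ^+ 2 / 2) * L y - 2 * th * cut A y) Z
      ((1 + th ^+ 2 / 2) * I - 2 * th * fine (leb A)).
    apply: D' => y y' Zy Zy' yy'.
    set a := 2 * fine (leb (live m `&` _)); set p := fine (leb (A `&` _)).
    have a0 : 0 <= a by rewrite mulr_ge0// fine_ge0.
    have p0 : 0 <= p by rewrite fine_ge0.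
    have lw := low_density_ge1 lambda hlambda y y'.
    have lw0 := low_density_ge0 lambda hlambda y y'.
    have p20 : 0 <= 2 * p by rewrite mulr_ge0.
    have hx := hypotenuse_extend th a (2 * p) (m y' - m y) a0 p20.
    apply: le_trans (ler_wpM2l lw0 hx) _; rewrite mulrBr mulrCA; apply: lerB.
      rewrite ler_wpM2l//; apply: le_trans (edge y y' r1 r2 Zy Zy' yy'); rewrite gE.
      rewrite ler_wpM2l// ler_wsqrtr// lerD2l -[leLHS]real_normK ?num_real//.
      rewrite ler_pXn2r ?nnegrE ?fine_ge0//; apply: slice_length_symdiff => //; exact: Zfin.
    have -> : th * (2 * p) = 2 * th * p by ring.
    by rewrite ler_peMl// mulr_ge0.
  have hv := volume_slice_length lambda hlambda F mF.
  have vF : weighted_volume f F = v%:E by case: isoF.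
  have aF := slice_finite_volume lambda hlambda F v mF vF.
  have := minimal lambda hlambda F v I v0 isoF perF _ _ _ _ D'.
  by rewrite -hv// vF => /(_ erefl); lra.
have A0 : fine (leb A) = 0.
  apply/eqP; rewrite eq_le fine_ge0// andbT; apply/ler_addgt0Pr => e e0; rewrite add0r.
  have [th th0 hth] := exists_small I (4 * e) I0 (mulr_gt0 (ltr0n _ 4) e0).
  have := gain th th0.
  rewrite (_ : 2 * th * _ = th * (2 * fine (leb A))); last by ring.
  rewrite (_ : th ^+ 2 / 2 * I = th * (I * th / 2)); last by ring.
  by rewrite ler_pM2l//; lra.
have lA0 : leb A = 0%E by rewrite -[LHS]fineK ?ge0_fin_numE// A0.
have aF := slice_finite_volume lambda hlambda F v mF.
have {}aF : (area R F < +oo)%E by apply: aF; case: isoF.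
have FF := ae_filter_ringOfSetsType leb.
have nA : {ae leb, forall y, ~ A y} by exists A; split=> // y /= /contrapT.
apply: filterS2 nA (ae_slice_finite F mF aF) => y nAy fy g.
apply: nAy; apply/AE; split=> //; case: g => h _ _; apply: lt_le_trans h _.
by apply: le_outer_measure => t [].
Qed.

(** [L] is bounded, and monotone on [Z]: past a height where it is within [e] of its supremum below
    [c], it cannot vary more. *)
Lemma left_limit (c e : R) : 0 < e -> exists2 r, 0 < r & forall y y', Z y -> Z y' ->
  c - r < y < c -> c - r < y' < c -> L y' <= L y + e.
Proof.
move=> e0; pose S : set R := [set L y | y in Z `&` `]-oo, c[%classic].
have S0 : has_sup S.
  split; last by exists I => _ [y _ <-]; have /andP[] := LI y.
  have [|y Zy /andP[_ yc]] := generic_point Z (c - 1) c hZ; first by lra.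
  by exists (L y), y => //; split=> //; rewrite /= in_itv.
have [x [y0 [Zy0 +] xE] hy0] := sup_adherent e0 S0; rewrite -xE in hy0; rewrite /= in_itv/= => y0c.
exists (c - y0); first by rewrite subr_gt0.
move=> y y' Zy Zy'; rewrite subKr => /andP[h1 h2] /andP[h3 h4].
have := slice_total_mono lambda hlambda _ _ _ _ D _ _ Zy0 Zy (ltW h1).
have : L y' <= sup S by apply: sup_upper_bound => //; exists y' => //; split=> //; rewrite /= in_itv.
lra.
Qed.

Lemma right_limit (c e : R) : 0 < e -> exists2 r, 0 < r & forall y y', Z y -> Z y' ->
  c < y < c + r -> c < y' < c + r -> L y' <= L y + e.
Proof.
move=> e0; pose S : set R := [set L y | y in Z `&` `]c, +oo[%classic].
have S0 : has_inf S.
  split; last by exists 0 => _ [y _ <-]; have /andP[] := LI y.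
  have [|y Zy /andP[yc _]] := generic_point Z c (c + 1) hZ; first by lra.
  by exists (L y), y => //; split=> //; rewrite /= in_itv/= andbT.
have [x [y0 [Zy0 +] xE] hy0] := inf_adherent e0 S0; rewrite -xE in hy0; rewrite /= in_itv/= andbT => y0c.
exists (y0 - c); first by rewrite subr_gt0.
move=> y y' Zy Zy'; rewrite addrC subrK => /andP[h1 h2] /andP[h3 h4].
have := slice_total_mono lambda hlambda _ _ _ _ D _ _ Zy' Zy0 (ltW h4).
have : inf S <= L y by apply: inf_lbound => //; [case: S0|exists y => //; split=> //; rewrite /= in_itv/= andbT].
lra.
Qed.

Definition lower_part (c t : R) : R := if t < c then m t else 0.
Definition upper_part (c t : R) : R := if c < t then m t else 0.

Let m0 := slice_ge0 _ _ _ _ _ D.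

Let live_low c y y' : live (lower_part c) `&` `]y, y'[%classic = live m `&` `]y, Num.min y' c[%classic.
Proof.
apply/seteqP; split=> t; rewrite /live /lower_part /= !in_itv/= lt_min.
  by case: ifP => [tc [h /andP[-> ->]]//|_ [+ _]]; rewrite ltxx.
by move=> [h /and3P[-> -> tc]]; rewrite tc.
Qed.

Let live_up c y y' : live (upper_part c) `&` `]y, y'[%classic = live m `&` `](Num.max y c), y'[%classic.
Proof.
apply/seteqP; split=> t; rewrite /live /upper_part /= !in_itv/= gt_max.
  by case: ifP => [tc [h /andP[-> ->]]//|_ [+ _]]; rewrite ltxx.
by move=> [h /andP[/andP[-> tc] ->]]; rewrite tc.
Qed.

Let live_split y t y' : y < t -> t < y' ->
  fine (leb (live m `&` `]y, y'[%classic)) <= fine (leb (live m `&` `]y, t[%classic)) + (y' - t) /\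
  fine (leb (live m `&` `]y, y'[%classic)) <= fine (leb (live m `&` `]t, y'[%classic)) + (t - y).
Proof.
move=> yt ty'.
have fin a b : leb (live m `&` `]a, b[%classic) \is a fin_num.
  by rewrite ge0_fin_numE//; exact: live_cell_finite.
rewrite -!lee_fin !EFinD !fineK//; split.
  apply: (@le_trans _ _ (leb ((live m `&` `]y, t[%classic) `|` `[t, y'[%classic))).
    apply: le_outer_measure => s [ms]; rewrite /= !in_itv/= => /andP[h1 h2].
    by have [st|ts] := ltP s t; [left; split=> //; rewrite h1|right; rewrite /= h2].
  apply: (@le_trans _ _ (leb (live m `&` `]y, t[%classic) + leb (`[t, y'[%classic : set RT))%E).
    exact: outer_measureU2.
  by apply: leeD => //; rewrite lebesgue_measure_itv/= lte_fin ty'.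
apply: (@le_trans _ _ (leb ((live m `&` `]t, y'[%classic) `|` `]y, t]%classic))).
  apply: le_outer_measure => s [ms]; rewrite /= !in_itv/= => /andP[h1 h2].
  by have [st|ts] := leP s t; [right; rewrite /= h1|left; split=> //; rewrite h2].
apply: (@le_trans _ _ (leb (live m `&` `]t, y'[%classic) + leb (`]y, t]%classic : set RT))%E).
  exact: outer_measureU2.
by apply: leeD => //; rewrite lebesgue_measure_itv/= lte_fin yt.
Qed.

Let fine0 : fine (leb (set0 : set RT)) = 0. Proof. by rewrite measure0. Qed.

(** The set is cut at height [c] and closed there by a horizontal segment, which is paid at density
    psi(c) and has about the length of the slice at [y0]; the terms in [e] absorb the passage from
    [y0] to [c]. *)
Lemma lower_data (c e y0 : R) : 0 < e -> Z y0 -> y0 < c ->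
  (forall y, Z y -> y0 < y < c -> L y <= L y0 + e) ->
  exists L1, slice_data (lower_part c) L1 Z (L y0 + e + psi c * (m y0 + 3 * e)).
Proof.
move=> e0 Zy0 y0c osc; set K := L y0 + e + _.
have psi0 : 0 <= psi c by exact: (density_ge0 lambda hlambda (0, c)).
have pK : 0 <= psi c * (m y0 + 3 * e) by rewrite mulr_ge0// addr_ge0// mulr_ge0// ltW.
have LK y : Z y -> y < c -> L y <= L y0 + e.
  move=> Zy yc; have [h|h] := leP y y0; last by apply: osc => //; rewrite h.
  have := slice_total_mono lambda hlambda _ _ _ _ D _ _ Zy Zy0 h; lra.
have L0 y : 0 <= L y by have /andP[] := LI y.
have K0 : 0 <= K by have := L0 y0; rewrite /K; lra.
exists (fun t => if t < c then L t else K); split=> //.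
- by move=> y; rewrite /lower_part; case: ifP.
- apply: measurable_fun_ifT => //; last exact: slice_mfun D.
  by apply: measurable_fun_ltr.
- move=> y y' Zy Zy' yy'; case: ifP => h'; case: ifP => h.
  + have := LK y' Zy' h'; have := L0 y; rewrite /K; lra.
  + by move: h; rewrite (le_lt_trans yy' h').
  + have := L0 y; lra.
  + by rewrite subrr.
move=> y y' Zy Zy' yy'; rewrite live_low /lower_part.
have [y'c|cy'] := ltP y' c.
  by rewrite (lt_trans yy' y'c); exact: slice_edge D _ _ Zy Zy' yy'.
have [yc|cy] := ltP y c; last first.
  rewrite (_ : `]y, c[%classic = set0) ?setI0 ?fine0; last first.
    by apply/seteqP; split=> // t; rewrite /= in_itv/= => /andP[h1 h2]; move: (lt_trans h1 h2); rewrite ltNge cy.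
  by rewrite !subrr mulr0 !expr0n/= addr0 sqrtr0 mulr0.
(* A generic height just below the cut: between it and [c] there is at most [e] of live heights, and
   m is at most m(y0) + e there. *)
have [|t Zt /andP[t1 tc]] := generic_point Z (Num.max y (Num.max y0 (c - e))) c hZ.
  by rewrite !gt_max yc y0c/=; lra.
move: t1; rewrite !gt_max => /and3P[yt y0t ct].
have lip := slice_diff lambda hlambda _ _ _ _ D _ _ Zy0 Zt (ltW y0t).
have Lt := LK t Zt tc.
have mt : m t <= m y0 + e.
  by have := ler_norm (m t - m y0); lra.
set a := 2 * fine (leb (live m `&` `]y, t[%classic)).
have a0 : 0 <= a by rewrite mulr_ge0// fine_ge0.
have [sp _] := live_split y t c yt tc.
have lw0 := low_density_ge0 lambda hlambda y y'.
apply: (@le_trans _ _ (low y y' * (Num.sqrt (a ^+ 2 + (m t - m y) ^+ 2) + 2 * e + m t))).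
  rewrite ler_wpM2l//; have b0 : 0 <= `|m t - m y| by [].
  have e20 : 0 <= 2 * e by rewrite mulr_ge0// ltW.
  have := hypotenuse_add a `|m t - m y| (2 * e) (m t) a0 b0 e20 (m0 t).
  rewrite real_normK ?num_real//; apply: le_trans; rewrite ler_wsqrtr//; apply: lerD.
    rewrite ler_pXn2r ?nnegrE ?mulr_ge0 ?fine_ge0 ?addr_ge0//; rewrite /a; lra.
  rewrite sub0r sqrrN ler_pXn2r ?nnegrE ?addr_ge0//.
  by have := ler_norm (m y - m t); rewrite distrC; lra.
rewrite -addrA mulrDr.
have h1 : low y y' * Num.sqrt (a ^+ 2 + (m t - m y) ^+ 2) <= L t - L y.
  apply: le_trans (slice_edge _ _ _ _ _ D _ _ Zy Zt yt); rewrite ler_wpM2r ?sqrtr_ge0//.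
  by apply: low_density_sub => //; exact: le_trans (ltW tc) cy'.
have h2 : low y y' * (2 * e + m t) <= psi c * (m y0 + 3 * e).
  apply: ler_pM => //; first by rewrite addr_ge0// mulr_ge0// ltW.
    by apply: low_density_at; rewrite (ltW yc).
  lra.
rewrite /K; lra.
Qed.

Lemma upper_data (c e y0 : R) : 0 < e -> Z y0 -> c < y0 ->
  (forall y, Z y -> c < y < y0 -> L y0 <= L y + e) ->
  exists L2, slice_data (upper_part c) L2 Z (I - (L y0 - e - psi c * (m y0 + 3 * e))).
Proof.
move=> e0 Zy0 y0c osc; set K := L y0 - e - _.
have psi0 : 0 <= psi c by exact: (density_ge0 lambda hlambda (0, c)).
have pK : 0 <= psi c * (m y0 + 3 * e) by rewrite mulr_ge0// addr_ge0// mulr_ge0// ltW.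
have LK y : Z y -> c < y -> L y0 - e <= L y.
  move=> Zy yc; have [h|h] := leP y0 y.
    have := slice_total_mono lambda hlambda _ _ _ _ D _ _ Zy0 Zy h; lra.
  by rewrite lerBlDr; apply: osc => //; rewrite yc.
have L0 y : L y <= I by have /andP[] := LI y.
have K0 : K <= I by have := L0 y0; rewrite /K; lra.
exists (fun t => if c < t then L t else K); split=> //.
- by move=> y; rewrite /upper_part; case: ifP.
- apply: measurable_fun_ifT => //; last exact: slice_mfun D.
  by apply: measurable_fun_ltr.
- move=> y y' Zy Zy' yy'; case: ifP => h'; case: ifP => h.
  + have := LK y Zy h; have := L0 y'; rewrite /K; lra.
  + have := L0 y'; lra.
  + by move: h'; rewrite (lt_le_trans h yy').
  + by rewrite subrr subr_ge0.
move=> y y' Zy Zy' yy'; rewrite live_up /upper_part.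
have [yc|cy] := ltP c y.
  by rewrite (lt_trans yc yy'); exact: slice_edge D _ _ Zy Zy' yy'.
have [y'c|cy'] := ltP c y'; last first.
  rewrite (_ : `]c, y'[%classic = set0) ?setI0 ?fine0; last first.
    by apply/seteqP; split=> // t; rewrite /= in_itv/= => /andP[h1 h2]; move: (lt_trans h1 h2); rewrite ltNge cy'.
  by rewrite !subrr mulr0 !expr0n/= addr0 sqrtr0 mulr0.
have [|t Zt /andP[tc t1]] := generic_point Z c (Num.min y' (Num.min y0 (c + e))) hZ.
  by rewrite !lt_min y'c y0c/=; lra.
move: t1; rewrite !lt_min => /and3P[yt y0t ct].
have lip := slice_diff lambda hlambda _ _ _ _ D _ _ Zt Zy0 (ltW y0t).
have Lt := LK t Zt tc.
have L1 : L y0 <= L t + e by lra.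
have mt : m t <= m y0 + e.
  by have := ler_norm (m t - m y0); rewrite distrC; lra.
set a := 2 * fine (leb (live m `&` `]t, y'[%classic)).
have a0 : 0 <= a by rewrite mulr_ge0// fine_ge0.
have [_ sp] := live_split c t y' tc yt.
have lw0 := low_density_ge0 lambda hlambda y y'.
apply: (@le_trans _ _ (low y y' * (Num.sqrt (a ^+ 2 + (m y' - m t) ^+ 2) + 2 * e + m t))).
  rewrite ler_wpM2l//; have b0 : 0 <= `|m y' - m t| by [].
  have e20 : 0 <= 2 * e by rewrite mulr_ge0// ltW.
  have := hypotenuse_add a `|m y' - m t| (2 * e) (m t) a0 b0 e20 (m0 t).
  rewrite real_normK ?num_real//; apply: le_trans; rewrite ler_wsqrtr//; apply: lerD.
    rewrite ler_pXn2r ?nnegrE ?mulr_ge0 ?fine_ge0 ?addr_ge0//; rewrite /a; lra.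
  rewrite subr0 ler_pXn2r ?nnegrE ?addr_ge0//.
  by have := ler_norm (m y' - m t); lra.
rewrite -addrA mulrDr.
have h1 : low y y' * Num.sqrt (a ^+ 2 + (m y' - m t) ^+ 2) <= L y' - L t.
  apply: le_trans (slice_edge _ _ _ _ _ D _ _ Zt Zy' yt); rewrite ler_wpM2r ?sqrtr_ge0//.
  by apply: low_density_sub => //; exact: le_trans cy (ltW tc).
have h2 : low y y' * (2 * e + m t) <= psi c * (m y0 + 3 * e).
  apply: ler_pM => //; first by rewrite addr_ge0// mulr_ge0// ltW.
    by apply: low_density_at; rewrite cy ltW.
  lra.
rewrite /K; lra.
Qed.

End OneSet.
End NoPinch.

(** * Overlap of the slices below and above a height *)

Section Pinch.
Context {R : realType}.
Variable lambda : R.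
Hypothesis hlambda : 1 < lambda.
Local Notation leb := (@lebesgue_measure R).
Local Notation RT := (measurableTypeR R).
Local Notation f := (strip_density lambda).
Local Notation psi := (fiber_density lambda).
Local Notation low := (low_density lambda).
Local Notation slice_data := (slice_data lambda).

Lemma symdiff_inter (X Y : set RT) : measurable X -> measurable Y -> (leb X < +oo)%E -> (leb Y < +oo)%E ->
  fine (leb X) + fine (leb Y) <= fine (leb (X `+` Y)) + 2 * fine (leb (X `&` Y)).
Proof.
move=> mX mY Xoo Yoo.
have fin (D C : set RT) : D `<=` C -> (leb C < +oo)%E -> leb D \is a fin_num.
  by move=> DC Coo; rewrite ge0_fin_numE// (le_lt_trans _ Coo)//; exact: le_outer_measure.
have f1 : leb (X `\` Y) \is a fin_num by apply: fin Xoo => x [].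
have f2 : leb (Y `\` X) \is a fin_num by apply: fin Yoo => x [].
have f3 : leb (X `&` Y) \is a fin_num by apply: fin Xoo => x [].
have -> : (leb (X `+` Y) = leb (X `\` Y) + leb (Y `\` X))%E.
  apply: measureU; [exact: measurableD|exact: measurableD|].
  by apply/seteqP; split=> // x [[Xx _] [_ nX]].
have h1 : (leb X <= leb (X `\` Y) + leb (X `&` Y))%E.
  apply: (@le_trans _ _ (leb ((X `\` Y) `|` (X `&` Y)))); last exact: outer_measureU2.
  by apply: le_outer_measure => x Xx; have [Yx|nYx] := pselect (Y x); [right|left].
have h2 : (leb Y <= leb (Y `\` X) + leb (X `&` Y))%E.
  apply: (@le_trans _ _ (leb ((Y `\` X) `|` (X `&` Y)))); last exact: outer_measureU2.
  by apply: le_outer_measure => x Yx; have [Xx|nXx] := pselect (X x); [right|left].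
rewrite fineD//; move: h1 h2.
rewrite -(fineK f1) -(fineK f2) -(fineK f3) -(fineK (_ : leb X \is a fin_num)) ?ge0_fin_numE//.
rewrite -(fineK (_ : leb Y \is a fin_num)) ?ge0_fin_numE// -!EFinD !lee_fin /=; lra.
Qed.

Definition above (c : R) : set (R * R) := [set p | c < p.2].

Lemma above_measurable c : measurable (above c : set (RT * RT)).
Proof.
have -> : above c = setT `*` `]c, +oo[%classic.
  by apply/seteqP; split=> p; rewrite /above /= in_itv/= andbT; [split|case].
by apply: measurableX => //; exact: measurable_itv.
Qed.

Definition two_sided (F : set (RT * RT)) (c : R) : Prop :=
  (0 < area R (F `&` below c))%E /\ (0 < area R (F `&` above c))%E.

Lemma slice_length_below (F : set (RT * RT)) c : slice_length (F `&` below c) = lower_part F c.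
Proof.
apply/funext => t; rewrite /slice_length /lower_part; case: ifPn => tc.
  congr (fine (leb _)); apply/seteqP; split=> x; first by move=> [].
  by move=> Fx; split.
rewrite (_ : slice _ t = set0) ?measure0//; apply/seteqP; split=> // x [_].
by rewrite /below/= (negbTE tc).
Qed.

Lemma slice_length_above (F : set (RT * RT)) c : slice_length (F `&` above c) = upper_part F c.
Proof.
apply/funext => t; rewrite /slice_length /upper_part; case: ifPn => tc.
  congr (fine (leb _)); apply/seteqP; split=> x; first by move=> [].
  by move=> Fx; split.
rewrite (_ : slice _ t = set0) ?measure0//; apply/seteqP; split=> // x [_].
by rewrite /above/= (negbTE tc).
Qed.

Lemma area_line c : area R (setT `*` [set c]) = 0%E.
Proof. by rewrite area_rect// lebesgue_measure_set1 mule0. Qed.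

Section OneSet.
Variables (F : set (RT * RT)) (v I : R).
Hypothesis v0 : 0 < v.
Hypothesis isoF : isoperimetric f v F.
Hypothesis perF : weighted_perimeter f F = I%:E.
Variables (L : R -> R) (Z : set RT).
Local Notation m := (slice_length F).
Hypothesis D : slice_data m L Z I.
Hypothesis LI : forall y, 0 <= L y <= I.
Hypothesis Zfin : forall y, Z y -> (leb (slice F y) < +oo)%E.
Hypothesis edge : forall y y' r1 r2, Z y -> Z y' -> y < y' ->
  low y y' * Num.sqrt ((2 * fine (leb (live m `&` `]y, y'[%classic)) +
     2 * fine (leb (gapped 0 y y' r1 r2 F))) ^+ 2 +
     fine (leb (slice F y `+` slice F y')) ^+ 2) <= L y' - L y.

Let mF : measurable F. Proof. by case: isoF. Qed.
Let vF : weighted_volume f F = v%:E. Proof. by case: isoF. Qed.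
Let aF : (area R F < +oo)%E. Proof. exact: slice_finite_volume hlambda F v mF vF. Qed.

Lemma symdiff_edge y y' : Z y -> Z y' -> y < y' ->
  low y y' * fine (leb (slice F y `+` slice F y')) <= L y' - L y.
Proof.
move=> Zy Zy' yy'; apply: le_trans (edge y y' 0 0 Zy Zy' yy').
rewrite ler_wpM2l ?low_density_ge0// -{1}[fine _]ger0_norm ?fine_ge0// -sqrtr_sqr ler_wsqrtr//.
by rewrite lerDr sqr_ge0.
Qed.

Lemma split_volume c : two_sided F c -> exists v1 v2, [/\ 0 < v1, 0 < v2, v1 + v2 = v,
  (\int[leb]_t (psi t * lower_part F c t)%:E = v1%:E)%E &
  (\int[leb]_t (psi t * upper_part F c t)%:E = v2%:E)%E].
Proof.
move=> [a1 a2].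
have m1 : measurable (F `&` below c) by apply: measurableI => //; exact: below_measurable.
have m2 : measurable (F `&` above c) by apply: measurableI => //; exact: above_measurable.
have A1 : (area R (F `&` below c) < +oo)%E.
  by apply: le_lt_trans aF; apply: le_measure; rewrite ?inE// => p [].
have A2 : (area R (F `&` above c) < +oo)%E.
  by apply: le_lt_trans aF; apply: le_measure; rewrite ?inE// => p [].
pose V1 := weighted_volume f (F `&` below c). pose V2 := weighted_volume f (F `&` above c).
have V12 : (V1 + V2 = v%:E)%E.
  apply/eqP; rewrite eq_le; apply/andP; split.
    rewrite -vF /V1 /V2 /weighted_volume -ge0_integral_setU//.
    - apply: ge0_subset_integral => //; [exact: measurableU|exact: densityE_measurable| |by move=> p [] []].
      by move=> p _; rewrite lee_fin density_ge0.
    - exact: densityE_measurable.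
    - by move=> p _; rewrite lee_fin density_ge0.
    - apply/disj_setPS => p [[_ h1] [_ h2]]; move: h1 h2; rewrite /below/above/= => h1 h2.
      by have := lt_trans h1 h2; rewrite ltxx.
  have mU : measurable ((F `&` below c) `|` (F `&` above c)) by exact: measurableU.
  rewrite -vF; apply: le_trans (volume_symdiff lambda hlambda _ _ mF mU) _.
  rewrite (_ : area R (F `+` _) = 0%E) ?mule0 ?adde0; last first.
    apply/eqP; rewrite eq_le measure_ge0 andbT -(area_line c); apply: le_measure; rewrite ?inE.
    - exact: symdiff_measurable.
    - by apply: measurableX => //; exact: measurable_set1.
    move=> p [[Fp np]|[[[Fp _]|[Fp _]] nF]] //; split=> //=.
    apply/eqP; rewrite eq_le !leNgt; apply/andP; split; apply/negP => h; apply: np; [right|left]; split=> //.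
  rewrite /weighted_volume ge0_integral_setU//.
  - exact: densityE_measurable.
  - by move=> p _; rewrite lee_fin density_ge0.
  - apply/disj_setPS => p [[_ h1] [_ h2]]; move: h1 h2; rewrite /below/above/= => h1 h2.
    by have := lt_trans h1 h2; rewrite ltxx.
have p1 : (0 < V1)%E by apply: lt_le_trans a1 _; exact: area_le_volume.
have p2 : (0 < V2)%E by apply: lt_le_trans a2 _; exact: area_le_volume.
have f1 : V1 \is a fin_num.
  by rewrite ge0_fin_numE ?(ltW p1)// (le_lt_trans _ (ltry v))// -V12 leeDl// ltW.
have f2 : V2 \is a fin_num.
  by rewrite ge0_fin_numE ?(ltW p2)// (le_lt_trans _ (ltry v))// -V12 leeDr// ltW.
exists (fine V1), (fine V2); split.
- by rewrite -lte_fin fineK.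
- by rewrite -lte_fin fineK.
- by apply: EFin_inj; rewrite EFinD !fineK.
- by rewrite fineK// -slice_length_below /V1 volume_slice_length.
- by rewrite fineK// -slice_length_above /V2 volume_slice_length.
Qed.

(* If nearby slices on both sides of height c had almost disjoint traces, cutting F at c would cost nothing, whereas
   two sets of smaller volume cost definitely more than one. *)
Lemma no_pinch c : two_sided F c -> exists e r, [/\ 0 < e, 0 < r &
  forall y y', Z y -> Z y' -> c - r < y < c -> c < y' < c + r ->
    e < fine (leb (slice F y `&` slice F y'))].
Proof.
move=> Tc; have [v1 [v2 [v10 v20 v12 hv1 hv2]]] := split_volume c Tc.
have I0 := total_ge0 _ _ _ _ _ D.
have v1v : v1 < v by lra. have v2v : v2 <= v by lra.
have [d d0 hd] := minimal_part_strict lambda hlambda F v I v0 isoF perF _ v1 hv1 v10 v1v I0.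
have l0 : 0 < lambda by exact: lt_trans hlambda.
have C0 : 0 <= 2 + 8 * lambda by rewrite addr_ge0// mulr_ge0// ltW.
(* The excess cost of cutting must stay below 1, as [minimal_part_strict] requires, and below d / (2
   v), which after multiplication by [v] is half of the strict gain. *)
have [b [b0 b1 bd]] := exists_min2 1 (d / (2 * v)) ltr01 (divr_gt0 d0 (mulr_gt0 (ltr0n _ 2) v0)).
have [e e0 he] := exists_small _ _ C0 b0.
apply: contrapT => no.
have bad r : 0 < r -> exists y y', [/\ Z y, Z y', c - r < y < c, c < y' < c + r &
    fine (leb (slice F y `&` slice F y')) <= e].
  move=> r0; apply: contrapT => no'; apply: no; exists e, r; split=> // y y' Zy Zy' hy hy'.
  by rewrite ltNge; apply/negP => h; apply: no'; exists y, y'.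
have [r1 r10 hr1] := left_limit lambda hlambda F I L Z D LI c e e0.
have [r2 r20 hr2] := right_limit lambda hlambda F I L Z D LI c e e0.
have [r3 r30 hr3] := low_density_near lambda c.
have [r4 [r40 r41 r42]] := exists_min2 _ _ r10 r20.
have [r [r0 rr4 rr3]] := exists_min2 _ _ r40 r30.
have [y [y' [Zy Zy' /andP[hy1 hy2] /andP[hy1' hy2'] hyy']]] := bad r r0.
have [|L1 D1] := lower_data lambda hlambda F I L Z D LI c e y e0 Zy hy2.
  by move=> t Zt /andP[t1 t2]; apply: hr1 => //; apply/andP; split=> //; lra.
have [|L2 D2] := upper_data lambda hlambda F I L Z D LI c e y' e0 Zy' hy1'.
  by move=> t Zt /andP[t1 t2]; apply: hr2 => //; apply/andP; split=> //; lra.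
set P1 := _ + _ in D1; set P2 := I - _ in D2.
have P20 := total_ge0 _ _ _ _ _ D2.
have lowE : low y y' = psi c by apply: hr3; apply/andP; split=> //; lra.
have yy' : y < y' by exact: lt_trans hy1'.
have cross := symdiff_edge y y' Zy Zy' yy'.
rewrite lowE in cross.
have psi0 : 0 <= psi c by exact: (density_ge0 lambda hlambda (0, c)).
have psil : psi c <= lambda by exact: (density_le lambda hlambda (0, c)).
have sd := symdiff_inter _ _ (slice_measurable F y mF) (slice_measurable F y' mF) (Zfin _ Zy) (Zfin _ Zy').
have h1 : psi c * (m y + m y' - 2 * e) <= L y' - L y.
  apply: le_trans cross; rewrite ler_wpM2l// /slice_length; lra.
have h2 : psi c * (8 * e) <= lambda * (8 * e) by rewrite ler_wpM2r// mulr_ge0// ltW.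
(* The two closing segments have length m(y) + m(y') + 6 e, while [L] already pays for at least m(y)
   + m(y') - 2 e between the two heights, all at density psi(c). The remaining 2 e comes from the
   oscillation of [L]. *)
have P12 : P1 + P2 <= I + (2 + 8 * lambda) * e.
  rewrite /P1 /P2.
  rewrite (_ : L y + e + psi c * (m y + 3 * e) + (I - (L y' - e - psi c * (m y' + 3 * e))) =
    I + 2 * e + psi c * (8 * e) + (psi c * (m y + m y' - 2 * e) - (L y' - L y))); last by ring.
  rewrite (_ : (2 + 8 * lambda) * e = 2 * e + lambda * (8 * e)); last by ring.
  lra.
have P1I : P1 <= I + 1 by lra.
have k1 := hd _ _ _ D1 P1I.
have k2 := minimal_part lambda hlambda F v I v0 isoF perF _ _ _ _ v2 D2 hv2 v20 v2v.
have k3 : (P1 + P2) * v <= (I + d / (2 * v)) * v by rewrite ler_wpM2r// ?(ltW v0)//; lra.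
have k4 : d / (2 * v) * v = d / 2 by field; rewrite gt_eqF.
have k5 : I * v1 + I * v2 = I * v by rewrite -mulrDr v12.
have e1 : (P1 + P2) * v = P1 * v + P2 * v by ring.
have e2 : (I + d / (2 * v)) * v = I * v + d / 2 by rewrite -k4; ring.
rewrite e1 e2 in k3.
move: k1 k2 k3 k5 d0; move: (P1 * v) (P2 * v) (I * v) (I * v1) (I * v2) => X1 X2 X3 X4 X5; lra.
Qed.

End OneSet.
End Pinch.

(** * Density-one points *)

Section DensityOneSet.
Context {R : realType}.
Local Notation leb := (@lebesgue_measure R).
Local Notation RT := (measurableTypeR R).
Implicit Types (p : R * R) (F : set (RT * RT)).

(** With [grid2] this yields a countable family of short intervals, two steps long, such that every
    point is interior to arbitrarily small ones. Excluding gaps for these gives a single null set of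
    heights. *)
Definition grid (k : nat * nat * nat) : R := - (k.1.1)%:R + k.2%:R / (k.1.2).+1%:R.

Definition grid2 (k : nat * nat * nat) : R := grid (k.1, k.2.+2).

Lemma grid_lt k : grid k < grid2 k.
Proof.
rewrite -subr_gt0 (_ : grid2 k - grid k = 2 / (k.1.2).+1%:R) ?divr_gt0//.
by rewrite /grid2 /grid /= -[k.2.+2%:R]natr1 -[k.2.+1%:R]natr1; ring.
Qed.

Lemma grid_near (x h : R) : 0 < h -> exists k, x - h < grid k /\ grid k < x < grid2 k /\ grid2 k < x + h.
Proof.
move=> h0; pose n := (Num.truncn (2 / h)).+1; pose K := (Num.truncn `|x|).+2.
have n0 : 0 < n.+1%:R :> R by rewrite ltr0n.
pose w : R := n.+1%:R^-1; have w0 : 0 < w by rewrite invr_gt0.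
have nw : n.+1%:R * w = 1 by rewrite divff// gt_eqF.
have wh : 2 * w < h.
  rewrite ltr_pdivrMr// mulrC -ltr_pdivrMr//; apply: lt_trans (truncnS_gt _) _.
  by rewrite ltr_nat.
have xK : - K%:R + 1 < x.
  have : `|x| < (Num.truncn `|x|).+1%:R by exact: truncnS_gt.
  rewrite ltr_norml /K -[X in - X + 1]natr1 => /andP[+ _]; lra.
have w1 : w <= 1 by rewrite invf_le1// ler1n.
have s0 : 0 <= (x + K%:R) * n.+1%:R by rewrite mulr_ge0//; lra.
have /andP[j1 j2] := truncn_itv s0.
set j := Num.truncn _ in j1 j2.
have j0 : (0 < j)%N.
  rewrite truncn_gt0; apply: (@le_trans _ _ (n.+1%:R)); first by rewrite ler1n.
  rewrite ler_peMl ?ler0n//; lra.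
have jE : j = j.-1.+1 by rewrite prednK.
(* The interval starts one step early, so that [x] is interior even if it is a grid point. *)
exists (K, n, j.-1); rewrite /grid2 /grid /= -/w.
have xE : (x + K%:R) * n.+1%:R * w = x + K%:R by rewrite -mulrA nw mulr1.
have a1 : j%:R * w <= x + K%:R by rewrite -xE ler_pM2r.
have a2 : x + K%:R < j.+1%:R * w by rewrite -xE ltr_pM2r.
have jm : (j.-1)%:R = j%:R - 1 :> R by rewrite {2}jE -natr1 addrK.
have jp : j.+1%:R = j%:R + 1 :> R by rewrite natr1.
rewrite -jE jm jp; rewrite jp mulrDl mul1r in a2.
rewrite mulrBl mulrDl mul1r; lra.
Qed.

Definition box (a b c d : R) : set (RT * RT) := `]a, b[%classic `*` `]c, d[%classic.

Lemma box_measurable a b c d : measurable (box a b c d).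
Proof. by apply: measurableX; exact: measurable_itv. Qed.

Lemma box_open a b c d : open (box a b c d : set (R * R)).
Proof.
rewrite (_ : (box a b c d : set (R * R)) = (fst @^-1` [set x | a < x]) `&` (fst @^-1` [set x | x < b]) `&`
    ((snd @^-1` [set x | c < x]) `&` (snd @^-1` [set x | x < d]))); last first.
  apply/seteqP; split=> p; rewrite /box /= !in_itv/=.
    by move=> [/andP[h1 h2] /andP[h3 h4]].
  by move=> [[-> ->] [-> ->]].
have cf := @fst_continuous2 R; have cs := @snd_continuous2 R.
have lt_open (x : R) : open [set t : R | t < x] by exact: open_lt.
have gt_open (x : R) : open [set t : R | x < t] by exact: open_gt.
apply: openI; apply: openI; apply: open_comp => //; by move=> p _; [exact: cf|exact: cs].
Qed.

(** The open representative of [F]. Boxes are used as neighbourhoods so that the condition can be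
    checked slice by slice. *)
Definition full F : set (R * R) :=
  [set p | exists a b c d, box a b c d p /\ area R (box a b c d `\` F) = 0%E].

Lemma full_open F : open (full F).
Proof.
rewrite openE => p [a [b [c [d [bp h]]]]]; rewrite /interior.
have := box_open a b c d; rewrite openE => /(_ p bp); apply: filterS => q bq.
by exists a, b, c, d.
Qed.

Lemma slice_box a b c d y : c < y < d -> slice (box a b c d) y = `]a, b[%classic.
Proof.
move=> yi; apply/seteqP; split=> x; rewrite /slice /box /=; first by case.
by move=> h; split=> //; rewrite in_itv.
Qed.

Lemma box_full F a b c d : measurable F ->
  {ae leb, forall y, c < y < d -> leb (`]a, b[%classic `\` slice F y) = 0%E} ->
  area R (box a b c d `\` F) = 0%E.
Proof.
move=> mF h; have mB := box_measurable a b c d.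
have mD : measurable (box a b c d `\` F) by exact: measurableD.
rewrite area_slices// -(integral0 leb setT); apply: ae_eq_integral => //.
  exact: slice_volume_measurable.
have FF := ae_filter_ringOfSetsType leb.
apply: filterS h => y hy _; have [yi|yi] := boolP (c < y < d).
  by rewrite (_ : slice _ y = `]a, b[%classic `\` slice F y) ?hy// -(slice_box a b c d y yi).
rewrite (_ : slice _ y = set0) ?measure0//; apply/seteqP; split=> // x [[_]].
by rewrite /= in_itv/= (negbTE yi).
Qed.

Lemma box_slices F a b c d : measurable F -> area R (box a b c d `\` F) = 0%E ->
  {ae leb, forall y, c < y < d -> leb (`]a, b[%classic `\` slice F y) = 0%E}.
Proof.
move=> mF h; have mD : measurable (box a b c d `\` F) by apply: measurableD => //; exact: box_measurable.
have FF := ae_filter_ringOfSetsType leb.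
apply: filterS (slice_null _ mD h) => y hy yi.
by rewrite -hy -(slice_box a b c d y yi).
Qed.

(** Every admissible box around a point contains one with rational corners, so countably many null
    sets suffice. *)
Lemma full_null F : measurable F -> area R (full F `\` F) = 0%E.
Proof.
move=> mF; pose q (i : rat * rat * (rat * rat)) := box (ratr i.1.1) (ratr i.1.2) (ratr i.2.1) (ratr i.2.2) `\` F.
pose B (n : nat) : set (RT * RT) := if unpickle n is Some i then
   (if area R (q i) == 0%E then q i else set0) else set0.
have mq i : measurable (q i) by apply: measurableD => //; exact: box_measurable.
have nB n : (area R).-negligible (B n).
  rewrite /B; case: (unpickle n) => [i|]; last exact: negligible_set0.
  by case: ifPn => [/eqP h|_]; [exists (q i); split|exact: negligible_set0].
have [X [mX X0 hX]] := negligible_bigcup nB.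
apply/eqP; rewrite eq_le measure_ge0 andbT -X0; apply: le_measure; rewrite ?inE//.
  by apply: measurableD => //; apply: open_measurable2; exact: full_open.
move=> p [[a [b [c [d [[]]]]]]]; rewrite /= !in_itv/= => /andP[a1 b1] /andP[c1 d1] h nF; apply: hX.
have [a' /itvP a'P] := rat_in_itvoo a1; have [b' /itvP b'P] := rat_in_itvoo b1.
have [c' /itvP c'P] := rat_in_itvoo c1; have [d' /itvP d'P] := rat_in_itvoo d1.
exists (pickle ((a', b'), (c', d'))); first by [].
rewrite /B pickleK; have -> : area R (q ((a', b'), (c', d'))) == 0%E.
  rewrite eq_le measure_ge0 andbT -h; apply: le_measure; rewrite ?inE//.
    by apply: measurableD => //; exact: box_measurable.
  move=> r [[]]; rewrite /= !in_itv/= => /andP[h1 h2] /andP[h3 h4] nFr; split=> //.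
  split; rewrite /= in_itv/=; apply/andP; split.
  - by apply: lt_trans h1; rewrite a'P.
  - by apply: lt_trans h2 _; rewrite b'P.
  - by apply: lt_trans h3; rewrite c'P.
  - by apply: lt_trans h4 _; rewrite d'P.
by split=> //; split; rewrite /= in_itv/= ?a'P ?b'P ?c'P ?d'P.
Qed.

Lemma full_strip (S : set RT) (a b x : R) : a < x < b -> leb (`]a, b[%classic `\` S) = 0%E ->
  (0 < leb (S `&` `]-oo, x[%classic))%E /\ (0 < leb (S `&` `]x, +oo[%classic))%E.
Proof.
move=> /andP[ax xb] h.
have pos (T : set RT) (u w : R) : u < w -> a <= u -> w <= b -> `]u, w[%classic `<=` T ->
    (0 < leb (S `&` T))%E.
  move=> uw au wb uT; rewrite lt_neqAle measure_ge0 andbT; apply/negP => /eqP h0.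
  have : (leb (`]u, w[%classic : set RT) <= leb (S `&` T) + leb (`]a, b[%classic `\` S))%E.
    apply: (@le_trans _ _ (leb ((S `&` T) `|` (`]a, b[%classic `\` S)))); last exact: outer_measureU2.
    apply: le_outer_measure => t tu; have [St|nSt] := pselect (S t); [left|right].
      by split=> //; exact: uT.
    split=> //; move: tu; rewrite /= !in_itv/= => /andP[h1 h2].
    by rewrite (le_lt_trans au h1) (lt_le_trans h2 wb).
  by rewrite -h0 h adde0 lebesgue_measure_itv/= lte_fin uw -EFinB lee_fin subr_le0 leNgt uw.
split.
  by apply: (pos _ a x) => //; [exact: ltW|move=> t; rewrite /= !in_itv/= => /andP[]].
by apply: (pos _ x b) => //; [exact: ltW|move=> t; rewrite /= !in_itv/= andbT => /andP[]].
Qed.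

Lemma no_gap_fill (S : set RT) (a b : R) : ~ gap 0 a b S ->
  (0 < leb (S `&` `]-oo, a[%classic))%E -> (0 < leb (S `&` `]b, +oo[%classic))%E ->
  leb (`]a, b[%classic `\` S) = 0%E.
Proof.
move=> ng h1 h2; apply/eqP; rewrite eq_le measure_ge0 andbT leNgt; apply/negP => h.
by apply: ng; split.
Qed.

Section convex.
Variable F : set (RT * RT).
Hypothesis mF : measurable F.
Hypothesis nogap : forall r1 r2, {ae leb, forall y, ~ gap 0 r1 r2 (slice F y)}.

Lemma no_gap_grid : {ae leb, forall y, forall k, ~ gap 0 (grid k) (grid2 k) (slice F y)}.
Proof.
have h : {ae leb, forall y, forall i, forall k, unpickle i = Some k -> ~ gap 0 (grid k) (grid2 k) (slice F y)}.
  apply: ae_foralln => i; have FF := ae_filter_ringOfSetsType leb.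
  case: (unpickle i) => [k|]; last by apply: filterS filterT.
  by apply: filterS (nogap (grid k) (grid2 k)) => y hy k' [<-].
have FF := ae_filter_ringOfSetsType leb.
by apply: filterS h => y hy k; apply: (hy (pickle k)); rewrite pickleK.
Qed.

(** Almost every slice near height [c] has mass on the left of a small grid interval around [x],
    coming from the box of [x1], and on its right, from the box of [x2]. Having no gap, it fills the
    interval. *)
Lemma full_convex x1 x2 x c : full F (x1, c) -> full F (x2, c) -> x1 <= x <= x2 -> full F (x, c).
Proof.
move=> [a1 [b1 [c1 [d1 [[]]]]]]; rewrite /= !in_itv/= => /andP[a1x b1x] /andP[c1c d1c] h1.
move=> [a2 [b2 [c2 [d2 [[]]]]]]; rewrite /= !in_itv/= => /andP[a2x b2x] /andP[c2c d2c] h2 /andP[x1x xx2].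
have := exists_min2 (x1 - a1) (b2 - x2); rewrite !subr_gt0 => /(_ a1x b2x) [h [h0 ha hb]].
have [k [k1 [/andP[k2 k3] k4]]] := grid_near x h h0.
exists (grid k), (grid2 k), (Num.max c1 c2), (Num.min d1 d2); split.
  by split; rewrite /= in_itv/= ?k2// lt_min gt_max c1c c2c d1c d2c.
apply: box_full => //; have FF := ae_filter_ringOfSetsType leb.
apply: filterS3 no_gap_grid (box_slices F _ _ _ _ mF h1) (box_slices F _ _ _ _ mF h2) => y ng f1 f2.
rewrite lt_min gt_max => /andP[/andP[y1 y2] /andP[y3 y4]].
have g1 := f1 (introT andP (conj y1 y3)); have g2 := f2 (introT andP (conj y2 y4)).
apply: no_gap_fill; first exact: ng.
  have xi : a1 < Num.min (grid k) x1 < b1.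
    by rewrite lt_min gt_min b1x orbT andbT a1x andbT; lra.
  have [p1 _] := full_strip (slice F y) a1 b1 _ xi g1; apply: lt_le_trans p1 _.
  by apply: le_outer_measure => t [St]; rewrite /= !in_itv/= lt_min => /andP[].
have xi : a2 < Num.max (grid2 k) x2 < b2.
  by rewrite gt_max lt_max a2x orbT/= b2x andbT; lra.
have [_ p2] := full_strip (slice F y) a2 b2 _ xi g2; apply: lt_le_trans p2 _.
by apply: le_outer_measure => t [St]; rewrite /= !in_itv/= !andbT gt_max => /andP[].
Qed.

Lemma full_two_sided p : full F p -> two_sided F p.2.
Proof.
move=> [a [b [c [d [[]]]]]]; rewrite /= !in_itv/= => /andP[a1 b1] /andP[c1 d1] h.
have ab : a < b by exact: lt_trans b1.
have {}h : area R (box a b c d `\` F) = 0%E by exact: h.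
have pos (S : set RT) (u w : R) : measurable S -> u < w -> c <= u -> w <= d -> `]u, w[%classic `<=` S ->
    (0 < area R (F `&` (setT `*` S)))%E.
  move=> mS uw cu wd uS; rewrite lt_neqAle measure_ge0 andbT; apply/negP => /eqP h0.
  have mFS : measurable (F `&` (setT `*` S)) by apply: measurableI => //; exact: measurableX.
  have mBF : measurable (box a b c d `\` F) by apply: measurableD => //; exact: box_measurable.
  have : (area R (box a b u w) <= area R (F `&` (setT `*` S)) + area R (box a b c d `\` F))%E.
    apply: (@le_trans _ _ (area R ((F `&` (setT `*` S)) `|` (box a b c d `\` F)))); last first.
      by apply: measureU2.
    apply: le_measure; rewrite ?inE; [exact: box_measurable|exact: measurableU|].
    move=> q [qa qu]; have [Fq|nFq] := pselect (F q); [left|right].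
      by split=> //; split=> //; exact: uS.
    split=> //; split=> //; move: qu; rewrite /= !in_itv/= => /andP[k1 k2].
    by rewrite (le_lt_trans cu k1) (lt_le_trans k2 wd).
  rewrite -h0 h adde0 /box area_rect; [|exact: measurable_itv|exact: measurable_itv].
  rewrite !lebesgue_measure_itv/= !lte_fin uw ab -!EFinB -EFinM lee_fin leNgt mulr_gt0// subr_gt0//.
split.
  rewrite (_ : below p.2 = setT `*` `]-oo, p.2[%classic).
    by apply: (pos _ c p.2) => //; [exact: ltW|move=> t; rewrite /= !in_itv/= => /andP[]].
  by apply/seteqP; split=> q; rewrite /below /= in_itv/=; [split|case].
rewrite (_ : above p.2 = setT `*` `]p.2, +oo[%classic).
  by apply: (pos _ p.2 d) => //; [exact: ltW|move=> t; rewrite /= !in_itv/= andbT => /andP[]].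
by apply/seteqP; split=> q; rewrite /above /= in_itv/= andbT; [split|case].
Qed.

End convex.

Lemma two_sided_between F c1 c2 c : measurable F -> two_sided F c1 -> two_sided F c2 -> c1 <= c <= c2 -> two_sided F c.
Proof.
move=> mF [h1 _] [_ h2] /andP[cc1 cc2]; split.
  apply: lt_le_trans h1 _; apply: le_measure; rewrite ?inE; try by apply: measurableI => //; exact: below_measurable.
  by move=> p [Fp pc]; split=> //; exact: lt_le_trans pc cc1.
apply: lt_le_trans h2 _; apply: le_measure; rewrite ?inE; try by apply: measurableI => //; exact: above_measurable.
by move=> p [Fp pc]; split=> //; exact: le_lt_trans cc2 pc.
Qed.

End DensityOneSet.

(** * Connectedness of the open representative *)

Section Connectedness.
Context {R : realType}.
Local Notation leb := (@lebesgue_measure R).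
Local Notation RT := (measurableTypeR R).
Implicit Types (p : R * R).

(** [j] is the first index with more than e/4 of [X] on its left. One step earlier there is at most
    e/4, and three steps are at most e/4 long, so more than e/4 remains on the right. *)
Lemma split_grid (X : set RT) (e : R) : measurable X -> (leb X < +oo)%E -> 0 < e -> (e%:E < leb X)%E ->
  exists k, ((e / 4)%:E < leb (X `&` `]-oo, grid k[%classic))%E /\
    ((e / 4)%:E < leb (X `&` `]grid2 k, +oo[%classic))%E.
Proof.
move=> mX Xoo e0 eX; pose n := Num.truncn (12 / e).
pose w : R := n.+1%:R^-1; have w0 : 0 < w by rewrite invr_gt0.
have we : 3 * w <= e / 4.
  have : 12 / e < n.+1%:R by exact: truncnS_gt.
  rewrite /w ltr_pdivrMr// => h.
  rewrite ler_pdivrMr//; lra.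
have e8 : 0 < e / 8 by rewrite divr_gt0.
(* All but e/8 of [X] lies in the window, so the search for [j] starts below the threshold and ends
   above it. *)
have [K hK] := finite_tail X (e / 8) mX Xoo e8.
have {hK} tail := hK K (leqnn K).
pose g j := grid (K, n, j) : R.
have gE j : g j = - K%:R + j%:R * w by [].
pose h j := leb (X `&` `]-oo, g j[%classic).
have mI (A : set RT) : measurable A -> (leb (X `&` A) < +oo)%E.
  by move=> mA; apply: le_lt_trans Xoo; apply: le_outer_measure => t [].
have ex : exists j, ((e / 4)%:E < h j)%E.
  exists (2 * K * n.+1).+1.
  have gK : K%:R < g (2 * K * n.+1).+1.
    rewrite gE -natr1 mulrDl mul1r natrM -mulrA divff ?gt_eqF ?ltr0n// mulr1 natrM; lra.
  have : (leb X <= h (2 * K * n.+1).+1 + leb (X `\` window K))%E.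
    apply: (@le_trans _ _ (leb ((X `&` `]-oo, g (2 * K * n.+1).+1[%classic) `|` (X `\` window K)))); last exact: outer_measureU2.
    apply: le_outer_measure => t Xt; have [Wt|nWt] := pselect (window K t); [left|by right].
    split=> //; move: Wt; rewrite /window/= !in_itv/= => /andP[_ h2]; exact: le_lt_trans gK.
  move=> hX; rewrite ltNge; apply/negP => hh.
  have : (leb X <= (e / 4)%:E + (e / 8)%:E)%E by apply: le_trans hX _; apply: leeD => //; exact: ltW.
  by rewrite leNgt (lt_trans _ eX)// -EFinD lte_fin; lra.
have ex' : exists j, (fun j => (e / 4)%:E < h j)%E j by exact: ex.
case: (ex_minnP ex') => j hj jmin.
have j0 : (0 < j)%N.
  rewrite lt0n; apply/negP => /eqP j0; move: hj; rewrite j0 ltNge => /negP; apply.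
  apply: (@le_trans _ _ (leb (X `\` window K))); last first.
    by apply: le_trans (ltW tail) _; rewrite lee_fin; lra.
  apply: le_outer_measure => t [Xt]; rewrite /= !in_itv/= gE mul0r addr0 => tK; split=> //.
  by rewrite /window/= in_itv/= => /andP[h1 _]; move: (le_lt_trans h1 tK); rewrite ltxx.
have hj1 : (h j.-1 <= (e / 4)%:E)%E.
  rewrite leNgt; apply/negP => /jmin; by rewrite leqNgt prednK// leqnn.
exists (K, n, j); split; first exact: hj.
have jE : g j.+2 = g j.-1 + 3 * w.
  by rewrite !gE -{1}(prednK j0) -!natr1; ring.
rewrite ltNge; apply/negP => hr.
have : (leb X <= h j.-1 + leb (`[g j.-1, g j.+2]%classic : set RT) + leb (X `&` `]g j.+2, +oo[%classic))%E.
  apply: (@le_trans _ _ (leb ((X `&` `]-oo, g j.-1[%classic) `|` `[g j.-1, g j.+2]%classic `|` (X `&` `]g j.+2, +oo[%classic)))).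
    apply: le_outer_measure => t Xt; have [h1|h1] := ltP t (g j.-1).
      by left; left; split=> //; rewrite /= in_itv.
    have [h2|h2] := leP t (g j.+2); first by left; right; rewrite /= in_itv/= h1.
    by right; split=> //; rewrite /= in_itv/= h2.
  apply: (@le_trans _ _ (leb ((X `&` `]-oo, g j.-1[%classic) `|` `[g j.-1, g j.+2]%classic) + leb (X `&` `]g j.+2, +oo[%classic))%E).
    exact: outer_measureU2.
  by apply: leeD => //; exact: outer_measureU2.
have -> : leb (`[g j.-1, g j.+2]%classic : set RT) = (3 * w)%:E.
  rewrite lebesgue_measure_itv/= lte_fin jE ifT; last by rewrite ltrDl mulr_gt0.
  by rewrite -EFinB addrAC subrr add0r.
move=> hX; move: eX; rewrite ltNge => /negP; apply.
have h3 : (leb X <= (e / 4)%:E + (e / 4)%:E + (e / 4)%:E)%E.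
  apply: le_trans hX _; apply: leeD; last exact: hr.
  by apply: leeD => //; rewrite lee_fin; lra.
by apply: le_trans h3 _; rewrite -!EFinD lee_fin; lra.
Qed.

Lemma symdiff_trace (X Y A : set RT) (e : R) : measurable X -> measurable Y -> measurable A ->
  (leb X < +oo)%E -> (leb Y < +oo)%E -> fine (leb (X `+` Y)) <= e ->
  (leb (X `&` A) <= leb (Y `&` A) + e%:E)%E.
Proof.
move=> mX mY mA Xoo Yoo h.
have fXY : leb (X `+` Y) \is a fin_num.
  rewrite ge0_fin_numE//; apply: (@le_lt_trans _ _ (leb X + leb Y)%E); last exact: lte_add_pinfty.
  apply: (@le_trans _ _ (leb (X `|` Y))); last exact: outer_measureU2.
  by apply: le_outer_measure => x [[? _]|[? _]]; [left|right].
apply: (@le_trans _ _ (leb (Y `&` A) + leb (X `+` Y))%E); last first.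
  by apply: leeD => //; rewrite -(fineK fXY) lee_fin.
apply: (@le_trans _ _ (leb ((Y `&` A) `|` (X `+` Y)))); last exact: outer_measureU2.
by apply: le_outer_measure => t [Xt At]; have [Yt|nYt] := pselect (Y t); [left|right; left].
Qed.

Lemma row_continuous (c : R) : continuous (fun x : R => (x, c) : R * R).
Proof.
move=> x; apply/cvg_ballP => e e0; apply: filterS (nbhsx_ballx x _ e0) => y h.
by split; [exact: h|exact: ballxx].
Qed.

Lemma column_continuous (x : R) : continuous (fun t : R => (x, t) : R * R).
Proof.
move=> t; apply/cvg_ballP => e e0; apply: filterS (nbhsx_ballx t _ e0) => y h.
by split; [exact: ballxx|exact: h].
Qed.

Section OneSet.
Variables (F : set (RT * RT)) (L : R -> R) (Z : set RT).
Hypothesis mF : measurable F.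
Hypothesis hZ : {ae leb, forall y, Z y}.
Hypothesis Zfin : forall y, Z y -> (leb (slice F y) < +oo)%E.
Hypothesis sym : forall y y', Z y -> Z y' -> y < y' -> fine (leb (slice F y `+` slice F y')) <= L y' - L y.
Hypothesis nogap : forall r1 r2, {ae leb, forall y, ~ gap 0 r1 r2 (slice F y)}.

(** Mass larger than [e] on either side of the grid interval survives a change of the slice by [e],
    and a slice without gap then fills the interval. *)
Lemma close_fill (S : set RT) (y : R) (k : nat * nat * nat) (e : R) : measurable S -> (leb S < +oo)%E -> Z y ->
  ~ gap 0 (grid k) (grid2 k) (slice F y) -> 0 < e -> fine (leb (S `+` slice F y)) <= e ->
  (e%:E < leb (S `&` `]-oo, grid k[%classic))%E -> (e%:E < leb (S `&` `]grid2 k, +oo[%classic))%E ->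
  leb (`]grid k, grid2 k[%classic `\` slice F y) = 0%E.
Proof.
move=> mS Soo Zy ng e0 Se h1 h2.
have pos (A : set RT) : measurable A -> (e%:E < leb (S `&` A))%E -> (0 < leb (slice F y `&` A))%E.
  move=> mA h; have := symdiff_trace S (slice F y) A e mS (slice_measurable F y mF) mA Soo (Zfin y Zy) Se.
  move=> /(lt_le_trans h) h'; rewrite lt_neqAle measure_ge0 andbT; apply/negP => /eqP h0.
  by move: h'; rewrite -h0 add0e ltxx.
by apply: no_gap_fill => //; apply: pos => //; exact: measurable_itv.
Qed.

Hypothesis osc_left : forall c e, 0 < e -> exists2 r, 0 < r & forall y y', Z y -> Z y' ->
  c - r < y < c -> c - r < y' < c -> L y' <= L y + e.
Hypothesis osc_right : forall c e, 0 < e -> exists2 r, 0 < r & forall y y', Z y -> Z y' ->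
  c < y < c + r -> c < y' < c + r -> L y' <= L y + e.
Hypothesis nopinch : forall c, two_sided F c -> exists e r, [/\ 0 < e, 0 < r &
  forall y y', Z y -> Z y' -> c - r < y < c -> c < y' < c + r -> e < fine (leb (slice F y `&` slice F y'))].

(** Two generic slices on either side of [c] share mass more than [e], part of it on both sides of a
    grid interval. Every nearby slice differs by at most e/8 from the one on its own side of [c],
    hence fills that interval. *)
Lemma core c : two_sided F c -> exists x r, 0 < r /\ forall t, c - r < t < c + r -> full F (x, t).
Proof.
move=> /nopinch [e [r1 [e0 r10 h1]]]; have e8 : 0 < e / 8 by rewrite divr_gt0.
have [r2 r20 h2] := osc_left c (e / 8) e8. have [r3 r30 h3] := osc_right c (e / 8) e8.
have [r4 [r40 r41 r42]] := exists_min2 _ _ r10 r20.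
have [r [r0 rr4 rr3]] := exists_min2 _ _ r40 r30.
have [|a Za /andP[a1 a2]] := generic_point Z (c - r) c hZ; first by lra.
have [|b Zb /andP[b1 b2]] := generic_point Z c (c + r) hZ; first by lra.
pose X := slice F a `&` slice F b.
have mX : measurable X by apply: measurableI; exact: slice_measurable.
have Xoo : (leb X < +oo)%E by apply: le_lt_trans (Zfin a Za); apply: le_outer_measure => t [].
have eX : (e%:E < leb X)%E.
  rewrite -(fineK (_ : leb X \is a fin_num)) ?ge0_fin_numE// lte_fin; apply: h1 => //; apply/andP; split; lra.
have [k [k1 k2]] := split_grid X e mX Xoo e0 eX.
have e84 : ((e / 8)%:E < (e / 4)%:E)%E by rewrite lte_fin; lra.
have gk := @grid_lt R k.
exists ((grid k + grid2 k) / 2), r; split=> // t /andP[t1 t2].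
exists (grid k), (grid2 k), (c - r), (c + r); split.
  by split; rewrite /= in_itv/= ?t1//; apply/andP; split; lra.
apply: box_full => //; have FF := ae_filter_ringOfSetsType leb.
have npt (s : R) : {ae leb, forall y : R, y <> s}.
  exists [set s]; split=> //; first exact: lebesgue_measure_set1.
  by move=> y /= /contrapT.
have nc : {ae leb, forall y : R, [/\ y <> c, y <> a & y <> b]}.
  by apply: filterS3 (npt c) (npt a) (npt b) => y.
apply: filterS3 hZ nc (no_gap_grid F nogap) => y Zy [yc ya yb] ng /andP[y1 y2].
have use (s : R) (S := slice F s) : Z s -> X `<=` S -> s != y ->
    (s < y -> L y <= L s + e / 8) -> (y < s -> L s <= L y + e / 8) ->
    leb (`]grid k, grid2 k[%classic `\` slice F y) = 0%E.
  move=> Zs XS sy o1 o2; apply: (close_fill S y k (e / 8)) => //.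
  - exact: slice_measurable.
  - exact: Zfin.
  - move: sy; rewrite neq_lt => /orP[sy|ys]; first by have := sym s y Zs Zy sy; have := o1 sy; rewrite -/S; lra.
    by rewrite setYC; have := sym y s Zy Zs ys; have := o2 ys; rewrite -/S; lra.
  - apply: lt_le_trans (lt_trans e84 k1) _; by apply: le_outer_measure => u [Xu ?]; split=> //; exact: XS.
  - apply: lt_le_trans (lt_trans e84 k2) _; by apply: le_outer_measure => u [Xu ?]; split=> //; exact: XS.
have near_l (u : R) : c - r < u < c -> c - r2 < u < c.
  move=> /andP[u1 ->]; rewrite andbT; apply: le_lt_trans u1; rewrite lerB//; exact: le_trans r42.
have near_r (u : R) : c < u < c + r -> c < u < c + r3.
  by move=> /andP[-> u2]; apply: lt_le_trans u2 _; rewrite lerD2l.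
have [yc'|cy|yc'] := ltgtP y c; last by [].
  apply: (use a) => //; first by move=> u [].
  - by apply/eqP => h; apply: ya.
  - by move=> _; apply: h2 => //; apply: near_l; apply/andP; split.
  - by move=> _; apply: h2 => //; apply: near_l; apply/andP; split.
apply: (use b) => //; first by move=> u [].
- by apply/eqP => h; apply: yb.
- by move=> _; apply: h3 => //; apply: near_r; apply/andP; split.
- by move=> _; apply: h3 => //; apply: near_r; apply/andP; split.
Qed.

(** A nonempty relatively clopen part [B] contains the whole row of each of its points, since rows
    are convex, and spreads along the vertical segments of [core]. The heights it meets are
    therefore clopen in the interval of two-sided heights. *)
Lemma full_connected : connected (full F).
Proof.
move=> B [[x0 c0] B0] [V oV BV] [C cC BC].
have BU : B `<=` full F by rewrite BV => p [].
have inB (S : set (R * R)) p q : connected S -> S `<=` full F -> S p -> B p -> S q -> B q.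
  move=> cS SU Sp Bp Sq.
  have : S `&` B = S.
    apply: cS; first by exists p.
    - by exists V => //; rewrite BV setIA (setIidl SU).
    - by exists C => //; rewrite BC setIA (setIidl SU).
  by move=> /seteqP[_ h]; have [] := h q Sq.
have ci (u w : R) : connected [set t : R | u <= t <= w].
  by apply/connected_intervalP => s t /=; rewrite /= => /andP[h1 h2] /andP[h3 h4] x /andP[h5 h6];
     rewrite (le_trans h1 h5) (le_trans h6 h4).
have cio (u w : R) : connected [set t : R | u < t < w].
  by apply/connected_intervalP => s t /=; rewrite /= => /andP[h1 h2] /andP[h3 h4] x /andP[h5 h6];
     rewrite (lt_le_trans h1 h5) (le_lt_trans h6 h4).
have hor x1 x2 c : B (x1, c) -> full F (x2, c) -> B (x2, c).
  move=> B1 U2; have U1 := BU _ B1.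
  pose S := (fun x : R => (x, c)) @` [set t | Num.min x1 x2 <= t <= Num.max x1 x2].
  apply: (inB S (x1, c)) => //.
  - apply: connected_continuous_connected; first exact: ci.
    by apply: continuous_subspaceT; exact: row_continuous.
  - move=> _ [t ht <-]; move: ht; rewrite /=; case: (leP x1 x2) => x12 ht.
      exact: (full_convex F mF nogap x1 x2).
    exact: (full_convex F mF nogap x2 x1).
  - by exists x1 => //=; rewrite ge_min le_max lexx.
  - by exists x2 => //=; rewrite ge_min le_max lexx !orbT.
have ver x c r t1 t2 : (forall t, c - r < t < c + r -> full F (x, t)) -> c - r < t1 < c + r ->
    c - r < t2 < c + r -> B (x, t1) -> B (x, t2).
  move=> hU h1 h2 B1; pose S := (fun t : R => (x, t)) @` [set t | c - r < t < c + r].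
  apply: (inB S (x, t1)) => //.
  - apply: connected_continuous_connected; first exact: cio.
    by apply: continuous_subspaceT; exact: column_continuous.
  - by move=> _ [t ht <-]; exact: hU.
  - by exists t1.
  - by exists t2.
pose T : set R := [set c | two_sided F c]. pose TB : set R := [set c | exists x, B (x, c)].
have cT : connected T.
  apply/connected_intervalP => s t /= hs ht x hx; exact: two_sided_between mF hs ht hx.
(* The open union of the vertical segments through heights with property [P]; it describes both [TB]
   and its complement in [T]. *)
pose near (P : R -> Prop) : set R := [set t | exists x c r, [/\ P c, 0 < r,
  (forall s, c - r < s < c + r -> full F (x, s)) & c - r < t < c + r]].
have near_open P : open (near P).
  rewrite openE => t [x [c [r [Pc r0 hU /andP[t1 t2]]]]]; rewrite /interior.
  have h1 : nbhs t [set s : R | c - r < s] by apply: open_nbhs_nbhs; split=> //; exact: open_gt.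
  have h2 : nbhs t [set s : R | s < c + r] by apply: open_nbhs_nbhs; split=> //; exact: open_lt.
  apply: filterS2 h1 h2 => s s1 s2; exists x, c, r; split=> //; by apply/andP.
have selfc (c r : R) : 0 < r -> c - r < c < c + r by move=> r0; apply/andP; split; lra.
have TBT : TB `<=` T by move=> c [x /BU /(full_two_sided F mF)].
have TBE : TB = T.
  apply: cT; first by exists c0, x0.
  - exists (near TB); first exact: near_open.
    apply/seteqP; split=> t.
      move=> tTB; split; first exact: TBT.
      have [x [r [r0 hU]]] := core t (TBT _ tTB); exists x, t, r; split=> //; exact: selfc.
    move=> [_ [x [c [r [[x' Bx'] r0 hU ht]]]]]; exists x.
    apply: (ver x c r c) => //; first exact: selfc.
    by apply: hor Bx' _; apply: hU; exact: selfc.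
  - exists (~` near (T `\` TB)); first exact/open_closedC/near_open.
    apply/seteqP; split=> t.
      move=> tTB; split; first exact: TBT.
      move=> [x [c [r [[_ nTB] r0 hU ht]]]]; apply: nTB; exists x.
      have [x' Bx'] := tTB.
      apply: (ver x c r t) => //; first exact: selfc.
      by apply: hor Bx' _; exact: hU.
    move=> [Tt nt]; apply: contrapT => ntB; apply: nt.
    have [x [r [r0 hU]]] := core t Tt; exists x, t, r; split=> //; exact: selfc.
apply/seteqP; split=> // -[x c] Up.
have : TB c by rewrite TBE; exact: (full_two_sided F mF (x, c)).
by move=> [x' Bx']; exact: hor Bx' Up.
Qed.

End OneSet.
End Connectedness.

(** * The open representative has full measure in the minimiser *)

Section FullCover.
Context {R : realType}.
Local Notation leb := (@lebesgue_measure R).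
Local Notation RT := (measurableTypeR R).

(** Of two such points the smaller one lies in a null set of the form: part of [S] to the left of a
    rational number. Outside the countable union of these null sets at most one point remains. *)
Lemma extreme_left_negligible (S : set RT) : measurable S ->
  leb.-negligible [set x | S x /\ leb (S `&` `]-oo, x[%classic) = 0%E].
Proof.
move=> mS; pose q (i : rat) : set RT := S `&` `]-oo, (ratr i : R)[%classic.
pose B (n : nat) : set RT := if unpickle n is Some i then (if leb (q i) == 0%E then q i else set0) else set0.
have nB n : leb.-negligible (B n).
  rewrite /B; case: (unpickle n) => [i|]; last exact: negligible_set0.
  case: ifPn => [/eqP h|_]; last exact: negligible_set0.
  by exists (q i); split => //; apply: measurableI => //; exact: measurable_itv.
have NB := negligible_bigcup nB.
pose E : set RT := [set x | [/\ S x, leb (S `&` `]-oo, x[%classic) = 0%E & ~ (\bigcup_n B n) x]].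
have [x0 E0] : exists x0, E `<=` [set x0].
  have [[x0 [Sx0 h0 n0]]|nE] := pselect (E !=set0); last first.
    by exists 0 => x Ex; exfalso; apply: nE; exists x.
  exists x0 => x [Sx hx nx].
  have key (a b : R) : S a -> ~ (\bigcup_n B n) a -> leb (S `&` `]-oo, b[%classic) = 0%E -> a < b -> False.
    move=> Sa na hb ab; have [i /itvP iP] := rat_in_itvoo ab.
    apply: na; exists (pickle i); first by [].
    rewrite /B pickleK.
    rewrite (_ : leb (q i) == 0%E); first by split=> //; rewrite /= in_itv/= iP.
    rewrite eq_le measure_ge0 andbT -hb; apply: le_outer_measure => t [St]; rewrite /= !in_itv/= => ti.
    by split=> //; apply: lt_trans ti _; rewrite iP.
  by have [h|h|//] := ltgtP x x0; exfalso; [exact: (key x x0)|exact: (key x0 x)].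
apply: (@negligibleS _ _ _ _ ((\bigcup_n B n) `|` [set x0])).
  move=> x [Sx hx]; have [h|h] := pselect ((\bigcup_n B n) x); [by left|right].
  by apply: E0.
apply: negligibleU => //; exists [set x0]; split=> //; exact: lebesgue_measure_set1.
Qed.

Lemma extreme_right_negligible (S : set RT) : measurable S ->
  leb.-negligible [set x | S x /\ leb (S `&` `]x, +oo[%classic) = 0%E].
Proof.
move=> mS; pose q (i : rat) : set RT := S `&` `](ratr i : R), +oo[%classic.
pose B (n : nat) : set RT := if unpickle n is Some i then (if leb (q i) == 0%E then q i else set0) else set0.
have nB n : leb.-negligible (B n).
  rewrite /B; case: (unpickle n) => [i|]; last exact: negligible_set0.
  case: ifPn => [/eqP h|_]; last exact: negligible_set0.
  by exists (q i); split => //; apply: measurableI => //; exact: measurable_itv.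
have NB := negligible_bigcup nB.
pose E : set RT := [set x | [/\ S x, leb (S `&` `]x, +oo[%classic) = 0%E & ~ (\bigcup_n B n) x]].
have [x0 E0] : exists x0, E `<=` [set x0].
  have [[x0 [Sx0 h0 n0]]|nE] := pselect (E !=set0); last first.
    by exists 0 => x Ex; exfalso; apply: nE; exists x.
  exists x0 => x [Sx hx nx].
  have key (a b : R) : S a -> ~ (\bigcup_n B n) a -> leb (S `&` `]b, +oo[%classic) = 0%E -> b < a -> False.
    move=> Sa na hb ab; have [i /itvP iP] := rat_in_itvoo ab.
    apply: na; exists (pickle i); first by [].
    rewrite /B pickleK.
    rewrite (_ : leb (q i) == 0%E); first by split=> //; rewrite /= in_itv/= iP.
    rewrite eq_le measure_ge0 andbT -hb; apply: le_outer_measure => t [St]; rewrite /= !in_itv/= !andbT => ti.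
    by split=> //; apply: lt_trans ti; rewrite iP.
  by have [h|h|//] := ltgtP x x0; exfalso; [exact: (key x0 x)|exact: (key x x0)].
apply: (@negligibleS _ _ _ _ ((\bigcup_n B n) `|` [set x0])).
  move=> x [Sx hx]; have [h|h] := pselect ((\bigcup_n B n) x); [by left|right].
  by apply: E0.
apply: negligibleU => //; exists [set x0]; split=> //; exact: lebesgue_measure_set1.
Qed.

Section OneSet.
Variables (F : set (RT * RT)) (L : R -> R) (Z : set RT) (I : R).
Hypothesis mF : measurable F.
Hypothesis hZ : {ae leb, forall y, Z y}.
Hypothesis Zfin : forall y, Z y -> (leb (slice F y) < +oo)%E.
Hypothesis sym : forall y y', Z y -> Z y' -> y < y' -> fine (leb (slice F y `+` slice F y')) <= L y' - L y.
Hypothesis total : forall y y', Z y -> Z y' -> y <= y' -> L y' - L y <= I.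
Hypothesis nogap : forall r1 r2, {ae leb, forall y, ~ gap 0 r1 r2 (slice F y)}.

Let mono y y' : Z y -> Z y' -> y <= y' -> L y <= L y'.
Proof.
move=> Zy Zy'; rewrite le_eqVlt => /orP[/eqP ->//|yy'].
by rewrite -subr_ge0; apply: le_trans (sym y y' Zy Zy' yy'); rewrite fine_ge0.
Qed.

(** Two-sided smallness of the oscillation of [L], which rules out a jump larger than [d] at [c]. *)
Definition steady (d c : R) : Prop := exists r, 0 < r /\
  forall y y', Z y -> Z y' -> c - r < y -> y < y' -> y' < c + r -> L y' - L y <= d.

(** On a grid of mesh at most 2/(n+1) fewer than I/d cells, or none, have growth above [d], so the
    exceptional heights of a window have measure at most (I/d)(2/(n+1)) for every n. *)
Lemma steady_ae (d : R) : 0 < d -> {ae leb, forall c, steady d c}.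
Proof.
move=> d0; have FF := ae_filter_ringOfSetsType leb.
suff h : {ae leb, forall c, forall K : nat, window K c -> steady d c}.
  apply: filterS h => c hc; apply: (hc (Num.truncn `|c|).+1).
  by rewrite /window/= in_itv/= -ler_norml ltW// truncnS_gt.
apply: ae_foralln => K.
pose Bd : set RT := [set c | window K c /\ ~ steady d c].
have I0 : 0 <= I.
  by have [y Zy _] := generic_point Z 0 1 hZ ltr01; have := total y y Zy Zy (lexx y); rewrite subrr.
have /choice[N hN] : forall n : nat, exists N : set RT, [/\ measurable N, Bd `<=` N &
    (leb N <= (I / d * (2 / n.+1%:R))%:E)%E].
  move=> n; have [y /= [Zy yS y0 yN]] := slab_nodes Z K.+1 n.+1 hZ isT.
  set M := (2 * K.+1 * n.+1).+1 in yN.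
  pose g i := L (y i.+1) - L (y i).
  have g0 i : 0 <= g i by rewrite subr_ge0 mono// ltW//; have [] := yS i.
  pose A i : set RT := if d < g i then `[y i, y i.+1]%classic else set0.
  have mA i : measurable (A i) by rewrite /A; case: ifP => // _; exact: measurable_itv.
  pose X : set RT := \big[setU/set0]_(i < M) A i.
  have mX : measurable X by apply: bigsetU_measurable => i _.
  pose Y : set RT := \bigcup_i [set y i].
  have mY : measurable Y by apply: bigcupT_measurable => i; exact: measurable_set1.
  have Y0 : leb Y = 0%E by apply/countable_lebesgue_measure0/bigcup_countable => // i _; exact: countable1.
  exists (X `|` Y); split; first exact: measurableU.
    move=> c [Wc nsc]; apply: contrapT => nXY.
    have nY i : c <> y i by move=> h; apply: nXY; right; exists i.
    have KS : K%:R <= K.+1%:R :> R by rewrite ler_nat.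
    have yc : y 0 <= c <= y M.
      move: Wc; rewrite /window/= in_itv/= => /andP[w1 w2].
      by rewrite (le_trans y0) ?(le_trans _ w1) ?lerN2//= (le_trans w2)// (le_trans KS).
    have M1 : (1 < M)%N by rewrite /M ltnS !muln_gt0.
    have [i iM /andP[h1 h2]] := find_cell M y M1 c yc.
    have h1' : y i < c by rewrite lt_neqAle h1 andbT; apply/eqP => h; apply: (nY i).
    have h2' : c < y i.+1 by rewrite lt_neqAle h2 andbT; apply/eqP => h; exact: (nY i.+1).
    have gd : g i <= d.
      rewrite leNgt; apply/negP => gi; apply: nXY; left; rewrite /X -bigcup_mkord; exists i => //.
      by rewrite /A gi /= in_itv/= h1.
    apply: nsc; have := exists_min2 (c - y i) (y i.+1 - c); rewrite !subr_gt0 => /(_ h1' h2') [r [r0 r1 r2]].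
    exists r; split=> // t t' Zt Zt' k1 k2 k3; apply: le_trans gd; rewrite /g; apply: lerB.
      by apply: mono => //; lra.
    by apply: mono => //; lra.
  apply: (@le_trans _ _ (leb X + leb Y)%E); first exact: outer_measureU2.
  rewrite Y0 adde0; have sub : (leb X <= \sum_(i < M) leb (A i))%E.
    rewrite /X; elim: (M) => [|k IH]; first by rewrite !big_ord0 measure0.
    rewrite !big_ord_recr/=; apply: (@le_trans _ _ (leb (\big[setU/set0]_(i < k) A i) + leb (A k))%E).
      exact: outer_measureU2.
    exact: leeD.
  apply: (le_trans sub).
  apply: (@le_trans _ _ (\sum_(i < M) (g i / d * (2 / n.+1%:R))%:E)%E).
    apply: lee_sum => i _; rewrite /A; case: ifPn => [gi|_]; last first.
      by rewrite measure0 lee_fin !mulr_ge0// ?invr_ge0 ?(ltW d0).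
    have [y1 y2] := yS i; rewrite lebesgue_measure_itv/= lte_fin y1 -EFinB lee_fin.
    apply: le_trans y2 _; rewrite ler_peMl ?divr_ge0// ler_pdivlMr// mul1r ltW//.
  rewrite sumEFin lee_fin -mulr_suml ler_wpM2r ?divr_ge0// -mulr_suml ler_wpM2r ?invr_ge0 ?(ltW d0)//.
  rewrite -(big_mkord xpredT g) /g (telescope_sumr (fun i => L (y i)) (leq0n M)).
  apply: total => //; apply: (node_le M y); first by move=> i _; have [] := yS i.
  by rewrite leqnn.
exists (\bigcap_n N n); split.
- by apply: bigcapT_measurable => n; have [] := hN n.
- apply/eqP; rewrite eq_le measure_ge0 andbT; apply/lee_addgt0Pr => e e0; rewrite add0e.
  have C0 : 0 <= I / d * 2 by rewrite !mulr_ge0// invr_ge0 ltW.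
  have [c c0 hc] := exists_small _ e C0 e0.
  pose n := Num.truncn c^-1.
  apply: (@le_trans _ _ (leb (N n))); first by apply: le_outer_measure => t; apply.
  have [_ _ h] := hN n; apply: le_trans h _; rewrite lee_fin mulrA; apply: le_trans hc.
  rewrite ler_wpM2l// -[c]invrK lef_pV2 ?posrE ?invr_gt0// ltW//; exact: truncnS_gt.
by move=> c /= nc n _; have [_ h _] := hN n; apply: h; apply: contrapT => nB; apply: nc => Wc; apply: contrapT => ns; apply: nB.
Qed.

(** A point of the slice with mass on both sides of it has a grid interval around it with mass above
    [th] on both sides. Slices at nearby heights differ by at most [th] and have no gap, so they
    fill the interval. The remaining points are the negligible extreme ones. *)
Lemma full_slice c : Z c -> (forall k, ~ gap 0 (grid k) (grid2 k) (slice F c)) ->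
  (forall d, 0 < d -> steady d c) ->
  leb (slice F c `\` slice (full F) c) = 0%E.
Proof.
move=> Zc ngc sc; set S := slice F c.
have mS : measurable S by exact: slice_measurable.
have Soo : (leb S < +oo)%E by exact: Zfin.
have fin (A : set RT) : leb (S `&` A) \is a fin_num.
  by rewrite ge0_fin_numE// (le_lt_trans _ Soo)//; apply: le_outer_measure => t [].
have mU : measurable (slice (full F) c).
  by apply: slice_measurable; apply: open_measurable2; exact: full_open.
apply: measure_negligible; first exact: measurableD.
apply: negligibleS (negligibleU (extreme_left_negligible S mS) (extreme_right_negligible S mS)).
move=> x [Sx nU]; apply: contrapT => /not_orP[n1 n2].
have pos (A : set RT) : ~ (S x /\ leb (S `&` A) = 0%E) -> 0 < fine (leb (S `&` A)).
  move=> h; rewrite lt_neqAle fine_ge0// andbT; apply/negP => /eqP h0; apply: h; split=> //.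
  by rewrite -(fineK (fin A)) -h0.
have p1 := pos _ n1; have p2 := pos _ n2.
have [th0' [th0'0 t1 t2]] := exists_min2 _ _ p1 p2.
(* Each side of [x] has mass at least 3 th, of which at most [th] is lost to the grid interval, so
   more than [th] is left. *)
pose th := th0' / 3; have th0 : 0 < th by rewrite divr_gt0.
have [k [k1 [/andP[k2 k3] k4]]] := grid_near x th th0.
have [r [r0 hr]] := sc th th0.
apply: nU; exists (grid k), (grid2 k), (c - r), (c + r); split.
  by split; rewrite /= in_itv/= ?k2//; apply/andP; split; lra.
apply: box_full => //; have FF := ae_filter_ringOfSetsType leb.
have nc : {ae leb, forall y : R, y <> c}.
  exists [set c]; split=> //; first exact: lebesgue_measure_set1.
  by move=> y /= /contrapT.
have cover (A B C : set RT) : A `<=` B `|` C -> fine (leb (S `&` A)) <= fine (leb (S `&` B)) + fine (leb (S `&` C)).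
  move=> ABC; rewrite -lee_fin EFinD !fineK//.
  apply: (@le_trans _ _ (leb ((S `&` B) `|` (S `&` C)))); last exact: outer_measureU2.
  by apply: le_outer_measure => t [St /ABC[h|h]]; [left|right].
have itv (u w d : R) : w - u <= d -> 0 <= d -> fine (leb (S `&` `[u, w]%classic)) <= d.
  move=> uw d00; rewrite -lee_fin fineK//; apply: (@le_trans _ _ (leb (`[u, w]%classic : set RT))).
    by apply: le_outer_measure => t [].
  by rewrite lebesgue_measure_itv/= lte_fin; case: ifP => _; rewrite -?EFinB lee_fin.
have q1 : (th%:E < leb (S `&` `]-oo, grid k[%classic))%E.
  have h : fine (leb (S `&` `]-oo, x[%classic)) <= fine (leb (S `&` `]-oo, grid k[%classic)) + fine (leb (S `&` `[grid k, x]%classic)).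
    apply: cover => t; rewrite /= !in_itv/= => tx; have [tk|tk] := ltP t (grid k); [by left|right].
    by rewrite ltW.
  have h' : fine (leb (S `&` `[grid k, x]%classic)) <= th by apply: itv; [lra|exact: ltW].
  rewrite -(fineK (fin _)) lte_fin; move: h h' t1; rewrite /th in th0 *; lra.
have q2 : (th%:E < leb (S `&` `]grid2 k, +oo[%classic))%E.
  have h : fine (leb (S `&` `]x, +oo[%classic)) <= fine (leb (S `&` `]grid2 k, +oo[%classic)) + fine (leb (S `&` `[x, grid2 k]%classic)).
    apply: cover => t; rewrite /= !in_itv/= !andbT => tx; have [tk|tk] := ltP (grid2 k) t; [by left|right].
    by rewrite ltW.
  have h' : fine (leb (S `&` `[x, grid2 k]%classic)) <= th by apply: itv; [lra|exact: ltW].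
  rewrite -(fineK (fin _)) lte_fin; move: h h' t2; rewrite /th in th0 *; lra.
apply: filterS3 hZ nc (no_gap_grid F nogap) => y Zy yc ng /andP[y1 y2].
apply: (close_fill F Z mF Zfin S y k th) => //.
have [h|h|//] := ltgtP y c.
  rewrite setYC; apply: le_trans (sym y c Zy Zc h) _; apply: hr => //; lra.
apply: le_trans (sym c y Zc Zy h) _; apply: hr => //; lra.
Qed.

Lemma full_cover : area R (F `\` full F) = 0%E.
Proof.
have mD : measurable (F `\` (full F : set (RT * RT))).
  by apply: measurableD => //; apply: open_measurable2; exact: full_open.
rewrite area_slices// -(integral0 leb setT); apply: ae_eq_integral => //.
  exact: slice_volume_measurable.
have st : {ae leb, forall c, forall n : nat, steady (n.+1%:R^-1) c}.
  by apply: ae_foralln => n; apply: steady_ae; rewrite invr_gt0.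
have FF := ae_filter_ringOfSetsType leb.
apply: filterS3 hZ (no_gap_grid F nogap) st => c Zc ng sc _.
apply: (full_slice c Zc ng) => d d0.
have [r [r0 hr]] := sc (Num.truncn d^-1); exists r; split=> // y y' Zy Zy' h1 h2 h3.
apply: le_trans (hr y y' Zy Zy' h1 h2 h3) _.
rewrite -[leRHS]invrK lef_pV2 ?posrE ?invr_gt0// ltW//; exact: truncnS_gt.
Qed.

End OneSet.
End FullCover.

Section Proposition.
Context {R : realType}.
Variable lambda : R.
Hypothesis hlambda : 1 < lambda.
Local Notation leb := (@lebesgue_measure R).
Local Notation RT := (measurableTypeR R).
Local Notation f := (strip_density lambda).

Lemma isoperimetric_connected (v : R) (F : set (RT * RT)) : 0 < v -> isoperimetric f v F ->
  essentially_connected F.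
Proof.
move=> v0 isoF; have [mF vF minF] := isoF.
have [C [sC bC vC]] := competitor lambda hlambda v v0.
have aF := slice_finite_volume lambda hlambda F v mF vF.
have PF : weighted_perimeter f F \is a fin_num.
  rewrite ge0_fin_numE ?weighted_perimeter_ge0//; apply: le_lt_trans bC.
  apply: le_trans (weighted_perimeter_smooth lambda C sC).
  by apply: minF => //; apply: open_measurable2; case: sC.
have perF := esym (fineK PF).
have [L [Z [D LI Zfin edge]]] := perimeter_data lambda hlambda F _ mF aF perF.
have hZ := slice_generic _ _ _ _ _ D.
have nogap := no_gap lambda hlambda F v _ v0 isoF perF L Z D Zfin edge.
have sym y y' : Z y -> Z y' -> y < y' -> fine (leb (slice F y `+` slice F y')) <= L y' - L y.
  move=> Zy Zy' yy'; apply: le_trans (symdiff_edge lambda hlambda F L Z edge y y' Zy Zy' yy').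
  by rewrite ler_peMl ?fine_ge0// low_density_ge1.
exists (full F); split.
- exact: full_open.
- have mU : measurable (full F : set (RT * RT)) by apply: open_measurable2; exact: full_open.
  have cover := full_cover F L Z _ mF hZ Zfin sym (slice_total _ _ _ _ _ D) nogap.
  have null := full_null F mF.
  apply/eqP; rewrite eq_le measure_ge0 andbT.
  apply: (@le_trans _ _ (area R (full F `\` F) + area R (F `\` full F))%E).
    by apply: measureU2; apply: measurableD.
  by rewrite null cover adde0.
- apply: (full_connected F L Z mF hZ Zfin sym nogap).
  + exact: left_limit hlambda F _ L Z D LI.
  + exact: right_limit hlambda F _ L Z D LI.
  + exact: no_pinch hlambda F v _ v0 isoF perF L Z D LI Zfin edge.
Qed.

End Proposition.

Theorem proposition3p5 (R : realType) (lambda : R) (hlambda : 1 < lambda)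
    (v : R) (hv : 0 < v) :
  (exists E : set (R * R), isoperimetric (strip_density lambda) v E) /\
  (forall E : set (R * R), isoperimetric (strip_density lambda) v E ->
     essentially_connected E).
Proof.
split; first exact: isoperimetric_exists.
by move=> E; exact: isoperimetric_connected.
Qed.
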